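(* Let $k$ be an algebraically closed field of characteristic $p>0$, or a complete discrete valuation ring whose residue field is algebraically closed of characteristic $p>0$. Let $G$ be a finite group, $B$ a block of $kG$ with defect group $Q$, $H=N_G(Q)$, and $b$ the block of $kH$ that is the Brauer correspondent of $B$. Let $\mathfrak{X}=\{Q\cap Q^\sigma\mid\sigma\in G\setminus H\}$. Let $\mathbf{C}$ be one of the categories of complexes or homotopy categories listed in the context. Then the functors $\mathcal{I}$ and $\mathcal{R}$ induced by induction and restriction give equivalences $$\mathcal{I}:\frac{\mathbf{C}(b)}{\mathfrak{X}\text{-}\mathbf{Proj}(\mathbf{C}(b))}\longrightarrow\frac{\mathbf{C}(B)}{\mathfrak{X}\text{-}\mathbf{Proj}(\mathbf{C}(B))},\qquad \mathcal{R}:\frac{\mathbf{C}(B)}{\mathfrak{X}\text{-}\mathbf{Proj}(\mathbf{C}(B))}\longrightarrow\frac{\mathbf{C}(b)}{\mathfrak{X}\text{-}\mathbf{Proj}(\mathbf{C}(b))},$$ and these are equivalences of triangulated categories.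
   Context: Complexes. $\mathbf{Cpx}(kG)$ is the category of cochain complexes of $kG$-modules and chain maps; $\mathbf{Cpx}^+,\mathbf{Cpx}^-,\mathbf{Cpx}^b$ are the full subcategories of complexes bounded above, bounded below, and both. $\mathbf{cpxFL}(kG)$ is the full subcategory of complexes all of whose terms have finite composition length, with bounded versions $\mathbf{cpxFL}^{+},\mathbf{cpxFL}^{-},\mathbf{cpxFL}^{b}$. $\otimes=\otimes_k$ with diagonal action; $Q^\sigma=\sigma^{-1}Q\sigma$. Categories allowed. The category of complexes is any one of $\mathbf{Cpx}$, $\mathbf{Cpx}^{*}$, $\mathbf{cpxFL}$, $\mathbf{cpxFL}^{*}$ with $*\in\{+,-,b\}$ (for $kG$, respectively $kH$). Let $V$ be a finitely generated $kG$-module that is free over $k$. An exact sequence $E$ of complexes is term split if it splits as a sequence of modules in each degree; $V$-split if $V\otimes E$ is split as a sequence of complexes; $V$-term split if $V\otimes E$ is term split; term+$V$-split if both term split and $V$-split. For a class $\mathscr{E}$ of exact sequences an object $P$ is $\mathscr{E}$-projective if $\mathrm{Hom}(P,-)$ is exact on all sequences in $\mathscr{E}$. The homotopy categories $\mathcal{K}$, $\mathcal{K}_{V\text{-split}}$, $\mathcal{K}_{V\text{-ts}}$, $\mathcal{K}_{\mathrm{ts}+V\text{-split}}$ of a category of complexes are obtained by factoring out the morphisms that factor through $\mathscr{E}$-projective objects, where $\mathscr{E}$ is the class of term split, $V$-split, $V$-term split, term+$V$-split sequences respectively; for $H$ one uses $V_{\downarrow H}$. $\mathbf{C}$ is a category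 of complexes or one of its homotopy categories; $\mathbf{C}(B)$ is the full subcategory of the category for $kG$ of complexes whose terms lie in $B$, and $\mathbf{C}(b)$ is the analogue for $b$ over $kH$. Relative projectivity. An object is $\mathfrak{X}$-projective if it is a direct summand of a direct sum of objects induced from subgroups $P\in\mathfrak{X}$; $\mathfrak{X}\text{-}\mathbf{Proj}(\cdot)$ is the full subcategory of such objects, and the quotient categories have morphisms modulo those factoring through an $\mathfrak{X}$-projective object. Every object of $\mathbf{C}(B)$ or $\mathbf{C}(b)$ is $Q$-projective. Functors. $\mathcal{I}$ is induced by $X\mapsto kG\otimes_{kH}X$, and $\mathcal{R}$ by restriction to $H$ (which, modulo $\mathfrak{Y}$-projective objects with $\mathfrak{Y}=\{H\cap Q^\sigma\mid\sigma\in G\setminus H\}$, lands in $\mathbf{C}(b)$; a morphism between objects of $\mathbf{C}(b)$ factors through a $\mathfrak{Y}$-projective object if and only if it factors through an $\mathfrak{X}$-projective one). Modulo $\mathfrak{X}$-projective objects the functor $\mathcal{I}$ takes $\mathbf{C}(b)$ into $\mathbf{C}(B)$. Triangulation. Let $V_{\mathfrak{X}}=\bigoplus_{P\in\mathfrak{X}}k_P^{\uparrow G}$, and let $S$ be the class of $V_{\mathfrak{X}}$-split exact sequences of complexes in $B$ which, in the case of a homotopy category, also belong to the class $\mathscr{E}$ defining it. The quotient $\mathbf{C}(B)/\mathfrak{X}\text{-}\mathbf{Proj}(\mathbf{C}(B))$ is regarded as the stable category of the Frobenius exact category of complexes in $B$ with exact structure $S$: the shift is $\Omega_S^{-1}$,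 where $0\to X\to I\to\Omega_S^{-1}(X)\to0$ is in $S$ with $I$ $S$-injective, and the distinguished triangles are those isomorphic to $X\xrightarrow{\sigma}Y\to E\to\Omega_S^{-1}(X)$, with $E$ the pushout of $X\to I$ along $\sigma$. The same construction is used for $b$, with $k_P^{\uparrow H}$ and $V_{\downarrow H}$.
   Formalization: The triangulated claim omits the case of empty X (Q normal in G) when C is a category of complexes itself or a V-split or V-term split homotopy category with V=0: there S is all exact sequences and the quotient is in general not its stable category. Both equivalences hold unrestricted. *)

(* Defs.v *)
From HB Require Import structures.
From mathcomp Require Import all_boot all_order all_fingroup all_algebra.
From mathcomp Require Import generic_quotient boolp classical_sets.

Set Implicit Arguments.
Unset Strict Implicit.
Unset Printing Implicit Defensive.

Import GRing.Theory.
Local Open Scope ring_scope.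

Definition closed_field_pchar (p : nat) (k : idomainType) : Prop :=
  [/\ GRing.field_axiom k, GRing.closed_field_axiom k & p \in [pchar k]].

Definition uniformizer (k : idomainType) (pi : k) : Prop :=
  [/\ pi != 0, pi \isn't a GRing.unit &
      forall x : k, x != 0 ->
        exists2 u, u \is a GRing.unit & exists n, x = u * pi ^+ n].

Definition adically_close (k : idomainType) (pi : k) (n : nat) (x y : k) :=
  exists z, x - y = pi ^+ n * z.

Definition adically_complete (k : idomainType) (pi : k) : Prop :=
  forall u : nat -> k,
    (forall n, exists N, forall i j, (N <= i)%N -> (N <= j)%N ->
       adically_close pi n (u i) (u j)) ->
    exists l, forall n, exists N, forall i, (N <= i)%N ->
       adically_close pi n (u i) l.

(* F is the residue field: the kernel of r is the maximal ideal, i.e. the set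
   of nonunits. *)
Definition complete_dvr (p : nat) (k : idomainType) : Prop :=
  (exists2 pi : k, uniformizer pi & adically_complete pi) /\
  (exists (F : closedFieldType) (r : {rmorphism k -> F}),
     [/\ forall y, exists x, r x = y,
         forall x, (r x == 0) = (x \isn't a GRing.unit) &
         p \in [pchar F]]).

Definition galg (k : comNzRingType) (gT : finGroupType) := {ffun gT -> k}.

Section GroupAlgebra.
Variables (k : comNzRingType) (gT : finGroupType).
Local Notation A := (galg k gT).

HB.instance Definition _ := GRing.Lmodule.copy A {ffun gT -> k^o}.

Implicit Types (a b c : A) (x y : gT).

Definition gelt x : A := [ffun y => (y == x)%:R].
Definition gmul a b : A := [ffun x => \sum_y a y * b (y^-1 * x)%g].

Lemma gmulA : associative gmul.
Proof.
move=> a b c; apply/ffunP => x; rewrite !ffunE.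
transitivity (\sum_y \sum_z a y * (b (y^-1 * z)%g * c (z^-1 * x)%g)).
  apply: eq_bigr => y _; rewrite ffunE mulr_sumr.
  rewrite (reindex_inj (mulgI y^-1)%g) /=; apply: eq_bigr => z _.
  by rewrite invMg invgK mulgA mulgK.
rewrite exchange_big; apply: eq_bigr => z _ /=; rewrite ffunE mulr_suml.
by apply: eq_bigr => y _; rewrite mulrA.
Qed.

Lemma gmul1l : left_id (gelt 1%g) gmul.
Proof.
move=> a; apply/ffunP => x; rewrite ffunE (bigD1 1%g) //= ffunE eqxx mul1r.
rewrite invg1 mul1g big1 ?addr0 // => y /negPf ney.
by rewrite ffunE ney mul0r.
Qed.

Lemma gmul1r : right_id (gelt 1%g) gmul.
Proof.
move=> a; apply/ffunP => x; rewrite ffunE (bigD1 x) //= ffunE mulVg eqxx mulr1.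
rewrite big1 ?addr0 // => y ney; rewrite ffunE -eq_mulVg1 (negPf ney).
by rewrite mulr0.
Qed.

Lemma gmulDl : left_distributive gmul +%R.
Proof.
move=> a b c; apply/ffunP => x; rewrite !ffunE -big_split; apply: eq_bigr => y _.
by rewrite !ffunE mulrDl.
Qed.

Lemma gmulDr : right_distributive gmul +%R.
Proof.
move=> a b c; apply/ffunP => x; rewrite !ffunE -big_split; apply: eq_bigr => y _.
by rewrite !ffunE mulrDr.
Qed.

Lemma gelt1_neq0 : gelt 1%g != 0.
Proof.
by apply/eqP => /ffunP/(_ 1%g)/eqP; rewrite !ffunE eqxx oner_eq0.
Qed.

HB.instance Definition _ := GRing.Zmodule_isNzRing.Build A
  gmulA gmul1l gmul1r gmulDl gmulDr gelt1_neq0.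

Lemma galgME a b x : (a * b) x = \sum_y a y * b (y^-1 * x)%g.
Proof. by rewrite ffunE. Qed.

Lemma galgZE (s : k) a x : (s *: a) x = s * a x.
Proof. by rewrite ffunE. Qed.

Lemma gscaleAl (s : k) a b : s *: (a * b) = (s *: a) * b.
Proof.
apply/ffunP => x; rewrite galgZE !galgME mulr_sumr.
by apply: eq_bigr => y _; rewrite galgZE mulrA.
Qed.

HB.instance Definition _ := GRing.Lmodule_isLalgebra.Build k A gscaleAl.

Lemma gscaleAr (s : k) a b : s *: (a * b) = a * (s *: b).
Proof.
apply/ffunP => x; rewrite galgZE !galgME mulr_sumr.
by apply: eq_bigr => y _; rewrite galgZE mulrCA.
Qed.

HB.instance Definition _ := GRing.Lalgebra_isAlgebra.Build k A gscaleAr.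

Lemma gelt1 : gelt 1%g = 1. Proof. by []. Qed.

Lemma geltM x y : gelt (x * y)%g = gelt x * gelt y.
Proof.
apply/ffunP => z; rewrite galgME ffunE (bigD1 x) //= !ffunE eqxx mul1r.
rewrite big1 ?addr0 => [|w /negPf new]; last by rewrite ffunE new mul0r.
by rewrite -(inj_eq (mulgI x) (_ * z)%g) mulKVg.
Qed.

Lemma galg_sum a : a = \sum_x a x *: gelt x.
Proof.
apply/ffunP => x; rewrite sum_ffunE (bigD1 x) //= galgZE ffunE eqxx mulr1.
rewrite big1 ?addr0 // => y ney.
by rewrite galgZE ffunE eq_sym (negPf ney) mulr0.
Qed.

End GroupAlgebra.

Arguments gelt {k gT} x.

Section GroupAlgebraMorphism.
Variables (k : comNzRingType) (gT : finGroupType) (A : algType k).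
Variable phi : gT -> A.
Hypotheses (phi1 : phi 1%g = 1) (phiM : {morph phi : x y / (x * y)%g >-> x * y}).

Definition galg_ext (a : galg k gT) : A := \sum_x a x *: phi x.

Lemma galg_ext_zmod : zmod_morphism galg_ext.
Proof.
move=> a b; rewrite /galg_ext -sumrB; apply: eq_bigr => x _.
by rewrite !ffunE scalerBl.
Qed.

Lemma galg_ext_monoid : monoid_morphism galg_ext.
Proof.
split=> [|a b]; rewrite /galg_ext.
  rewrite (bigD1 1%g) //= ffunE eqxx scale1r phi1 big1 ?addr0 // => x /negPf nx.
  by rewrite ffunE nx scale0r.
transitivity (\sum_x \sum_y (a y * b (y^-1 * x)%g) *: phi x).
  by apply: eq_bigr => x _; rewrite galgME scaler_suml.
rewrite exchange_big mulr_suml; apply: eq_bigr => y _ /=.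
rewrite (reindex_inj (mulgI y)) mulr_sumr /=; apply: eq_bigr => x _.
by rewrite mulKg phiM -scalerAl -scalerAr scalerA.
Qed.

End GroupAlgebraMorphism.

Section Subgroups.
Variables (k : comNzRingType) (gT : finGroupType).

Definition gincl (P : {group gT}) : galg k (subg_of P) -> galg k gT :=
  galg_ext (fun x => gelt (sgval x)).

Lemma gincl_zmod P : zmod_morphism (@gincl P).
Proof. exact: galg_ext_zmod. Qed.

Lemma gincl_monoid P : monoid_morphism (@gincl P).
Proof.
by apply: galg_ext_monoid => // x y; rewrite -geltM.
Qed.

HB.instance Definition _ P := GRing.isZmodMorphism.Build _ _ (@gincl P)
  (@gincl_zmod P).
HB.instance Definition _ P := GRing.isMonoidMorphism.Build _ _ (@gincl P)
  (@gincl_monoid P).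

Definition gaug (a : galg k gT) : k := \sum_x a x.

Lemma gaugE a : gaug a = galg_ext (fun=> 1 : k^o) a.
Proof. by apply: eq_bigr => x _; rewrite [RHS]mulr1. Qed.

Lemma gaug_zmod : zmod_morphism gaug.
Proof. by move=> a b; rewrite !gaugE; exact: (@galg_ext_zmod k gT k^o). Qed.

Lemma gaug_monoid : monoid_morphism gaug.
Proof.
have [g1 gM] : monoid_morphism (galg_ext (fun=> 1 : k^o) : galg k gT -> k^o).
  by apply: galg_ext_monoid => // x y; rewrite mulr1.
by split=> [|a b]; rewrite !gaugE.
Qed.

HB.instance Definition _ := GRing.isZmodMorphism.Build _ _ gaug gaug_zmod.
HB.instance Definition _ := GRing.isMonoidMorphism.Build _ _ gaug gaug_monoid.

End Subgroups.

Arguments gincl {k gT} P _.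
Arguments gaug {k gT} _.

Definition rest (S R : pzRingType) (f : {rmorphism S -> R}) (M : lmodType R)
  : Type := M.

Section Rest.
Variables (S R : pzRingType) (f : {rmorphism S -> R}).

HB.instance Definition _ (M : lmodType R) := GRing.Zmodule.on (rest f M).

Section Module.
Variable M : lmodType R.
Definition rest_scale (s : S) (m : rest f M) : rest f M := f s *: (m : M).

Lemma rest_scaleA s t (m : rest f M) :
  rest_scale s (rest_scale t m) = rest_scale (s * t) m.
Proof. by rewrite /rest_scale scalerA rmorphM. Qed.
Lemma rest_scale1 : left_id 1 rest_scale.
Proof. by move=> m; rewrite /rest_scale rmorph1 scale1r. Qed.
Lemma rest_scaleDr : right_distributive rest_scale +%R.
Proof. by move=> s m n; rewrite /rest_scale scalerDr. Qed.
Lemma rest_scaleDl m : {morph rest_scale^~ m : s t / s + t}.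
Proof. by move=> s t; rewrite /rest_scale rmorphD scalerDl. Qed.

HB.instance Definition _ := GRing.Zmodule_isLmodule.Build S (rest f M)
  rest_scaleA rest_scale1 rest_scaleDr rest_scaleDl.
End Module.

Variables (M N : lmodType R) (g : {linear M -> N}).
Definition rest_map (m : rest f M) : rest f N := g m.

Lemma rest_map_linear : linear rest_map.
Proof. by move=> s m n; rewrite /rest_map; apply: linearP. Qed.

HB.instance Definition _ :=
  GRing.isLinear.Build S (rest f M) (rest f N) *:%R rest_map rest_map_linear.
End Rest.

Arguments rest_map {S R} f {M N} g m.

(* [tensor ra X] is A (x)_S X for an additive group A with right action ra of S
   and a left S-module X: formal sums of pairs, i.e. sequences, modulo the
   congruence generated by commutativity, biadditivity and S-balancedness. *)
Section Tensor.
Local Open Scope quotient_scope.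
Variables (S : pzRingType) (A : zmodType) (ra : A -> S -> A) (X : lmodType S).

Inductive tensor_rel : seq (A * X) -> seq (A * X) -> Prop :=
| tensor_refl s : tensor_rel s s
| tensor_sym s t : tensor_rel s t -> tensor_rel t s
| tensor_trans s t u : tensor_rel s t -> tensor_rel t u -> tensor_rel s u
| tensor_cat s t s' t' : tensor_rel s s' -> tensor_rel t t' ->
    tensor_rel (s ++ t) (s' ++ t')
| tensor_comm s t : tensor_rel (s ++ t) (t ++ s)
| tensor_zero x : tensor_rel [:: (0, x)] [::]
| tensor_addl a b x : tensor_rel [:: (a + b, x)] [:: (a, x); (b, x)]
| tensor_addr a x y : tensor_rel [:: (a, x + y)] [:: (a, x); (a, y)]
| tensor_bal a s x : tensor_rel [:: (ra a s, x)] [:: (a, s *: x)].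

Definition tensor_eqb (s t : seq (A * X)) : bool := `[< tensor_rel s t >].

Lemma tensor_eqb_equiv : equiv_class_of tensor_eqb.
Proof.
split=> [s|s t|t s u].
- by apply/asboolP; constructor.
- by apply/asboolP/asboolP; apply: tensor_sym.
- by move=> /asboolP st /asboolP tu; apply/asboolP; apply: tensor_trans st tu.
Qed.

Canonical tensor_equiv := EquivRelPack tensor_eqb_equiv.

Definition tensor : Type := {eq_quot tensor_equiv}.
HB.instance Definition _ := Choice.on tensor.
HB.instance Definition _ := EqQuotient.on tensor.

Lemma tensor_piP s t :
  reflect (\pi_tensor s = \pi_tensor t) `[< tensor_rel s t >].
Proof. exact: (@eqquotP _ _ tensor). Qed.

Lemma tensor_pi s t : tensor_rel s t -> \pi_tensor s = \pi_tensor t.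
Proof. by move=> /asboolP/tensor_piP. Qed.

Lemma tensor_repr s : tensor_rel (repr (\pi_tensor s)) s.
Proof. by apply/asboolP/tensor_piP; rewrite reprK. Qed.

Definition tens (a : A) (x : X) : tensor := \pi_tensor [:: (a, x)].
Definition tensor0 : tensor := \pi_tensor [::].
Definition tensorD (u v : tensor) : tensor := \pi_tensor (repr u ++ repr v).
Definition tensorN (u : tensor) : tensor :=
  \pi_tensor [seq (- p.1, p.2) | p <- repr u].

Lemma tensorDE s t :
  tensorD (\pi_tensor s) (\pi_tensor t) = \pi_tensor (s ++ t).
Proof. by apply: tensor_pi; apply: tensor_cat; apply: tensor_repr. Qed.

Lemma tensorDA : associative tensorD.
Proof.
move=> u v w; rewrite -[u]reprK -[v]reprK -[w]reprK (tensorDE (repr v)).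
by rewrite (tensorDE (repr u) (repr v)) !tensorDE catA.
Qed.
Lemma tensorDC : commutative tensorD.
Proof. by move=> u v; apply: tensor_pi; apply: tensor_comm. Qed.
Lemma tensor0D : left_id tensor0 tensorD.
Proof. by move=> u; rewrite -[u]reprK tensorDE. Qed.
Lemma tensorND : left_inverse tensor0 tensorN tensorD.
Proof.
move=> u; rewrite /tensorN -[u in X in tensorD _ X]reprK tensorDE.
apply: tensor_pi; elim: (repr u) => [|[a x] s IHs] /=; first by constructor.
set t := map _ s; rewrite -/t in IHs.
apply: tensor_trans (_ : tensor_rel ([:: (- a, x); (a, x)] ++ (s ++ t)) _).
  apply: (@tensor_cat [:: (- a, x)] _ [:: (- a, x)] ((a, x) :: s ++ t)).
    by constructor.
  exact: (tensor_comm t ((a, x) :: s)).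
rewrite -[[::]]cats0; apply: tensor_cat; last first.
  by apply: tensor_trans IHs; constructor.
apply: tensor_trans (tensor_zero x); apply: tensor_sym.
by rewrite -(addNr a); constructor.
Qed.

HB.instance Definition _ := GRing.isZmodule.Build tensor
  tensorDA tensorDC tensor0D tensorND.

Lemma tens_sum s : \pi_tensor s = \sum_(p <- s) tens p.1 p.2 :> tensor.
Proof.
elim: s => [|[a x] s IHs]; first by rewrite big_nil.
by rewrite big_cons -IHs -[LHS](tensorDE [:: (a, x)] s).
Qed.

Lemma tensDl a b x : tens (a + b) x = tens a x + tens b x.
Proof.
rewrite [RHS](tensorDE [:: (a, x)] [:: (b, x)]).
by apply: tensor_pi; constructor.
Qed.
Lemma tensDr a x y : tens a (x + y) = tens a x + tens a y.
Proof.
rewrite [RHS](tensorDE [:: (a, x)] [:: (a, y)]).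
by apply: tensor_pi; constructor.
Qed.
Lemma tens_bal a s x : tens (ra a s) x = tens a (s *: x).
Proof. by apply: tensor_pi; constructor. Qed.

Lemma tens_ind (P : tensor -> Prop) :
  P 0 -> (forall u v, P u -> P v -> P (u + v)) ->
  (forall a x, P (tens a x)) -> forall u, P u.
Proof.
move=> P0 PD Pt u; rewrite -[u]reprK tens_sum.
by apply: big_ind => // p _; apply: Pt.
Qed.

Definition balanced (Z : zmodType) (b : A -> X -> Z) : Prop :=
  [/\ forall a a' x, b (a + a') x = b a x + b a' x,
      forall a x x', b a (x + x') = b a x + b a x' &
      forall a s x, b (ra a s) x = b a (s *: x)].

Definition tens_lift (Z : zmodType) (b : A -> X -> Z) (u : tensor) : Z :=
  \sum_(p <- repr u) b p.1 p.2.

Section Lift.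
Variables (Z : zmodType) (b : A -> X -> Z).
Hypothesis bb : balanced b.

Lemma tens_lift_pi s :
  tens_lift b (\pi_tensor s) = \sum_(p <- s) b p.1 p.2.
Proof.
have [bDl bDr bbal] := bb.
rewrite /tens_lift; move: (repr _) (tensor_repr s) => t st.
elim: {s t} st => //=.
- by move=> ? ? ? _ -> _ ->.
- by move=> ? ? ? ? _ IH1 _ IH2; rewrite !big_cat /= IH1 IH2.
- by move=> ? ?; rewrite !big_cat /= addrC.
- move=> x; rewrite big_seq1 big_nil /=; apply: (addrI (b 0 x)).
  by rewrite -bDl !addr0.
- by move=> a a' x; rewrite big_seq1 !big_cons big_nil addr0 bDl.
- by move=> a x x'; rewrite big_seq1 !big_cons big_nil addr0 bDr.
- by move=> a t x; rewrite !big_seq1 bbal.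
Qed.

Lemma tens_liftE a x : tens_lift b (tens a x) = b a x.
Proof. by rewrite tens_lift_pi big_seq1. Qed.

Lemma tens_lift_zmod : zmod_morphism (tens_lift b).
Proof.
have D u v : tens_lift b (u + v) = tens_lift b u + tens_lift b v.
  rewrite -[u]reprK -[v]reprK [_ + _](tensorDE (repr u) (repr v)).
  by rewrite !tens_lift_pi big_cat.
move=> u v; apply: (addIr (tens_lift b v)).
by rewrite -D !subrK.
Qed.
End Lift.

End Tensor.

(* R (x)_S X for f : S -> R, R being a right S-module through f. *)
Definition ind (S R : pzRingType) (f : {rmorphism S -> R}) (X : lmodType S)
  : Type := tensor (fun (a : R) (s : S) => a * f s) X.

Section Ind.
Variables (S R : pzRingType) (f : {rmorphism S -> R}).

HB.instance Definition _ (X : lmodType S) := GRing.Zmodule.on (ind f X).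

Definition itens (X : lmodType S) (r : R) (x : X) : ind f X :=
  tens (fun (a : R) (s : S) => a * f s) r x.

Section Module.
Variable X : lmodType S.

Definition ind_scale (r : R) (u : ind f X) : ind f X :=
  tens_lift (fun (a : R) (x : X) => itens (r * a) x) u.

Lemma ind_scale_balanced r :
  balanced (fun (a : R) s => a * f s) (fun (a : R) (x : X) => itens (r * a) x).
Proof.
split=> *; rewrite /itens ?mulrDr ?tensDl ?tensDr ?mulrA //.
exact: tens_bal.
Qed.

Lemma ind_scale_tens r a x : ind_scale r (itens a x) = itens (r * a) x.
Proof. exact: (tens_liftE (ind_scale_balanced r)). Qed.

Lemma ind_scaleDr : right_distributive ind_scale +%R.
Proof.
move=> r u v; have B := tens_lift_zmod (ind_scale_balanced r).
have := B (u + v) v; rewrite addrK => /eqP.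
by rewrite eq_sym subr_eq => /eqP.
Qed.

Lemma ind_scale0 r : ind_scale r 0 = 0.
Proof. by have /eqP := ind_scaleDr r 0 0; rewrite addr0 -subr_eq subrr => /eqP. Qed.

Lemma ind_scaleA r t (u : ind f X) :
  ind_scale r (ind_scale t u) = ind_scale (r * t) u.
Proof.
elim/tens_ind: u => [|u v IHu IHv|a x]; rewrite ?ind_scale0 //.
  by rewrite !ind_scaleDr IHu IHv.
by rewrite !ind_scale_tens mulrA.
Qed.

Lemma ind_scale1 : left_id 1 ind_scale.
Proof.
move=> u; elim/tens_ind: u => [|u v IHu IHv|a x]; rewrite ?ind_scale0 //.
  by rewrite ind_scaleDr IHu IHv.
by rewrite ind_scale_tens mul1r.
Qed.

Lemma ind_scaleDl u : {morph ind_scale^~ u : r t / r + t}.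
Proof.
move=> r t /=; elim/tens_ind: u => [|u v IHu IHv|a x].
- by rewrite !ind_scale0 addr0.
- by rewrite !ind_scaleDr IHu IHv addrACA.
- by rewrite !ind_scale_tens mulrDl; apply: tensDl.
Qed.

HB.instance Definition _ := GRing.Zmodule_isLmodule.Build R (ind f X)
  ind_scaleA ind_scale1 ind_scaleDr ind_scaleDl.
End Module.

Section Map.
Variables (X Y : lmodType S) (g : {linear X -> Y}).

Definition ind_map (u : ind f X) : ind f Y :=
  tens_lift (fun (a : R) (x : X) => itens a (g x)) u.

Lemma ind_map_balanced :
  balanced (fun (a : R) s => a * f s) (fun (a : R) (x : X) => itens a (g x)).
Proof.
split=> *; rewrite /itens ?linearD ?tensDl ?tensDr ?linearZ //.
exact: tens_bal.
Qed.

Lemma ind_map_tens a x : ind_map (itens a x) = itens a (g x).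
Proof. exact: (tens_liftE ind_map_balanced). Qed.

Lemma ind_map_zmod : zmod_morphism ind_map.
Proof. exact: (tens_lift_zmod ind_map_balanced). Qed.

HB.instance Definition _ :=
  GRing.isZmodMorphism.Build (ind f X) (ind f Y) ind_map ind_map_zmod.

Lemma ind_map_scale : scalable ind_map.
Proof.
move=> r u; elim/tens_ind: u => [|u v IHu IHv|a x].
- by rewrite !(scaler0, raddf0).
- by rewrite scalerDr [LHS]raddfD [ind_map (_ + _)]raddfD /= IHu IHv scalerDr.
- rewrite [_ *: _]ind_scale_tens !ind_map_tens; symmetry.
  exact: ind_scale_tens.
Qed.

HB.instance Definition _ :=
  GRing.isScalable.Build R (ind f X) (ind f Y) *:%R ind_map ind_map_scale.
End Map.
End Ind.

Arguments itens {S R} f {X} r x.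
Arguments ind_map {S R} f {X Y} g u.

(* V (x)_k X with the diagonal action: sum_g a_g g acts as
   v (x) x |-> sum_g a_g g v (x) g x. *)
Section DiagonalTensor.
Variables (k : comNzRingType) (gT : finGroupType).
Local Notation A := (galg k gT).
Variable V : lmodType A.
Local Notation resk M := (rest (in_alg A) M).

Definition kact (v : resk V) (c : k) : resk V := c *: v.

Definition dtens (X : lmodType A) : Type := tensor kact (resk X).
HB.instance Definition _ (X : lmodType A) := GRing.Zmodule.on (dtens X).

Definition dt (X : lmodType A) (v : V) (x : X) : dtens X :=
  tens kact (v : resk V) (x : resk X).

Section Module.
Variable X : lmodType A.

Lemma dtDl u v (x : X) : dt (u + v) x = dt u x + dt v x.
Proof. exact: tensDl. Qed.
Lemma dtDr v (x y : X) : dt v (x + y) = dt v x + dt v y.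
Proof. exact: tensDr. Qed.
Lemma dtZ (c : k) v (x : X) : dt ((c%:A : A) *: v) x = dt v ((c%:A : A) *: x).
Proof. exact: tens_bal. Qed.
Lemma dt0l (x : X) : dt 0 x = 0.
Proof. by apply: (addrI (dt 0 x)); rewrite -dtDl !addr0. Qed.
Lemma dt_suml I (r : seq I) (F : I -> V) (x : X) :
  dt (\sum_(i <- r) F i) x = \sum_(i <- r) dt (F i) x.
Proof. by elim/big_rec2: _ => [|i u v _ <-]; rewrite ?dt0l ?dtDl. Qed.
Lemma dt_ind (P : dtens X -> Prop) :
  P 0 -> (forall u v, P u -> P v -> P (u + v)) ->
  (forall v x, P (dt v x)) -> forall u, P u.
Proof. exact: tens_ind. Qed.

Definition dscale (a : A) (u : dtens X) : dtens X :=
  tens_lift (fun (v : resk V) (x : resk X) =>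
    \sum_(g : gT) dt ((a g *: gelt g) *: (v : V)) (gelt g *: (x : X))) u.

Lemma dscale_balanced (a : A) : balanced kact
  (fun (v : resk V) (x : resk X) =>
    \sum_(g : gT) dt ((a g *: gelt g) *: (v : V)) (gelt g *: (x : X))).
Proof.
split=> [u v x|v x y|v c x]; rewrite -?big_split; apply: eq_bigr => g _ /=.
- by rewrite scalerDr dtDl.
- by rewrite scalerDr dtDr.
have cC (b : A) (M : lmodType A) (m : M) : b *: ((c%:A : A) *: m) = (c%:A : A) *: (b *: m).
  by rewrite !scalerA -scalerAr -scalerAl mulr1 mul1r.
by rewrite [kact v c]/((c%:A : A) *: (v : V)) cC dtZ -cC.
Qed.

Lemma dscale_dt a v x :
  dscale a (dt v x) = \sum_(g : gT) dt ((a g *: gelt g) *: v) (gelt g *: x).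
Proof. exact: (tens_liftE (dscale_balanced a)). Qed.

Lemma dscaleDr : right_distributive dscale +%R.
Proof.
move=> a u v; have B := tens_lift_zmod (dscale_balanced a).
have := B (u + v) v; rewrite addrK => /eqP.
by rewrite eq_sym subr_eq => /eqP.
Qed.

Lemma dscale0 a : dscale a 0 = 0.
Proof. by have /eqP := dscaleDr a 0 0; rewrite addr0 -subr_eq subrr => /eqP. Qed.

Lemma dscale_sum a I (r : seq I) (F : I -> dtens X) :
  dscale a (\sum_(i <- r) F i) = \sum_(i <- r) dscale a (F i).
Proof. by elim/big_rec2: _ => [|i u v _ <-]; rewrite ?dscale0 ?dscaleDr. Qed.

Lemma dscaleA a b (u : dtens X) : dscale a (dscale b u) = dscale (a * b) u.
Proof.
elim/dt_ind: u => [|u v IHu IHv|v x]; rewrite ?dscale0 //.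
  by rewrite !dscaleDr IHu IHv.
rewrite !dscale_dt dscale_sum.
transitivity (\sum_(h : gT) \sum_(g : gT)
   dt (((a g * b h) *: gelt (g * h)%g) *: v) (gelt (g * h)%g *: x)).
  apply: eq_bigr => h _; rewrite dscale_dt; apply: eq_bigr => g _.
  by rewrite !scalerA -scalerAl -scalerAr !scalerA -!geltM.
rewrite exchange_big /=.
transitivity (\sum_(g : gT) \sum_(h : gT)
   dt (((a g * b (g^-1 * h)%g) *: gelt h) *: v) (gelt h *: x)).
  apply: eq_bigr => g _; rewrite [RHS](reindex_inj (mulgI g)) /=.
  by apply: eq_bigr => h _; rewrite mulKg.
rewrite exchange_big /=; apply: eq_bigr => h _.
by rewrite -dt_suml -scaler_suml -scaler_suml galgME.
Qed.

Lemma dscale1 : left_id 1 dscale.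
Proof.
move=> u; elim/dt_ind: u => [|u v IHu IHv|v x]; rewrite ?dscale0 //.
  by rewrite dscaleDr IHu IHv.
rewrite dscale_dt (bigD1 1%g) //= -gelt1 ffunE eqxx !scale1r.
rewrite big1 ?addr0 ?gelt1 ?scale1r // => g /negPf ng.
by rewrite ffunE ng !scale0r dt0l.
Qed.

Lemma dscaleDl u : {morph dscale^~ u : a b / a + b}.
Proof.
move=> a b /=; elim/dt_ind: u => [|u v IHu IHv|v x].
- by rewrite !dscale0 addr0.
- by rewrite !dscaleDr IHu IHv addrACA.
rewrite !dscale_dt -big_split; apply: eq_bigr => g _ /=.
by rewrite ffunE !scalerDl dtDl.
Qed.

HB.instance Definition _ := GRing.Zmodule_isLmodule.Build A (dtens X)
  dscaleA dscale1 dscaleDr dscaleDl.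
End Module.

Section Map.
Variables (X Y : lmodType A) (f : {linear X -> Y}).

Definition dtens_map (u : dtens X) : dtens Y :=
  tens_lift (fun (v : resk V) (x : resk X) => dt (v : V) (f x)) u.

Lemma dtens_map_balanced :
  balanced kact (fun (v : resk V) (x : resk X) => dt (v : V) (f x)).
Proof.
split=> [u v x|v x y|v c x].
- exact: dtDl.
- by rewrite -dtDr; congr (dt _ _); apply: linearD.
- rewrite [kact v c]/((c%:A : A) *: (v : V)) dtZ.
  by congr (dt _ _); rewrite -linearZ.
Qed.

Lemma dtens_map_dt v x : dtens_map (dt v x) = dt v (f x).
Proof. exact: (tens_liftE dtens_map_balanced). Qed.

Lemma dtens_map_zmod : zmod_morphism dtens_map.
Proof. exact: (tens_lift_zmod dtens_map_balanced). Qed.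

HB.instance Definition _ :=
  GRing.isZmodMorphism.Build (dtens X) (dtens Y) dtens_map dtens_map_zmod.

Lemma dtens_map_scale : scalable dtens_map.
Proof.
move=> a u; elim/dt_ind: u => [|u v IHu IHv|v x].
- by rewrite !(scaler0, raddf0).
- by rewrite scalerDr [LHS]raddfD [dtens_map (_ + _)]raddfD /= IHu IHv scalerDr.
rewrite [a *: _](dscale_dt a v x) raddf_sum dtens_map_dt.
rewrite [RHS](dscale_dt a v (f x)); apply: eq_bigr => g _.
by rewrite /= dtens_map_dt linearZ.
Qed.

HB.instance Definition _ :=
  GRing.isScalable.Build A (dtens X) (dtens Y) *:%R dtens_map dtens_map_scale.
End Map.
End DiagonalTensor.

Arguments dt {k gT V X} v x.
Arguments dtens_map {k gT} V {X Y} f u.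

Section Blocks.
Variables (k : idomainType) (gT : finGroupType).
Local Notation A := (galg k gT).

(* A block is given by its block idempotent. *)
Definition central_idempotent (e : A) : Prop :=
  e * e = e /\ forall a, a * e = e * a.

Definition is_block (e : A) : Prop :=
  [/\ central_idempotent e, e != 0 &
      forall f, central_idempotent f -> f * e = f -> f = 0 \/ f = e].

(* e lies in the image of the relative trace from (kG)^P to (kG)^G *)
Definition in_rel_trace (P : {group gT}) (e : A) : Prop :=
  exists2 a : A, forall g, g \in P -> gelt g * a = a * gelt g &
    e = \sum_(C in rcosets P [set: gT])
          gelt (fingroup.repr C)^-1%g * a * gelt (fingroup.repr C).

Definition is_defect_group (e : A) (Q : {group gT}) : Prop :=
  in_rel_trace Q e /\
  forall P : {group gT}, P \proper Q -> ~ in_rel_trace P e.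

End Blocks.

(* The Brauer homomorphism at Q truncates an element of (kG)^Q to 'C(Q) and
   reduces its coefficients modulo the maximal ideal of k, the set of nonunits
   (which is 0 if k is a field). *)
Definition brauer_correspondent (k : idomainType) (gT : finGroupType)
    (Q : {group gT}) (e : galg k gT) (b : galg k (subg_of 'N(Q))) : Prop :=
  [/\ is_block b,
      is_defect_group b (sgval @*^-1 Q)%G &
      forall c : subg_of 'N(Q), sgval c \in 'C(Q)%g ->
        e (sgval c) - b c \isn't a GRing.unit].

Arguments brauer_correspondent {k gT} Q e b.

Section Families.
Variable gT : finGroupType.

Definition famX (Q : {group gT}) : {set {group gT}} :=
  [set (Q :&: Q :^ s)%G | s in ~: 'N(Q)%g].

Definition famY (Q : {group gT}) : {set {group gT}} :=
  [set ('N(Q) :&: Q :^ s)%G | s in ~: 'N(Q)%g].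

Definition fam_sub (H : {group gT}) (F : {set {group gT}}) :
    {set {group (subg_of H)}} :=
  [set (sgval @*^-1 P)%G | P in F].

End Families.

Record complex (R : pzRingType) := Complex {
  cx :> int -> lmodType R;
  cd : forall n, {linear cx n -> cx (n + 1)};
  cdd : forall n x, cd (n + 1) (cd n x) = 0 }.

Arguments cd {R} X n : rename.

Record chmap (R : pzRingType) (X Y : complex R) := Chmap {
  ch :> forall n, {linear X n -> Y n};
  chd : forall n x, ch (n + 1) (cd X n x) = cd Y n (ch n x) }.

Section ChainMaps.
Variable R : pzRingType.
Implicit Types X Y Z : complex R.

Definition cheq X Y (f g : chmap X Y) : Prop := forall n, f n =1 g n.

Definition chid X : chmap X X :=
  @Chmap R X X (fun n => idfun) (fun n x => erefl).

Program Definition chcomp X Y Z (g : chmap Y Z) (f : chmap X Y) : chmap X Z :=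
  @Chmap R X Z (fun n => g n \o f n) _.
Next Obligation. by rewrite /= !chd. Qed.

Program Definition chadd X Y (f g : chmap X Y) : chmap X Y :=
  @Chmap R X Y (fun n => f n \+ g n) _.
Next Obligation. by rewrite /= !chd linearD. Qed.

Program Definition chsub X Y (f g : chmap X Y) : chmap X Y :=
  @Chmap R X Y (fun n => f n \- g n) _.
Next Obligation. by rewrite /= !chd linearB. Qed.

Program Definition ch0 X Y : chmap X Y := @Chmap R X Y (fun n => \0) _.
Next Obligation. by rewrite linear0. Qed.

Definition exact_seq X Y Z (i : chmap X Y) (p : chmap Y Z) : Prop :=
  forall n, [/\ injective (i n),
    forall y, p n y = 0 <-> exists x, i n x = y &
    forall z, exists y, p n y = z].

Definition split_seq X Y Z (i : chmap X Y) (p : chmap Y Z) : Prop :=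
  exists (r : chmap Y X) (s : chmap Z Y),
    [/\ cheq (chcomp r i) (chid X), cheq (chcomp p s) (chid Z) &
        cheq (chadd (chcomp i r) (chcomp s p)) (chid Y)].

Definition term_split_seq X Y Z (i : chmap X Y) (p : chmap Y Z) : Prop :=
  forall n, exists (r : {linear Y n -> X n}) (s : {linear Z n -> Y n}),
    [/\ forall x, r (i n x) = x, forall z, p n (s z) = z &
        forall y, i n (r y) + s (p n y) = y].

(* exactness of 0 -> Hom(P,X) -> Hom(P,Y) -> Hom(P,Z) -> 0 *)
Definition hom_from_exact (P X Y Z : complex R) (i : chmap X Y)
    (p : chmap Y Z) : Prop :=
  [/\ forall f : chmap P X, cheq (chcomp i f) (ch0 P Y) -> cheq f (ch0 P X),
      forall g : chmap P Y, cheq (chcomp p g) (ch0 P Z) ->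
        exists f : chmap P X, cheq (chcomp i f) g &
      forall h : chmap P Z, exists g : chmap P Y, cheq (chcomp p g) h].

(* exactness of 0 -> Hom(Z,J) -> Hom(Y,J) -> Hom(X,J) -> 0 *)
Definition hom_to_exact (J X Y Z : complex R) (i : chmap X Y)
    (p : chmap Y Z) : Prop :=
  [/\ forall f : chmap Z J, cheq (chcomp f p) (ch0 Y J) -> cheq f (ch0 Z J),
      forall g : chmap Y J, cheq (chcomp g i) (ch0 X J) ->
        exists f : chmap Z J, cheq (chcomp f p) g &
      forall h : chmap X J, exists g : chmap Y J, cheq (chcomp g i) h].

(* D is the (possibly infinite) direct sum of the D_ i, with injections inj *)
Definition is_direct_sum (I : eqType) (D_ : I -> complex R) (D : complex R)
    (inj : forall i, chmap (D_ i) D) : Prop :=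
  forall n,
    (forall x : D n, exists (s : seq I) (y : forall i, D_ i n),
       x = \sum_(i <- s) inj i n (y i)) /\
    (forall (s : seq I) (y : forall i, D_ i n), uniq s ->
       \sum_(i <- s) inj i n (y i) = 0 -> forall i, i \in s -> y i = 0).

End ChainMaps.

Section Functors.
Variables (S R : pzRingType) (f : {rmorphism S -> R}).

Program Definition rest_cx (X : complex R) : complex S :=
  @Complex S (fun n => rest f (X n)) (fun n => rest_map f (cd X n)) _.
Next Obligation. exact: cdd. Qed.

Program Definition rest_ch (X Y : complex R) (g : chmap X Y) :
    chmap (rest_cx X) (rest_cx Y) :=
  @Chmap S (rest_cx X) (rest_cx Y) (fun n => rest_map f (g n)) _.
Next Obligation. exact: chd. Qed.

Program Definition ind_cx (X : complex S) : complex R :=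
  @Complex R (fun n => ind f (X n)) (fun n => ind_map f (cd X n)) _.
Next Obligation.
elim/tens_ind: x => [|u v IHu IHv|a x]; first by rewrite !raddf0.
  by rewrite !raddfD /= IHu IHv addr0.
by rewrite !ind_map_tens cdd; apply: (addrI (itens f a 0)); rewrite -tensDr !addr0.
Qed.

Program Definition ind_ch (X Y : complex S) (g : chmap X Y) :
    chmap (ind_cx X) (ind_cx Y) :=
  @Chmap R (ind_cx X) (ind_cx Y) (fun n => ind_map f (g n)) _.
Next Obligation.
elim/tens_ind: x => [|u v IHu IHv|a x]; first by rewrite !raddf0.
  by rewrite !raddfD /= IHu IHv.
by rewrite !ind_map_tens chd.
Qed.

End Functors.

Section TensorComplex.
Variables (k : comNzRingType) (gT : finGroupType) (V : lmodType (galg k gT)).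

Program Definition dtens_cx (X : complex (galg k gT)) : complex (galg k gT) :=
  @Complex _ (fun n => dtens V (X n)) (fun n => dtens_map V (cd X n)) _.
Next Obligation.
elim/dt_ind: x => [|u v IHu IHv|v x]; first by rewrite !raddf0.
  by rewrite !raddfD /= IHu IHv addr0.
by rewrite !dtens_map_dt cdd; apply: (addrI (dt v 0)); rewrite -dtDr !addr0.
Qed.

Program Definition dtens_ch (X Y : complex (galg k gT)) (g : chmap X Y) :
    chmap (dtens_cx X) (dtens_cx Y) :=
  @Chmap _ (dtens_cx X) (dtens_cx Y) (fun n => dtens_map V (g n)) _.
Next Obligation.
elim/dt_ind: x => [|u v IHu IHv|v x]; first by rewrite !raddf0.
  by rewrite !raddfD /= IHu IHv.
by rewrite !dtens_map_dt chd.
Qed.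

(* Since G is finite, a finitely generated kG-module that is free over k has a
   finite k-basis. *)
Definition fin_free : Prop :=
  exists n (b : 'I_n -> V), forall v, exists! c : {ffun 'I_n -> k},
    v = \sum_i ((c i)%:A : galg k gT) *: b i.

End TensorComplex.

(* the direct sum of the permutation modules k_P^G, P in F *)
Definition perm_module (k : comNzRingType) (gT : finGroupType)
    (F : {set {group gT}}) : lmodType (galg k gT) :=
  foldr (fun (P : {group gT}) (M : lmodType (galg k gT)) =>
     (ind (gincl P) (rest gaug k^o) * M)%type : lmodType (galg k gT))
   ('rV[galg k gT]_0 : lmodType (galg k gT)) (enum F).

Section FiniteLength.
Local Open Scope classical_set_scope.
Variables (R : pzRingType) (M : lmodType R).

Definition is_submodule (U : set M) : Prop :=
  [/\ U 0, forall x y, U x -> U y -> U (x + y) & forall a x, U x -> U (a *: x)].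

Definition finite_length : Prop :=
  exists (n : nat) (U : nat -> set M),
    [/\ forall i, is_submodule (U i), U 0%N = [set 0], U n = setT &
        forall i, (i < n)%N -> U i `<` U i.+1 /\
          forall W, is_submodule W -> U i `<=` W -> W `<=` U i.+1 ->
            W = U i \/ W = U i.+1].

End FiniteLength.

Inductive split_class := TermSplit | VSplit | VTermSplit | TermVSplit.

(* The flags select Cpx (false) or cpxFL (true), bounded above (^+) and bounded
   below (^-).  The category is the category of complexes itself if
   cc_htpy = None, and its homotopy category for the class c if
   cc_htpy = Some c; cc_V is relevant only for the classes involving V. *)
Record complex_cat (k : comNzRingType) (gT : finGroupType) := ComplexCat {
  cc_FL : bool;
  cc_above : bool;
  cc_below : bool;
  cc_htpy : option split_class;
  cc_V : lmodType (galg k gT) }.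

Definition sub_cat (k : comNzRingType) (gT : finGroupType) (H : {group gT})
    (C : complex_cat k gT) : complex_cat k (subg_of H) :=
  ComplexCat (cc_FL C) (cc_above C) (cc_below C) (cc_htpy C)
    (rest (gincl H) (cc_V C)).

Section Category.
Variables (k : comNzRingType) (gT : finGroupType) (C : complex_cat k gT).
Local Notation A := (galg k gT).
Implicit Types X Y Z P : complex A.

Definition in_cat X : Prop :=
  [/\ cc_FL C -> forall n, finite_length (X n),
      cc_above C -> exists N : int, forall n, N < n -> forall x : X n, x = 0 &
      cc_below C -> exists N : int, forall n, n < N -> forall x : X n, x = 0].

Definition in_class (c : split_class) X Y Z (i : chmap X Y) (p : chmap Y Z) :=
  let Vi := dtens_ch (cc_V C) i in
  let Vp := dtens_ch (cc_V C) p in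
  exact_seq i p /\
  match c with
  | TermSplit => term_split_seq i p
  | VSplit => split_seq Vi Vp
  | VTermSplit => term_split_seq Vi Vp
  | TermVSplit => term_split_seq i p /\ split_seq Vi Vp
  end.

Definition class_projective (c : split_class) P : Prop :=
  in_cat P /\
  forall X Y Z (i : chmap X Y) (p : chmap Y Z),
    in_cat X -> in_cat Y -> in_cat Z -> in_class c i p -> hom_from_exact P i p.

(* equality of morphisms in C *)
Definition ceq X Y (f g : chmap X Y) : Prop :=
  match cc_htpy C with
  | None => cheq f g
  | Some c => exists2 P, class_projective c P &
      exists (u : chmap X P) (v : chmap P Y), cheq (chsub f g) (chcomp v u)
  end.

Definition direct_summand X D : Prop :=
  exists X', in_cat X' /\
  exists (i : chmap X D) (p : chmap D X) (i' : chmap X' D) (p' : chmap D X'),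
    [/\ ceq (chcomp p i) (chid X), ceq (chcomp p' i') (chid X') &
        ceq (chadd (chcomp i p) (chcomp i' p')) (chid D)].

End Category.

Section RelativeProjectivity.
Variables (k : comNzRingType) (gT : finGroupType) (C : complex_cat k gT).
Variable F : {set {group gT}}.
Implicit Types X Y Z P : complex (galg k gT).

Definition fam_projective X : Prop :=
  in_cat C X /\
  exists (I : eqType) (P_ : I -> {group gT})
    (Y_ : forall i, complex (galg k (subg_of (P_ i))))
    (D : complex (galg k gT))
    (inj : forall i, chmap (ind_cx (gincl (P_ i)) (Y_ i)) D),
    [/\ forall i, P_ i \in F /\ in_cat (sub_cat (P_ i) C) (Y_ i),
        in_cat C D, is_direct_sum inj & direct_summand C X D].

Variable e : galg k gT.

Definition in_block X : Prop := forall n (x : X n), e *: x = x.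

(* equality of morphisms in C(B)/F-Proj(C(B)), where e is the idempotent of B;
   e = 1 gives the quotient of the whole category C *)
Definition stable_eq X Y (f g : chmap X Y) : Prop :=
  exists P, [/\ fam_projective P, in_block P &
    exists (u : chmap X P) (v : chmap P Y), ceq C (chsub f g) (chcomp v u)].

Definition stable_iso X Y (f : chmap X Y) : Prop :=
  exists g : chmap Y X, stable_eq (chcomp g f) (chid X) /\
                        stable_eq (chcomp f g) (chid Y).

Record block_complex := BlockComplex {
  bc :> complex (galg k gT);
  bc_cat : in_cat C bc;
  bc_block : in_block bc }.

End RelativeProjectivity.

(* The data of C(B)/F-Proj(C(B)): the objects are the complexes in B, the
   morphisms are represented by chain maps and compared by stable_eq. *)
Record stable_cat := StableCat {
  sc_ring : comNzRingType;
  sc_group : finGroupType;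
  sc_cat : complex_cat sc_ring sc_group;
  sc_fam : {set {group sc_group}};
  sc_block : galg sc_ring sc_group }.

Definition sc_ob (T : stable_cat) := block_complex (sc_cat T) (sc_block T).
Coercion sc_ob : stable_cat >-> Sortclass.

Definition sc_eq (T : stable_cat) (X Y : T) (f g : chmap X Y) : Prop :=
  stable_eq (sc_cat T) (sc_fam T) (sc_block T) f g.

Definition sc_iso (T : stable_cat) (X Y : T) (f : chmap X Y) : Prop :=
  stable_iso (sc_cat T) (sc_fam T) (sc_block T) f.

Record functor (T U : stable_cat) := Functor {
  fob :> T -> U;
  fmap : forall X Y : T, chmap X Y -> chmap (fob X) (fob Y);
  fmap_eq : forall (X Y : T) (f g : chmap X Y),
    sc_eq f g -> sc_eq (fmap f) (fmap g);
  fmap_id : forall X : T, sc_eq (fmap (chid X)) (chid (fob X));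
  fmap_comp : forall (X Y Z : T) (g : chmap Y Z) (f : chmap X Y),
    sc_eq (fmap (chcomp g f)) (chcomp (fmap g) (fmap f)) }.

Arguments fmap {T U} F {X Y} f : rename.

Definition equivalence (T U : stable_cat) (F : functor T U) : Prop :=
  exists (G : functor U T) (eta : forall X : T, chmap X (G (F X)))
    (eps : forall Y : U, chmap (F (G Y)) Y),
    [/\ forall X, sc_iso (eta X),
        forall (X X' : T) (f : chmap X X'),
          sc_eq (chcomp (eta X') f) (chcomp (fmap G (fmap F f)) (eta X)),
        forall Y, sc_iso (eps Y) &
        forall (Y Y' : U) (g : chmap Y Y'),
          sc_eq (chcomp (eps Y') (fmap F (fmap G g))) (chcomp g (eps Y))].

Section Triangulation.
Variable T : stable_cat.
Local Notation C := (sc_cat T).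
Local Notation VF := (perm_module (sc_ring T) (sc_fam T)).
Implicit Types X Y Z I : T.

Definition in_S X Y Z (i : chmap X Y) (p : chmap Y Z) : Prop :=
  [/\ exact_seq i p, split_seq (dtens_ch VF i) (dtens_ch VF p) &
      match cc_htpy C with None => True | Some c => in_class C c i p end].

Definition S_injective I : Prop :=
  forall X Y Z (i : chmap X Y) (p : chmap Y Z),
    in_S i p -> hom_to_exact I i p.

(* A choice of sequences 0 -> X -> sh_inj X -> sh X -> 0 in S with sh_inj X
   S-injective, together with the resulting functor sh = Omega_S^-1 on the
   stable category: sh f is represented by any map f' of cokernels induced by
   an extension g of f. *)
Record shift := Shift {
  sh :> functor T T;
  sh_inj : T -> T;
  sh_i : forall X, chmap X (sh_inj X);
  sh_p : forall X, chmap (sh_inj X) (sh X);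
  sh_S : forall X, in_S (sh_i X) (sh_p X);
  sh_injP : forall X, S_injective (sh_inj X);
  sh_map : forall X Y (f : chmap X Y) (g : chmap (sh_inj X) (sh_inj Y))
      (f' : chmap (sh X) (sh Y)),
    cheq (chcomp g (sh_i X)) (chcomp (sh_i Y) f) ->
    cheq (chcomp f' (sh_p X)) (chcomp (sh_p Y) g) ->
    sc_eq (fmap sh f) f' }.

Definition is_pushout X Y I E (i : chmap X I) (s : chmap X Y) (a : chmap I E)
    (b : chmap Y E) : Prop :=
  cheq (chcomp a i) (chcomp b s) /\
  forall W (a' : chmap I W) (b' : chmap Y W),
    cheq (chcomp a' i) (chcomp b' s) ->
    exists h : chmap E W,
      [/\ cheq (chcomp h a) a', cheq (chcomp h b) b' &
          forall h' : chmap E W, cheq (chcomp h' a) a' ->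
            cheq (chcomp h' b) b' -> cheq h' h].

Definition standard_triangle (W : shift) X Y E (s : chmap X Y) (b : chmap Y E)
    (q : chmap E (W X)) : Prop :=
  exists a : chmap (sh_inj W X) E,
    [/\ is_pushout (sh_i W X) s a b, cheq (chcomp q a) (sh_p W X) &
        cheq (chcomp q b) (ch0 Y (W X))].

Definition distinguished (W : shift) X Y Z (u : chmap X Y) (v : chmap Y Z)
    (w : chmap Z (W X)) : Prop :=
  exists (X0 Y0 E : T) (s : chmap X0 Y0) (b : chmap Y0 E) (q : chmap E (W X0))
    (al : chmap X X0) (be : chmap Y Y0) (ga : chmap Z E),
    [/\ standard_triangle s b q, [/\ sc_iso al, sc_iso be & sc_iso ga],
        sc_eq (chcomp be u) (chcomp s al),
        sc_eq (chcomp ga v) (chcomp b be) &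
        sc_eq (chcomp (fmap W al) w) (chcomp q ga)].

End Triangulation.

Definition triangulated (T U : stable_cat) (WT : shift T) (WU : shift U)
    (F : functor T U) : Prop :=
  (forall (X Y : T) (f g : chmap X Y),
     sc_eq (fmap F (chadd f g)) (chadd (fmap F f) (fmap F g))) /\
  exists phi : forall X : T, chmap (F (WT X)) (WU (F X)),
    [/\ forall X, sc_iso (phi X),
        forall (X Y : T) (f : chmap X Y),
          sc_eq (chcomp (phi Y) (fmap F (fmap WT f)))
                (chcomp (fmap WU (fmap F f)) (phi X)) &
        forall (X Y Z : T) (u : chmap X Y) (v : chmap Y Z) (w : chmap Z (WT X)),
          distinguished u v w ->
          distinguished (fmap F u) (fmap F v) (chcomp (phi X) (fmap F w))].

(* S is V-split for a nonzero V, or contained in the term split sequences.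
   Otherwise (e.g. if the family is empty and C is the category of complexes
   itself) S consists of all exact sequences, while only the zero object is
   projective relative to the zero module: the quotient is then not the stable
   category for S. *)
Definition S_nondegenerate (k : comNzRingType) (gT : finGroupType)
    (C : complex_cat k gT) (F : {set {group gT}}) : Prop :=
  F != finset.set0 \/
  match cc_htpy C with
  | None => False
  | Some TermSplit | Some TermVSplit => True
  | Some VSplit | Some VTermSplit => exists v : cc_V C, v != 0
  end.

Section GreenCorrespondence.
Variables (k : comNzRingType) (gT : finGroupType) (C : complex_cat k gT).
Variables (Q : {group gT}) (e : galg k gT) (b : galg k (subg_of 'N(Q))).

Definition stable_B : stable_cat := StableCat C (famX Q) e.
Definition stable_b : stable_cat :=
  StableCat (sub_cat 'N(Q) C) (fam_sub 'N(Q) (famX Q)) b.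

(* F is isomorphic to X |-> kG (x)_kH X as a functor to C(kG)/X-Proj *)
Definition induced_by_ind (F : functor stable_b stable_B) : Prop :=
  exists eta : forall X : stable_b, chmap (ind_cx (gincl 'N(Q)) X) (F X),
    (forall X, stable_iso C (famX Q) 1 (eta X)) /\
    (forall (X Y : stable_b) (f : chmap X Y),
       stable_eq C (famX Q) 1 (chcomp (eta Y) (ind_ch (gincl 'N(Q)) f))
                              (chcomp (fmap F f) (eta X))).

(* F is isomorphic to restriction to H as a functor to C(kH)/Y-Proj *)
Definition induced_by_res (F : functor stable_B stable_b) : Prop :=
  let CH := sub_cat 'N(Q) C in
  let FY := fam_sub 'N(Q) (famY Q) in
  exists eta : forall X : stable_B, chmap (rest_cx (gincl 'N(Q)) X) (F X),
    (forall X, stable_iso CH FY 1 (eta X)) /\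
    (forall (X Y : stable_B) (f : chmap X Y),
       stable_eq CH FY 1 (chcomp (eta Y) (rest_ch (gincl 'N(Q)) f))
                         (chcomp (fmap F f) (eta X))).

End GreenCorrespondence.

Arguments induced_by_ind {k gT C Q e b} F.
Arguments induced_by_res {k gT C Q e b} F.

Arguments stable_B {k gT} C Q e.
Arguments stable_b {k gT} C Q b.

(* Main.v *)
(** A chain map f vanishes in C(B)/X-Proj iff, up to a map that factors through
    a projective object for the class defining the homotopy category, f is a sum
    over a finite G-set with stabilizers in X of an equivariant family of
    k-linear maps of complexes. If s runs over G outside H and P <= Q lies in no
    Q^s, then Br_P(e) and Br_P(b) agree over the residue field, since their
    difference is nilpotent. By Rosenberg's lemma b(1 - e) is a trace from X and
    e(1 - b) one from the groups H and Q^s intersected. So the unit of the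
    adjunction between e Ind and b Res is invertible modulo X-projectives; the
    counit has a section because e is a trace from Q, and since e Ind is
    adjoint to b Res on both sides this makes them inverse equivalences.

    A sequence is in S iff it is exact and every stably zero map on its first
    term extends to the second; J is S-injective iff 1_J is stably zero.
    Therefore an exact functor which has an adjoint, both respecting stably zero
    maps, preserves S, S-injectives and pushouts, and so the triangles. *)
From HB Require Import structures.
Require Import Defs.
From mathcomp Require Import all_boot all_order all_fingroup all_algebra.
From mathcomp Require Import generic_quotient boolp mxrepresentation mxabelem pgroup sylow.

Set Implicit Arguments.
Unset Strict Implicit.
Unset Printing Implicit Defensive.

Import Order.TTheory GRing.Theory Num.Theory.
Local Open Scope ring_scope.

(** * Traces of equivariant families *)

(** Relative projectivity is handled through traces (Higman's criterion) and not through summands of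
    induced complexes: families over finite sets with an action can be restricted, multiplied and
    induced by changing the action only. The Mackey formula becomes a computation of stabilizers,
    and the infinite direct sums allowed in projective objects are met only once. The obstacle is
    that restriction from [G] to [H] is controlled modulo the groups [H :&: Q :^ s], which may be
    larger than [Q :&: Q :^ s]. It is overcome by the identity of a complex in [b], which is a trace
    from [Q]: a product of traces is a trace from intersections, and [Q] meets [H :&: Q :^ s] in
    [Q :&: Q :^ s]. The functors to the blocks are defined before passing to quotients, by cutting
    with the central idempotents; then the adjunction identities are equalities of chain maps, and
    only the invertibility of unit and counit is a stable statement. Finite length over [kG] is
    translated into a condition over [k], which can be compared between the groups. *)

Definition gmodule (gT : finGroupType) (M : zmodType) (rho : gT -> M -> M) :=
  [/\ forall m, rho 1%g m = m,
      forall g h m, rho (g * h)%g m = rho g (rho h m) &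
      forall g m n, rho g (m - n) = rho g m - rho g n].

Section TraceDefs.
Variables (gT : finGroupType) (M : zmodType) (rho : gT -> M -> M).

(** The action is a total function on [gT] whose composition law is required on [K] alone;
    restricting to a subgroup leaves the set, the action and the family unchanged. *)
Definition gaction (K : {group gT}) (Om : Type) (act : gT -> Om -> Om) :=
  (forall w, act 1%g w = w) /\
  (forall g h w, g \in K -> h \in K -> act (g * h)%g w = act g (act h w)).

Definition stab (K : {group gT}) (Om : eqType) (act : gT -> Om -> Om) (w : Om) :
  {set gT} := [set g in K | act g w == w].

(* The sums of K-orbit sums in M whose stabilizers satisfy Fam. *)
Definition gtrace (K : {group gT}) (Fam : {set gT} -> Prop) (m : M) : Prop :=
  exists (Om : finType) (act : gT -> Om -> Om) (s : Om -> M),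
    [/\ gaction K act, forall g w, g \in K -> s (act g w) = rho g (s w),
        forall w, s w != 0 -> Fam (stab K act w) & m = \sum_w s w].

Definition gfix (K : {group gT}) (m : M) := forall g, g \in K -> rho g m = m.

(** The relative trace from [P] to [K]. For [C = P :* x] and [m] fixed by [P] the summand is
    [rho x^-1 m], whatever the representative. *)
Definition gTr (P K : {group gT}) (m : M) : M :=
  \sum_(C in rcosets P K) rho (fingroup.repr C)^-1%g m.

End TraceDefs.

Section Traces.
Variables (gT : finGroupType) (M : zmodType) (rho : gT -> M -> M).
Hypothesis rhoP : gmodule rho.
Implicit Types (K P : {group gT}) (F : {set gT} -> Prop) (m n : M).

Lemma rho1 m : rho 1%g m = m. Proof. by case: rhoP. Qed.
Lemma rhoM g h m : rho (g * h)%g m = rho g (rho h m). Proof. by case: rhoP. Qed.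
Lemma rhoB g m n : rho g (m - n) = rho g m - rho g n. Proof. by case: rhoP. Qed.
Lemma rho0 g : rho g 0 = 0. Proof. by rewrite -[X in rho g X](subrr 0) rhoB subrr. Qed.
Lemma rhoN g m : rho g (- m) = - rho g m. Proof. by rewrite -sub0r rhoB rho0 sub0r. Qed.
Lemma rhoD g m n : rho g (m + n) = rho g m + rho g n.
Proof. by rewrite -{1}[n]opprK rhoB rhoN opprK. Qed.
Lemma rho_sum g I (r : seq I) (p : pred I) (f : I -> M) :
  rho g (\sum_(i <- r | p i) f i) = \sum_(i <- r | p i) rho g (f i).
Proof. by elim/big_rec2: _ => [|i u v _ <-]; rewrite ?rho0 ?rhoD. Qed.
Lemma rhoK g m : rho g^-1%g (rho g m) = m.
Proof. by rewrite -rhoM mulVg rho1. Qed.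
Lemma rho_eq0 g m : (rho g m == 0) = (m == 0).
Proof. by apply/eqP/eqP => [E|->]; rewrite ?rho0 // -(rhoK g m) E rho0. Qed.

Lemma gaction_inj K (Om : Type) (act : gT -> Om -> Om) g :
  gaction K act -> g \in K -> injective (act g).
Proof.
move=> [a1 aM] Kg v w E.
by rewrite -(a1 v) -(a1 w) -(mulVg g) !aM ?groupV // E.
Qed.

Lemma gtrace_fix K F m : gtrace rho K F m -> gfix rho K m.
Proof.
move=> [Om [act [s [ga se _ ->]]]] g Kg; rewrite rho_sum.
rewrite [RHS](reindex_inj (gaction_inj ga Kg)) /=.
by apply: eq_bigr => w _; rewrite se.
Qed.

Lemma gtrace_fam K F F' m : (forall S : {set gT}, S \subset K -> F S -> F' S) ->
  gtrace rho K F m -> gtrace rho K F' m.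
Proof.
move=> FF [Om [act [s [ga se sF ->]]]]; exists Om, act, s; split=> // w /sF.
by apply: FF; apply/subsetP => g; rewrite inE => /andP[].
Qed.

Lemma gtrace0 K F : gtrace rho K F 0.
Proof.
exists void, (fun _ w => w), (of_void _).
by split=> //; rewrite big1 //; case.
Qed.

Lemma gtraceD K F m n : gtrace rho K F m -> gtrace rho K F n ->
  gtrace rho K F (m + n).
Proof.
move=> [Om [act [s [[a1 aM] se sF ->]]]] [Om' [act' [s' [[a1' aM'] se' sF' ->]]]].
exists (Om + Om')%type.
exists (fun g v => match v with inl w => inl (act g w) | inr w => inr (act' g w) end).
exists (fun v => match v with inl w => s w | inr w => s' w end); split.
- split=> [[w|w]|g h [w|w] Kg Kh]; by rewrite ?a1 ?a1' ?aM ?aM'.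
- by move=> g [w|w] Kg; rewrite ?se ?se'.
- by case=> w => [/sF|/sF'].
by rewrite big_sumType.
Qed.

Lemma gtraceN K F m : gtrace rho K F m -> gtrace rho K F (- m).
Proof.
move=> [Om [act [s [ga se sF ->]]]]; exists Om, act, (fun w => - s w); split=> //.
- by move=> g w Kg; rewrite se // rhoN.
- by move=> w; rewrite oppr_eq0; apply: sF.
by rewrite sumrN.
Qed.

Lemma gtrace_sum K F I (r : seq I) (p : pred I) (f : I -> M) :
  (forall i, p i -> gtrace rho K F (f i)) ->
  gtrace rho K F (\sum_(i <- r | p i) f i).
Proof. by move=> H; apply: big_ind => //; [apply: gtrace0 | apply: gtraceD]. Qed.

(** The same family serves: over [K'] its stabilizers become [S :&: K']. No double coset
    decomposition has to be written down. *)
Lemma gtrace_res K K' F F' m : K' \subset K ->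
  (forall S : {set gT}, S \subset K -> F S -> F' (S :&: K')) ->
  gtrace rho K F m -> gtrace rho K' F' m.
Proof.
move=> sK FF [Om [act [s [[a1 aM] se sF ->]]]]; exists Om, act, s; split=> //.
- by split=> // g h w Kg Kh; rewrite aM // (subsetP sK).
- by move=> g w Kg; rewrite se // (subsetP sK).
move=> w /sF /FF; have -> : stab K' act w = stab K act w :&: K'.
  apply/setP => g; rewrite !inE andbAC; case K'g: (g \in K') => /=; last by rewrite andbF.
  by rewrite (subsetP sK).
by apply; apply/subsetP => g; rewrite inE => /andP[].
Qed.

Lemma gfix_gtrace K (F : _ -> Prop) m : F (K : {set gT}) -> gfix rho K m ->
  gtrace rho K F m.
Proof.
move=> FK fm; exists unit, (fun _ w => w), (fun=> m); split=> //.
- by move=> g w /fm.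
- move=> w _; have -> // : stab K (fun _ w => w) w = K.
  by apply/setP => g; rewrite inE eqxx andbT.
by rewrite (bigD1 tt) //= big1 ?addr0 //; case.
Qed.

(* The G-set induced from the P-set Om, in coordinates given by the coset
   representatives. *)
Lemma gtrace_Tr_part P K K' (D : pred {set gT}) F F' m : P \subset K -> K' \subset K ->
  (forall C g, g \in K' -> D (C :* g)%g = D C) ->
  (forall (S : {set gT}) x, S \subset P -> x \in K -> D (P :* x)%g -> F S ->
     F' ((S :^ x) :&: K')%g) ->
  gtrace rho P F m ->
  gtrace rho K' F' (\sum_(C in rcosets P K | D C) rho (fingroup.repr C)^-1%g m).
Proof.
move=> sPK sK' DM FF [Om [act [s [[a1 aM] se sF ->]]]].
pose R := [set C in rcosets P K | D C]; pose r (C : {set gT}) := fingroup.repr C.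
have rP C : C \in R -> (P :* r C)%g = C.
  by rewrite inE => /andP[/rcosetsP[x _ ->] _]; rewrite rcoset_repr.
have rK C : C \in R -> r C \in K.
  rewrite inE => /andP[/rcosetsP[x Kx ->] _]; have := mem_repr_rcoset P x.
  by case/rcosetP=> y Py E; rewrite /r E groupM // (subsetP sPK).
have RM C g : g \in K' -> ((C :* g)%g \in R) = (C \in R).
  move=> K'g; have Kg := subsetP sK' g K'g; rewrite !inE DM //; congr (_ && _).
  apply/idP/idP; last first.
    case/rcosetsP=> x Kx ->; rewrite -rcosetM; apply/rcosetsP.
    by exists (x * g)%g; rewrite ?groupM.
  case/rcosetsP=> x Kx E; apply/rcosetsP; exists (x * g^-1)%g; first by rewrite groupM ?groupV.
  by rewrite rcosetM -E rcosetK.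
(* The cocycle of the chosen representatives: [q g C] lies in [P] and carries the fibre over [C] to
   the fibre over [C :* g^-1]. *)
pose q g C := (r (C :* g^-1)%g * g * (r C)^-1)%g.
have qP g C : g \in K' -> C \in R -> q g C \in P.
  move=> Kg RC; rewrite /q -mem_rcoset rP //.
  have := mem_repr_rcoset P (r C * g^-1)%g.
  by rewrite rcosetM rP // mem_rcoset invgK.
pose act' g (v : {set gT} * Om) :=
  if v.1 \in R then ((v.1 :* g^-1)%g, act (q g v.1) v.2) else v.
exists ({set gT} * Om)%type, act'.
exists (fun v => if v.1 \in R then rho (r v.1)^-1%g (s v.2) else 0).
have a1' v : act' 1%g v = v.
  case: v => C w; rewrite /act' /=; case: ifP => // RC.
  by rewrite /q invg1 rcoset1 mulg1 mulgV a1.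
split.
- split=> // g h [C w] Kg Kh; rewrite /act' /=; case RC: (C \in R); rewrite /= ?RC //.
  rewrite RM ?groupV // RC invMg rcosetM; congr (_, _).
  rewrite -aM ?qP ?RM ?groupV //; congr (act _ w).
  by rewrite /q invMg rcosetM -!mulgA mulKg.
- move=> g [C w] Kg; rewrite /act' /=; case RC: (C \in R); rewrite /= ?RC ?rho0 //.
  rewrite RM ?groupV // RC se ?qP // -!rhoM; congr (rho _ _).
  by rewrite /q -!mulgA mulKg.
- case=> C w /=; case RC: (C \in R); rewrite ?eqxx // rho_eq0 => /sF FS.
  have -> : stab K' act' (C, w) = (stab P act w :^ r C :&: K')%g.
    apply/setP => g; rewrite inE [RHS]inE mem_conjg !inE /act' /= RC xpair_eqE.
    have rC : r C \in C by rewrite -{2}(rP C RC) rcoset_refl.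
    have gE : (g ^ (r C)^-1)%g = (r C * g^-1 * (r C)^-1)^-1%g.
      by rewrite conjgE !invMg !invgK mulgA.
    have cE : ((C :* g^-1)%g == C) = ((g ^ (r C)^-1)%g \in P).
      rewrite gE groupV -mem_rcoset; apply/eqP/idP => [E|Pg].
        have : (r C * g^-1)%g \in (C :* g^-1)%g by rewrite mem_rcoset invgK mulgKV.
        by rewrite E rP.
      by rewrite -{1}(rP C RC) -rcosetM; rewrite (rcoset_eqP Pg) rP.
    rewrite cE; case Pg: (_ \in P) => /=; last by rewrite andbF.
    rewrite andbC; congr (_ && _); suff -> : q g C = (g ^ (r C)^-1)%g by [].
    rewrite /q; have -> : (C :* g^-1)%g = C by apply/eqP; rewrite cE.
    by rewrite conjgE invgK mulgA.
  apply: FF (rK _ RC) _ FS; first by apply/subsetP => g; rewrite inE => /andP[].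
  by rewrite rP //; move: RC; rewrite inE => /andP[].
rewrite (eq_bigr (fun C => \sum_w rho (r C)^-1%g (s w))) => [|C RC]; last first.
  by rewrite rho_sum.
rewrite pair_big /= [RHS](bigID (fun v => v.1 \in R)) /= [X in _ = _ + X]big1; last first.
  by move=> v /negPf ->.
rewrite addr0; apply: eq_big => v; first by rewrite inE andbT.
by rewrite andbT => H; rewrite inE H.
Qed.

Lemma gtrace_Tr P K F F' m : P \subset K ->
  (forall (S : {set gT}) x, S \subset P -> x \in K -> F S -> F' (S :^ x)%g) ->
  gtrace rho P F m -> gtrace rho K F' (gTr rho P K m).
Proof.
move=> sPK FF tm; rewrite /gTr (eq_bigl (fun C => (C \in rcosets P K) && true)).
  apply: (gtrace_Tr_part (F := F) sPK (subxx K)) tm => // S x SP Kx _ FS.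
  rewrite (setIidPl _); first exact: FF.
  by rewrite -(conjGid Kx) conjSg (subset_trans SP).
by move=> C; rewrite andbT.
Qed.

(** The coset [P] contributes [m] itself; the other cosets are permuted by right multiplication by
    [P], and their representatives lie outside [P]. This is the Mackey formula without its trivial
    double coset. *)
Lemma gTr_rest P F F' m K : P \subset K ->
  (forall (S : {set gT}) x, S \subset P -> x \in K -> x \notin P -> F S ->
     F' ((S :^ x) :&: P)%g) ->
  gtrace rho P F m -> gtrace rho P F' (gTr rho P K m - m).
Proof.
move=> sPK FF tm; rewrite /gTr (bigD1 (P : {set gT})) /=; last first.
  by apply/rcosetsP; exists 1%g; rewrite ?rcoset1.
have rP : fingroup.repr P \in P by apply: (fingroup.mem_repr 1%g).
have -> : rho (fingroup.repr P)^-1%g m = m by rewrite (gtrace_fix tm) ?groupV.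
rewrite addrAC subrr add0r.
apply: (gtrace_Tr_part (D := fun C => C != P) (F := F) sPK sPK) tm => [C g Pg|S x SP Kx ne FS].
  congr (~~ _); apply/eqP/eqP => [E|->]; last by rewrite rcoset_id.
  by rewrite -(rcosetK g C) E rcoset_id // groupV.
by apply: FF => //; apply: contraNN ne => Px; rewrite rcoset_id.
Qed.

Lemma gTr_trans P K (L : {group gT}) m : P \subset K -> K \subset L -> gfix rho P m ->
  gTr rho P L m = gTr rho K L (gTr rho P K m).
Proof.
move=> sPK sKL fm; pose r (C : {set gT}) := fingroup.repr C.
have rE x : exists2 u, u \in P & r (P :* x)%g = (u * x)%g.
  by rewrite /r; have [u Pu ->] := rcosetP (mem_repr_rcoset P x); exists u.
have mE x : rho (r (P :* x)%g)^-1%g m = rho x^-1%g m.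
  by have [u Pu ->] := rE x; rewrite invMg rhoM fm ?groupV.
rewrite /gTr (partition_big (fun C => K :* r C)%g (mem (rcosets K L))) /=; last first.
  move=> _ /rcosetsP[x Lx ->]; have [u Pu ->] := rE x; apply/rcosetsP; exists (u * x)%g => //.
  by rewrite groupM // (subsetP sKL) // (subsetP sPK).
apply: eq_bigr => D /rcosetsP[x Lx DE]; rewrite rho_sum.
have Dr : (K :* r D)%g = D by rewrite DE rcoset_repr.
rewrite -[r D]/(fingroup.repr D) in Dr; set d := fingroup.repr D in Dr *.
have Ld : d \in L.
  have : d \in D by rewrite -Dr rcoset_refl.
  by rewrite DE => /rcosetP[u Ku ->]; rewrite groupM // (subsetP sKL).
transitivity (\sum_(C in (fun C => C :* d)%g @: rcosets P K) rho (r C)^-1%g m).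
  apply: eq_bigl => C; apply/andP/imsetP => [[/rcosetsP[y Ly ->] /eqP CD]|[C' /rcosetsP[q Kq ->] ->]].
    exists (P :* (y * d^-1))%g; last by rewrite -rcosetM mulgKV.
    apply/rcosetsP; exists (y * d^-1)%g => //; rewrite -mem_rcoset Dr -CD.
    by have [u Pu ->] := rE y; rewrite mem_rcoset invMg mulKVg groupV (subsetP sPK).
  rewrite -rcosetM; split.
    by apply/rcosetsP; exists (q * d)%g; rewrite // groupM // (subsetP sKL).
  have [u Pu ->] := rE (q * d)%g.
  by rewrite !rcosetM (rcoset_id (subsetP sPK u Pu)) (rcoset_id Kq) Dr.
rewrite big_imset /=; last by move=> C C' _ _; apply: (can_inj (rcosetK d)).
apply: eq_bigr => _ /rcosetsP[y Ky ->].
by rewrite -rcosetM mE invMg rhoM; congr (rho _ _); symmetry; apply: mE.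
Qed.

End Traces.

Section TraceMaps.
Variables (gT : finGroupType) (L M N : zmodType).
Variables (rl : gT -> L -> L) (rm : gT -> M -> M) (rn : gT -> N -> N).
Hypotheses (rlP : gmodule rl) (rmP : gmodule rm) (rnP : gmodule rn).
Implicit Types (K : {group gT}) (F : {set gT} -> Prop).

Lemma gtrace_map K F (phi : M -> N) m :
  (forall x y, phi (x - y) = phi x - phi y) ->
  (forall g x, g \in K -> phi (rm g x) = rn g (phi x)) ->
  gtrace rm K F m -> gtrace rn K F (phi m).
Proof.
move=> pB pe [Om [act [s [ga se sF ->]]]].
have p0 : phi 0 = 0 by rewrite -(subrr 0) pB subrr.
have pN x : phi (- x) = - phi x by rewrite -sub0r pB p0 sub0r.
have pD x y : phi (x + y) = phi x + phi y by rewrite -{1}[y]opprK pB pN opprK.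
exists Om, act, (fun w => phi (s w)); split=> //.
- by move=> g w Kg; rewrite se ?pe.
- by move=> w nz; apply: sF; apply: contraNneq nz => ->; rewrite p0.
by elim/big_rec2: _ => [|i u v _ <-]; rewrite ?p0 ?pD.
Qed.

(** On [Om * Om'] with the diagonal action the stabilizers are intersections; this is how products
    of traces come from smaller groups. *)
Lemma gtrace_mul K F F' F'' (mu : L -> M -> N) x y :
  (forall a b z, mu (a + b) z = mu a z + mu b z) ->
  (forall a z t, mu a (z + t) = mu a z + mu a t) ->
  (forall g a z, g \in K -> mu (rl g a) (rm g z) = rn g (mu a z)) ->
  (forall S S' : {set gT}, F S -> F' S' -> F'' (S :&: S')) ->
  gtrace rl K F x -> gtrace rm K F' y -> gtrace rn K F'' (mu x y).
Proof.
move=> mDl mDr me FF [Om [act [s [[a1 aM] se sF ->]]]].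
move=> [Om' [act' [s' [[a1' aM'] se' sF' ->]]]].
have m0l z : mu 0 z = 0 by apply: (addrI (mu 0 z)); rewrite -mDl !addr0.
have m0r a : mu a 0 = 0 by apply: (addrI (mu a 0)); rewrite -mDr !addr0.
exists (Om * Om')%type, (fun g v => (act g v.1, act' g v.2)).
exists (fun v => mu (s v.1) (s' v.2)); split.
- by split=> [[w w']|g h [w w'] Kg Kh] /=; rewrite ?a1 ?a1' ?aM ?aM'.
- by move=> g [w w'] Kg /=; rewrite se ?se' ?me.
- move=> [w w'] /= nz.
  have /sF Fw : s w != 0 by apply: contraNneq nz => ->; rewrite m0l.
  have /sF' Fw' : s' w' != 0 by apply: contraNneq nz => ->; rewrite m0r.
  suff -> : stab K (fun g v => (act g v.1, act' g v.2)) (w, w') =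
            stab K act w :&: stab K act' w' by apply: FF.
  by apply/setP => g; rewrite !inE xpair_eqE /=; case: (g \in K).
rewrite -(pair_big predT predT (fun w w' => mu (s w) (s' w'))) /=.
transitivity (\sum_w mu (s w) (\sum_w' s' w')).
  by elim/big_rec2: _ => [|i u v _ <-]; rewrite ?m0l ?mDl.
apply: eq_bigr => w _.
by elim/big_rec2: _ => [|i u v _ <-]; rewrite ?m0r ?mDr.
Qed.
End TraceMaps.

Section TraceSub.
Variables (gT : finGroupType) (H : {group gT}) (M : zmodType).
Variables (rs : subg_of H -> M -> M) (rho : gT -> M -> M).
Hypothesis rsE : forall h, rs h =1 rho (sgval h).

(** [H] occurs both as the group type [subg_of H] and as a subset of [gT]: blocks of [kH] live over
    the former, restrictions of traces over the latter. This lemma and the next translate. *)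
Lemma gtrace_sgval F m : gtrace rs [set: subg_of H] F m ->
  gtrace rho H (fun S => F (sgval @^-1: S)) m.
Proof.
move=> [Om [act [s [[a1 aM] se sF ->]]]].
exists Om, (fun g => act (subg H g)), s; split=> //.
- split=> [w|g h w Hg Hh]; first by rewrite (morph1 (subg_morphism H)) a1.
  by rewrite subgM // aM ?inE.
- by move=> g w Hg; rewrite se ?inE // rsE subgK.
move=> w /sF; suff -> : stab [set: subg_of H] act w =
   sgval @^-1: stab H (fun g => act (subg H g)) w by [].
by apply/setP => g; rewrite !inE subgP sgvalK.
Qed.

Lemma gtrace_subg (F : {set gT} -> Prop) F' m :
  (forall S : {set gT}, S \subset H -> F S -> F' (sgval @^-1: S)) ->
  gtrace rho H F m -> gtrace rs [set: subg_of H] F' m.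
Proof.
move=> FF [Om [act [s [[a1 aM] se sF ->]]]].
exists Om, (fun g => act (sgval g)), s; split=> //.
- by split=> [w|g h w _ _]; rewrite ?a1 ?aM ?subgP.
- by move=> g w _; rewrite se ?subgP // rsE.
move=> w /sF FS; have -> : stab [set: subg_of H] (fun g => act (sgval g)) w =
   sgval @^-1: stab H act w by apply/setP => g; rewrite !inE subgP.
by apply: FF => //; apply/subsetP => g; rewrite inE => /andP[].
Qed.
End TraceSub.

Section Canonical.
Variables (gT : finGroupType) (M : zmodType) (rho : gT -> M -> M).
Hypothesis rhoP : gmodule rho.

(** Sort the orbits by members of [Fam]. In each orbit choose a point whose stabilizer lies in some
    [P]; its [P]-orbit is then a block of imprimitivity, whose translates by coset representatives
    make up the whole orbit. [t P] sums [s] over these [P]-orbits. *)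
Lemma gtrace_canon (Fam : {set {group gT}}) m :
  gtrace rho [set: gT] (fun S => exists2 P : {group gT}, P \in Fam &
    exists x, S :^ x \subset P)%g m ->
  exists t : {group gT} -> M, (forall P, P \in Fam -> gfix rho P (t P)) /\
    m = \sum_(P in Fam) gTr rho P [set: gT] (t P).
Proof.
move=> [Om [act [s [[a1 aM] se sF ->]]]].
have {}aM g h w : act (g * h)%g w = act g (act h w) by apply: aM; rewrite inE.
have {}se g w : s (act g w) = rho g (s w) by apply: se; rewrite inE.
have aK g w : act g^-1%g (act g w) = w by rewrite -aM mulVg a1.
have aI g : injective (act g) by apply: can_inj (aK g).
pose G := [set: gT]; pose orb w := [set act g w | g : gT].
have orbE g w : orb (act g w) = orb w.
  apply/setP => v; apply/imsetP/imsetP => -[h _ ->].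
    by exists (h * g)%g; rewrite ?aM.
  by exists (h * g^-1)%g; rewrite ?aM ?aK.
(* The choice is made on the orbit as a set, so that all its points share it. *)
pose ch (O : {set Om}) := [pick v : {group gT} * Om |
  [&& v.1 \in Fam, v.2 \in O & stab [set: gT] act v.2 \subset v.1]].
have chP O P w : ch O = Some (P, w) ->
  [/\ P \in Fam, w \in O & stab [set: gT] act w \subset P].
  by rewrite /ch; case: pickP => // -[P' w'] /= /and3P[? ? ?] [<- <-].
have chN w : s w != 0 -> ch (orb w).
  move=> /sF [P FP [x Sx]]; rewrite /ch; case: pickP => [v /andP[] //|].
  move/(_ (P, act x^-1%g w)) => /negP[]; rewrite /= FP imset_f ?inE //=.
  apply: subset_trans Sx; apply/subsetP => g; rewrite mem_conjg !inE /= -aM => /eqP e.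
  by apply/eqP; apply: (aI x^-1%g); rewrite -aM conjgE invgK mulKg.
pose W P := [set w | (s w != 0) && (ch (orb w) == Some (P, w))].
pose D (P : {group gT}) := [set act g w | g in P, w in W P].
pose E P := [set w | (s w != 0) && (if ch (orb w) is Some v then v.1 == P else false)].
have DM (P : {group gT}) g w : g \in P -> (act g w \in D P) = (w \in D P).
  move=> Pg; apply/imset2P/imset2P => -[h v Ph Wv].
    by move=> /(congr1 (act g^-1%g)); rewrite aK -aM => ->; exists (g^-1 * h)%g v; rewrite ?groupM ?groupV.
  by move=> ->; exists (g * h)%g v; rewrite ?groupM ?aM.
have sE P : \sum_(w in E P) s w = gTr rho P [set: gT] (\sum_(w in D P) s w).
  rewrite /gTr; under [RHS]eq_bigr => C _.
    rewrite (rho_sum rhoP); under eq_bigr => w _ do rewrite -se.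
    over.
  rewrite pair_big /=.
  pose f (v : {set gT} * Om) := act (fingroup.repr v.1)^-1%g v.2.
  have -> : E P = f @: setX (rcosets P [set: gT]) (D P).
    apply/setP => w; rewrite inE; apply/idP/imsetP.
      case/andP=> nz; case chw: (ch (orb w)) => [[P' w']|] // /eqP /= eP.
      move: chw; rewrite {P'}eP => chw; have [FP wo sP] := chP _ _ _ chw.
      case/imsetP: (wo) => g _ ew'.
      have wE : w = act g^-1%g w' by rewrite ew' aK.
      have Ww' : w' \in W P by rewrite inE ew' orbE se (rho_eq0 rhoP) nz /= -ew' chw.
      have := mem_repr_rcoset P g; case/rcosetP => p Pp rE.
      exists (P :* g, act p w')%g.
        rewrite inE /= ; apply/andP; split; first by apply/rcosetsP; exists g; rewrite ?inE.
        by apply/imset2P; exists p w'.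
      by rewrite /f /= rE invMg aM aK wE.
    case=> -[C v] /setXP [/= RC /imset2P [p w' Pp]]; rewrite inE => /andP [nz /eqP chw] -> ->.
    by rewrite /f /= !se !(rho_eq0 rhoP) nz /= !orbE chw /=.
  (* Cosets that yield the same point have representatives differing by an element of [P], because
     the stabilizer of the chosen point lies in [P]. *)
  rewrite big_imset /=; last first.
    move=> [C v] [C' v'] /setXP [/= RC /imset2P [p w Pp]]; rewrite inE => /andP [nz /eqP chw] ->.
    move=> /setXP [/= RC' /imset2P [p' w' Pp']]; rewrite inE => /andP [nz' /eqP chw'] ->.
    rewrite /f /= => e.
    have oe : orb w = orb w'.
      by move/(congr1 orb): e; rewrite !orbE.
    have ew : w = w' by move: chw; rewrite oe chw' => -[].
    rewrite -{w' oe nz' chw'}ew in e *.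
    have [FP wo sP] := chP _ _ _ chw.
    have : (p'^-1 * fingroup.repr C' * (fingroup.repr C)^-1 * p)%g \in P.
      by apply: (subsetP sP); rewrite !inE !aM e -!aM mulgK mulVg a1 eqxx.
    rewrite groupMr // -mulgA groupMl ?groupV // => PC.
    have eC : C = C'.
      case/rcosetsP: RC PC => x _ ->; case/rcosetsP: RC' => x' _ -> PC.
      rewrite -(rcoset_repr P x) -(rcoset_repr P x'); apply/esym/rcoset_eqP.
      by rewrite mem_rcoset.
    by move: e; rewrite eC => /aI ->.
  by apply: eq_bigl => v; rewrite inE.
exists (fun P => \sum_(w in D P) s w); split=> [P FP g Pg|].
  rewrite (rho_sum rhoP) [RHS](reindex_inj (aI g)) /=.
  by apply: eq_big => w; rewrite ?DM // => _; rewrite se.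
transitivity (\sum_(w | s w != 0) s w).
  by rewrite [LHS](bigID (fun w => s w != 0)) /= [X in _ + X]big1 ?addr0 // => w /negPn/eqP.
rewrite (partition_big (fun w => (odflt (1%G, w) (ch (orb w))).1) (mem Fam)) /=; last first.
  by move=> w /chN; case chw: ch => [[P w']|] //= _; case: (chP _ _ _ chw).
apply: eq_bigr => P FP; rewrite -sE; apply: eq_bigl => w; rewrite inE.
case nz: (s w != 0) => //=; case: (ch _) (chN w nz) => //.
Qed.
End Canonical.

(** * Reduction to the residue field *)

(** In a field the nonunits reduce to [0], so the identity has the required kernel; in the other
    case the residue map is given. *)
Lemma residue_ring (p : nat) (k : idomainType) :
  closed_field_pchar p k \/ complete_dvr p k ->
  exists (F : fieldType) (r : {rmorphism k -> F}),
    (forall x, (r x == 0) = (x \isn't a GRing.unit)) /\ p \in [pchar F].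
Proof.
case=> [[fa _ pk]|[_ [F [r [_ rP pF]]]]]; last by exists F, r.
pose F : fieldType := HB.pack_for fieldType k (GRing.UnitRing_isField.Build k fa).
exists F, (idfun : {rmorphism k -> k}); split=> // x.
rewrite /=; apply/idP/negP => [/eqP ->|nu]; first by rewrite unitr0.
by apply: contra_notT nu; apply: fa.
Qed.

Section Conjugation.
Variables (k : comNzRingType) (gT : finGroupType).
Local Notation A := (galg k gT).
Implicit Types (a b : A) (g x : gT).

Lemma gelt_mull g a x : (gelt g * a) x = a (g^-1 * x)%g.
Proof.
rewrite galgME (bigD1 g) //= ffunE eqxx mul1r big1 ?addr0 // => y /negPf ny.
by rewrite ffunE ny mul0r.
Qed.

Lemma gelt_mulr g a x : (a * gelt g) x = a (x * g^-1)%g.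
Proof.
rewrite galgME (bigD1 (x * g^-1)%g) //= ffunE invMg invgK mulgKV eqxx mulr1.
rewrite big1 ?addr0 // => y /negP ny; rewrite ffunE; case: eqP => [E|]; rewrite ?mulr0 //.
by case: ny; rewrite -E invMg invgK mulKVg.
Qed.

Definition gconj g a : A := gelt g * a * gelt g^-1%g.

Lemma gconjE g a x : gconj g a x = a (x ^ g)%g.
Proof. by rewrite /gconj gelt_mulr gelt_mull invgK conjgE mulgA. Qed.

Lemma gconjP : gmodule gconj.
Proof.
split=> [m|g h m|g m n]; rewrite /gconj.
- by rewrite invg1 !gelt1 mul1r mulr1.
- by rewrite invMg !geltM !mulrA.
- by rewrite mulrBr mulrBl.
Qed.

Lemma geltV g : gelt g^-1%g * gelt g = 1 :> A.
Proof. by rewrite -geltM mulVg. Qed.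

Lemma gconjM g a b : gconj g (a * b) = gconj g a * gconj g b.
Proof. by rewrite /gconj -!mulrA (mulrA (gelt g^-1%g)) geltV mul1r. Qed.

Lemma gconj1 g : gconj g 1 = 1.
Proof. by rewrite /gconj mulr1 -geltM mulgV. Qed.

Lemma gfix_comm (K : {group gT}) a :
  gfix gconj K a <-> (forall g, g \in K -> gelt g * a = a * gelt g).
Proof.
split=> H g Kg.
  by rewrite -{2}(H g Kg) /gconj -!mulrA geltV mulr1.
by rewrite /gconj H // -mulrA -geltM mulgV mulr1.
Qed.

Lemma gfixM (K : {group gT}) a b : gfix gconj K a -> gfix gconj K b ->
  gfix gconj K (a * b).
Proof. by move=> fa fb g Kg; rewrite gconjM fa ?fb. Qed.

Lemma gfixB (K : {group gT}) a b : gfix gconj K a -> gfix gconj K b ->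
  gfix gconj K (a - b).
Proof. by move=> fa fb g Kg; rewrite (rhoB gconjP) fa ?fb. Qed.

Lemma gfix1 (K : {group gT}) : gfix gconj K 1.
Proof. by move=> g _; rewrite gconj1. Qed.

Lemma central_gfix (K : {group gT}) a : (forall c, c * a = a * c) -> gfix gconj K a.
Proof. by move=> H; apply/gfix_comm. Qed.

Lemma gtrace_mulr (K : {group gT}) F F' a b :
  (forall S : {set gT}, S \subset K -> F S -> F' S) ->
  gtrace gconj K F a -> gfix gconj K b -> gtrace gconj K F' (a * b).
Proof.
move=> FF ta fb; have := @gtrace_map _ _ _ gconj gconj K F' (fun x : A => x * b) a _ _ (gtrace_fam FF ta); apply.
  by move=> x y; rewrite mulrBl.
by move=> g x Kg; rewrite gconjM fb.
Qed.

Lemma gtrace_mull (K : {group gT}) F a b :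
  gfix gconj K a -> gtrace gconj K F b -> gtrace gconj K F (a * b).
Proof.
move=> fa tb; have := @gtrace_map _ _ _ gconj gconj K F (fun x : A => a * x) b _ _ tb; apply.
  by move=> x y; rewrite mulrBr.
by move=> g x Kg; rewrite gconjM fa.
Qed.

Lemma gtrace_mul2 (K : {group gT}) F F' F'' a b :
  (forall S S' : {set gT}, F S -> F' S' -> F'' (S :&: S')) ->
  gtrace gconj K F a -> gtrace gconj K F' b -> gtrace gconj K F'' (a * b).
Proof.
move=> FF; apply: (gtrace_mul (rl := gconj) (rm := gconj)) FF => *.
- exact: mulrDl.
- exact: mulrDr.
- by rewrite gconjM.
Qed.
End Conjugation.
Arguments gconj {k gT} g a.

Section RelTrace.
Variables (k : idomainType) (gT : finGroupType).
Local Notation A := (galg k gT).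

Lemma in_rel_traceE (Q : {group gT}) (e : A) :
  in_rel_trace Q e <->
  exists2 a : A, gfix gconj Q a & e = gTr gconj Q [set: gT] a.
Proof.
split=> -[a fa ->]; exists a.
- by apply/gfix_comm.
- by apply: eq_bigr => C _; rewrite /gconj invgK.
- by apply/gfix_comm.
- by apply: eq_bigr => C _; rewrite /gconj invgK.
Qed.

Lemma rel_trace_gtrace (Q : {group gT}) (e : A) : in_rel_trace Q e ->
  gtrace gconj [set: gT] (fun S => exists x, S \subset Q :^ x)%g e.
Proof.
case/in_rel_traceE => a fa ->.
apply: (gtrace_Tr (gconjP _ _) (F := fun S => S \subset Q)); first exact: subsetT.
  by move=> S x _ _ SQ; exists x; rewrite conjSg.
exact: gfix_gtrace.
Qed.

End RelTrace.

Section Augment.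
Variables (k : comNzRingType) (gT : finGroupType) (H : {group gT}).

Lemma ginclE (b : galg k (subg_of H)) x :
  gincl H b x = if x \in H then b (subg H x) else 0.
Proof.
rewrite /gincl /galg_ext sum_ffunE; case: ifP => Hx.
  rewrite (bigD1 (subg H x)) //= galgZE ffunE subgK // eqxx mulr1.
  rewrite big1 ?addr0 // => y ny; rewrite galgZE ffunE; case: eqP => [E|_]; last by rewrite mulr0.
  by case/eqP: ny; rewrite E sgvalK.
rewrite big1 // => y _; rewrite galgZE ffunE; case: eqP => [E|_]; last by rewrite mulr0.
by move: Hx; rewrite E subgP.
Qed.

Lemma gincl_gelt h : gincl H (gelt h) = gelt (sgval h) :> galg k gT.
Proof.
apply/ffunP => x; rewrite ginclE !ffunE; case: ifP => Hx.
  by rewrite -{2}(@subgK gT H x Hx) (inj_eq (@subg_inj gT H)).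
by case: eqP => // E; move: Hx; rewrite E subgP.
Qed.

Lemma gincl_gconj h (a : galg k (subg_of H)) :
  gincl H (gconj h a) = gconj (sgval h) (gincl H a).
Proof. by rewrite /gconj !rmorphM /= !gincl_gelt. Qed.

Definition gtrunc (a : galg k gT) : galg k (subg_of H) := [ffun h => a (sgval h)].

Lemma gtrunc_gconj h a : gtrunc (gconj (sgval h) a) = gconj h (gtrunc a).
Proof. by apply/ffunP => x; rewrite ffunE !gconjE ffunE. Qed.

Lemma gincl_trunc a x : gincl H (gtrunc a) x = if x \in H then a x else 0.
Proof. by rewrite ginclE; case: ifP => // Hx; rewrite ffunE subgK. Qed.
End Augment.
Arguments gtrunc {k gT} H a.

Section Gmap.
Variables (k F : comNzRingType) (r : {rmorphism k -> F}) (gT : finGroupType).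

Definition gmap (a : galg k gT) : galg F gT := [ffun x => r (a x)].

Lemma gmap_zmod : zmod_morphism gmap.
Proof. by move=> a b; apply/ffunP => x; rewrite !ffunE rmorphB. Qed.
Lemma gmap_monoid : monoid_morphism gmap.
Proof.
split=> [|a b]; apply/ffunP => x; rewrite ffunE.
  by rewrite -!gelt1 !ffunE; case: eqP; rewrite ?rmorph1 ?rmorph0.
by rewrite !galgME rmorph_sum; apply: eq_bigr => y _; rewrite rmorphM !ffunE.
Qed.
HB.instance Definition _ := GRing.isZmodMorphism.Build _ _ gmap gmap_zmod.
HB.instance Definition _ := GRing.isMonoidMorphism.Build _ _ gmap gmap_monoid.

End Gmap.

Section PGroupSum.
Variables (gT : finGroupType) (p : nat) (P : {group gT}) (V : zmodType).
Hypotheses (pP : (p.-group P)%g) (pV : forall v : V, v *+ p = 0).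

(** A [P]-orbit outside ['C(P)] has length a positive power of [p], and [phi] is constant on it, so
    that it contributes [0]. *)
Lemma pgroup_sum (phi : gT -> V) :
  (forall g y, g \in P -> phi (y ^ g)%g = phi y) ->
  \sum_y phi y = \sum_(y in 'C(P)%g) phi y.
Proof.
move=> inv; rewrite [LHS](bigID (mem 'C(P)%g)) /= [X in _ + X]big_mkcond /=.
pose psi y := if y \notin 'C(P)%g then phi y else 0.
rewrite -[X in _ + X]/(\sum_y psi y); suff -> : \sum_y psi y = 0 by rewrite addr0.
have psiJ g y : g \in P -> psi (y ^ g)%g = psi y.
  move=> Pg; rewrite /psi inv // memJ_norm //.
  exact: (subsetP (norms_cent (normG P))).
have actsP : [acts P, on [set: gT] | 'J]%g by apply/actsP => g _ y; rewrite !inE.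
transitivity (\sum_(y in [set: gT]) psi y); first by apply: eq_bigl => y; rewrite inE.
rewrite (set_partition_big _ (orbit_partition actsP)) /=; apply: big1 => O /imsetP[x _ ->].
rewrite (eq_bigr (fun=> psi x)) => [|y /orbitP[g Pg <-]]; last exact: psiJ.
rewrite sumr_const; have [fx|nfx] := boolP (x \in 'C(P)%g).
  by rewrite /psi fx mul0rn.
rewrite card_orbit; have pI : p.-nat #|P : 'C_P[x | 'J]|%g by apply: pnat_dvd (dvdn_indexg _ _) pP.
have [n en] := p_natP pI; rewrite en; case: n en => [|n] en; last first.
  by rewrite expnS mulrnA pV mul0rn.
case/negP: nfx; rewrite -sub_cent1 -astab1J; apply: subset_trans (subsetIr P _).
by rewrite -indexg_eq1 en.
Qed.
End PGroupSum.

(** * The Brauer correspondence modulo traces *)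

Section Nilpotent.
Variables (F : fieldType) (p : nat) (gT : finGroupType).
Hypothesis pF : p \in [pchar F].
Local Notation A := (galg F gT).
Local Notation n := #|gT|.

(** Right multiplication by [a] on row vectors indexed by [gT]; the rank is the dimension of the
    left ideal generated by [a]. *)
Definition regmx (a : A) : 'M[F]_n :=
  \matrix_(i, j) a ((enum_val i)^-1 * enum_val j)%g.

Lemma regmxM a b : regmx (a * b) = regmx a *m regmx b.
Proof.
apply/matrixP => i j; rewrite !mxE galgME (reindex_inj (mulgI (enum_val i)^-1%g)) /=.
rewrite (reindex (@enum_val _ gT)) /=; last exact/onW_bij/enum_val_bij.
by apply: eq_bigr => l _; rewrite !mxE invMg invgK -!mulgA mulKVg.
Qed.

Lemma regmx1 : regmx 1 = 1%:M.
Proof.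
apply/matrixP => i j; rewrite !mxE -gelt1 ffunE -eq_mulVg1.
by rewrite (inj_eq enum_val_inj).
Qed.

Lemma regmx_eq0 a : regmx a = 0 -> a = 0.
Proof.
move/matrixP => E; apply/ffunP => x; have := E (enum_rank 1%g) (enum_rank x).
by rewrite !mxE !enum_rankK invg1 mul1g ffunE.
Qed.

Lemma regmx_sum a : regmx a = \sum_x a x *: regmx (gelt x).
Proof.
apply/matrixP => i j; rewrite summxE mxE (bigD1 ((enum_val i)^-1 * enum_val j)%g) //=.
rewrite !mxE ffunE eqxx mulr1 big1 ?addr0 // => x nx.
by rewrite !mxE ffunE eq_sym (negPf nx) mulr0.
Qed.

Lemma regmx_repr (Q : {group gT}) : mx_repr Q (fun x => regmx (gelt x)).
Proof. by split=> [|x y _ _]; rewrite ?gelt1 ?regmx1 // geltM regmxM. Qed.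

(* On a nonzero FQ-submodule W = (FG)z^N, the p-group Q has a nonzero fixed
   vector w. The Q-orbit sums in wz vanish, so that Wz has smaller dimension. *)
Lemma local_nilpotent (Q : {group gT}) (z : A) : (p.-group Q)%g ->
  gfix gconj Q z -> (forall x, x \notin 'N(Q)%g -> z x = 0) ->
  (forall x, x \in 'C(Q)%g -> z x = 0) -> exists N, z ^+ N = 0.
Proof.
move=> pQ fz zN zC; pose d N := \rank (regmx (z ^+ N)).
suff key N : (exists N', z ^+ N' = 0) \/ (d N.+1 < d N)%N.
  have [//|nE] := pselect (exists N, z ^+ N = 0).
  have {}key N : (d N.+1 < d N)%N by case: (key N).
  have bd N : (d N + N <= d 0)%N.
    by elim: N => [|N IH]; rewrite ?addn0 // addnS -addSn; apply: leq_trans IH; rewrite leq_add2r key.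
  have := leq_trans (leq_addl _ _) (bd (d 0).+1).
  by rewrite ltnn.
have [e|nz] := eqVneq (regmx (z ^+ N)) 0; first by left; exists N; apply: regmx_eq0.
right; rewrite /d; set W := regmx (z ^+ N).
pose rG := MxRepresentation (regmx_repr Q).
have zNf : gfix gconj Q (z ^+ N).
  by elim: N {nz W} => [|N IH]; [apply: gfix1 | rewrite exprS; apply: gfixM].
have Wmod : mxmodule rG W.
  apply/mxmoduleP => x Qx; rewrite /= -regmxM -(iffLR (gfix_comm Q _) zNf) //.
  by rewrite regmxM submxMl.
have rk0 : (0 < \rank W)%N by rewrite lt0n mxrank_eq0.
have := rfix_pgroup_pchar pF (submod_repr Wmod) rk0 pQ (subxx _).
rewrite -mxrank_eq0 rfix_submod // => nzf.
have : (W :&: rfix_mx rG Q)%MS != 0.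
  apply: contraNneq nzf => ->; by rewrite linear0 mxrank0.
case/rowV0Pn => w; rewrite sub_capmx => /andP[wW /rfix_mxP wfix] w0.
have wR q x : q \in Q -> w *m regmx (gelt (q * x)%g) = w *m regmx (gelt x).
  by move=> Qq; rewrite geltM regmxM mulmxA; have /= -> := wfix q Qq.
have wz : w *m regmx z = 0.
  rewrite regmx_sum mulmx_sumr.
  have -> : \sum_x w *m (z x *: regmx (gelt x)) = \sum_x z x *: (w *m regmx (gelt x)).
    by apply: eq_bigr => x _; rewrite scalemxAr.
  have pV (v : 'rV[F]_n) : v *+ p = 0.
    by rewrite -scaler_nat (pcharf0 pF) scale0r.
  rewrite (pgroup_sum pQ pV) => [|g y Qg].
    by apply: big1 => x /zC ->; rewrite scale0r.
  have -> : z (y ^ g)%g = z y by rewrite -gconjE fz.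
  have [Ny|/zN ->] := boolP (y \in 'N(Q)%g); last by rewrite !scale0r.
  (* For [y] normalizing [Q], [y ^ g] is [y] multiplied on the left by elements of [Q], which fix
     [w]. So the summand is constant on [Q]-orbits, as [pgroup_sum] requires, and on ['C(Q)] the
     coefficients of [z] vanish. *)
  have -> : (y ^ g = g^-1 * ((g ^ y^-1) * y))%g by rewrite !conjgE invgK !mulgA mulgKV.
  by rewrite !wR ?groupV // memJ_norm // groupV.
(* The rank drops by the dimension of the kernel of [z] on [W], which contains [w]. *)
have := mxrank_mul_ker W (regmx z); rewrite -regmxM -exprSr => <-.
rewrite -[X in (X < _)%N]addn0 ltn_add2l lt0n mxrank_eq0.
apply: contraNneq w0 => c0; have : (w <= W :&: kermx (regmx z))%MS.
  by rewrite sub_capmx wW; apply/sub_kermxP.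
by rewrite c0 submx0.
Qed.

(** Conjugating [y] by [P] does not change [a y * b (y^-1 * x)], as [x] centralizes [P]; in
    characteristic [p] only the fixed [y] count. This is the multiplicativity of the Brauer map. *)
Lemma pgroup_brauerM (P : {group gT}) (a b : A) x : (p.-group P)%g ->
  gfix gconj P a -> gfix gconj P b -> x \in 'C(P)%g ->
  (a * b) x = \sum_(y in 'C(P)%g) a y * b (y^-1 * x)%g.
Proof.
move=> pP fa fb Cx; rewrite galgME (pgroup_sum pP) // => [v|g y Pg].
  by rewrite -mulr_natr (pcharf0 pF) mulr0.
rewrite -gconjE fa // -[in b _](_ : ((y^-1 * x) ^ g = (y ^ g)^-1 * x)%g) -?gconjE ?fb //.
rewrite conjMg conjVg; congr (_ * _)%g.
by rewrite conjgE (centP Cx g Pg) mulKg.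
Qed.

Definition brauer (P : {group gT}) (a : A) : A := [ffun x => if x \in 'C(P)%g then a x else 0].

Lemma brauerM (P : {group gT}) a b : (p.-group P)%g ->
  gfix gconj P a -> gfix gconj P b -> brauer P (a * b) = brauer P a * brauer P b.
Proof.
move=> pP fa fb; apply/ffunP => x; rewrite [LHS]ffunE [RHS]galgME [RHS](bigID (mem 'C(P)%g)) /=.
rewrite [X in _ = _ + X]big1 ?addr0 => [|y /negPf nC]; last by rewrite ffunE nC mul0r.
case: ifP => Cx; first rewrite (pgroup_brauerM pP fa fb Cx).
  by apply: eq_bigr => y Cy; rewrite !ffunE Cy groupM ?groupV.
by rewrite big1 // => y Cy; rewrite !ffunE groupMl ?groupV // Cx mulr0.
Qed.

Lemma brauerB (P : {group gT}) a b : brauer P (a - b) = brauer P a - brauer P b.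
Proof. by apply/ffunP => x; rewrite !ffunE; case: ifP; rewrite ?subr0. Qed.

(** The difference [d] of two commuting idempotents satisfies [d ^+ 3 = d], so a vanishing power
    forces [d = 0]. *)
Lemma idem_diff_nilp (R : nzRingType) (E B : R) N :
  E * E = E -> B * B = B -> E * B = B * E -> (E - B) ^+ N = 0 -> E = B.
Proof.
move=> EE BB EB; pose P := E * B.
have EP : E * P = P by rewrite mulrA EE.
have BP : B * P = P by rewrite /P EB mulrA BB.
have d2 : (E - B) * (E - B) = E - P - (P - B).
  by rewrite mulrBl !mulrBr EE BB -EB.
have d3 : (E - B) * ((E - B) * (E - B)) = E - B.
  rewrite d2 mulrBl !mulrBr EE EP BP BB -EB subrr subr0 opprB.
  by rewrite subr0 addrA subrK.
have dj j : (E - B) ^+ j.*2.+1 = E - B.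
  by elim: j => [|j IH]; rewrite ?expr1 // doubleS exprS exprS IH.
by move=> dN; rewrite -[E](subrK B) -(dj N) -addnn -addSn exprD dN mulr0 add0r.
Qed.

Lemma idem_mul_sub (R : nzRingType) (E B : R) : E * E = E -> B * B = B ->
  E * B = B * E -> (E * (1 - B)) * (E * (1 - B)) = E * (1 - B).
Proof.
move=> EE BB EB; have c : (1 - B) * E = E * (1 - B) by rewrite mulrBl mulrBr mul1r mulr1 EB.
have i : (1 - B) * (1 - B) = 1 - B by rewrite mulrBr mulr1 mulrBl mul1r BB subrr subr0.
by rewrite mulrA -(mulrA E) c mulrA EE -mulrA i.
Qed.
End Nilpotent.

Section Units.
Variables (k : idomainType) (F : fieldType) (r : {rmorphism k -> F}) (gT : finGroupType).
Hypothesis rP : forall x, (r x == 0) = (x \isn't a GRing.unit).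
Local Notation A := (galg k gT).

(** The matrix [L] of left multiplication by [1 - mu] reduces to the identity over [F], so its
    determinant is a unit of [k]. *)
Lemma one_sub_rinv (mu : A) : gmap r mu = 0 -> exists u, (1 - mu) * u = 1.
Proof.
move=> mu0; pose c := 1 - mu.
pose L : 'M[k]_#|gT| := \matrix_(i, j) c (enum_val i * (enum_val j)^-1)%g.
have Lu : L \in unitmx.
  rewrite unitmxE -[_ \is a _]negbK -rP -det_map_mx.
  suff -> : map_mx r L = 1%:M by rewrite det1 oner_eq0.
  apply/matrixP => i j; rewrite !mxE !ffunE rmorphB.
  move/ffunP/(_ (enum_val i * (enum_val j)^-1)%g): mu0; rewrite !ffunE => ->.
  by rewrite subr0 -eq_mulgV1 (inj_eq enum_val_inj); case: eqP; rewrite ?rmorph1 ?rmorph0.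
pose w : 'cV[k]_#|gT| := invmx L *m (\col_i (1 : A) (enum_val i)).
exists [ffun x => w (enum_rank x) 0]; apply/ffunP => x.
have := mulmxA L (invmx L) (\col_i (1 : A) (enum_val i)).
rewrite mulmxV // mul1mx => /matrixP/(_ (enum_rank x) 0); rewrite !mxE enum_rankK => <-.
rewrite galgME (reindex_inj (inj_comp (mulgI x) invg_inj)) /=.
rewrite (reindex (@enum_val _ gT)) /=; last exact/onW_bij/enum_val_bij.
by apply: eq_bigr => j _; congr (_ * _); [rewrite mxE enum_rankK | rewrite ffunE invMg invgK mulgKV enum_valK].
Qed.

(** The right inverse [u] is again congruent to [1], hence has a right inverse too, which must be
    [1 - mu]. *)
Lemma one_sub_unit (mu : A) : gmap r mu = 0 ->
  exists u, (1 - mu) * u = 1 /\ u * (1 - mu) = 1.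
Proof.
move=> mu0; have [u e] := one_sub_rinv mu0.
have u1 : gmap r (1 - u) = 0.
  have gB (x y : A) : gmap r (x - y) = gmap r x - gmap r y by exact: rmorphB.
  have g1 : gmap r (1 : A) = 1 by exact: rmorph1.
  have gM (x y : A) : gmap r (x * y) = gmap r x * gmap r y by exact: rmorphM.
  by have := congr1 (@gmap _ _ r gT) e; rewrite gM gB g1 mu0 subr0 mul1r gB g1 => ->; rewrite subrr.
have [v] := one_sub_rinv u1; rewrite opprB addrC subrK => e'.
exists u; split=> //; have -> // : 1 - mu = v.
by transitivity ((1 - mu) * (u * v)); [rewrite e' mulr1 | rewrite mulrA e mul1r].
Qed.

(* Rosenberg's lemma: multiplying f = sum_w s_w with f = sum_x f_x x, the terms
   with f_x a nonunit may be dropped modulo the maximal ideal, and each other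
   term has a smaller stabilizer or one in Y. *)
Lemma gtrace_shrink (K : {group gT}) (F0 Y : {set gT} -> Prop) (f : A) :
  (forall S S' : {set gT}, S' \subset S -> F0 S -> F0 S') ->
  (forall S S' : {set gT}, S' \subset S -> Y S -> Y S') ->
  (forall S : {set gT}, F0 S -> ~ Y S -> forall x, x \in 'C(S)%g -> r (f x) = 0) ->
  f * f = f -> gtrace gconj K F0 f -> gtrace gconj K Y f.
Proof.
move=> F0d Yd fC ff tf; have fK := gtrace_fix (gconjP _ _) tf.
(* The induction lowers the bound [N] on the orders of the stabilizers outside [Y]. It starts from
   [#|gT|] and ends at [0], where none is left, since every stabilizer contains [1]. *)
have step N : exists j mu, [/\ f = j + mu, gmap r mu = 0 &
    gtrace gconj K (fun S => Y S \/ (F0 S /\ (#|S| <= N)%N)) j]; last first.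
  have [j [mu [fE mu0 tj]]] := step 0%N.
  have [u [e1 e2]] := one_sub_unit mu0.
  have {}tj : gtrace gconj K Y j.
    move: tj => [Om [act [s [[a1 aM] se sF jE]]]]; exists Om, act, s; split=> //.
    move=> w /sF [//|[_]]; rewrite leqn0 cards_eq0 => /eqP/setP/(_ 1%g).
    by rewrite !inE group1 a1 eqxx.
  have muE : mu = f - j by rewrite fE addrC addKr.
  have uK : gfix gconj K u.
    have c1 : gfix gconj K (1 - mu).
      by apply: gfixB; [apply: gfix1 | rewrite muE; apply: gfixB => //; exact: (gtrace_fix (gconjP k gT) tj)].
    apply/gfix_comm => g Kg; have cg := iffLR (gfix_comm K _) c1 g Kg.
    by rewrite -[LHS]mul1r -e2 -!mulrA (mulrA (1 - mu) (gelt g)) -cg -mulrA e1 mulr1.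
  (* From [f = f * f = j * f + mu * f] one gets [(1 - mu) * f = j * f]. *)
  suff -> : f = u * (j * f) by apply: gtrace_mull => //; apply: gtrace_mulr tj fK.
  by rewrite -[LHS]mul1r -e2 -mulrA mulrBl mul1r -{1}ff {1}fE mulrDl addrK.
have [d Dd] : exists d, (#|gT| <= N + d)%N by exists #|gT|; apply: leq_addl.
elim: d N Dd => [|d IH] N Dd.
  exists f, 0; split; rewrite ?addr0 ?rmorph0 //; apply: gtrace_fam tf => S _ FS; right.
  by split=> //; rewrite addn0 in Dd; apply: leq_trans Dd; apply: max_card.
have [|j [mu [fE mu0 tj]]] := IH N.+1; first by rewrite addSnnS.
move: tj => [Om [act [s [[a1 aM] se sF jE]]]].
pose t (v : Om * gT) := s v.1 * (f v.2 *: gelt v.2).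
exists (\sum_(v | r (f v.2) != 0) t v), (\sum_(v | r (f v.2) == 0) t v + mu * f).
have gm (v : Om * gT) : r (f v.2) == 0 -> gmap r (t v) = 0.
  move=> /eqP e0; rewrite /t rmorphM; apply/ffunP => x; rewrite galgME big1 ?ffunE // => y _.
  by rewrite /= [X in _ * X]ffunE galgZE rmorphM e0 mul0r mulr0.
split.
- rewrite addrA; have -> : \sum_(v | r (f v.2) != 0) t v + \sum_(v | r (f v.2) == 0) t v = j * f.
    rewrite [in RHS](galg_sum f) jE mulr_suml addrC.
    transitivity (\sum_w \sum_x s w * (f x *: gelt x)); last by apply: eq_bigr => w _; rewrite mulr_sumr.
    by rewrite pair_big [RHS](bigID (fun v => r (f v.2) == 0)).
  by rewrite -mulrDl -fE ff.
- rewrite rmorphD rmorphM /= mu0 mul0r addr0 rmorph_sum big1 // => v; exact: gm.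
have fJ g x : g \in K -> f (x ^ g)%g = f x by move=> Kg; rewrite -gconjE fK.
have tJ g (w : Om) x : g \in K -> t (act g w, x ^ g^-1)%g = gconj g (t (w, x)).
  move=> Kg; rewrite /t /= gconjM se // fJ ?groupV //; congr (_ * _).
  by apply/ffunP => y; rewrite gconjE !ffunE -(can2_eq (conjgK g) (conjgKV g)).
exists (Om * gT)%type, (fun g v => (act g v.1, v.2 ^ g^-1)%g).
exists (fun v => if r (f v.2) != 0 then t v else 0); split.
- by split=> [[w x]|g h [w x] Kg Kh] /=; rewrite ?a1 ?invg1 ?conjg1 ?aM // invMg conjgM.
- move=> g [w x] Kg /=; rewrite fJ ?groupV // tJ //; case: ifP => // _.
  by rewrite (rho0 (gconjP k gT)).
- case=> w x /=; case: ifP => [rfx|]; last by rewrite eqxx.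
  move=> nz; have {nz} nz : s w != 0 by apply: contraNneq nz; rewrite /t /= => ->; rewrite mul0r.
  set S' := stab _ _ _; have sS : S' \subset stab K act w.
    by apply/subsetP => g; rewrite !inE xpair_eqE /= => /and3P[-> ->].
  have [YS|nY] := pselect (Y (stab K act w)); first by left; apply: Yd YS.
  case: (sF _ nz) => [//|[FS cS]]; right; split; first exact: F0d FS.
  (* If the stabilizer of [(w, x)] were all of [stab K act w], then [x] would centralize the latter,
     and [fC] would put [f x] in the kernel of [r]. *)
  rewrite -ltnS; apply: leq_trans cS; apply: proper_card; rewrite properEneq sS andbT.
  apply: contraNneq rfx => eS; apply/eqP; apply: (fC _ FS nY).
  apply/centP => g; rewrite -eS !inE xpair_eqE /= => /and3P[Kg _ /eqP e].
  by apply/commgP/conjg_fixP; rewrite -{1}e conjgKV.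
by rewrite big_mkcond.
Qed.
End Units.

Section DefectGroup.
Variables (k : idomainType) (F : fieldType) (r : {rmorphism k -> F}) (p : nat).
Hypotheses (rP : forall x, (r x == 0) = (x \isn't a GRing.unit)) (pF : p \in [pchar F]).
Variable gT : finGroupType.
Local Notation A := (galg k gT).

Lemma galgBE (K : comNzRingType) (a c : galg K gT) x : (a - c) x = a x - c x.
Proof. by rewrite !ffunE. Qed.

Lemma gTr_index (P Q : {group gT}) (a : A) : P \subset Q -> gfix gconj Q a ->
  gTr gconj P [set: gT] a = #|Q : P|%g%:R *: gTr gconj Q [set: gT] a.
Proof.
move=> sPQ fa; rewrite (gTr_trans (gconjP k gT) sPQ (subsetT Q)) => [|g Pg]; last by rewrite fa ?(subsetP sPQ).
have rQ C : C \in rcosets P Q -> (fingroup.repr C)^-1%g \in Q.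
  case/rcosetsP => x Qx ->; have [u Pu ->] := rcosetP (mem_repr_rcoset P x).
  by rewrite groupV groupM // (subsetP sPQ).
have -> : gTr gconj P Q a = #|Q : P|%g%:R *: a.
  rewrite /gTr (eq_bigr (fun=> a)) => [|C /rQ Qr]; last by rewrite fa.
  by rewrite sumr_const scaler_nat.
rewrite /gTr scaler_sumr; apply: eq_bigr => C _.
by apply/ffunP => x; rewrite gconjE !galgZE gconjE.
Qed.

(** For a Sylow [p]-subgroup [P] of [Q] the index [#|Q : P|] is invertible in [k]; so [e] is a trace
    from [P], and minimality of [Q] gives [P = Q]. *)
Lemma defect_pgroup (Q : {group gT}) (e : A) : is_defect_group e Q -> (p.-group Q)%g.
Proof.
move=> [tQ mQ]; have [P sP] := Sylow_exists p Q.
have sPQ := pHall_sub sP.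
have [/eqP E|neq] := eqVneq (P : {set gT}) Q; first by rewrite -(eqP E) (pHall_pgroup sP).
have /mQ [] : P \proper Q by rewrite properEneq neq.
case/in_rel_traceE: tQ => a fa eE; apply/in_rel_traceE.
have iu : (#|Q : P|%g%:R : k) \is a GRing.unit.
  rewrite -[_ \is a _]negbK -rP rmorph_nat -(dvdn_pcharf pF).
  by rewrite -p'natE ?(pcharf_prime pF) //; have /and3P[] := sP.
exists ((#|Q : P|%g%:R)^-1 *: a).
  move=> g Pg; apply/ffunP => x; rewrite gconjE !galgZE -gconjE fa //.
  exact: (subsetP sPQ).
have -> : gTr gconj P [set: gT] ((#|Q : P|%g%:R)^-1 *: a) = (#|Q : P|%g%:R)^-1 *: gTr gconj P [set: gT] a.
  rewrite /gTr scaler_sumr; apply: eq_bigr => C _.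
  by apply/ffunP => x; rewrite gconjE !galgZE gconjE.
by rewrite (gTr_index sPQ fa) -eE scalerA mulVr // scale1r.
Qed.

Variables (Q : {group gT}) (e : A) (b : galg k (subg_of 'N(Q))).
Hypotheses (he : is_block e) (hQ : is_defect_group e Q) (hb : brauer_correspondent Q e b).
Local Notation H := 'N(Q)%G.
Local Notation bG := (gincl H b).

Lemma corr_fix : gfix gconj H bG.
Proof.
case: hb => [[[_ bc] _ _] _ _] h Hh; rewrite -[h](@subgK gT H) // -gincl_gconj.
by rewrite (@central_gfix _ _ [set: subg_of H]%G _ bc) ?inE.
Qed.

Lemma corr_idem : bG * bG = bG.
Proof. by case: hb => [[[bb _] _ _] _ _]; rewrite -rmorphM bb. Qed.

Lemma block_idem : e * e = e. Proof. by case: he => [[]]. Qed.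
Lemma block_central a : a * e = e * a. Proof. by case: he => [[]]. Qed.
Lemma block_fix (K : {group gT}) : gfix gconj K e.
Proof. exact: central_gfix block_central. Qed.

Lemma corr_trace : gtrace gconj H (fun S => S \subset Q) bG.
Proof.
case: hb => [_ [tb _] _].
have {}tb := rel_trace_gtrace tb.
have {}tb := @gtrace_map _ _ _ gconj (fun h => gconj (sgval h)) _ _ (gincl H) _
  (fun x y => rmorphB _ x y) (fun h x _ => gincl_gconj h x) tb.
apply: gtrace_fam (gtrace_sgval (rho := gconj) (fun _ _ => erefl) tb) => S SH [x Sx].
apply/subsetP => s Ss; have Hs := subsetP SH s Ss.
have : subg H s \in (sgval @*^-1 Q :^ x)%g by apply: (subsetP Sx); rewrite inE subgK.
rewrite mem_conjg => /morphpreP[_] /=.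
rewrite -conjgE; by rewrite subgK // memJ_norm // groupV subgP.
Qed.

(* gmap r e restricted to H and gmap r b differ by a central element z of FH
   vanishing on C(Q). Hence z is nilpotent, and so is the difference of the
   commuting idempotents Br_P(e) and Br_P(b), the image of z. *)
Lemma brauer_block_corr (P : {group gT}) : P \subset Q ->
  (forall s, s \notin H -> ~~ (P \subset Q :^ s)%g) ->
  forall x, x \in 'C(P)%g -> r (e x) = r (bG x).
Proof.
move=> PQ nP; have pQ := defect_pgroup hQ; have pP := pgroupS PQ pQ.
have PH : P \subset H by apply: subset_trans PQ (normG Q).
(* An element [x] of ['C(P)] outside [H] would give [P = P :^ x], inside [Q :^ x], against [nP]. *)
have CH : 'C(P)%g \subset H.
  apply/subsetP => x Cx; apply: contraT => /nP /negP[].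
  have -> : (P : {set gT}) = (P :^ x)%g by apply/esym/normP; apply: (subsetP (cent_sub P)).
  by rewrite conjSg.
have gfixr (K : {group gT}) (a : A) : gfix gconj K a -> gfix gconj K (gmap r a).
  by move=> fa g Kg; apply/ffunP => x; rewrite gconjE !ffunE -gconjE fa.
pose eF := gmap r e; pose bF := gmap r bG.
pose z : galg F gT := [ffun x => if x \in H then eF x - bF x else 0].
have fz (K : {group gT}) : K \subset H -> gfix gconj K z.
  move=> KH g Kg; have Hg := subsetP KH g Kg.
  apply/ffunP => x; rewrite gconjE [LHS]ffunE [RHS]ffunE groupJr //.
  by rewrite -!gconjE (gfixr H _ (@block_fix H)) // (gfixr H _ corr_fix).
have [|x nx|x Cx|N zN] := @local_nilpotent F p gT pF Q z pQ _ _ _.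
- by apply: fz; apply: normG.
- by rewrite ffunE (negPf nx).
- have Hx : x \in H by apply: (subsetP (cent_sub Q)).
  case: hb => [_ _ hc]; rewrite ffunE Hx !ffunE ginclE Hx -rmorphB; apply/eqP; rewrite rP.
  by have := hc (subg H x); rewrite subgK //; apply.
have fe : gfix gconj P eF by apply/gfixr/block_fix.
have fb : gfix gconj P bF by apply: gfixr => g Pg; apply: corr_fix; apply: (subsetP PH).
have brz : brauer P z = brauer P eF - brauer P bF.
  rewrite -brauerB; apply/ffunP => x; rewrite !ffunE; case: ifP => // Cx.
  by rewrite (subsetP CH).
have brzN j : brauer P (z ^+ j.+1) = brauer P z ^+ j.+1 /\ gfix gconj P (z ^+ j.+1).
  elim: j => [|j [IH1 IH2]]; first by rewrite !expr1; split=> //; apply: fz.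
  rewrite ![_ ^+ j.+2]exprS; split; last by apply: gfixM => //; apply: fz.
  by rewrite (brauerM pF) ?IH1 //; apply: fz.
have : brauer P eF = brauer P bF.
  apply: (@idem_diff_nilp _ _ _ N.+1).
  - by rewrite -(brauerM pF) // -rmorphM block_idem.
  - by rewrite -(brauerM pF) // -rmorphM corr_idem.
  - by rewrite -!(brauerM pF) // -!rmorphM block_central.
  - rewrite -brz -(brzN N).1 exprS zN mulr0; apply/ffunP => x; rewrite !ffunE.
    by case: ifP.
by move=> /ffunP E x Cx; have := E x; rewrite !ffunE Cx.
Qed.

(** Rosenberg's lemma for the idempotent [bG * (1 - e)]: at a subgroup outside the family the Brauer
    images of [bG] and [e] agree, so that of [bG - bG * e] is the image of [bG - bG * bG = 0]. *)
Lemma corr_block_trace :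
  gtrace gconj H (fun S => exists2 s, s \notin H & S \subset Q :&: Q :^ s)%g
    (bG * (1 - e)).
Proof.
have pQ := defect_pgroup hQ.
apply: (gtrace_shrink rP (F0 := fun S => S \subset Q)).
- by move=> S S' /subset_trans; apply.
- by move=> S S' sS [s ns /(subset_trans sS)]; exists s.
(* Stabilizers are handled as sets; [S] and the group it generates have the same centralizer and lie
   in the same subgroups. *)
- move=> S SQ nY x; rewrite -cent_gen => Cx; pose P := <<S>>%G.
  have PQ : P \subset Q by rewrite gen_subG.
  have PH : P \subset H by apply: subset_trans PQ (normG Q).
  have nP s : s \notin H -> ~~ (P \subset Q :^ s)%g.
    move=> ns; apply/negP => Ps; apply: nY; exists s => //; rewrite subsetI SQ /=.
    exact: subset_trans (subset_gen S) Ps.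
  have E := brauer_block_corr PQ nP.
  rewrite -[r _]/((fun y => r ((bG * (1 - e)) y)) x).
  have pP := pgroupS PQ pQ.
  have fP (a : A) : gfix gconj H a -> gfix gconj P (gmap r a).
    by move=> fa g Pg; apply/ffunP => y; rewrite gconjE !ffunE -gconjE fa // (subsetP PH).
  have fB : gfix gconj P (gmap r bG) := fP _ corr_fix.
  have fe : gfix gconj P (gmap r e) := fP _ (@block_fix H).
  have -> : r ((bG * (1 - e)) x) = (gmap r bG - gmap r bG * gmap r e) x.
    by rewrite -rmorphM -rmorphB mulrBr mulr1 /= [RHS]ffunE.
  rewrite galgBE (pgroup_brauerM pF pP _ _ Cx) //.
  have -> : \sum_(y in 'C(P)%g) gmap r bG y * gmap r e (y^-1 * x)%g =
            \sum_(y in 'C(P)%g) gmap r bG y * gmap r bG (y^-1 * x)%g.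
    by apply: eq_bigr => y Cy; rewrite !ffunE E ?groupM ?groupV.
  rewrite -(pgroup_brauerM pF pP fB fB Cx).
  by rewrite -rmorphM corr_idem subrr.
- by apply: idem_mul_sub; rewrite ?corr_idem ?block_idem ?block_central.
- by apply: gtrace_mulr corr_trace _ => //; apply: gfixB; [apply: gfix1 | apply: block_fix].
Qed.

(** Here the stabilizers lie in arbitrary conjugates [Q :^ s]. For [s] outside [H] they are in the
    family already; for [s] in [H] they lie in [Q], and the Brauer images are compared as before. *)
Lemma block_corr_trace :
  gtrace gconj H (fun S => exists2 s, s \notin H & S \subset Q :^ s)%g (e * (1 - bG)).
Proof.
have pQ := defect_pgroup hQ.
apply: (gtrace_shrink rP (F0 := fun S => exists x, S \subset Q :^ x)%g).
- by move=> S S' sS [x Sx]; exists x; apply: subset_trans Sx.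
- by move=> S S' sS [s ns /(subset_trans sS)]; exists s.
- move=> S [s Ss] nY x; rewrite -cent_gen => Cx; pose P := <<S>>%G.
  have Hs : s \in H by apply: contraT => ns; case: nY; exists s.
  have PQ : P \subset Q by rewrite gen_subG -(normP Hs).
  have PH : P \subset H by apply: subset_trans PQ (normG Q).
  have nP t : t \notin H -> ~~ (P \subset Q :^ t)%g.
    move=> nt; apply/negP => Pt; apply: nY; exists t => //.
    exact: subset_trans (subset_gen S) Pt.
  have E := brauer_block_corr PQ nP.
  have pP := pgroupS PQ pQ.
  have fP (a : A) : gfix gconj H a -> gfix gconj P (gmap r a).
    by move=> fa g Pg; apply/ffunP => y; rewrite gconjE !ffunE -gconjE fa // (subsetP PH).
  have fB : gfix gconj P (gmap r bG) := fP _ corr_fix.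
  have fe : gfix gconj P (gmap r e) := fP _ (@block_fix H).
  have -> : r ((e * (1 - bG)) x) = (gmap r e - gmap r e * gmap r bG) x.
    by rewrite -rmorphM -rmorphB mulrBr mulr1 /= [RHS]ffunE.
  rewrite galgBE (pgroup_brauerM pF pP _ _ Cx) //.
  have -> : \sum_(y in 'C(P)%g) gmap r e y * gmap r bG (y^-1 * x)%g =
            \sum_(y in 'C(P)%g) gmap r e y * gmap r e (y^-1 * x)%g.
    by apply: eq_bigr => y Cy; rewrite !ffunE -(E (y^-1 * x)%g) ?groupM ?groupV.
  rewrite -(pgroup_brauerM pF pP fe fe Cx).
  by rewrite -rmorphM block_idem subrr.
- by apply: idem_mul_sub; rewrite ?corr_idem ?block_idem ?block_central.
- apply: (@gtrace_mulr _ _ _ (fun S => exists x, S \subset Q :^ x)%g) => //; first last.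
    by apply: gfixB; [apply: gfix1 | apply: corr_fix].
  apply: (gtrace_res (subsetT H) _ (rel_trace_gtrace hQ.1)).
  by move=> S _ [x Sx]; exists x; apply: subset_trans Sx; apply: subsetIl.
Qed.
End DefectGroup.

(** * Finite composition length over k *)

Section KLength.
Variables (k : idomainType) (F : fieldType) (r : {rmorphism k -> F}).
Hypothesis rP : forall x, (r x == 0) = (x \isn't a GRing.unit).

Lemma local_one_sub (c a : k) : c \isn't a GRing.unit -> 1 - c * a \is a GRing.unit.
Proof.
by rewrite -rP => /eqP c0; rewrite -[_ \is a _]negbK -rP rmorphB rmorphM c0 mul0r rmorph1 subr0 oner_eq0.
Qed.

Lemma unit_scaleK (M : lmodType k) (c : k) (x : M) : c \is a GRing.unit -> c^-1 *: (c *: x) = x.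
Proof. by move=> uc; rewrite scalerA mulVr // scale1r. Qed.

Section Lists.
Variable M : lmodType k.
Implicit Types (s : seq M) (U W : M -> Prop).

Fixpoint kspan s (m : M) : Prop :=
  if s is x :: s' then exists c : k, kspan s' (m - c *: x) else m = 0.

(** A list is read as the chain of the spans of its tails. The condition says that nonunits act as
    zero on each layer, which therefore is [0] or simple over [k]; this is finite length over [k] in
    a form that tolerates redundant entries. *)
Fixpoint kgood s : Prop :=
  if s is x :: s' then kgood s' /\ (forall c : k, c \isn't a GRing.unit -> kspan s' (c *: x))
  else True.

Definition ksub U := U 0 /\ forall (a : k) x y, U x -> U y -> U (a *: x + y).

Lemma ksubZ U (c : k) x : ksub U -> U x -> U (c *: x).
Proof. by move=> [U0 UL] Ux; rewrite -[_ *: _]addr0; apply: UL. Qed.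
Lemma ksubD U x y : ksub U -> U x -> U y -> U (x + y).
Proof. by move=> [U0 UL] Ux Uy; rewrite -[x]scale1r; apply: UL. Qed.
Lemma ksubB U x y : ksub U -> U x -> U y -> U (x - y).
Proof. by move=> [U0 UL] Ux Uy; rewrite addrC -scaleN1r; apply: UL. Qed.

Lemma kspan_sub s : ksub (kspan s).
Proof.
split; first by elim: s => //= x s IH; exists 0; rewrite scale0r subr0.
elim: s => [|x s IH] a u v /=; first by move=> -> ->; rewrite scaler0 addr0.
move=> [c uc] [d vd]; exists (a * c + d).
by rewrite scalerDl -scalerA opprD addrACA -scalerBr; apply: IH.
Qed.

Lemma kspan_cons x s m : kspan s m -> kspan (x :: s) m.
Proof. by exists 0; rewrite scale0r subr0. Qed.

Lemma kspan_mem x s : x \in s -> kspan s x.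
Proof.
elim: s => //= y s IH; rewrite inE => /orP[/eqP ->|/IH /(kspan_cons y) //].
by exists 1; rewrite scale1r subrr; apply: (kspan_sub s).1.
Qed.

Lemma kspan_cat s t m n : kspan s m -> kspan t n -> kspan (s ++ t) (m + n).
Proof.
elim: s m => [|x s IH] m /=; first by move=> -> tn; rewrite add0r.
by move=> [c mc] tn; exists c; rewrite addrAC; apply: IH.
Qed.

Definition klist U s :=
  [/\ kgood s, forall x, x \in s -> U x & forall m, U m -> kspan s m].

Lemma klist_cat U W s t : ksub W -> klist W t -> (forall x, x \in s -> U x) ->
  (forall x, W x -> U x) ->
  (forall c x, c \isn't a GRing.unit -> x \in s -> W (c *: x)) ->
  (forall m, U m -> exists2 n, kspan s n & W (m - n)) -> klist U (s ++ t).
Proof.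
move=> Ws [gt tW Wt] sU WU cW UE; split.
- elim: s sU cW {UE} => [|x s IH] //= sU cW; split=> [|c nc].
    apply: IH => [y ys|c y nc ys]; first by apply: sU; rewrite inE ys orbT.
    by apply: cW; rewrite // inE ys orbT.
  rewrite -[c *: x]add0r; apply: kspan_cat; first exact: (kspan_sub s).1.
  by apply: Wt; apply: cW; rewrite // inE eqxx.
- by move=> x; rewrite mem_cat => /orP[/sU //|/tW /WU].
- by move=> m /UE [n sn Wn]; rewrite -[m](subrK n) addrC; apply: kspan_cat => //; apply: Wt.
Qed.

(** Intersect [U] with the span of the tail. If [U] meets [x] modulo the tail, add such an element;
    otherwise only nonunits occur as coefficients of [x] on [U], and nonunit multiples of [x] are in
    the span of the tail. *)
Lemma klist_sub s U : kgood s -> ksub U -> (forall m, U m -> kspan s m) ->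
  exists t, klist U t.
Proof.
elim: s U => [|x s IH] U /=.
  move=> _ Us U0; exists [::]; split=> //.
move=> [gs gx] Us Usp.
pose U' m := U m /\ kspan s m.
have Us' : ksub U'.
  split; first by split; [apply: Us.1 | apply: (kspan_sub s).1].
  by move=> a u v [? ?] [? ?]; split; [apply: Us.2 | apply: (kspan_sub s).2].
have [t [gt tU' U't]] := IH U' gs Us' (fun m => @proj2 _ _).
have [[u [Uu ux]]|nu] := pselect (exists u, U u /\ kspan s (u - x)).
  exists (u :: t); split=> /=.
  - split=> // c nc; apply: U't; split; first exact: ksubZ.
    rewrite -[u](subrK x) scalerDr; apply: (ksubD (kspan_sub s)); last exact: gx.
    exact: (ksubZ _ (kspan_sub s)).
  - by move=> y; rewrite inE => /orP[/eqP -> //|/tU' []].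
  - move=> m Um; have [c mc] := Usp m Um; exists c; apply: U't; split.
      by apply: ksubB => //; apply: ksubZ.
    have -> : m - c *: u = (m - c *: x) - c *: (u - x) by rewrite scalerBr opprB addrA subrK.
    by apply: (ksubB (kspan_sub s)) => //; apply: (ksubZ _ (kspan_sub s)).
exists t; split=> // [y /tU' [] //|m Um]; apply: U't; split=> //.
have [c mc] := Usp m Um; have [uc|nc] := boolP (c \is a GRing.unit).
  case: nu; exists (c^-1 *: m); split; first exact: ksubZ.
  by rewrite -[x](unit_scaleK _ uc) -scalerBr; apply: (ksubZ _ (kspan_sub s)).
rewrite -[m](subrK (c *: x)); apply: (ksubD (kspan_sub s)) => //; exact: gx.
Qed.

(** Counts the layers onto which [U] maps surjectively. Redundant entries count for every submodule,
    so that differences of counts are lengths. *)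
Fixpoint krank s U : nat :=
  if s is x :: s' then (`[< exists2 u, U u & kspan s' (u - x) >] + krank s' U)%N else 0%N.

Lemma krank_mono s U W : (forall m, U m -> W m) -> (krank s U <= krank s W)%N.
Proof.
move=> UW; elim: s => //= x s IH; apply: leq_add => //.
case: asboolP => // -[u Uu ux]; case: asboolP => // -[]; exists u => //; exact: UW.
Qed.

Lemma krank_eq s U W : kgood s -> ksub U -> ksub W -> (forall m, U m -> W m) ->
  krank s U = krank s W -> forall m, kspan s m -> W m -> U m.
Proof.
move=> gs Us Ws UW; elim: s gs => [|x s IH] /= gs e m; first by move=> -> _; apply: Us.1.
case: gs => gs gx; move: e; have := krank_mono s UW.
case: asboolP => [[u Uu ux]|nU]; case: asboolP => [[w Ww wx]|nW] le e [c mc] Wm.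
- have {}IH := IH gs (addnI e).
  rewrite -[m](subrK (c *: u)); apply: (ksubD Us); last exact: ksubZ.
  apply: IH; last by apply: ksubB => //; apply: ksubZ => //; apply: UW.
  have -> : m - c *: u = (m - c *: x) - c *: (u - x) by rewrite scalerBr opprB addrA subrK.
  by apply: (ksubB (kspan_sub s)) => //; apply: (ksubZ _ (kspan_sub s)).
- by case: nW; exists u => //; apply: UW.
- by move: e le; rewrite add0n add1n => ->; rewrite ltnn.
have {}IH := IH gs (addnI e).
apply: IH => //; rewrite -[m](subrK (c *: x)); apply: (ksubD (kspan_sub s)) => //.
apply: gx; apply/negP => uc; apply: nW; exists (c^-1 *: m); first exact: ksubZ.
by rewrite -[x](unit_scaleK _ uc) -scalerBr; apply: (ksubZ _ (kspan_sub s)).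
Qed.

Lemma krank_size s U : (krank s U <= size s)%N.
Proof. by elim: s => //= x s IH; rewrite -add1n leq_add //; case: asboolP. Qed.

Definition klen := exists s, kgood s /\ forall m, kspan s m.
End Lists.

Lemma kspan_map (M N : lmodType k) (f : {linear M -> N}) s m :
  kspan s m -> kspan (map f s) (f m).
Proof.
elim: s m => [|x s IH] m /=; first by move=> ->; rewrite linear0.
by move=> [c mc]; exists c; rewrite -linearZ -linearB; apply: IH.
Qed.

Lemma kgood_map (M N : lmodType k) (f : {linear M -> N}) s : kgood s -> kgood (map f s).
Proof.
elim: s => //= x s IH [gs gx]; split=> [|c nc]; first exact: IH.
by rewrite -linearZ; apply: kspan_map; apply: gx.
Qed.

Lemma klen_surj (M N : lmodType k) (f : {linear M -> N}) :
  (forall y, exists x, f x = y) -> klen M -> klen N.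
Proof.
move=> fs [s [gs sM]]; exists (map f s); split; first exact: kgood_map.
by move=> y; have [x <-] := fs y; apply: kspan_map.
Qed.

(** Lifts to [U] of a list for its image under [f], followed by a list for the kernel. *)
Lemma klist_ext (M N : lmodType k) (f : {linear M -> N}) (U : M -> Prop) :
  klen N -> ksub U -> (exists t, klist (fun m => U m /\ f m = 0) t) -> exists t, klist U t.
Proof.
move=> [s [gs sN]] Us [t lt].
have Is : ksub (fun n => exists2 m, U m & f m = n).
  split; first by exists 0; rewrite ?linear0 //; apply: Us.1.
  by move=> a _ _ [x Ux <-] [y Uy <-]; exists (a *: x + y); rewrite ?linearP //; apply: Us.2.
have [u [gu uI Iu]] := klist_sub gs Is (fun m _ => sN m).
have Ks : ksub (fun m => U m /\ f m = 0).
  split; first by rewrite linear0; split=> //; apply: Us.1.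
  move=> a x y [Ux fx] [Uy fy]; split; first exact: Us.2.
  by rewrite linearP fx fy scaler0 addr0.
have {uI} [v [vU vu]] : exists v, (forall x, x \in v -> U x) /\ map f v = u.
  elim: u uI {gu Iu} => [|x u IH] uI; first by exists [::].
  have [|v [vU <-]] := IH; first by move=> y yu; apply: uI; rewrite inE yu orbT.
  have [|m Um fm] := uI x; first by rewrite inE eqxx.
  exists (m :: v); split; last by rewrite /= fm.
  by move=> y; rewrite inE => /orP[/eqP -> //|/vU].
have lift w n : kspan (map f w) n -> exists2 m, kspan w m & f m = n.
  elim: w n => [|x w IH] n /=; first by move=> ->; exists 0; rewrite ?linear0.
  move=> [c /IH [m wm fm]]; exists (m + c *: x); first by exists c; rewrite addrK.
  by rewrite linearD linearZ fm subrK.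
suff [t' [gt' t'U Ut']] : exists t', klist U t' by exists t'.
move: gu; rewrite -{u}vu in Iu * => gu.
have step w : (forall x, x \in w -> U x) -> kgood (map f w) -> exists t',
    [/\ kgood t', forall x, x \in t' -> U x &
      forall m, U m -> kspan (map f w) (f m) -> kspan t' m].
  elim: w => [|x w IH] wU /=.
    by case: lt => gt tK Kt _; exists t; split=> // [x /tK []|m Um fm] //; apply: Kt.
  move=> [gw gx]; have [|t' [gt' t'U Ut']] := IH _ gw; first by move=> y yw; apply: wU; rewrite inE yw orbT.
  have Ux : U x by apply: wU; rewrite inE eqxx.
  exists (x :: t'); split=> /=.
  - by split=> // c nc; apply: Ut'; [apply: ksubZ | rewrite linearZ; apply: gx].
  - by move=> y; rewrite inE => /orP[/eqP -> //|/t'U].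
  - move=> m Um [c mc]; exists c; apply: Ut'; first by apply: ksubB => //; apply: ksubZ.
    by rewrite linearB linearZ.
have [t' [gt' t'U Ut']] := step v vU gu.
by exists t'; split=> // m Um; apply: Ut' => //; apply: Iu; exists m.
Qed.

(** One map is peeled off at a time by [klist_ext], starting from the common kernel, which is zero.
    Finite length of induced, restricted and tensored complexes is reduced to this. *)
Lemma klen_joint (M : lmodType k) (I : finType) (N : I -> lmodType k)
    (f : forall i, {linear M -> N i}) :
  (forall i, klen (N i)) -> (forall m, (forall i, f i m = 0) -> m = 0) -> klen M.
Proof.
move=> kN inj; pose K (s : seq I) m := forall i, i \in s -> f i m = 0.
have Ks s : ksub (K s).
  split; first by move=> i _; rewrite linear0.
  by move=> a x y Kx Ky i ii; rewrite linearP Kx ?Ky // scaler0 addr0.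
suff [t [gt _ Mt]] : exists t, klist (K [::]) t by exists t; split=> // m; apply: Mt.
have : exists t, klist (K (enum I)) t.
  exists [::]; split=> // m Km; apply: inj => i; apply: Km; exact: mem_enum.
elim: (enum I) => //= i s IH [t lt]; apply: IH; apply: (klist_ext (f := f i)) => //.
exists t; case: lt => gt tK Kt; split=> // [x /tK Kx|m [Km fm]].
  by split=> [j js|]; apply: Kx; rewrite inE ?js ?eqxx ?orbT.
by apply: Kt => j; rewrite inE => /orP[/eqP ->|/Km].
Qed.

End KLength.
Arguments klen {k} M.

Section FiniteLengthKlen.
Variables (k : idomainType) (F : fieldType) (r : {rmorphism k -> F}).
Hypothesis rP : forall x, (r x == 0) = (x \isn't a GRing.unit).
Variable gT : finGroupType.
Local Notation A := (galg k gT).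

(** Generators are removed one by one: modulo [U], [x] is [c] times a combination of the generators,
    so the unit multiple [(1 - c * a) *: x] lies in the span of the others. *)
Lemma nakayama (M : lmodType k) (s : seq M) (U W : M -> Prop) (c : k) :
  ksub U -> c \isn't a GRing.unit -> (forall x, x \in s -> W x) ->
  (forall m, W m -> exists2 n, kspan s n & U (m - n)) ->
  (forall m, W m -> exists2 w, W w & U (m - c *: w)) ->
  forall m, W m -> U m.
Proof.
move=> Us nc; elim: s => [|x s IH] sW Wsp Wc.
  by move=> m /Wsp [n /= ->]; rewrite subr0.
apply: IH => // [y ys|m Wm]; first by apply: sW; rewrite inE ys orbT.
have [w Ww xw] := Wc x (sW x (mem_head x s)).
have [n /= [a na] wn] := Wsp w Ww.
have uca := local_one_sub rP a nc.
have [t st xt] : exists2 t, kspan s t & U (x - t).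
  exists ((1 - c * a)^-1 *: (c *: (n - a *: x))).
    exact/(ksubZ _ (kspan_sub s))/(ksubZ _ (kspan_sub s)).
  rewrite -[x in U (x - _)](unit_scaleK _ uca) -scalerBr; apply: ksubZ => //.
  have -> : (1 - c * a) *: x - c *: (n - a *: x) = (x - c *: w) + c *: (w - n).
    rewrite scalerBl scale1r -scalerA !scalerBr opprB addrA.
    by rewrite subrK addrA subrK.
  by apply: ksubD => //; apply: ksubZ.
have [q /= [d qd] mq] := Wsp m Wm.
exists (q - d *: x + d *: t).
  by apply: (ksubD (kspan_sub s)) => //; apply: (ksubZ _ (kspan_sub s)).
have -> : m - (q - d *: x + d *: t) = (m - q) + d *: (x - t).
  by rewrite scalerBr !opprD opprK !addrA.
by apply: ksubD => //; apply: ksubZ.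
Qed.

Lemma submod_ksub (M : lmodType A) (U : M -> Prop) : is_submodule U ->
  @ksub k (rest (in_alg A) M) U.
Proof.
by move=> [U0 UD UZ]; split=> // a x y Ux Uy; apply: UD => //; apply: UZ.
Qed.

Lemma set_ext (T : Type) (U W : T -> Prop) : (forall x, U x <-> W x) -> U = W.
Proof. by move=> E; apply: funext => x; apply: propext. Qed.

(** A simple layer is spanned over [k] by the translates of one vector [w], and a nonunit acts on it
    as zero: otherwise [c] times the layer would be the whole layer, against Nakayama's lemma. *)
Lemma finite_length_klen (M : lmodType A) : finite_length M ->
  klen (rest (in_alg A) M).
Proof.
move=> [n [U [Us U0 Un step]]].
have key i : (i <= n)%N -> exists t, @klist k (rest (in_alg A) M) (U i) t.
  elim: i => [_|i IH lt].
    by exists [::]; split=> //; rewrite U0 => m ->.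
  have [t lt_t] := IH (ltnW lt); have [[sU nsU] max] := step i lt.
  have [w Uw nw] : exists2 w, U i.+1 w & ~ U i w.
    apply: contrapT => H; apply: nsU => w Uw; apply: contrapT => nw; apply: H.
    by exists w.
  have [Ui0 UiD UiZ] := Us i; have [Uj0 UjD UjZ] := Us i.+1.
  have gen m : U i.+1 m -> exists a : A, U i (m - a *: w).
    pose W m := exists a : A, U i (m - a *: w).
    have sW : is_submodule W.
      split; first by exists 0; rewrite scale0r subr0.
      - move=> x y [a xa] [b yb]; exists (a + b).
        by rewrite scalerDl opprD addrACA; apply: UiD.
      - by move=> c x [a xa]; exists (c * a); rewrite -scalerA -scalerBr; apply: UiZ.
    have [||E|E] := max W sW.
    - by move=> x Ux; exists 0; rewrite scale0r subr0.
    - by move=> x [a xa]; rewrite -[x](subrK (a *: w)); apply: UjD => //; [apply: sU | apply: UjZ].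
    - case: nw; have : W w by exists 1; rewrite scale1r subrr.
      by rewrite E.
    - by rewrite -E.
  pose s : seq (rest (in_alg A) M) := [seq gelt g *: w | g <- enum gT].
  have sUj x : x \in s -> U i.+1 x by case/mapP => g _ ->; apply: UjZ.
  have spans m : U i.+1 m -> exists2 n, kspan s n & U i (m - n).
    move=> /gen [a ma]; exists (a *: w) => //.
    rewrite (galg_sum a) scaler_suml; apply: (big_ind (kspan s)).
    - exact: (kspan_sub s).1.
    - by move=> x y sx sy; apply: (ksubD (kspan_sub s)).
    - move=> g _; rewrite -[a g *: gelt g](_ : (a g)%:A * gelt g = _); last by rewrite -scalerAl mul1r.
      rewrite -scalerA; apply: (ksubZ _ (kspan_sub s)).
      by apply: kspan_mem; apply/mapP; exists g; rewrite ?mem_enum.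
  have ki := submod_ksub (Us i).
  exists (s ++ t); apply: (klist_cat ki lt_t) => // c x nc xs.
  pose W m := exists2 v, U i.+1 v & U i (m - (c%:A : A) *: v).
  have cC (b : A) m : b *: ((c%:A : A) *: m) = (c%:A : A) *: (b *: m) :> M.
    by rewrite !scalerA -scalerAr -scalerAl mulr1 mul1r.
  have sW : is_submodule W.
    split; first by exists 0 => //; rewrite scaler0 subr0.
    - move=> y z [u Uu yu] [v Uv zv]; exists (u + v); first exact: UjD.
      by rewrite scalerDr opprD addrACA; apply: UiD.
    - move=> b y [u Uu yu]; exists (b *: u); first exact: UjZ.
      by rewrite -cC -scalerBr; apply: UiZ.
  have Wc y : U i.+1 y -> W ((c%:A : A) *: y).
    by move=> Uy; exists y => //; rewrite subrr.
  have [||E|E] := max W sW.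
  - by move=> y Uy; exists 0 => //; rewrite scaler0 subr0.
  - by move=> y [u Uu yu]; rewrite -[y](subrK ((c%:A : A) *: u)); apply: UjD; [apply: sU | apply: UjZ].
  - by rewrite -E; apply: Wc; apply: sUj.
  - case: nw; apply: (@nakayama (rest (in_alg A) M) s (U i) (U i.+1) c) => //.
    by move=> m; rewrite -{1}E => -[u Uu mu]; exists u.
have [t [gt _ Ut]] := key n (leqnn n).
by exists t; split=> // m; apply: Ut; rewrite Un.
Qed.

(** [krank] is strictly monotone on submodules and bounded by the length of the list; among the
    submodules properly above [U], one of least [krank] is a next term of a composition series. *)
Lemma klen_finite_length (M : lmodType A) : klen (rest (in_alg A) M) ->
  finite_length M.
Proof.
move=> [s [gs sM]].
pose rk (U : M -> Prop) := @krank k (rest (in_alg A) M) s U.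
have rkE (U W : M -> Prop) : is_submodule U -> is_submodule W ->
    (forall m, U m -> W m) -> rk U = rk W -> U = W.
  move=> Us Ws UW e; apply: set_ext => m; split; first exact: UW.
  exact: (krank_eq gs (submod_ksub Us) (submod_ksub Ws) UW e (sM m)).
have Ts : @is_submodule A M (fun=> True) by [].
have key d (U : M -> Prop) : is_submodule U -> (size s - rk U <= d)%N ->
    exists n (V : nat -> M -> Prop),
    [/\ forall i, is_submodule (V i), V 0%N = U, V n = (fun=> True) &
        forall i, (i < n)%N -> ((forall m, V i m -> V i.+1 m) /\ ~ (forall m, V i.+1 m -> V i m)) /\
          forall W, is_submodule W -> (forall m, V i m -> W m) -> (forall m, W m -> V i.+1 m) ->
            W = V i \/ W = V i.+1].
  elim: d U => [|d IH] U Us le.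
    exists 0%N, (fun=> U); split=> //; apply: rkE => //; apply/eqP; rewrite eqn_leq krank_mono //=.
    by apply: leq_trans (krank_size s _) _; rewrite -subn_eq0 -leqn0.
  have [Ue|nU] := pselect (U = fun=> True); first by exists 0%N, (fun=> U); split.
  pose cand W n := [/\ is_submodule W, forall m, U m -> W m, W <> U & rk W = n].
  have exc : exists n, `[< exists W, cand W n >].
    by exists (rk (fun=> True)); apply/asboolP; exists (fun=> True); split=> // e; case: nU.
  have [n /asboolP [W [Ws UW WU rW]] min] := ex_minnP exc.
  have lt : (rk U < rk W)%N.
    rewrite ltn_neqAle krank_mono // andbT; apply/eqP => e; apply: WU.
    by symmetry; apply: rkE.
  have [|n' [V [Vs V0 Vn Vstep]]] := IH W Ws.
    by move: le; rewrite !leq_subLR => le; apply: leq_trans le _; rewrite addnS -addSn leq_add2r.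
  exists n'.+1, (fun i => if i is j.+1 then V j else U); split=> // [[|i] //|[|i] lt_i].
    rewrite V0; split.
      split=> // H; apply: WU; apply: set_ext => m; split; [exact: H | exact: UW].
    move=> W' W's UW' W'W; have [->|ne] := pselect (W' = U); first by left.
    right; apply: rkE => //; apply/eqP; rewrite eqn_leq krank_mono //= rW.
    by apply: min; apply/asboolP; exists W'.
  exact: Vstep.
have [|n [V [Vs V0 Vn Vstep]]] := key (size s) (fun m => m = 0) _ (leq_subr _ _).
  by split=> // [x y -> ->|a x ->]; rewrite ?addr0 ?scaler0.
exists n, V; split=> // i lt; exact: Vstep.
Qed.
End FiniteLengthKlen.

(** * Complexes *)

Lemma linear_ext (R : pzRingType) (U V : lmodType R) (f g : {linear U -> V}) :
  f =1 g -> f = g.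
Proof.
move: f g => [f [[fz] [fs]]] [g [[gz] [gs]]] /= /funext E; move: fz fs gz gs; rewrite E => fz fs gz gs.
by rewrite (Prop_irrelevance fz gz) (Prop_irrelevance fs gs).
Qed.

Lemma mk_linear (R : pzRingType) (U V : lmodType R) (f : U -> V) :
  linear f -> exists g : {linear U -> V}, forall x, g x = f x.
Proof.
move=> lf; pose m := GRing.isLinear.Build R U V *:%R f lf.
pose g : {linear U -> V} := HB.pack f m.
by exists g.
Qed.

Section Chmap.
Variable R : pzRingType.
Implicit Types X Y Z : complex R.

(** Function extensionality and proof irrelevance turn [cheq] into equality, so that chain maps form
    a group and equations between them can be rewritten. *)
Lemma chmap_ext X Y (f g : chmap X Y) : cheq f g -> f = g.
Proof.
case: f g => [f fd] [g gd] E.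
have e : f = g by apply: functional_extensionality_dep => n; apply: linear_ext (E n).
by move: fd gd {E}; rewrite e => fd gd; rewrite (Prop_irrelevance fd gd).
Qed.

Lemma cheqE X Y (f g : chmap X Y) : cheq f g = (f = g).
Proof. by apply: propext; split=> [/chmap_ext|->]. Qed.

Program Definition mk_chmap X Y (f : forall n, X n -> Y n) (fl : forall n, linear (f n))
    (fd : forall n x, f (n + 1) (cd X n x) = cd Y n (f n x)) : chmap X Y :=
  @Chmap R X Y (fun n => HB.pack (f n) (GRing.isLinear.Build R (X n) (Y n) *:%R (f n) (fl n))) _.

Program Definition chopp X Y (f : chmap X Y) : chmap X Y :=
  @mk_chmap X Y (fun n x => - f n x) _ _.
Next Obligation. by move=> a x y; rewrite linearP opprD scalerN. Qed.
Next Obligation. by rewrite chd raddfN. Qed.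

HB.instance Definition _ X Y := gen_eqMixin (chmap X Y).
HB.instance Definition _ X Y := gen_choiceMixin (chmap X Y).

Lemma chaddA X Y : associative (@chadd R X Y).
Proof. by move=> f g h; apply: chmap_ext => n x /=; rewrite addrA. Qed.
Lemma chaddC X Y : commutative (@chadd R X Y).
Proof. by move=> f g; apply: chmap_ext => n x /=; rewrite addrC. Qed.
Lemma chadd0 X Y : left_id (ch0 X Y) (@chadd R X Y).
Proof. by move=> f; apply: chmap_ext => n x /=; rewrite add0r. Qed.
Lemma chaddN X Y : left_inverse (ch0 X Y) (@chopp X Y) (@chadd R X Y).
Proof. by move=> f; apply: chmap_ext => n x /=; rewrite addNr. Qed.

HB.instance Definition _ X Y := GRing.isZmodule.Build (chmap X Y)
  (@chaddA X Y) (@chaddC X Y) (@chadd0 X Y) (@chaddN X Y).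

Lemma ch0E X Y n x : (0 : chmap X Y) n x = 0. Proof. by []. Qed.
Lemma chDE X Y (f g : chmap X Y) n x : (f + g) n x = f n x + g n x. Proof. by []. Qed.
Lemma chBE X Y (f g : chmap X Y) n x : (f - g) n x = f n x - g n x. Proof. by []. Qed.
Lemma ch_sumE X Y I (r : seq I) (P : pred I) (f : I -> chmap X Y) n x :
  (\sum_(i <- r | P i) f i) n x = \sum_(i <- r | P i) f i n x.
Proof. by elim/big_rec2: _ => // i u v _ <-. Qed.
Lemma chsubE X Y (f g : chmap X Y) : chsub f g = f - g.
Proof. exact: chmap_ext. Qed.
Lemma chaddE X Y (f g : chmap X Y) : chadd f g = f + g. Proof. by []. Qed.
Lemma ch00 X Y : ch0 X Y = 0. Proof. by []. Qed.
End Chmap.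

Notation "g \oc f" := (chcomp g f) (at level 40, left associativity).

Section ChmapComp.
Variable R : pzRingType.
Variables X Y Z W : complex R.

Lemma ocE (g : chmap Y Z) (f : chmap X Y) n x : (g \oc f) n x = g n (f n x).
Proof. by []. Qed.
Lemma ocA (h : chmap Z W) (g : chmap Y Z) (f : chmap X Y) : h \oc (g \oc f) = h \oc g \oc f.
Proof. exact: chmap_ext. Qed.
Lemma oc1l (f : chmap X Y) : chid Y \oc f = f. Proof. exact: chmap_ext. Qed.
Lemma oc1r (f : chmap X Y) : f \oc chid X = f. Proof. exact: chmap_ext. Qed.
Lemma oc0l (f : chmap X Y) : (0 : chmap Y Z) \oc f = 0. Proof. exact: chmap_ext. Qed.
Lemma oc0r (g : chmap Y Z) : g \oc (0 : chmap X Y) = 0.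
Proof. by apply: chmap_ext => n x; rewrite ocE linear0. Qed.
Lemma ocDl (g h : chmap Y Z) (f : chmap X Y) : (g + h) \oc f = g \oc f + h \oc f.
Proof. exact: chmap_ext. Qed.
Lemma ocDr (g : chmap Y Z) (f h : chmap X Y) : g \oc (f + h) = g \oc f + g \oc h.
Proof. by apply: chmap_ext => n x; rewrite ocE linearD. Qed.
Lemma ocNl (g : chmap Y Z) (f : chmap X Y) : (- g) \oc f = - (g \oc f).
Proof. exact: chmap_ext. Qed.
Lemma ocBl (g h : chmap Y Z) (f : chmap X Y) : (g - h) \oc f = g \oc f - h \oc f.
Proof. exact: chmap_ext. Qed.
Lemma ocBr (g : chmap Y Z) (f h : chmap X Y) : g \oc (f - h) = g \oc f - g \oc h.
Proof. by apply: chmap_ext => n x; rewrite ocE linearB. Qed.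
Lemma oc_suml I (r : seq I) (P : pred I) (g : I -> chmap Y Z) (f : chmap X Y) :
  (\sum_(i <- r | P i) g i) \oc f = \sum_(i <- r | P i) (g i \oc f).
Proof. by elim/big_rec2: _ => [|i u v _ <-]; rewrite ?oc0l ?ocDl. Qed.
Lemma oc_sumr I (r : seq I) (P : pred I) (g : chmap Y Z) (f : I -> chmap X Y) :
  g \oc (\sum_(i <- r | P i) f i) = \sum_(i <- r | P i) (g \oc f i).
Proof. by elim/big_rec2: _ => [|i u v _ <-]; rewrite ?oc0r ?ocDr. Qed.
End ChmapComp.

Section FunctorMaps.
Variables (S R : pzRingType) (f : {rmorphism S -> R}).

Lemma rest_ch1 (X : complex R) : rest_ch f (chid X) = chid (rest_cx f X).
Proof. exact: chmap_ext. Qed.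
Lemma rest_chM (X Y Z : complex R) (g : chmap Y Z) (h : chmap X Y) :
  rest_ch f (g \oc h) = rest_ch f g \oc rest_ch f h.
Proof. exact: chmap_ext. Qed.
Lemma rest_chB (X Y : complex R) (g h : chmap X Y) :
  rest_ch f (g - h) = rest_ch f g - rest_ch f h.
Proof. exact: chmap_ext. Qed.
Lemma rest_chD (X Y : complex R) (g h : chmap X Y) :
  rest_ch f (g + h) = rest_ch f g + rest_ch f h.
Proof. exact: chmap_ext. Qed.
Lemma rest_ch_inj (X Y : complex R) : injective (@rest_ch S R f X Y).
Proof. by move=> g h E; apply: chmap_ext => n x; have := congr1 (fun t : chmap (rest_cx f X) (rest_cx f Y) => t n x) E. Qed.

Lemma ind_chE (X Y : complex S) (g : chmap X Y) n a x :
  ind_ch f g n (itens f a x) = itens f a (g n x).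
Proof. exact: ind_map_tens. Qed.

Lemma ind_ext_eq (X : complex S) (Y : complex R) (g h : chmap (ind_cx f X) Y) :
  (forall n x, g n (itens f 1 x) = h n (itens f 1 x)) -> g = h.
Proof.
move=> E; apply: chmap_ext => n u; elim/tens_ind: u => [|u v IHu IHv|a x].
- by rewrite !linear0.
- by rewrite !linearD IHu IHv.
have -> : tens (fun (a0 : R) (s : S) => a0 * f s) a x = a *: itens f 1 x.
  by rewrite [RHS]ind_scale_tens mulr1.
by rewrite !linearZ E.
Qed.

Lemma ind_ch1 (X : complex S) : ind_ch f (chid X) = chid (ind_cx f X).
Proof. by apply: ind_ext_eq => n x; rewrite ind_chE. Qed.
Lemma ind_chM (X Y Z : complex S) (g : chmap Y Z) (h : chmap X Y) :
  ind_ch f (g \oc h) = ind_ch f g \oc ind_ch f h.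
Proof. by apply: ind_ext_eq => n x; rewrite ocE !ind_chE. Qed.
Lemma itensD (M : lmodType S) a (x y : M) : itens f a (x + y) = itens f a x + itens f a y.
Proof. exact: tensDr. Qed.
Lemma ind_chD (X Y : complex S) (g h : chmap X Y) :
  ind_ch f (g + h) = ind_ch f g + ind_ch f h.
Proof. by apply: ind_ext_eq => n x; rewrite chDE !ind_chE -itensD. Qed.
Lemma ind_ch0 (X Y : complex S) : ind_ch f (0 : chmap X Y) = 0.
Proof. by apply: (addrI (ind_ch f 0)); rewrite -ind_chD !addr0. Qed.
Lemma ind_chN (X Y : complex S) (g : chmap X Y) : ind_ch f (- g) = - ind_ch f g.
Proof. by apply: (addrI (ind_ch f g)); rewrite -ind_chD !subrr ind_ch0. Qed.
Lemma ind_chB (X Y : complex S) (g h : chmap X Y) :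
  ind_ch f (g - h) = ind_ch f g - ind_ch f h.
Proof. by rewrite ind_chD ind_chN. Qed.
End FunctorMaps.

Section KMaps.
Variables (k : comNzRingType) (gT : finGroupType).
Local Notation A := (galg k gT).
Implicit Types (X Y Z : complex A) (g h : gT).

Definition kx X : complex k := rest_cx (in_alg A) X.
Definition kres X Y (f : chmap X Y) : chmap (kx X) (kx Y) := rest_ch (in_alg A) f.

Lemma algC (M : lmodType A) (a : A) (c : k) (m : M) : a *: ((c%:A : A) *: m) = (c%:A : A) *: (a *: m).
Proof. by rewrite !scalerA -scalerAr -scalerAl mulr1 mul1r. Qed.

Lemma kchZ X Y (t : chmap (kx X) (kx Y)) n (c : k) (x : X n) :
  t n ((c%:A : A) *: x) = (c%:A : A) *: (t n x : Y n).
Proof. by transitivity (t n (c *: (x : kx X n))); rewrite ?linearZ. Qed.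

Program Definition lact X (a : A) : chmap (kx X) (kx X) :=
  @mk_chmap _ (kx X) (kx X) (fun n (x : X n) => a *: x) _ _.
Next Obligation. by move=> c x y; rewrite [in LHS]scalerDr; congr (_ + _); apply: algC. Qed.
Next Obligation. by move=> *; rewrite [RHS]linearZ. Qed.

(** The conjugation action of the group on [k]-linear maps of complexes; by [kfix_lift] its fixed
    points are the chain maps over the group algebra. *)
Program Definition kconj X Y g (t : chmap (kx X) (kx Y)) : chmap (kx X) (kx Y) :=
  @mk_chmap _ (kx X) (kx Y) (fun n (x : X n) => (gelt g : A) *: (t n ((gelt g^-1%g : A) *: x) : Y n)) _ _.
Next Obligation.
move=> c x y /=; rewrite [in X in t n X]scalerDr.
rewrite [X in t n (X + _)](_ : _ = (c%:A : A) *: ((gelt g^-1%g : A) *: (x : X n))); last exact: algC.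
by rewrite linearD [in LHS]scalerDr kchZ algC.
Qed.
Next Obligation.
transitivity (gelt g *: (t (n + 1) (cd (kx X) n (gelt g^-1%g *: (x : X n))) : Y (n + 1))).
  have -> // : (gelt g^-1%g : A) *: (rest_map (in_alg A) (cd X n) x : X (n + 1)) = cd (kx X) n (gelt g^-1%g *: (x : X n)).
  by rewrite /= /rest_map linearZ.
by rewrite chd /= /rest_map linearZ.
Qed.

Lemma kconjE X Y g (t : chmap (kx X) (kx Y)) n (x : X n) :
  kconj g t n x = (gelt g : A) *: (t n ((gelt g^-1%g : A) *: x) : Y n).
Proof. by []. Qed.

Lemma geltK g (M : lmodType A) (m : M) : (gelt g^-1%g : A) *: ((gelt g : A) *: m) = m.
Proof. by rewrite scalerA -geltM mulVg gelt1 scale1r. Qed.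
Lemma geltKV g (M : lmodType A) (m : M) : (gelt g : A) *: ((gelt g^-1%g : A) *: m) = m.
Proof. by rewrite scalerA -geltM mulgV gelt1 scale1r. Qed.

Lemma kconjP X Y : gmodule (@kconj X Y).
Proof.
split=> [t|g h t|g s t]; apply: chmap_ext => n x; rewrite !kconjE.
- by rewrite invg1 gelt1 !scale1r.
- by rewrite invMg !geltM -!scalerA.
- by rewrite -[RHS]scalerBr.
Qed.

Lemma kconj_comp X Y Z g (s : chmap (kx Y) (kx Z)) (t : chmap (kx X) (kx Y)) :
  kconj g (s \oc t) = kconj g s \oc kconj g t.
Proof. by apply: chmap_ext => n x; rewrite ocE !kconjE geltK. Qed.

Lemma kconj_kres X Y g (f : chmap X Y) : kconj g (kres f) = kres f.
Proof.
apply: chmap_ext => n x; rewrite kconjE.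
by rewrite -[RHS]/(f n x) -[X in _ *: X]/(f n ((gelt g^-1%g : A) *: x)) linearZ geltKV.
Qed.

Lemma kconj_lact X g a : kconj g (lact X a) = lact X (gconj g a).
Proof. by apply: chmap_ext => n x; rewrite kconjE /= /gconj !scalerA. Qed.

Lemma lactB X a b : lact X (a - b) = lact X a - lact X b.
Proof. by apply: chmap_ext => n x /=; rewrite scalerBl. Qed.

Lemma kfix_lift X Y (t : chmap (kx X) (kx Y)) :
  gfix (@kconj X Y) [set: gT] t -> exists f : chmap X Y, kres f = t.
Proof.
move=> ft; have tg g n (x : X n) : t n ((gelt g : A) *: x) = (gelt g : A) *: (t n x : Y n).
  have -> : t n ((gelt g : A) *: x) = kconj g t n ((gelt g : A) *: x) by rewrite ft ?inE.
  by rewrite kconjE geltK.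
have ta n (a : A) (x : X n) : t n (a *: x) = a *: (t n x : Y n).
  rewrite (galg_sum a) !scaler_suml [LHS](raddf_sum (t n)); apply: eq_bigr => g _ /=.
  have E (M : lmodType A) (m : M) : (a g *: gelt g) *: m = ((a g)%:A : A) *: (gelt g *: m).
    by rewrite scalerA -scalerAl mul1r.
  by rewrite !E kchZ tg.
have tl n : linear (fun x : X n => (t n x : Y n)).
  by move=> a x y; rewrite -ta; exact: (raddfD (t n)).
exists (@mk_chmap _ X Y (fun n x => t n x) tl (fun n x => chd t x)).
exact: chmap_ext.
Qed.
End KMaps.

(** * Induction and restriction *)

Section Induction.
Variables (k : comNzRingType) (gT : finGroupType) (H : {group gT}).
Local Notation A := (galg k gT).
Local Notation B := (galg k (subg_of H)).
Local Notation f := (@gincl k gT H).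
Local Notation Ind := (ind_cx f).
Local Notation Res := (rest_cx f).

Lemma gincl_alg (c : k) : f (c%:A : B) = c%:A.
Proof.
apply/ffunP => x; rewrite ginclE; case: ifP => Hx; rewrite !galgZE -!gelt1 !ffunE.
  by rewrite -{2}(@subgK gT H x Hx) -[1%g in RHS]/(sgval (1%g : subg_of H)) (inj_eq (@subg_inj gT H)).
by case: eqP => E; rewrite ?mulr0 //; move: Hx; rewrite E group1.
Qed.

Lemma gtrunc_mul (a : A) (b : B) : gtrunc H (a * f b) = gtrunc H a * b.
Proof.
apply/ffunP => x; rewrite ffunE !galgME (bigID (mem H)) /= [X in _ + X]big1 ?addr0 => [|y nH].
  rewrite (reindex (fun y : subg_of H => sgval y)) /=; last first.
    exists (subg H) => [y _|y Hy]; first exact: sgvalK.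
    by rewrite subgK.
  rewrite (eq_bigl xpredT) => [|y]; last by rewrite subgP.
  apply: eq_bigr => y _; rewrite ffunE -[((sgval y)^-1 * sgval x)%g]/(sgval (y^-1 * x)%g).
  by rewrite ginclE subgP sgvalK.
by rewrite ginclE groupMr ?subgP // groupV (negPf nH) mulr0.
Qed.

Lemma gtrunc_incl_mul (b : B) (a : A) : gtrunc H (f b * a) = b * gtrunc H a.
Proof.
apply/ffunP => x; rewrite ffunE !galgME (bigID (mem H)) /= [X in _ + X]big1 ?addr0 => [|y nH].
  rewrite (reindex (fun y : subg_of H => sgval y)) /=; last first.
    exists (subg H) => [y _|y Hy]; first exact: sgvalK.
    by rewrite subgK.
  rewrite (eq_bigl xpredT) => [|y]; last by rewrite subgP.
  apply: eq_bigr => y _; rewrite ginclE subgP sgvalK ffunE.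
  by [].
by rewrite ginclE (negPf nH) mul0r.
Qed.

Lemma gtruncD (a a' : A) : gtrunc H (a + a') = gtrunc H a + gtrunc H a'.
Proof. by apply/ffunP => x; rewrite !ffunE. Qed.

Lemma gtrunc_gelt (g : gT) : gtrunc H (gelt g) = if g \in H then gelt (subg H g) else 0 :> B.
Proof.
apply/ffunP => x; rewrite ffunE; case: ifP => Hg; rewrite !ffunE.
  by rewrite -{1}(@subgK gT H g Hg) (inj_eq (@subg_inj gT H)).
by case: eqP => // E; move: Hg; rewrite -E subgP.
Qed.

Lemma gtrunc1 : gtrunc H (1 : A) = 1 :> B.
Proof.
rewrite -gelt1 gtrunc_gelt group1 -gelt1; congr gelt; apply: (@subg_inj gT H).
by rewrite subgK // group1.
Qed.

(** [kG] is free as a right [kH]-module on the inverses of the right coset representatives, and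
    [gtrunc] reads off the coefficients. *)
Lemma gtrunc_dec (a : A) : a = \sum_(C in rcosets H [set: gT])
  gelt (fingroup.repr C)^-1%g * f (gtrunc H (gelt (fingroup.repr C) * a)).
Proof.
apply/ffunP => x; rewrite sum_ffunE.
have e C : (gelt (fingroup.repr C)^-1%g * f (gtrunc H (gelt (fingroup.repr C) * a))) x =
    if (fingroup.repr C * x)%g \in H then a x else 0.
  by rewrite gelt_mull invgK gincl_trunc gelt_mull mulKg.
rewrite (eq_bigr _ (fun C _ => e C)) (bigD1 (H :* x^-1)%g) /=; last first.
  by apply/rcosetsP; exists x^-1%g; rewrite ?inE.
have [h Hh ->] := rcosetP (mem_repr_rcoset H x^-1%g).
rewrite mulgKV Hh big1 ?addr0 // => C /andP[/rcosetsP[y _ ->] ne].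
case: ifP => // Hy; case/eqP: ne; rewrite -(rcoset_repr H y); apply/rcoset_eqP.
by rewrite mem_rcoset invgK.
Qed.

Section Maps.
Variable X : complex B.

Lemma itens_bal n (a : A) (b : B) (x : X n) : itens f (a * f b) x = itens f a (b *: x).
Proof. exact: tens_bal. Qed.
Lemma itensZ n (a c : A) (x : X n) : a *: itens f c x = itens f (a * c) x.
Proof. exact: ind_scale_tens. Qed.

Program Definition ind_in : chmap X (Res (Ind X)) :=
  @mk_chmap _ X (Res (Ind X)) (fun n x => itens f 1 x) _ _.
Next Obligation.
move=> b x y; rewrite itensD; congr (_ + _).
by rewrite -itens_bal mul1r -[f b]mulr1 -itensZ.
Qed.
Next Obligation. by rewrite -[RHS]/(ind_map f (cd X n) (itens f 1 x)) ind_map_tens. Qed.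

Let pr_bal n : balanced (fun (a : A) (s : B) => a * f s) (fun (a : A) (x : X n) => gtrunc H a *: x).
Proof.
split=> [a a' x|a x y|a s x]; first by rewrite gtruncD scalerDl.
  by rewrite scalerDr.
by rewrite gtrunc_mul scalerA.
Qed.

Let pr n (u : Res (Ind X) n) : X n := tens_lift (fun (a : A) (x : X n) => gtrunc H a *: x) u.

Let pr_tens n a (x : X n) : pr (itens f a x) = gtrunc H a *: x.
Proof. exact: (tens_liftE (@pr_bal n)). Qed.

Let prB n : zmod_morphism (@pr n).
Proof. exact: (tens_lift_zmod (@pr_bal n)). Qed.

Let prL n : linear (@pr n).
Proof.
have pD u v : pr (u + v) = pr u + @pr n v.
  by have := prB (u + v) v; rewrite addrK => ->; rewrite subrK.
have p0 : @pr n 0 = 0 by rewrite -(subrr 0) prB subrr.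
move=> b u v; rewrite pD; congr (_ + _).
elim/tens_ind: u => [|u u' IHu IHu'|a x]; first by rewrite scaler0 p0 scaler0.
  by rewrite scalerDr !pD IHu IHu' scalerDr.
rewrite [b *: _](itensZ (f b) a x) -[tens _ a x]/(itens f a x) !pr_tens.
by rewrite gtrunc_incl_mul scalerA.
Qed.

(** Reads off the component at the trivial coset. It is the counit of the second adjunction, in
    which induction is right adjoint to restriction. *)
Program Definition ind_pr : chmap (Res (Ind X)) X :=
  @mk_chmap _ (Res (Ind X)) X pr prL _.
Next Obligation.
move: x; pose g1 (u : Res (Ind X) n) := pr (cd (Res (Ind X)) n u).
have p0 m : @pr m 0 = 0 by rewrite -(subrr 0) prB subrr.
have pD m u v : pr (u + v) = pr u + @pr m v.
  by have := prL 1 u v; rewrite !scale1r.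
elim/tens_ind => [|u u' IHu IHu'|a x].
- by rewrite linear0 !p0 linear0.
- by rewrite linearD !pD linearD IHu IHu'.
by rewrite /= -[tens _ a x]/(itens f a x) ind_map_tens !pr_tens linearZ.
Qed.

Lemma ind_prE n a (x : X n) : ind_pr n (itens f a x) = gtrunc H a *: x.
Proof. exact: pr_tens. Qed.
Lemma ind_inE n (x : X n) : ind_in n x = itens f 1 x. Proof. by []. Qed.

Lemma ind_dec n (u : Ind X n) : u = \sum_(C in rcosets H [set: gT])
  gelt (fingroup.repr C)^-1%g *: itens f 1 (ind_pr n (gelt (fingroup.repr C) *: u : Ind X n)).
Proof.
have P0 : ind_pr n (0 : Ind X n) = 0 by exact: linear0.
have PD (v w : Ind X n) : ind_pr n (v + w) = ind_pr n v + ind_pr n w.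
  exact: (linearD (ind_pr n)).
have i0 : itens f 1 (0 : X n) = 0 by apply: (addrI (itens f 1 0)); rewrite -itensD !addr0.
elim/tens_ind: u => [|u v IHu IHv|a x].
- by rewrite big1 // => C _; rewrite scaler0 P0 i0 scaler0.
- rewrite {1}IHu {1}IHv -big_split; apply: eq_bigr => C _; cbv beta.
  by rewrite [in RHS]scalerDr PD itensD scalerDr.
rewrite -[tens _ a x]/(itens f a x) {1}(gtrunc_dec a).
transitivity (\sum_(C in rcosets H [set: gT]) itens f (gelt (fingroup.repr C)^-1%g *
   f (gtrunc H (gelt (fingroup.repr C) * a))) x).
  rewrite /itens; elim/big_rec2: _ => [|C u v _ <-]; last exact: tensDl.
  by apply: (addrI (tens (fun (a : A) s => a * f s) 0 x)); rewrite -tensDl !addr0.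
apply: eq_bigr => C _; rewrite [gelt (fingroup.repr C) *: _]itensZ ind_prE itensZ mulr1.
exact: itens_bal.
Qed.
End Maps.

Section Adjunction.
Variables (X : complex B) (Y : complex A).

Section Ext.
Variable g : chmap X (Res Y).
Let eb n : balanced (fun (a : A) (s : B) => a * f s) (fun (a : A) (x : X n) => a *: (g n x : Y n)).
Proof.
split=> [a a' x|a x y|a s x]; first by rewrite scalerDl.
  by rewrite linearD scalerDr.
by rewrite linearZ -scalerA.
Qed.
Let ex n (u : Ind X n) : Y n := tens_lift (fun (a : A) (x : X n) => a *: (g n x : Y n)) u.
Let ex_tens n a x : @ex n (itens f a x) = a *: (g n x : Y n).
Proof. exact: (tens_liftE (@eb n)). Qed.
Let exB n : zmod_morphism (@ex n). Proof. exact: (tens_lift_zmod (@eb n)). Qed.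
Let ex0 n : @ex n 0 = 0. Proof. by rewrite -(subrr 0) exB subrr. Qed.
Let exD n u v : @ex n (u + v) = ex u + ex v.
Proof. by rewrite -{1}[v]opprK exB -[- v]sub0r exB ex0 sub0r opprK. Qed.
Let exL n : linear (@ex n).
Proof.
move=> c u v; rewrite exD; congr (_ + _).
elim/tens_ind: u => [|u u' IHu IHu'|a x]; first by rewrite scaler0 ex0 scaler0.
  by rewrite scalerDr !exD IHu IHu' scalerDr.
by rewrite [c *: _](itensZ c a x) -[tens _ a x]/(itens f a x) !ex_tens scalerA.
Qed.
Program Definition ind_ext : chmap (Ind X) Y := @mk_chmap _ (Ind X) Y ex exL _.
Next Obligation.
elim/tens_ind: x => [|u u' IHu IHu'|a x].
- by rewrite linear0 !ex0 linear0.
- by rewrite linearD !exD linearD IHu IHu'.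
by rewrite /= -[tens _ a x]/(itens f a x) ind_map_tens !ex_tens linearZ chd.
Qed.
Lemma ind_extE n a x : ind_ext n (itens f a x) = a *: (g n x : Y n).
Proof. exact: ex_tens. Qed.
End Ext.

Lemma ind_ext_in (g : chmap X (Res Y)) : rest_ch f (ind_ext g) \oc ind_in X = g.
Proof.
apply: chmap_ext => n x; rewrite ocE ind_inE -[LHS]/(ind_ext g n (itens f 1 x)).
by rewrite ind_extE scale1r.
Qed.

Lemma ind_ext_uniq (h h' : chmap (Ind X) Y) :
  rest_ch f h \oc ind_in X = rest_ch f h' \oc ind_in X -> h = h'.
Proof.
move=> E; apply: ind_ext_eq => n x.
exact: (congr1 (fun t : chmap X (Res Y) => t n x) E).
Qed.
End Adjunction.

(** The identity on elements. Scalars act on a restricted complex through [gincl H], and this agrees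
    with their action from [kG] only by [gincl_alg]. *)
Definition k_to_res (Y : complex A) : chmap (kx Y) (kx (Res Y)).
Proof.
refine (@mk_chmap _ (kx Y) (kx (Res Y)) (fun n x => x) _ _) => // n c x y.
by change ((c%:A : A) *: (x : Y n) + y = f (c%:A : B) *: (x : Y n) + y); rewrite gincl_alg.
Defined.

Definition k_of_res (Y : complex A) : chmap (kx (Res Y)) (kx Y).
Proof.
refine (@mk_chmap _ (kx (Res Y)) (kx Y) (fun n x => x) _ _) => // n c x y.
by change (f (c%:A : B) *: (x : Y n) + y = (c%:A : A) *: (x : Y n) + y); rewrite gincl_alg.
Defined.

Lemma kconj_of_res (Y Z : complex A) h (t : chmap (kx (Res Y)) (kx (Res Z))) :
  k_of_res Z \oc kconj h t \oc k_to_res Y =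
  kconj (sgval h) (k_of_res Z \oc t \oc k_to_res Y).
Proof.
apply: chmap_ext => n x.
rewrite [LHS]/((f (gelt h)) *: (t n (f (gelt h^-1%g) *: (x : Y n)) : Z n)).
by rewrite !gincl_gelt.
Qed.

Lemma kconj_to_res (Y Z : complex A) h (t : chmap (kx Y) (kx Z)) :
  kconj h (k_to_res Z \oc t \oc k_of_res Y) =
  k_to_res Z \oc kconj (sgval h) t \oc k_of_res Y.
Proof.
apply: chmap_ext => n x.
rewrite [LHS]/((f (gelt h)) *: (t n (f (gelt h^-1%g) *: (x : Y n)) : Z n)).
by rewrite !gincl_gelt.
Qed.

(* The k-linear map Y -> Ind X defined by an H-linear map Y -> X on the summand
   1 (x) X of Ind X; its relative trace is the other adjoint map. *)
Definition kin (X : complex B) : chmap (kx X) (kx (Ind X)) :=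
  k_of_res (Ind X) \oc kres (ind_in X).
Definition kpr (X : complex B) : chmap (kx (Ind X)) (kx X) :=
  kres (ind_pr X) \oc k_to_res (Ind X).

Lemma gfix_of_res (Y Z : complex A) (t : chmap (Res Y) (Res Z)) :
  gfix (@kconj k gT Y Z) H (k_of_res Z \oc kres t \oc k_to_res Y).
Proof.
move=> g Hg; rewrite -[g](@subgK gT H) // -kconj_of_res.
by rewrite kconj_kres.
Qed.

Lemma gTr_fix (Y Z : complex A) (P : {group gT}) (t : chmap (kx Y) (kx Z)) :
  gfix (@kconj k gT Y Z) P t -> gfix (@kconj k gT Y Z) [set: gT] (gTr (@kconj k gT Y Z) P [set: gT] t).
Proof.
move=> ft; apply: (gtrace_fix (kconjP Y Z) (F := fun=> True)).
by apply: (gtrace_Tr (kconjP Y Z) (F := fun=> True)) => //; [apply: subsetT | apply: gfix_gtrace].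
Qed.

Lemma gTrE (Y Z : complex A) (P : {group gT}) (t : chmap (kx Y) (kx Z)) n (y : Y n) :
  gTr (@kconj k gT Y Z) P [set: gT] t n y =
  \sum_(C in rcosets P [set: gT]) gelt (fingroup.repr C)^-1%g *:
     (t n (gelt (fingroup.repr C) *: y) : Z n).
Proof.
by rewrite /gTr ch_sumE; apply: eq_bigr => C _; rewrite kconjE invgK.
Qed.

Definition coind (Y : complex A) (X : complex B) (g : chmap (Res Y) X) : chmap Y (Ind X) :=
  projT1 (cid (kfix_lift (gTr_fix (gfix_of_res (ind_in X \oc g))))).

Lemma coindE Y X (g : chmap (Res Y) X) n y : coind g n y =
  \sum_(C in rcosets H [set: gT]) gelt (fingroup.repr C)^-1%g *:
     itens f 1 (g n (gelt (fingroup.repr C) *: (y : Y n))).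
Proof.
have E := projT2 (cid (kfix_lift (gTr_fix (gfix_of_res (ind_in X \oc g))))).
transitivity (kres (coind g) n y); first by [].
by rewrite [kres _]E gTrE.
Qed.

Lemma ind_pr_uniq (Y : complex A) (X : complex B) (h h' : chmap Y (Ind X)) :
  ind_pr X \oc rest_ch f h = ind_pr X \oc rest_ch f h' -> h = h'.
Proof.
move=> E; apply: chmap_ext => n y; rewrite [LHS]ind_dec [RHS]ind_dec.
apply: eq_bigr => C _; congr (_ *: itens f 1 _); rewrite -!linearZ.
exact: (congr1 (fun t : chmap (Res Y) X => t n (gelt (fingroup.repr C) *: (y : Y n))) E).
Qed.

Lemma ind_pr_coind (Y : complex A) (X : complex B) (g : chmap (Res Y) X) :
  ind_pr X \oc rest_ch f (coind g) = g.
Proof.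
apply: chmap_ext => n y; rewrite ocE -[rest_ch f (coind g) n y]/(coind g n y) coindE.
have prr (g0 : gT) x : ind_pr X n (gelt g0 *: (itens f 1 x : Ind X n)) =
    if g0 \in H then gelt (subg H g0) *: x else 0.
  by rewrite itensZ ind_prE mulr1 gtrunc_gelt; case: ifP; rewrite ?scale0r.
have rH : fingroup.repr H \in H by apply: (fingroup.mem_repr 1%g).
transitivity (\sum_(C in rcosets H [set: gT]) if (fingroup.repr C)^-1%g \in H then
    gelt (subg H (fingroup.repr C)^-1%g) *: g n (gelt (fingroup.repr C) *: (y : Y n)) else 0).
  by rewrite (raddf_sum (ind_pr X n)); apply: eq_bigr => C _; exact: prr.
rewrite (bigD1 (H : {set gT})) /=; last by apply/rcosetsP; exists 1%g; rewrite ?inE // rcoset1.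
rewrite groupV rH big1 ?addr0 => [|C /andP[RC ne]].
  have -> : gelt (fingroup.repr H) *: (y : Y n) = gelt (subg H (fingroup.repr H)) *: (y : Res Y n).
    by rewrite -[RHS]/(f (gelt _) *: (y : Y n)) gincl_gelt subgK.
  by rewrite linearZ scalerA -geltM -subgM ?groupV // mulVg (morph1 (subg_morphism H)) gelt1 scale1r.
rewrite groupV; case: ifP => // rC; case/eqP: ne; case/rcosetsP: RC rC => x _ -> rC.
exact: etrans (esym (rcoset_repr H x)) (rcoset_id rC).
Qed.

(** The map under the trace is [t] on the summand [1 (x) X] and zero on the others; its translates
    over the cosets add up to the induced map. For [t] the identity this is Higman's criterion for
    an induced complex. *)
Lemma ind_ch_Tr (X Y : complex B) (t : chmap X Y) :
  kres (ind_ch f t) = gTr (@kconj k gT _ _) H [set: gT] (kin Y \oc kres t \oc kpr X).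
Proof.
apply: chmap_ext => n u; rewrite gTrE -[LHS]/(ind_ch f t n u) {1}(ind_dec u).
rewrite raddf_sum; apply: eq_bigr => C _ /=; rewrite linearZ; congr (_ *: _).
exact: ind_chE.
Qed.
End Induction.

(** * Exact sequences of complexes *)

Program Definition mk_complex (R : pzRingType) (T : int -> lmodType R)
    (d : forall n, T n -> T (n + 1)) (dl : forall n, linear (d n))
    (dd : forall n x, d (n + 1) (d n x) = 0) : complex R :=
  @Complex R T (fun n => HB.pack (d n) (GRing.isLinear.Build R (T n) (T (n + 1)) *:%R (d n) (dl n))) _.

Section SubModule.
Variables (R : pzRingType) (M : lmodType R) (P : M -> Prop).

Definition submod_of (h : is_submodule P) : Type := {x : M | `[< P x >]}.

Section Ops.
Variable h : is_submodule P.
Local Notation T := (submod_of h).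
HB.instance Definition _ := gen_eqMixin T.
HB.instance Definition _ := gen_choiceMixin T.

Definition sm_val (u : T) : M := val (u : {x : M | `[< P x >]}).
Lemma sm_valP u : P (sm_val u). Proof. exact/asboolP/(valP (u : {x : M | `[< P x >]})). Qed.
Lemma sm_inj : injective sm_val. Proof. exact: val_inj. Qed.
Definition sm_mk x (Px : P x) : T := exist _ x (introT (asboolP _) Px).
Lemma sm_mkK x (Px : P x) : sm_val (sm_mk Px) = x. Proof. by []. Qed.

Let P0 : P 0. Proof. by case: h. Qed.
Let PD x y : P x -> P y -> P (x + y). Proof. by case: h => _ H _; apply: H. Qed.
Let PZ a x : P x -> P (a *: x). Proof. by case: h => _ _ H; apply: H. Qed.
Let PN x : P x -> P (- x). Proof. by rewrite -scaleN1r; apply: PZ. Qed.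

Definition sm_add (u v : T) : T := sm_mk (PD (sm_valP u) (sm_valP v)).
Definition sm_opp (u : T) : T := sm_mk (PN (sm_valP u)).
Definition sm_scale a (u : T) : T := sm_mk (PZ a (sm_valP u)).
Let aA : associative sm_add. Proof. by move=> u v w; apply: sm_inj; rewrite !sm_mkK addrA. Qed.
Let aC : commutative sm_add. Proof. by move=> u v; apply: sm_inj; rewrite !sm_mkK addrC. Qed.
Let a0 : left_id (sm_mk P0) sm_add. Proof. by move=> u; apply: sm_inj; rewrite !sm_mkK add0r. Qed.
Let aN : left_inverse (sm_mk P0) sm_opp sm_add.
Proof. by move=> u; apply: sm_inj; rewrite !sm_mkK addNr. Qed.
HB.instance Definition _ := GRing.isZmodule.Build T aA aC a0 aN.
Let sA a b u : sm_scale a (sm_scale b u) = sm_scale (a * b) u.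
Proof. by apply: sm_inj; rewrite !sm_mkK scalerA. Qed.
Let s1 : left_id 1 sm_scale. Proof. by move=> u; apply: sm_inj; rewrite !sm_mkK scale1r. Qed.
Let sDr : right_distributive sm_scale +%R.
Proof. by move=> a u v; apply: sm_inj; rewrite !sm_mkK scalerDr. Qed.
Let sDl u : {morph sm_scale^~ u : a b / a + b}.
Proof. by move=> a b; apply: sm_inj; rewrite !sm_mkK scalerDl. Qed.
HB.instance Definition _ := GRing.Zmodule_isLmodule.Build R T sA s1 sDr sDl.
Lemma sm_val_linear : linear sm_val. Proof. by []. Qed.
End Ops.
End SubModule.
Arguments submod_of {R M P} h.

Section Quotient.
Variables (R : pzRingType) (M : lmodType R) (N : M -> Prop).

Section Canon.
Hypothesis h : is_submodule N.
Let ex x : exists y, N (x - y). Proof. by exists x; rewrite subrr; case: h. Qed.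
Definition qcanon x := projT1 (cid (ex x)).
Lemma qcanonP x : N (x - qcanon x). Proof. exact: projT2 (cid (ex x)). Qed.
Let NZ a x : N x -> N (a *: x). Proof. by case: h => _ _ H; apply: H. Qed.
Let ND x y : N x -> N y -> N (x + y). Proof. by case: h => _ H _; apply: H. Qed.
Let NN x : N x -> N (- x). Proof. by rewrite -scaleN1r; apply: NZ. Qed.
(** The representative is chosen from the predicate [N (x - y)] in [y], which depends only on the
    coset of [x]; extensionality makes the choice canonical. *)
Lemma qcanon_eq x y : N (x - y) -> qcanon x = qcanon y.
Proof.
move=> Nxy; have E : (fun z => N (x - z)) = (fun z => N (y - z)).
  apply: funext => z; apply: propext; split=> Nz.
    have -> : y - z = - (x - y) + (x - z) by rewrite opprB addrA subrK.
    by apply: ND => //; apply: NN.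
  have -> : x - z = (x - y) + (y - z) by rewrite addrA subrK.
  exact: ND.
rewrite /qcanon; move: (ex x) (ex y); rewrite E => e1 e2.
by rewrite (Prop_irrelevance e1 e2).
Qed.
Lemma qcanonK x : qcanon (qcanon x) = qcanon x.
Proof. by apply: qcanon_eq; rewrite -opprB; apply/NN/qcanonP. Qed.
Lemma qcanon_eqP x y : qcanon x = qcanon y -> N (x - y).
Proof.
move=> E; rewrite -[x - y](_ : (x - qcanon x) + - (y - qcanon x) = _); last by rewrite opprB addrA subrK.
by apply: ND; [apply: qcanonP | rewrite E; exact: NN (qcanonP y)].
Qed.
End Canon.

Definition quot_of (h : is_submodule N) : Type := {x : M | qcanon h x == x}.

Section Ops.
Variable h : is_submodule N.
Local Notation T := (quot_of h).
HB.instance Definition _ := gen_eqMixin T.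
HB.instance Definition _ := gen_choiceMixin T.
Definition qpi x : T := exist _ (qcanon h x) (introT eqP (qcanonK h x)).
Lemma qpi_eq x y : N (x - y) -> qpi x = qpi y.
Proof. by move=> Nxy; apply: val_inj => /=; apply: qcanon_eq. Qed.
Lemma qpi_eqP x y : qpi x = qpi y -> N (x - y).
Proof. by move/(congr1 val) => /= /qcanon_eqP. Qed.
Definition qval (u : T) : M := val (u : {x : M | qcanon h x == x}).
Lemma qvalK u : qpi (qval u) = u. Proof. by apply: val_inj => /=; exact/eqP/(valP u). Qed.
Lemma qpiK x : N (qval (qpi x) - x).
Proof. by apply: qpi_eqP; rewrite qvalK. Qed.

Let ND x y : N x -> N y -> N (x + y). Proof. by case: h => _ H _; apply: H. Qed.
Let NZ a x : N x -> N (a *: x). Proof. by case: h => _ _ H; apply: H. Qed.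
Let NN x : N x -> N (- x). Proof. by rewrite -scaleN1r; apply: NZ. Qed.

Definition q_add u v := qpi (qval u + qval v).
Definition q_opp u := qpi (- qval u).
Definition q_scale a u := qpi (a *: qval u).
Lemma qpiD x y : q_add (qpi x) (qpi y) = qpi (x + y).
Proof. by apply: qpi_eq; rewrite opprD addrACA; apply: ND; apply: qpiK. Qed.
Lemma qpiZ a x : q_scale a (qpi x) = qpi (a *: x).
Proof. by apply: qpi_eq; rewrite -scalerBr; apply/NZ/qpiK. Qed.
Lemma qpiN x : q_opp (qpi x) = qpi (- x).
Proof. by apply: qpi_eq; rewrite -opprD; apply/NN/qpiK. Qed.
Let aA : associative q_add.
Proof. by move=> u v w; rewrite -[u]qvalK -[v]qvalK -[w]qvalK !qpiD addrA. Qed.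
Let aC : commutative q_add.
Proof. by move=> u v; rewrite -[u]qvalK -[v]qvalK !qpiD addrC. Qed.
Let a0 : left_id (qpi 0) q_add. Proof. by move=> u; rewrite -[u]qvalK !qpiD add0r. Qed.
Let aN : left_inverse (qpi 0) q_opp q_add.
Proof. by move=> u; rewrite -[u]qvalK qpiN qpiD addNr. Qed.
HB.instance Definition _ := GRing.isZmodule.Build T aA aC a0 aN.
Let sA a b u : q_scale a (q_scale b u) = q_scale (a * b) u.
Proof. by rewrite -[u]qvalK !qpiZ scalerA. Qed.
Let s1 : left_id 1 q_scale. Proof. by move=> u; rewrite -[u]qvalK qpiZ scale1r. Qed.
Let sDr : right_distributive q_scale +%R.
Proof. by move=> a u v; rewrite -[u]qvalK -[v]qvalK [qpi _ + qpi _]qpiD !qpiZ [RHS]qpiD scalerDr. Qed.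
Let sDl u : {morph q_scale^~ u : a b / a + b}.
Proof. by move=> a b; rewrite -[u]qvalK /= !qpiZ [RHS]qpiD scalerDl. Qed.
HB.instance Definition _ := GRing.Zmodule_isLmodule.Build R T sA s1 sDr sDl.
Lemma qpi_linear : linear qpi.
Proof. by move=> a x y; rewrite -qpiD -qpiZ. Qed.
Lemma qpi_eq0 x : qpi x = 0 <-> N x.
Proof. by split=> [/qpi_eqP|Nx]; [rewrite subr0 | apply: qpi_eq; rewrite subr0]. Qed.
End Ops.
End Quotient.
Arguments quot_of {R M N} h.

Section SubComplex.
Variables (R : pzRingType) (X : complex R) (P : forall n, X n -> Prop).
Hypotheses (h : forall n, is_submodule (@P n)) (hd : forall n x, P x -> P (cd X n x)).

Program Definition sub_cx : complex R :=
  @mk_complex R (fun n => submod_of (h n) : lmodType R)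
    (fun n (u : submod_of (h n)) => sm_mk (h (n + 1)) (hd (sm_valP u))) _ _.
Next Obligation. by move=> a u v; apply: sm_inj; rewrite sm_mkK !sm_val_linear linearP. Qed.
Next Obligation. by apply: sm_inj; rewrite !sm_mkK cdd. Qed.

Definition sub_in : chmap sub_cx X :=
  @mk_chmap _ sub_cx X (fun n u => sm_val u) (fun n => @sm_val_linear _ _ _ (h n))
    (fun n u => erefl).

Lemma sub_in_inj n : injective (sub_in n). Proof. exact: sm_inj. Qed.

Lemma sub_in_mem n x : P x <-> exists u, sub_in n u = x.
Proof.
split=> [Px|[u <-]]; last exact: sm_valP.
by exists (sm_mk (h n) Px).
Qed.
End SubComplex.

Section CokerComplex.
Variables (R : pzRingType) (X : complex R) (P : forall n, X n -> Prop).
Hypotheses (h : forall n, is_submodule (@P n)) (hd : forall n x, P x -> P (cd X n x)).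

Let dq n (u : quot_of (h n)) : quot_of (h (n + 1)) := qpi (h (n + 1)) (cd X n (qval u)).
Let dqE n x : dq (qpi (h n) x) = qpi (h (n + 1)) (cd X n x).
Proof. by apply: qpi_eq; rewrite -linearB; apply: hd; apply: qpiK. Qed.
Let dqL n : linear (@dq n).
Proof.
move=> a u v; rewrite -[u]qvalK -[v]qvalK -qpi_linear !dqE -qpi_linear.
by rewrite linearP.
Qed.

Program Definition quot_cx : complex R :=
  @mk_complex R (fun n => quot_of (h n) : lmodType R) dq dqL _.
Next Obligation. by rewrite -[x]qvalK !dqE cdd; apply/qpi_eq0; case: (h (n + 1 + 1)). Qed.

Program Definition quot_pr : chmap X quot_cx :=
  @mk_chmap _ X quot_cx (fun n x => qpi (h n) x) (fun n => @qpi_linear _ _ _ (h n)) _.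

Lemma quot_pr_surj n y : exists x, quot_pr n x = y.
Proof. by exists (qval y); exact: qvalK. Qed.
Lemma quot_pr_eq0 n x : quot_pr n x = 0 <-> P x.
Proof. exact: qpi_eq0. Qed.
End CokerComplex.

Section Exactness.
Variable R : pzRingType.
Implicit Types X Y Z W : complex R.

Lemma ch_lift X Y W (i : chmap X Y) (g : chmap W Y) :
  (forall n, injective (i n)) -> (forall n w, exists x, i n x = g n w) ->
  exists h : chmap W X, i \oc h = g.
Proof.
move=> inj ex; pose h n w := projT1 (cid (ex n w)).
have hE n w : i n (h n w) = g n w by exact: projT2 (cid (ex n w)).
have hl n : linear (h n) by move=> a u v; apply: inj; rewrite linearP !hE linearP.
have hd n w : h (n + 1) (cd W n w) = cd X n (h n w) by apply: inj; rewrite hE !chd hE.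
exists (@mk_chmap _ W X h hl hd); exact: chmap_ext.
Qed.

Lemma ch_factor Y Z W (p : chmap Y Z) (g : chmap Y W) :
  (forall n z, exists y, p n y = z) -> (forall n y, p n y = 0 -> g n y = 0) ->
  exists h : chmap Z W, h \oc p = g.
Proof.
move=> sur ker; pose s n z := projT1 (cid (sur n z)).
have sE n z : p n (s n z) = z by exact: projT2 (cid (sur n z)).
have gE n y y' : p n y = p n y' -> g n y = g n y'.
  by move=> E; apply/eqP; rewrite -subr_eq0 -linearB ker // linearB E subrr.
pose h n z := g n (s n z).
have hE n y : h n (p n y) = g n y by apply: gE; rewrite sE.
have hl n : linear (h n).
  by move=> a u v; rewrite /h -linearP; apply: gE; rewrite linearP !sE.
have hd n z : h (n + 1) (cd Z n z) = cd W n (h n z).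
  by rewrite -{1}[z]sE -chd hE chd.
exists (@mk_chmap _ Z W h hl hd); exact: chmap_ext.
Qed.

Lemma exact_comp0 X Y Z (i : chmap X Y) (p : chmap Y Z) : exact_seq i p -> p \oc i = 0.
Proof.
move=> E; apply: chmap_ext => n x; have [_ K _] := E n.
by rewrite ocE; apply/K; exists x.
Qed.

Lemma exact_lift X Y Z W (i : chmap X Y) (p : chmap Y Z) (g : chmap W Y) :
  exact_seq i p -> p \oc g = 0 -> exists h : chmap W X, i \oc h = g.
Proof.
move=> E pg; apply: ch_lift => [n|n w]; have [I K _] := E n; first exact: I.
by apply/K; rewrite -ocE pg.
Qed.

Lemma exact_factor X Y Z W (i : chmap X Y) (p : chmap Y Z) (g : chmap Y W) :
  exact_seq i p -> g \oc i = 0 -> exists h : chmap Z W, h \oc p = g.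
Proof.
move=> E gi; apply: ch_factor => [n|n y]; have [I K S] := E n; first exact: S.
by move/K => [x <-]; rewrite -ocE gi.
Qed.

Lemma exact_mono X Y Z W (i : chmap X Y) (p : chmap Y Z) (f g : chmap W X) :
  exact_seq i p -> i \oc f = i \oc g -> f = g.
Proof.
move=> E ifg; apply: chmap_ext => n x; have [I _ _] := E n; apply: I.
by rewrite -!ocE ifg.
Qed.

Lemma exact_epi X Y Z W (i : chmap X Y) (p : chmap Y Z) (f g : chmap Z W) :
  exact_seq i p -> f \oc p = g \oc p -> f = g.
Proof.
move=> E fgp; apply: chmap_ext => n z; have [_ _ S] := E n; have [y <-] := S z.
by rewrite -!ocE fgp.
Qed.

Lemma split_of_retraction X Y Z (i : chmap X Y) (p : chmap Y Z) (r : chmap Y X) :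
  exact_seq i p -> r \oc i = chid X -> split_seq i p.
Proof.
move=> E ri; have [|s sp] := @exact_factor _ _ _ _ i p (chid Y - i \oc r) E.
  by rewrite ocBl oc1l -ocA ri oc1r subrr.
exists r, s; rewrite !cheqE chaddE sp addrCA subrr addr0; split=> //.
apply: (exact_epi E); rewrite -ocA sp ocBr oc1r oc1l ocA (exact_comp0 E) oc0l subr0 //.
Qed.

Lemma split_of_section X Y Z (i : chmap X Y) (p : chmap Y Z) (s : chmap Z Y) :
  exact_seq i p -> p \oc s = chid Z -> split_seq i p.
Proof.
move=> E ps; have [|r ir] := @exact_lift _ _ _ _ i p (chid Y - s \oc p) E.
  by rewrite ocBr oc1r ocA ps oc1l subrr.
apply: (split_of_retraction (r := r)) => //.
apply: (exact_mono E); rewrite ocA ir ocBl oc1l oc1r -ocA (exact_comp0 E) oc0r subr0 //.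
Qed.

Lemma hom_from_exactP P X Y Z (i : chmap X Y) (p : chmap Y Z) : exact_seq i p ->
  (hom_from_exact P i p <-> forall h : chmap P Z, exists g : chmap P Y, p \oc g = h).
Proof.
move=> E; split=> [[_ _ H] h|H]; first by have [g /chmap_ext gE] := H h; exists g.
split=> [f|g|h].
- rewrite !cheqE ch00 => f0; apply: (exact_mono E); by rewrite f0 oc0r.
- rewrite cheqE ch00 => g0; have [f fE] := exact_lift E g0; by exists f; rewrite cheqE.
- by have [g gE] := H h; exists g; rewrite cheqE.
Qed.

Lemma hom_to_exactP J X Y Z (i : chmap X Y) (p : chmap Y Z) : exact_seq i p ->
  (hom_to_exact J i p <-> forall h : chmap X J, exists g : chmap Y J, g \oc i = h).
Proof.
move=> E; split=> [[_ _ H] h|H]; first by have [g /chmap_ext gE] := H h; exists g.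
split=> [f|g|h].
- rewrite !cheqE ch00 => f0; apply: (exact_epi E); by rewrite f0 oc0l.
- rewrite cheqE ch00 => g0; have [f fE] := exact_factor E g0; by exists f; rewrite cheqE.
- by have [g gE] := H h; exists g; rewrite cheqE.
Qed.

Lemma coker_exact X Y (i : chmap X Y) : (forall n, injective (i n)) ->
  exists Z (p : chmap Y Z), exact_seq i p.
Proof.
move=> inj; pose P n y := exists x, i n x = y.
have h n : is_submodule (P n).
  split; first by exists 0; rewrite linear0.
  - by move=> _ _ [x <-] [y <-]; exists (x + y); rewrite linearD.
  - by move=> a _ [x <-]; exists (a *: x); rewrite linearZ.
have hd n y : P n y -> P (n + 1) (cd Y n y) by move=> [x <-]; exists (cd X n x); rewrite chd.
exists (quot_cx h hd), (quot_pr h hd) => n; split; first exact: inj.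
  by move=> y; apply: quot_pr_eq0.
exact: quot_pr_surj.
Qed.

Lemma ker_exact Y Z (p : chmap Y Z) : (forall n z, exists y, p n y = z) ->
  exists X (i : chmap X Y), exact_seq i p.
Proof.
move=> sur; pose P n (y : Y n) := p n y = 0.
have h n : is_submodule (P n).
  split; first by rewrite /P linear0.
  - by move=> x y; rewrite /P linearD => -> ->; rewrite addr0.
  - by move=> a y; rewrite /P linearZ /= => ->; rewrite scaler0.
have hd n y : P n y -> P (n + 1) (cd Y n y) by rewrite /P chd => ->; rewrite linear0.
exists (sub_cx h hd), (sub_in h hd) => n; split; first exact: sub_in_inj.
  by move=> y; apply: (sub_in_mem h hd).
exact: sur.
Qed.

Section Biproduct.
Variables X Y : complex R.
Program Definition biprod : complex R :=
  @mk_complex R (fun n => (X n * Y n)%type : lmodType R)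
    (fun n (u : (X n * Y n)%type) => (cd X n u.1, cd Y n u.2)) _ _.
Next Obligation. by move=> a u v; rewrite /= !linearP. Qed.
Next Obligation. by rewrite !cdd. Qed.
Definition bp1 : chmap biprod X :=
  @mk_chmap _ biprod X (fun n u => u.1) (fun _ _ _ _ => erefl) (fun _ _ => erefl).
Definition bp2 : chmap biprod Y :=
  @mk_chmap _ biprod Y (fun n u => u.2) (fun _ _ _ _ => erefl) (fun _ _ => erefl).
Program Definition bi1 : chmap X biprod := @mk_chmap _ X biprod (fun n x => (x, 0)) _ _.
Next Obligation. by move=> a x y; congr pair; rewrite /= scaler0 addr0. Qed.
Next Obligation. by rewrite linear0. Qed.
Program Definition bi2 : chmap Y biprod := @mk_chmap _ Y biprod (fun n x => (0, x)) _ _.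
Next Obligation. by move=> a x y; congr pair; rewrite /= scaler0 addr0. Qed.
Next Obligation. by rewrite linear0. Qed.
Lemma bp11 : bp1 \oc bi1 = chid X. Proof. exact: chmap_ext. Qed.
Lemma bp22 : bp2 \oc bi2 = chid Y. Proof. exact: chmap_ext. Qed.
Lemma bp12 : bp1 \oc bi2 = 0. Proof. exact: chmap_ext. Qed.
Lemma bp21 : bp2 \oc bi1 = 0. Proof. exact: chmap_ext. Qed.
Lemma biprod1 : bi1 \oc bp1 + bi2 \oc bp2 = chid biprod.
Proof.
apply: chmap_ext => n [x y]; rewrite chDE !ocE /=.
by congr pair; rewrite /= ?addr0 ?add0r.
Qed.
End Biproduct.

Program Definition zero_cx : complex R :=
  @Complex R (fun n => 'rV[R]_0 : lmodType R) (fun n => \0) _.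

Lemma zero_cx0 n (x : zero_cx n) : x = 0. Proof. exact: thinmx0. Qed.
End Exactness.

(** * Categories of complexes and stably zero maps *)

Section GradedCategory.
Variables (k : idomainType) (F : fieldType) (r : {rmorphism k -> F}).
Hypothesis rP : forall x, (r x == 0) = (x \isn't a GRing.unit).

(** Membership in the category is expressed by the underlying graded [k]-modules alone, so that
    complexes over different groups become comparable. *)
Definition gcat (fl ab be : bool) (D : int -> lmodType k) : Prop :=
  [/\ fl -> forall n, klen (D n),
      ab -> exists N : int, forall n, (N < n)%R -> forall x : D n, x = 0 &
      be -> exists N : int, forall n, (n < N)%R -> forall x : D n, x = 0].

Lemma gcat_joint fl ab be (D : int -> lmodType k) (I : finType) (E : I -> int -> lmodType k)
    (phi : forall i n, {linear D n -> E i n}) :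
  (forall i, gcat fl ab be (E i)) ->
  (forall n x, (forall i, phi i n x = 0) -> x = 0) -> gcat fl ab be D.
Proof.
move=> cE inj; split.
- by move=> fl1 n; apply: (klen_joint (f := phi^~ n)) (inj n) => i; case: (cE i) => + _ _; apply.
- move=> ab1; have ex i : exists N : int, forall n, (N < n)%R -> forall x : E i n, x = 0.
    by case: (cE i) => _ + _; apply.
  exists (\sum_i `|projT1 (cid (ex i))|)%R => n ltn x; apply: inj => i.
  apply: (projT2 (cid (ex i))); apply: le_lt_trans ltn.
  by apply: le_trans (ler_norm _) _; rewrite (bigD1 i) //= lerDl sumr_ge0.
- move=> be1; have ex i : exists N : int, forall n, (n < N)%R -> forall x : E i n, x = 0.
    by case: (cE i) => _ _; apply.
  exists (- \sum_i `|projT1 (cid (ex i))|)%R => n ltn x; apply: inj => i.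
  apply: (projT2 (cid (ex i))); apply: lt_le_trans ltn _.
  rewrite lerNl; apply: le_trans (_ : `|projT1 (cid (ex i))| <= _); first by rewrite -normrN ler_norm.
  by rewrite (bigD1 i) //= lerDl sumr_ge0.
Qed.

Lemma gcat_surj fl ab be (D E : int -> lmodType k) (phi : forall n, {linear D n -> E n}) :
  gcat fl ab be D -> (forall n y, exists x, phi n x = y) -> gcat fl ab be E.
Proof.
move=> [c1 c2 c3] sur; split.
- by move=> /c1 c n; apply: klen_surj (sur n) (c n).
- move=> /c2 [N c]; exists N => n lt y; have [x <-] := sur n y.
  by rewrite (c n lt x) linear0.
- move=> /c3 [N c]; exists N => n lt y; have [x <-] := sur n y.
  by rewrite (c n lt x) linear0.
Qed.

Lemma gcat_shift fl ab be (D : int -> lmodType k) (a : int) :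
  gcat fl ab be D -> gcat fl ab be (fun n => D (n + a)).
Proof.
move=> [c1 c2 c3]; split.
- by move=> /c1 c n; apply: c.
- by move=> /c2 [N c]; exists (N - a) => n lt x; apply: c; rewrite -ltrBlDr.
- by move=> /c3 [N c]; exists (N - a) => n lt x; apply: c; rewrite -ltrBrDr.
Qed.

Definition ccat gT (C : complex_cat k gT) := gcat (cc_FL C) (cc_above C) (cc_below C).

Lemma in_catE gT (C : complex_cat k gT) (X : complex (galg k gT)) :
  in_cat C X <-> ccat C (fun n => kx X n).
Proof.
split=> -[c1 c2 c3]; split=> //.
  by move=> /c1 c n; apply: (finite_length_klen rP).
by move=> /c1 c n; exact: klen_finite_length (c n).
Qed.

(** Over [k], [Y] embeds in a finite product of objects of the category. The group may change: for
    an induced complex the maps are the components at the cosets. *)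
Lemma in_cat_kjoint gT gT' (C : complex_cat k gT) (C' : complex_cat k gT')
    (Y : complex (galg k gT)) (I : finType) (X : I -> complex (galg k gT'))
    (phi : forall i, chmap (kx Y) (kx (X i))) :
  [/\ cc_FL C = cc_FL C', cc_above C = cc_above C' & cc_below C = cc_below C'] ->
  (forall i, in_cat C' (X i)) ->
  (forall n y, (forall i, phi i n y = 0) -> y = 0) -> in_cat C Y.
Proof.
move=> [e1 e2 e3] cX inj; apply/in_catE; rewrite /ccat e1 e2 e3.
by apply: (gcat_joint (phi := fun i n => phi i n)) inj => i; apply/in_catE.
Qed.

Section OneGroup.
Variables (gT : finGroupType) (C : complex_cat k gT).
Local Notation A := (galg k gT).
Implicit Types (X Y Z W P : complex A).

Lemma in_cat_mono X Y (i : chmap X Y) : (forall n, injective (i n)) ->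
  in_cat C Y -> in_cat C X.
Proof.
move=> inj cY; apply: (@in_cat_kjoint _ _ C C X unit (fun=> Y) (fun=> kres i)) => // n y /(_ tt) E.
by apply: inj; rewrite linear0.
Qed.

Lemma in_cat_epi X Y (p : chmap X Y) : (forall n y, exists x, p n x = y) ->
  in_cat C X -> in_cat C Y.
Proof. by move=> sur /in_catE cX; apply/in_catE; apply: (gcat_surj (phi := fun n => kres p n)) cX sur. Qed.

Lemma in_cat_biprod X Y : in_cat C X -> in_cat C Y -> in_cat C (biprod X Y).
Proof.
move=> cX cY; apply: (@in_cat_kjoint _ _ C C _ bool (fun b => if b then X else Y)
  (fun b => if b return chmap (kx _) (kx (if b then X else Y)) then kres (bp1 X Y) else kres (bp2 X Y))) => //.
  by case.
by move=> n [x y] H; have := H true; have := H false => /= -> ->.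
Qed.

Lemma in_cat_zero : in_cat C (zero_cx A).
Proof.
apply: (@in_cat_kjoint _ _ C C _ void (fun=> zero_cx A) (fun i => match i with end)) => // n y _.
exact: zero_cx0.
Qed.

Lemma in_cat_exact1 X Y Z (i : chmap X Y) (p : chmap Y Z) : exact_seq i p -> in_cat C Y -> in_cat C X.
Proof. by move=> E; apply: (in_cat_mono (i := i)) => n; case: (E n). Qed.
Lemma in_cat_exact3 X Y Z (i : chmap X Y) (p : chmap Y Z) : exact_seq i p -> in_cat C Y -> in_cat C Z.
Proof. by move=> E; apply: (in_cat_epi (p := p)) => n; case: (E n). Qed.

Lemma class_projectiveP c P : class_projective C c P <->
  in_cat C P /\ forall X Y Z (i : chmap X Y) (p : chmap Y Z) (h : chmap P Z),
    in_cat C X -> in_cat C Y -> in_cat C Z -> in_class C c i p ->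
    exists g : chmap P Y, p \oc g = h.
Proof.
split=> -[cP H]; split=> // X Y Z i p.
  move=> h cX cY cZ ic; have := H X Y Z i p cX cY cZ ic.
  by case: ic => E _ /(hom_from_exactP P E); apply.
move=> cX cY cZ ic; have [E _] := ic.
by apply/(hom_from_exactP P E) => h; apply: H ic.
Qed.

Lemma class_projective_biprod c P P' :
  class_projective C c P -> class_projective C c P' -> class_projective C c (biprod P P').
Proof.
move=> /class_projectiveP [cP H] /class_projectiveP [cP' H'].
apply/class_projectiveP; split; first exact: in_cat_biprod.
move=> X Y Z j q h cX cY cZ ic.
have [g gE] := H _ _ _ _ _ (h \oc bi1 P P') cX cY cZ ic.
have [g' gE'] := H' _ _ _ _ _ (h \oc bi2 P P') cX cY cZ ic.
exists (g \oc bp1 P P' + g' \oc bp2 P P').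
by rewrite ocDr !ocA gE gE' -!ocA -ocDr biprod1 oc1r.
Qed.

Lemma class_projective_zero c : class_projective C c (zero_cx A).
Proof.
apply/class_projectiveP; split; first exact: in_cat_zero.
move=> X Y Z j q h _ _ _ _; exists 0; apply: chmap_ext => n x.
by rewrite (zero_cx0 x) !linear0.
Qed.

Definition cz X Y (f : chmap X Y) : Prop :=
  if cc_htpy C is Some c then
    exists2 P, class_projective C c P & exists (u : chmap X P) (v : chmap P Y), f = v \oc u
  else f = 0.

Lemma ceqP X Y (f g : chmap X Y) : ceq C f g <-> cz (f - g).
Proof.
rewrite /ceq /cz; case: (cc_htpy C) => [c|]; last first.
  by rewrite cheqE; split=> [->|/eqP]; rewrite ?subrr // subr_eq0 => /eqP.
by split=> -[P cP [u [v E]]]; exists P => //; exists u, v; move: E; rewrite cheqE chsubE.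
Qed.

Lemma cz0 X Y : cz (0 : chmap X Y).
Proof.
rewrite /cz; case: (cc_htpy C) => // c; exists (zero_cx A); first exact: class_projective_zero.
by exists 0, 0; rewrite oc0l.
Qed.

Lemma czD X Y (f g : chmap X Y) : cz f -> cz g -> cz (f + g).
Proof.
rewrite /cz; case: (cc_htpy C) => [c|-> ->]; last by rewrite addr0.
move=> [P cP [u [v ->]]] [P' cP' [u' [v' ->]]].
exists (biprod P P'); first exact: class_projective_biprod.
exists (bi1 P P' \oc u + bi2 P P' \oc u'), (v \oc bp1 P P' + v' \oc bp2 P P').
rewrite ocDl !ocDr -!ocA !(ocA (bp1 _ _)) !(ocA (bp2 _ _)) bp11 bp12 bp21 bp22.
by rewrite !oc0l !oc1l !oc0r addr0 add0r.
Qed.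

Lemma czN X Y (f : chmap X Y) : cz f -> cz (- f).
Proof.
rewrite /cz; case: (cc_htpy C) => [c|->]; last by rewrite oppr0.
by move=> [P cP [u [v ->]]]; exists P => //; exists u, (- v); rewrite ocNl.
Qed.

Lemma cz_compl X Y Z (g : chmap Y Z) (f : chmap X Y) : cz f -> cz (g \oc f).
Proof.
rewrite /cz; case: (cc_htpy C) => [c|->]; last by rewrite oc0r.
by move=> [P cP [u [v ->]]]; exists P => //; exists u, (g \oc v); rewrite ocA.
Qed.

Lemma cz_compr X Y Z (g : chmap Y Z) (f : chmap X Y) : cz g -> cz (g \oc f).
Proof.
rewrite /cz; case: (cc_htpy C) => [c|->]; last by rewrite oc0l.
by move=> [P cP [u [v ->]]]; exists P => //; exists (u \oc f), v; rewrite ocA.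
Qed.

Definition ktrace (Fam : {set gT} -> Prop) X Y (f : chmap X Y) : Prop :=
  gtrace (@kconj k gT X Y) [set: gT] Fam (kres f).

Definition szero (Fam : {set gT} -> Prop) X Y (f : chmap X Y) : Prop :=
  exists2 f' : chmap X Y, ktrace Fam f' & cz (f - f').

Section Trace.
Variable Fam : {set gT} -> Prop.

Lemma ktrace0 X Y : ktrace Fam (0 : chmap X Y).
Proof.
rewrite /ktrace; have -> : kres (0 : chmap X Y) = 0 by exact: chmap_ext.
exact: gtrace0.
Qed.
Lemma ktraceD X Y (f g : chmap X Y) : ktrace Fam f -> ktrace Fam g -> ktrace Fam (f + g).
Proof. by move=> tf tg; rewrite /ktrace /kres rest_chD; apply: gtraceD. Qed.
Lemma ktraceN X Y (f : chmap X Y) : ktrace Fam f -> ktrace Fam (- f).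
Proof.
move=> tf; rewrite /ktrace; have -> : kres (- f) = - kres f by exact: chmap_ext.
exact: (gtraceN (kconjP X Y)).
Qed.
Lemma ktrace_comp X Y Z W (h : chmap Z W) (g : chmap Y Z) (f : chmap X Y) :
  ktrace Fam g -> ktrace Fam (h \oc g \oc f).
Proof.
move=> tg; have := @gtrace_map _ _ _ (@kconj k gT Y Z) (@kconj k gT X W) [set: gT]%G Fam
  (fun t => kres h \oc t \oc kres f) _ _ _ tg.
rewrite -!rest_chM; apply=> [s t|g0 t _]; first by rewrite ocBr ocBl.
by rewrite -[X in X \oc _ \oc _](kconj_kres g0) -[X in _ \oc _ \oc X](kconj_kres g0) -!kconj_comp.
Qed.
Lemma ktrace_compl X Y Z (g : chmap Y Z) (f : chmap X Y) : ktrace Fam f -> ktrace Fam (g \oc f).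
Proof. by move=> tf; rewrite -[_ \oc _]oc1r; apply: ktrace_comp. Qed.
Lemma ktrace_compr X Y Z (g : chmap Y Z) (f : chmap X Y) : ktrace Fam g -> ktrace Fam (g \oc f).
Proof. by move=> tg; rewrite -[g]oc1l; apply: ktrace_comp. Qed.

Lemma szero0 X Y : szero Fam (0 : chmap X Y).
Proof. by exists 0; [apply: ktrace0 | rewrite subrr; apply: cz0]. Qed.
Lemma szeroD X Y (f g : chmap X Y) : szero Fam f -> szero Fam g -> szero Fam (f + g).
Proof.
move=> [f' tf cf] [g' tg cg]; exists (f' + g'); first exact: ktraceD.
by rewrite opprD addrACA; apply: czD.
Qed.
Lemma szeroN X Y (f : chmap X Y) : szero Fam f -> szero Fam (- f).
Proof.
move=> [f' tf cf]; exists (- f'); first exact: ktraceN.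
by rewrite -opprD; apply: czN.
Qed.
Lemma szero_compl X Y Z (g : chmap Y Z) (f : chmap X Y) : szero Fam f -> szero Fam (g \oc f).
Proof.
move=> [f' tf cf]; exists (g \oc f'); first exact: ktrace_compl.
by rewrite -ocBr; apply: cz_compl.
Qed.
Lemma szero_compr X Y Z (g : chmap Y Z) (f : chmap X Y) : szero Fam g -> szero Fam (g \oc f).
Proof.
move=> [f' tf cf]; exists (f' \oc f); first exact: ktrace_compr.
by rewrite -ocBl; apply: cz_compr.
Qed.
Lemma szero_trace X Y (f : chmap X Y) : ktrace Fam f -> szero Fam f.
Proof. by move=> tf; exists f => //; rewrite subrr; apply: cz0. Qed.
Lemma szero_cz X Y (f : chmap X Y) : cz f -> szero Fam f.
Proof. by move=> cf; exists 0; [apply: ktrace0 | rewrite subr0]. Qed.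
End Trace.

Lemma ktrace_mul (F1 F2 F3 : {set gT} -> Prop) X Y Z (g : chmap Y Z) (f : chmap X Y) :
  (forall S S' : {set gT}, F1 S -> F2 S' -> F3 (S :&: S')) ->
  ktrace F1 g -> ktrace F2 f -> ktrace F3 (g \oc f).
Proof.
move=> FF tg tf; rewrite /ktrace /kres rest_chM.
apply: (gtrace_mul (mu := fun s t => s \oc t)) FF tg tf => *.
- exact: ocDl.
- exact: ocDr.
- by rewrite kconj_comp.
Qed.

Lemma gtrace_lact (K : {group gT}) F1 X (a : A) : gtrace gconj K F1 a ->
  gtrace (@kconj k gT X X) K F1 (lact X a).
Proof.
apply: gtrace_map => [x y|g x _]; [exact: lactB | by rewrite kconj_lact].
Qed.
End OneGroup.
End GradedCategory.

(** * Block components, finite products and direct sums of complexes *)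

Section BlockTruncation.
Variables (k : idomainType) (gT : finGroupType).
Local Notation A := (galg k gT).
Variable e : A.
Hypothesis he : central_idempotent e.
Implicit Types (X Y : complex A).

Let ee : e * e = e. Proof. by case: he. Qed.
Let ec a : a * e = e * a. Proof. by case: he. Qed.

Program Definition cact X : chmap X X := @mk_chmap _ X X (fun n x => e *: x) _ _.
Next Obligation. by move=> a x y; rewrite scalerDr !scalerA ec. Qed.
Next Obligation. by rewrite linearZ. Qed.

Lemma cactE X n (x : X n) : cact X n x = e *: x. Proof. by []. Qed.
Lemma cact_nat X Y (f : chmap X Y) : f \oc cact X = cact Y \oc f.
Proof. by apply: chmap_ext => n x; rewrite !ocE !cactE linearZ. Qed.
Lemma cact_block X : in_block e X -> cact X = chid X.
Proof. by move=> bX; apply: chmap_ext => n x; rewrite cactE bX. Qed.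

Let tsub X n : is_submodule (fun x : X n => e *: x = x).
Proof.
split; first by rewrite scaler0.
- by move=> x y ex ey; rewrite scalerDr ex ey.
- by move=> a x ex; rewrite scalerA -ec -scalerA ex.
Qed.
Let tstab X n (x : X n) : e *: x = x -> e *: cd X n x = cd X n x.
Proof. by move=> ex; rewrite -linearZ ex. Qed.

Definition trunc_cx X : complex A := sub_cx (@tsub X) (@tstab X).
Definition trunc_in X : chmap (trunc_cx X) X := sub_in (@tsub X) (@tstab X).

Lemma trunc_in_inj X n : injective (trunc_in X n).
Proof. exact: sub_in_inj. Qed.

Lemma trunc_block X : in_block e (trunc_cx X).
Proof.
move=> n x; apply: trunc_in_inj; rewrite linearZ /=.
by apply/(sub_in_mem (@tsub X) (@tstab X)); exists x.
Qed.

Let ex_pr X : exists p : chmap X (trunc_cx X), trunc_in X \oc p = cact X.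
Proof.
apply: ch_lift => n; first exact: trunc_in_inj.
by move=> w; apply/(sub_in_mem (@tsub X) (@tstab X)); rewrite cactE scalerA ee.
Qed.
Definition trunc_pr X : chmap X (trunc_cx X) := projT1 (cid (ex_pr X)).
Lemma trunc_inpr X : trunc_in X \oc trunc_pr X = cact X.
Proof. exact: projT2 (cid (ex_pr X)). Qed.
Lemma trunc_mono X W (f g : chmap W (trunc_cx X)) : trunc_in X \oc f = trunc_in X \oc g -> f = g.
Proof.
move=> E; apply: chmap_ext => n x; apply: trunc_in_inj.
by rewrite -!ocE E.
Qed.
Lemma trunc_prin X : trunc_pr X \oc trunc_in X = chid (trunc_cx X).
Proof.
apply: trunc_mono; rewrite ocA trunc_inpr -cact_nat.
by rewrite cact_block //; apply: trunc_block.
Qed.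
End BlockTruncation.

Lemma central_idempotent1 (k : idomainType) gT : central_idempotent (1 : galg k gT).
Proof. by split=> [|a]; rewrite ?mulr1 ?mul1r. Qed.

Lemma central_idempotent_compl (k : idomainType) gT (e : galg k gT) :
  central_idempotent e -> central_idempotent (1 - e).
Proof.
move=> [ee ec]; split=> [|a]; last by rewrite mulrBr mulrBl mulr1 mul1r ec.
by rewrite mulrBr mulr1 mulrBl mul1r ee subrr subr0.
Qed.

Section DirectProduct.
Variables (R : pzRingType) (I : finType) (D_ : I -> complex R).

Definition dfun (n : int) : Type := forall i, D_ i n.
Section Deg.
Variable n : int.
Local Notation T := (dfun n).
HB.instance Definition _ := gen_eqMixin T.
HB.instance Definition _ := gen_choiceMixin T.
Definition df_add (u v : T) : T := fun i => u i + v i.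
Definition df_opp (u : T) : T := fun i => - u i.
Definition df_zero : T := fun i => 0.
Definition df_scale a (u : T) : T := fun i => a *: u i.
Let ext (u v : T) : (forall i, u i = v i) -> u = v. Proof. exact: functional_extensionality_dep. Qed.
Let aA : associative df_add. Proof. by move=> u v w; apply: ext => i; rewrite /df_add addrA. Qed.
Let aC : commutative df_add. Proof. by move=> u v; apply: ext => i; rewrite /df_add addrC. Qed.
Let a0 : left_id df_zero df_add. Proof. by move=> u; apply: ext => i; rewrite /df_add add0r. Qed.
Let aN : left_inverse df_zero df_opp df_add.
Proof. by move=> u; apply: ext => i; rewrite /df_add addNr. Qed.
HB.instance Definition _ := GRing.isZmodule.Build T aA aC a0 aN.
Let sA a b u : df_scale a (df_scale b u) = df_scale (a * b) u.
Proof. by apply: ext => i; rewrite /df_scale scalerA. Qed.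
Let s1 : left_id 1 df_scale. Proof. by move=> u; apply: ext => i; rewrite /df_scale scale1r. Qed.
Let sDr : right_distributive df_scale +%R.
Proof. by move=> a u v; apply: ext => i; rewrite /df_scale scalerDr. Qed.
Let sDl u : {morph df_scale^~ u : a b / a + b}.
Proof. by move=> a b; apply: ext => i; rewrite /df_scale scalerDl. Qed.
HB.instance Definition _ := GRing.Zmodule_isLmodule.Build R T sA s1 sDr sDl.
End Deg.

Program Definition dprod_cx : complex R :=
  @mk_complex R (fun n => dfun n : lmodType R) (fun n (u : dfun n) i => cd (D_ i) n (u i)) _ _.
Next Obligation. by move=> a u v; apply: functional_extensionality_dep => i; rewrite linearP. Qed.
Next Obligation. by apply: functional_extensionality_dep => i; rewrite cdd. Qed.

Definition dp_pr i : chmap dprod_cx (D_ i) :=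
  @mk_chmap _ dprod_cx (D_ i) (fun n u => u i) (fun _ _ _ _ => erefl) (fun _ _ => erefl).

Let dw i n (x : D_ i n) : dfun n := dfwith (fun j => 0 : D_ j n) x.
Let dwE i n (x : D_ i n) : dw x i = x. Proof. by rewrite /dw dfwith_in. Qed.
Let dwN i j n (x : D_ i n) : i != j -> dw x j = 0.
Proof. by move=> ne; rewrite /dw dfwith_out // eq_sym. Qed.

Program Definition dp_in i : chmap (D_ i) dprod_cx := @mk_chmap _ (D_ i) dprod_cx (fun n x => dw x) _ _.
Next Obligation.
move=> a x y; apply: functional_extensionality_dep => j.
rewrite -[RHS]/(a *: dw x j + dw y j).
by have [<-|ne] := eqVneq i j; rewrite ?dwE // !dwN // scaler0 addr0.
Qed.
Next Obligation.
apply: functional_extensionality_dep => j; rewrite -[RHS]/(cd (D_ j) n (dw x j)).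
by have [<-|ne] := eqVneq i j; rewrite ?dwE // !dwN // linear0.
Qed.

Lemma dp_prin i : dp_pr i \oc dp_in i = chid _.
Proof. by apply: chmap_ext => n x; rewrite ocE /= dwE. Qed.

Lemma dp_prin0 i j : i != j -> dp_pr j \oc dp_in i = 0.
Proof. by move=> ne; apply: chmap_ext => n x; rewrite ocE /= dwN. Qed.

Lemma dprod_direct_sum : @is_direct_sum R I D_ dprod_cx dp_in.
Proof.
have ev n i (s : seq I) (y : forall i, D_ i n) :
    (\sum_(j <- s) dp_in j n (y j) : dfun n) i = \sum_(j <- s) (dw (y j) i).
  by rewrite -[LHS]/(dp_pr i n (\sum_(j <- s) dp_in j n (y j))) raddf_sum.
move=> n; split=> [x|s y us sy i si].
  exists (enum I), (fun i => x i); apply: functional_extensionality_dep => i.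
  rewrite ev (bigD1_seq i) ?mem_enum ?enum_uniq //= dwE big1 ?addr0 // => j ne.
  by rewrite dwN.
have := congr1 (fun u : dfun n => u i) sy; rewrite ev (bigD1_seq i) //= dwE big1 ?addr0 // => j ne.
by rewrite dwN.
Qed.
End DirectProduct.

Lemma big_widen (I : eqType) (V : zmodType) (s u : seq I) (z : I -> V) :
  uniq s -> uniq u -> {subset s <= u} -> (forall i, i \notin s -> z i = 0) ->
  \sum_(i <- s) z i = \sum_(i <- u) z i.
Proof.
move=> us uu su z0; rewrite [RHS](bigID (mem s)) /= [X in _ = _ + X]big1 ?addr0; last exact: z0.
rewrite -[in RHS]big_filter; apply: perm_big; apply: uniq_perm => //; first exact: filter_uniq.
by move=> i; rewrite mem_filter; case si: (i \in s) => //=; rewrite su.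
Qed.

Section DirectSumMaps.
Variables (R S : pzRingType) (f : {rmorphism S -> R}) (I : eqType).
Variables (D_ : I -> complex R) (D : complex R) (inj : forall i, chmap (D_ i) D).
Hypothesis ds : is_direct_sum inj.

Let dec n (x : D n) : exists s (y : forall i, D_ i n),
  [/\ uniq s, forall i, i \notin s -> y i = 0 & x = \sum_(i <- s) inj i n (y i)].
Proof.
have [s [y ->]] := (ds n).1 x.
exists (undup s), (fun i => y i *+ count_mem i s); split.
- exact: undup_uniq.
- by move=> i; rewrite mem_undup => /count_memPn ->.
rewrite -big_undup_iterop_count; apply: eq_bigr => i _ /=.
by rewrite raddfMn.
Qed.

Let dec_eq n s s' (y y' : forall i, D_ i n) : uniq s -> uniq s' ->
  (forall i, i \notin s -> y i = 0) -> (forall i, i \notin s' -> y' i = 0) ->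
  \sum_(i <- s) inj i n (y i) = \sum_(i <- s') inj i n (y' i) -> forall i, y i = y' i.
Proof.
move=> us us' y0 y0' E i; pose u := undup (s ++ s').
have su : {subset s <= u} by move=> j; rewrite mem_undup mem_cat => ->.
have su' : {subset s' <= u} by move=> j; rewrite mem_undup mem_cat orbC => ->.
have uu : uniq u by apply: undup_uniq.
have [iu|] := boolP (i \in u); last first.
  by rewrite mem_undup mem_cat negb_or => /andP[/y0 -> /y0' ->].
apply/eqP; rewrite -subr_eq0; apply/eqP.
apply: ((ds n).2 u (fun i => y i - y' i) uu _ i iu).
under eq_bigr => j _ do rewrite linearB.
rewrite sumrB -(big_widen us uu su) => [|j /y0 ->]; last by rewrite linear0.
by rewrite -(big_widen us' uu su') => [|j /y0' ->]; rewrite ?linear0 // E subrr.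
Qed.

(** The universal property of a possibly infinite direct sum for maps that are linear over [S] only;
    with [S = k] it assembles [k]-linear maps given on the summands. *)
Lemma dsum_map (W : complex R) (t : forall i, chmap (rest_cx f (D_ i)) (rest_cx f W)) :
  exists g : chmap (rest_cx f D) (rest_cx f W), forall i, g \oc rest_ch f (inj i) = t i.
Proof.
pose s n x := projT1 (cid (@dec n x)).
pose y n x := projT1 (cid (projT2 (cid (@dec n x)))).
have sy n x : [/\ uniq (s n x), forall i, i \notin s n x -> y n x i = 0 &
    x = \sum_(i <- s n x) inj i n (y n x i)] by exact: projT2 (cid (projT2 (cid (@dec n x)))).
pose g n (x : rest_cx f D n) : rest_cx f W n := \sum_(i <- s n x) t i n (y n x i).
(* [g] is computed from a chosen expansion of its argument; by uniqueness of coordinates any other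
   expansion without repetitions gives the same value. *)
have gE n (u : seq I) (z : forall i, D_ i n) : uniq u ->
    g n (\sum_(i <- u) inj i n (z i)) = \sum_(i <- u) t i n (z i).
  move=> uu; set x := \sum_(i <- u) _; have [us y0 xE] := sy n x.
  pose z' i := if i \in u then z i else 0.
  have zz' i : i \in u -> z i = z' i by rewrite /z' => ->.
  have z'0 i : i \notin u -> z' i = 0 by rewrite /z' => /negPf ->.
  have E : forall i, y n x i = z' i.
    apply: (dec_eq us uu y0 z'0); rewrite -xE /x.
    by rewrite !big_seq; apply: eq_bigr => i iu; rewrite zz'.
  transitivity (\sum_(i <- undup (s n x ++ u)) t i n (z' i)).
    rewrite /g (eq_bigr (fun i => t i n (z' i))) => [|i _]; last by rewrite E.
    apply: (big_widen us (undup_uniq _)) => [i si|i nt].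
      by rewrite mem_undup mem_cat si.
    by rewrite -E y0 // linear0.
  rewrite [RHS]big_seq (eq_bigr (fun i => t i n (z' i)) (fun i iu => congr1 (t i n) (zz' i iu))) -big_seq.
  symmetry; apply: (big_widen uu (undup_uniq _)) => [i si|i nt].
    by rewrite mem_undup mem_cat si orbT.
  by rewrite z'0 // linear0.
have span2 n (x x' : D n) : exists u z z', [/\ uniq u, x = \sum_(i <- u) inj i n (z i) &
    x' = \sum_(i <- u) inj i n (z' i)].
  have [us y0 xE] := sy n x; have [us' y0' xE'] := sy n x'.
  exists (undup (s n x ++ s n x')), (y n x), (y n x'); rewrite undup_uniq; split=> //.
    rewrite {1}xE; apply: (big_widen us (undup_uniq _)) => [i si|i /y0 ->]; rewrite ?linear0 //.
    by rewrite mem_undup mem_cat si.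
  rewrite {1}xE'; apply: (big_widen us' (undup_uniq _)) => [i si|i /y0' ->]; rewrite ?linear0 //.
  by rewrite mem_undup mem_cat si orbT.
have gl n : linear (g n).
  move=> a x x'; have [u [z [z' [uu -> ->]]]] := span2 n x x'.
  have -> : a *: (\sum_(i <- u) inj i n (z i) : rest_cx f D n) + \sum_(i <- u) inj i n (z' i) =
      \sum_(i <- u) inj i n (a *: (z i : rest_cx f (D_ i) n) + z' i).
    rewrite scaler_sumr -big_split; apply: eq_bigr => i _ /=.
    exact: esym (linearP (rest_ch f (inj i) n) a (z i) (z' i)).
  rewrite !gE // scaler_sumr -big_split; apply: eq_bigr => i _ /=.
  by rewrite linearP.
have gd n x : g (n + 1) (cd (rest_cx f D) n x) = cd (rest_cx f W) n (g n x).
  have [u [z [_ [uu -> _]]]] := span2 n x x; rewrite gE // !raddf_sum.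
  have -> : \sum_(i <- u) cd (rest_cx f D) n (inj i n (z i)) = \sum_(i <- u) inj i (n + 1) (cd (D_ i) n (z i)).
    by apply: eq_bigr => i _; rewrite -[LHS]/(cd D n (inj i n (z i))) chd.
  rewrite gE //; apply: eq_bigr => i _; exact: (chd (t i)).
exists (@mk_chmap _ (rest_cx f D) (rest_cx f W) g gl gd) => i; apply: chmap_ext => n x.
rewrite ocE -[LHS]/(g n (inj i n x)).
pose z := dfwith (fun j => 0 : D_ j n) (x : D_ i n).
have -> : inj i n x = \sum_(j <- [:: i]) inj j n (z j) by rewrite big_seq1 /z dfwith_in.
by rewrite gE // big_seq1 /z dfwith_in.
Qed.

Lemma dsum_eq (W : complex R) (g h : chmap (rest_cx f D) (rest_cx f W)) :
  (forall i, g \oc rest_ch f (inj i) = h \oc rest_ch f (inj i)) -> g = h.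
Proof.
move=> E; apply: chmap_ext => n x; have [s [y ->]] := (ds n).1 x.
rewrite !raddf_sum; apply: eq_bigr => i _.
exact: (congr1 (fun t : chmap (rest_cx f (D_ i)) (rest_cx f W) => t n (y i)) (E i)).
Qed.
End DirectSumMaps.

(** * Higman's criterion for stable equality *)

Definition in_fam (gT : finGroupType) (Fam : {set {group gT}}) (S : {set gT}) : Prop :=
  exists2 P : {group gT}, P \in Fam & exists x, (S :^ x \subset P)%g.

Section StableEquality.
Variables (k : idomainType) (F : fieldType) (r : {rmorphism k -> F}).
Hypothesis rP : forall x, (r x == 0) = (x \isn't a GRing.unit).
Variables (gT : finGroupType) (C : complex_cat k gT).
Local Notation A := (galg k gT).
Implicit Types (X Y Z W : complex A) (Fam : {set {group gT}}).

Lemma in_cat_rest (H : {group gT}) Y : in_cat C Y -> in_cat (sub_cat H C) (rest_cx (gincl H) Y).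
Proof.
move=> cY; apply: (in_cat_kjoint rP (I := unit) (X := fun=> Y) (phi := fun=> k_of_res H Y)) => //.
by move=> n y /(_ tt).
Qed.

Lemma in_cat_ind (H : {group gT}) (X : complex (galg k (subg_of H))) :
  in_cat (sub_cat H C) X -> in_cat C (ind_cx (gincl H) X).
Proof.
move=> cX; apply: (@in_cat_kjoint _ _ _ rP _ _ C (sub_cat H C) _ {set gT} (fun=> X)
  (fun D => kpr X \oc lact _ (gelt (fingroup.repr D)))) => // n u u0.
rewrite (ind_dec u) big1 // => D _.
have -> : ind_pr X n (gelt (fingroup.repr D) *: (u : ind_cx (gincl H) X n)) = 0 by exact: u0 D.
have -> : itens (gincl H) 1 (0 : X n) = 0 by exact: (linear0 (ind_in X n)).
by rewrite scaler0.
Qed.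

Lemma kpr_kin_Tr (H : {group gT}) (X : complex (galg k (subg_of H))) :
  gTr (@kconj k gT (ind_cx (gincl H) X) (ind_cx (gincl H) X)) H [set: gT]
    (kin X \oc kpr X) = chid _.
Proof.
have := ind_ch_Tr (chid X); rewrite ind_ch1.
have -> : kres (chid X) = chid (kx X) by exact: chmap_ext.
by rewrite oc1r => <-; apply: chmap_ext.
Qed.

Lemma kin_kpr_fix (H : {group gT}) (X : complex (galg k (subg_of H))) :
  gfix (@kconj k gT (ind_cx (gincl H) X) (ind_cx (gincl H) X)) H (kin X \oc kpr X).
Proof.
have -> : kin X \oc kpr X =
    k_of_res H _ \oc kres (ind_in X \oc ind_pr X) \oc k_to_res H _.
  exact: chmap_ext.
exact: gfix_of_res.
Qed.

(** [E P] collects the idempotents [kin \oc kpr] of all summands induced from the same [P]. It is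
    fixed by [P], and the identity is the sum of the traces of the [E P] over [Fam]: a finite sum
    even if [I] is infinite. *)
Lemma direct_sum_trace Fam (I : eqType) (P_ : I -> {group gT})
    (Y_ : forall i, complex (galg k (subg_of (P_ i)))) (D : complex A)
    (inj : forall i, chmap (ind_cx (gincl (P_ i)) (Y_ i)) D) :
  is_direct_sum inj -> (forall i, P_ i \in Fam) -> ktrace (in_fam Fam) (chid D).
Proof.
move=> ds PF.
pose t P i : chmap (kx (ind_cx (gincl (P_ i)) (Y_ i))) (kx D) :=
  if P_ i == P then kres (inj i) \oc (kin (Y_ i) \oc kpr (Y_ i)) else 0.
pose E P := projT1 (cid (@dsum_map _ _ (in_alg A) I _ _ inj ds D (t P))).
have EE P i : E P \oc kres (inj i) = t P i.
  by have := projT2 (cid (@dsum_map _ _ (in_alg A) I _ _ inj ds D (t P))); apply.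
have Jl X Y Z g (s : chmap (kx Y) (kx Z)) (h : chmap X Y) :
    kconj g s \oc kres h = kconj g (s \oc kres h).
  by rewrite kconj_comp kconj_kres.
have Jr X Y Z g (s : chmap (kx X) (kx Y)) (h : chmap Y Z) :
    kres h \oc kconj g s = kconj g (kres h \oc s).
  by rewrite kconj_comp kconj_kres.
have Efix (P : {group gT}) : gfix (@kconj k gT D D) P (E P).
  move=> g Pg; apply: (dsum_eq ds) => i; rewrite Jl EE /t.
  case: eqP => [e|_]; last by rewrite (rho0 (kconjP _ _)).
  rewrite -Jr; move: (kin_kpr_fix (Y_ i)) => fx.
  by rewrite fx // e.
have Tr1 : kres (chid D) = \sum_(P in Fam) gTr (@kconj k gT D D) P [set: gT] (E P).
  apply: (dsum_eq ds) => i; rewrite /kres rest_ch1 oc1l oc_suml (bigD1 (P_ i)) //=.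
  have TrE P : gTr (@kconj k gT D D) P [set: gT] (E P) \oc kres (inj i) =
     \sum_(C0 in rcosets P [set: gT]) kconj (fingroup.repr C0)^-1%g (t P i).
    by rewrite /gTr oc_suml; apply: eq_bigr => C0 _; rewrite Jl EE.
  rewrite big1 ?addr0 => [|P /andP[_ ne]]; rewrite [gTr _ _ _ _ \oc _]TrE /t; last first.
    by rewrite eq_sym (negPf ne) big1 // => C0 _; rewrite (rho0 (kconjP _ _)).
  rewrite eqxx (eq_bigr (fun C0 => kres (inj i) \oc kconj (fingroup.repr C0)^-1%g
     (kin (Y_ i) \oc kpr (Y_ i)))) => [|C0 _]; last by rewrite Jr.
  rewrite -oc_sumr -[X in _ \oc X]/(gTr _ _ _ _) kpr_kin_Tr.
  exact: esym (oc1r _).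
rewrite /ktrace Tr1; apply: gtrace_sum => P PFam.
apply: (gtrace_Tr (kconjP D D) (subsetT P) (F := fun S => S \subset P)).
  by move=> S x SP _ _; exists P => //; exists x^-1%g; rewrite conjsgK.
by apply: gfix_gtrace => //; apply: Efix.
Qed.

Section Factor.
Variables (Fam : {set {group gT}}) (X Y : complex A).
Local Notation FT := {P : {group gT} | P \in Fam}.

Definition fam_sum : complex A :=
  dprod_cx (fun P : FT => ind_cx (gincl (val P)) (rest_cx (gincl (val P)) X)).

Lemma fam_sum_cat : in_cat C X -> in_cat C fam_sum.
Proof.
move=> cX; apply: (in_cat_kjoint rP (phi := fun P : FT =>
  kres (dp_pr (fun P : FT => ind_cx (gincl (val P)) (rest_cx (gincl (val P)) X)) P))) => //.
  by move=> P; apply/in_cat_ind/in_cat_rest.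
by move=> n y H; apply: functional_extensionality_dep => P; apply: H.
Qed.

(** The trace from [P] of [t] is the composite of the map from [X] to the complex induced from its
    restriction, coinduced from the identity, with the extension of [t] to that induced complex. *)
Lemma ktrace_factor (f : chmap X Y) : ktrace (in_fam Fam) f ->
  exists (u : chmap X fam_sum) (v : chmap fam_sum Y), f = v \oc u.
Proof.
move=> /(gtrace_canon (kconjP X Y)) [t [tf fE]].
pose D (P : FT) := ind_cx (gincl (val P)) (rest_cx (gincl (val P)) X).
have ex (P : FT) : exists h : chmap (rest_cx (gincl (val P)) X) (rest_cx (gincl (val P)) Y),
    k_of_res _ Y \oc kres h \oc k_to_res _ X = t (val P).
  have [|h hE] := @kfix_lift _ _ _ _ (k_to_res (val P) Y \oc t (val P) \oc k_of_res (val P) X).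
    by move=> x _; rewrite kconj_to_res tf ?(valP P) // subgP.
  by exists h; rewrite hE; apply: chmap_ext.
pose h P := projT1 (cid (ex P)).
have hE P : k_of_res _ Y \oc kres (h P) \oc k_to_res _ X = t (val P) by exact: projT2 (cid (ex P)).
exists (\sum_P dp_in D P \oc coind (chid (rest_cx (gincl (val P)) X))).
exists (\sum_P ind_ext (h P) \oc dp_pr D P).
apply: (@rest_ch_inj _ _ (in_alg A)); rewrite -/(kres f) fE.
rewrite oc_suml; transitivity (kres (\sum_(P : FT) ind_ext (h P) \oc coind (chid (rest_cx (gincl (val P)) X)))); last first.
  congr kres; apply: eq_bigr => P _; rewrite oc_sumr (bigD1 P) //= big1 ?addr0 => [|P' ne].
    by rewrite -ocA (ocA (dp_pr D P)) dp_prin oc1l.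
  by rewrite -ocA (ocA (dp_pr D P)) dp_prin0 // oc0l oc0r.
apply: chmap_ext => n x; rewrite -[RHS]/((\sum_(P : FT) _ : chmap X Y) n x) !ch_sumE.
rewrite (reindex_omap (val : FT -> {group gT}) insub) /=; last first.
  by move=> P PF; rewrite insubT.
rewrite (eq_bigl xpredT) => [|P]; last by rewrite (valP P) valK eqxx.
apply: eq_bigr => P _; rewrite gTrE -[RHS]/(ind_ext (h P) n (coind (chid (rest_cx (gincl (val P)) X)) n x)).
rewrite coindE raddf_sum; apply: eq_bigr => D0 _; cbv beta.
rewrite itensZ mulr1; have E := @ind_extE _ _ (val P) _ _ (h P) n (gelt (fingroup.repr D0)^-1%g) (gelt (fingroup.repr D0) *: (x : X n)).
by apply: etrans _ (esym E); rewrite -hE.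
Qed.
End Factor.

Section Block.
Variables (Fam : {set {group gT}}) (e : A).
Hypothesis he : central_idempotent e.

Lemma trunc_cat X : in_cat C X -> in_cat C (trunc_cx he X).
Proof. by apply: (in_cat_mono rP (i := trunc_in he X)) => n; apply: trunc_in_inj. Qed.

Lemma trunc_fam_sum X : in_cat C X -> fam_projective C Fam (trunc_cx he (fam_sum Fam X)).
Proof.
move=> cX; have cD := fam_sum_cat Fam cX; have he' := central_idempotent_compl he.
split; first exact: trunc_cat.
exists {P : {group gT} | P \in Fam}, (fun P => val P), (fun P => rest_cx (gincl (val P)) X).
exists (fam_sum Fam X), (dp_in (fun P : {P : {group gT} | P \in Fam} => ind_cx (gincl (val P)) (rest_cx (gincl (val P)) X))).
split=> // [P||].
- by split; [apply: (valP P) | apply: in_cat_rest].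
- exact: (dprod_direct_sum (I := {P : {group gT} | P \in Fam})).
exists (trunc_cx he' (fam_sum Fam X)); split.
  by apply: (in_cat_mono rP (i := trunc_in he' _)) cD => n; apply: trunc_in_inj.
exists (trunc_in he _), (trunc_pr he _), (trunc_in he' _), (trunc_pr he' _).
rewrite !trunc_prin chaddE !trunc_inpr; split; apply/(ceqP C).
- by rewrite subrr; apply: (cz0 rP).
- by rewrite subrr; apply: (cz0 rP).
have -> : cact he (fam_sum Fam X) + cact he' _ - chid _ = 0; last exact: (cz0 rP).
apply: chmap_ext => n x; rewrite chBE chDE !cactE scalerBl scale1r addrC.
by rewrite [e *: x + _]addrCA subrr addr0 addNr.
Qed.

(** A map through a summand of a sum of induced complexes goes through the identity of that sum,
    which is a trace. Conversely a trace on [X] factors through [fam_sum], and this can be cut down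
    to its component at [e] because [e] is the identity on [X]. *)
Lemma stable_eqP X Y (f g : chmap X Y) : in_cat C X -> in_block e X ->
  (stable_eq C Fam e f g <-> szero C (in_fam Fam) (f - g)).
Proof.
move=> cX bX; split.
  move=> [P [[cP [I [P_ [Y_ [D [inj [PY cD ds [X' [_ [i [p [i' [p' [pi _ _]]]]]]]]]]]]]] bP [u [v /ceqP fvu]]]].
  have pi1 : cz C (p \oc i - chid P) by apply/ceqP.
  exists (v \oc p \oc chid D \oc i \oc u).
    rewrite -ocA -(ocA (v \oc p)); apply: ktrace_compl; apply: ktrace_compr.
    by apply: direct_sum_trace ds _ => j; case: (PY j).
  rewrite oc1r; move: fvu; rewrite chsubE => fvu.
  have -> : f - g - v \oc p \oc i \oc u = (f - g - v \oc u) + (v \oc u - v \oc p \oc i \oc u).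
    by rewrite addrA subrK.
  apply: (czD rP) fvu _.
  have -> : v \oc u - v \oc p \oc i \oc u = - (v \oc (p \oc i - chid P) \oc u).
    by rewrite ocBr ocBl oc1r opprB !ocA.
  by apply: czN; apply: cz_compr; apply: cz_compl.
move=> [f' /ktrace_factor [u [v fE]] cf].
exists (trunc_cx he (fam_sum Fam X)); split.
- exact: trunc_fam_sum.
- exact: trunc_block.
exists (trunc_pr he _ \oc u), (v \oc trunc_in he _); apply/(ceqP C); rewrite chsubE.
suff -> : v \oc trunc_in he (fam_sum Fam X) \oc (trunc_pr he (fam_sum Fam X) \oc u) = f' by [].
by rewrite -ocA (ocA (trunc_in he _)) trunc_inpr -cact_nat (cact_block he bX) oc1r.
Qed.

Lemma stable_isoP X Y (f : chmap X Y) : in_cat C X -> in_block e X ->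
  in_cat C Y -> in_block e Y ->
  (stable_iso C Fam e f <-> exists g : chmap Y X, szero C (in_fam Fam) (g \oc f - chid X) /\
     szero C (in_fam Fam) (f \oc g - chid Y)).
Proof.
move=> cX bX cY bY; split=> -[g [H1 H2]]; exists g; split; apply/stable_eqP => //;
  by apply/(stable_eqP _ _ cX bX) || apply/(stable_eqP _ _ cY bY).
Qed.
End Block.
End StableEquality.

(** * Diagonal tensor products under restriction and induction *)

Section TensorMaps.
Variables (k : comNzRingType) (gT : finGroupType).
Local Notation A := (galg k gT).
Variable V : lmodType A.
Implicit Types (X Y Z : complex A).

Lemma dt_gelt (M : lmodType A) g (v : V) (x : M) :
  gelt g *: dt v x = dt (gelt g *: v) (gelt g *: x).
Proof.
rewrite -[LHS]/(dscale (gelt g) (dt v x)) dscale_dt (bigD1 g) //= ffunE eqxx scale1r.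
by rewrite big1 ?addr0 // => h /negPf ne; rewrite ffunE ne !scale0r dt0l.
Qed.

Lemma dt_alg (M : lmodType A) (c : k) (v : V) (x : M) :
  (c%:A : A) *: dt v x = dt ((c%:A : A) *: v) x.
Proof.
rewrite -[LHS]/(dscale _ (dt v x)) dscale_dt (bigD1 1%g) //= gelt1 scale1r.
rewrite galgZE -gelt1 ffunE eqxx mulr1 big1 ?addr0 // => h /negPf ne.
by rewrite galgZE ffunE ne mulr0 !scale0r dt0l.
Qed.

Lemma dtens_chE X Y (f : chmap X Y) n v (x : X n) : dtens_ch V f n (dt v x) = dt v (f n x).
Proof. exact: dtens_map_dt. Qed.

Lemma dtens_add_eq (X : lmodType A) (Z : zmodType) (s t : dtens V X -> Z) :
  (forall u v, s (u - v) = s u - s v) -> (forall u v, t (u - v) = t u - t v) ->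
  (forall v x, s (dt v x) = t (dt v x)) -> forall u, s u = t u.
Proof.
move=> sB tB E; have s0 : s 0 = 0 by rewrite -(subrr (0 : dtens V X)) sB subrr.
have t0 : t 0 = 0 by rewrite -(subrr (0 : dtens V X)) tB subrr.
have sD u v : s (u + v) = s u + s v by rewrite -{1}[v]opprK sB -[- v]sub0r sB s0 sub0r opprK.
have tD u v : t (u + v) = t u + t v by rewrite -{1}[v]opprK tB -[- v]sub0r tB t0 sub0r opprK.
by elim/dt_ind => [|u v IHu IHv|//]; rewrite ?s0 ?t0 // sD tD IHu IHv.
Qed.

Lemma dtens_eq X Z (s t : chmap (dtens_cx V X) Z) :
  (forall n v (x : X n), s n (dt v x) = t n (dt v x)) -> s = t.
Proof.
move=> E; apply: chmap_ext => n; apply: dtens_add_eq => // [u v|u v|v x]; rewrite ?linearB //.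
exact: E.
Qed.

Lemma dtens_k_ex X (W : complex k) (b : forall n, V -> X n -> W n) :
  (forall n u v x, b n (u + v) x = b n u x + b n v x) ->
  (forall n v x y, b n v (x + y) = b n v x + b n v y) ->
  (forall n c v x, b n ((c%:A : A) *: v) x = c *: b n v x) ->
  (forall n c v x, b n v ((c%:A : A) *: x) = c *: b n v x) ->
  (forall n v x, b (n + 1) v (cd X n x) = cd W n (b n v x)) ->
  exists t : chmap (kx (dtens_cx V X)) W, forall n v x, t n (dt v x) = b n v x.
Proof.
move=> bDl bDr bZl bZr bd.
have bb n : balanced (@kact k gT V) (fun (v : rest (in_alg A) V) (x : rest (in_alg A) (X n)) => b n v x).
  split=> [u v x|v x y|v c x]; [exact: bDl | exact: bDr |].
  exact: etrans (bZl n c v x) (esym (bZr n c v x)).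
pose t n (u : kx (dtens_cx V X) n) : W n :=
  tens_lift (fun (v : rest (in_alg A) V) (x : rest (in_alg A) (X n)) => b n v x) u.
have tE n v x : t n (dt v x) = b n v x by exact: (tens_liftE (bb n)).
have tB n u v : t n (u - v) = t n u - t n v by exact: (tens_lift_zmod (bb n)).
have t0 n : t n 0 = 0 by rewrite -(subrr 0) tB subrr.
have tD n u v : t n (u + v) = t n u + t n v by rewrite -{1}[v]opprK tB -[- v]sub0r tB t0 sub0r opprK.
have tl n : linear (t n).
  move=> c u v; rewrite tD; congr (_ + _).
  elim/dt_ind: u => [|u u' IHu IHu'|w x]; first by rewrite scaler0 t0 scaler0.
    by rewrite scalerDr !tD IHu IHu' scalerDr.
  by rewrite [c *: _](dt_alg c w x) !tE bZl.
have td n u : t (n + 1) (cd (kx (dtens_cx V X)) n u) = cd W n (t n u).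
  elim/dt_ind: u => [|u u' IHu IHu'|w x]; first by rewrite linear0 !t0 linear0.
    by rewrite linearD !tD IHu IHu' linearD.
  rewrite -[cd _ _ _]/(dtens_map V (cd X n) (dt w x)) dtens_map_dt !tE; exact: bd.
by exists (@mk_chmap _ (kx (dtens_cx V X)) W t tl td).
Qed.

Lemma dtens_ch_ex X Z (b : forall n, V -> X n -> Z n) :
  (forall n u v x, b n (u + v) x = b n u x + b n v x) ->
  (forall n v x y, b n v (x + y) = b n v x + b n v y) ->
  (forall n c v x, b n ((c%:A : A) *: v) x = (c%:A : A) *: b n v x) ->
  (forall n c v x, b n v ((c%:A : A) *: x) = (c%:A : A) *: b n v x) ->
  (forall n g v x, b n (gelt g *: v) (gelt g *: x) = gelt g *: b n v x) ->
  (forall n v x, b (n + 1) v (cd X n x) = cd Z n (b n v x)) ->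
  exists t : chmap (dtens_cx V X) Z, forall n v x, t n (dt v x) = b n v x.
Proof.
move=> bDl bDr bZl bZr bg bd.
have [t tE] := @dtens_k_ex X (kx Z) b bDl bDr bZl bZr bd.
have [|f fE] := @kfix_lift _ _ _ _ t; last by exists f => n v x; rewrite -tE -fE.
move=> g _; apply: chmap_ext => n; apply: dtens_add_eq => [u v|u v|v x]; rewrite ?linearB //.
by rewrite kconjE dt_gelt !tE bg geltKV.
Qed.
End TensorMaps.

Section RestTensor.
Variables (k : comNzRingType) (gT : finGroupType) (H : {group gT}).
Local Notation A := (galg k gT).
Local Notation B := (galg k (subg_of H)).
Variable V : lmodType A.
Local Notation f := (@gincl k gT H).
Local Notation Ind := (ind_cx f).
Local Notation Res := (rest_cx f).
Local Notation VH := (rest f V : lmodType B).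

(** The identity on pure tensors. The two sides are distinct quotients of formal sums, since scalars
    reach them through [kH] and through [kG]. *)
Lemma dtens_of_res_ex (X : complex A) : exists t : chmap (dtens_cx VH (Res X)) (Res (dtens_cx V X)),
  forall n (v : V) (x : X n), t n (dt (v : VH) (x : Res X n)) = dt v x.
Proof.
apply: dtens_ch_ex => n *.
- exact: dtDl.
- exact: dtDr.
- by rewrite -[LHS]/(dt (f _ *: (_ : V)) _) -[RHS]/(f _ *: dt _ _) gincl_alg dt_alg.
- by rewrite -[LHS]/(dt _ (f _ *: (_ : X n))) -[RHS]/(f _ *: dt _ _) gincl_alg dt_alg dtZ.
- rewrite -[LHS]/(dt (f _ *: (_ : V)) (f _ *: (_ : X n))) -[RHS]/(f _ *: dt _ _) gincl_gelt.
  by rewrite dt_gelt.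
- by rewrite -[RHS]/(dtens_map V (cd X n) (dt _ _)) dtens_map_dt.
Qed.
Definition dtens_of_res (X : complex A) := projT1 (cid (dtens_of_res_ex X)).
Lemma dtens_of_resE (X : complex A) n (v : V) (x : X n) :
  dtens_of_res X n (dt (v : VH) (x : Res X n)) = dt v x.
Proof. by move: (projT2 (cid (dtens_of_res_ex X))); apply. Qed.

Lemma dtens_to_res_ex (X : complex A) : exists t : chmap (Res (dtens_cx V X)) (dtens_cx VH (Res X)),
  forall n (v : V) (x : X n), t n (dt v x) = dt (v : VH) (x : Res X n).
Proof.
have [||||| t tE] := @dtens_k_ex _ _ V X (kx (dtens_cx VH (Res X))) (fun n v x => dt (v : VH) (x : Res X n)).
- by move=> *; apply: dtDl.
- by move=> *; apply: dtDr.
- move=> n c v x; rewrite -[RHS]/(((c%:A : B)) *: dt (v : VH) (x : Res X n)) dt_alg.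
  by congr (dt _ _); rewrite -[RHS]/(f _ *: (v : V)) gincl_alg.
- move=> n c v x; rewrite -[RHS]/(((c%:A : B)) *: dt (v : VH) (x : Res X n)) dt_alg dtZ.
  by congr (dt _ _); rewrite -[RHS]/(f _ *: (x : X n)) gincl_alg.
- move=> n v x; rewrite -[RHS]/(dtens_map VH (cd (Res X) n) (dt (v : VH) (x : Res X n))).
  by rewrite dtens_map_dt.
have [|h hE] := @kfix_lift _ _ (Res (dtens_cx V X)) (dtens_cx VH (Res X)) (t \oc k_of_res H _).
  move=> g _; apply: chmap_ext => n; apply: dtens_add_eq => [u v|u v|v x]; rewrite ?linearB //.
  rewrite kconjE -[X in _ *: X]/(t n (f (gelt g^-1%g) *: dt v x)) gincl_gelt dt_gelt tE dt_gelt.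
  rewrite -[RHS]/(t n (dt v x)) tE; congr (dt _ _).
    by rewrite -[LHS]/(f _ *: (_ : V)) gincl_gelt geltKV.
  by rewrite -[LHS]/(f _ *: (_ : X n)) gincl_gelt geltKV.
by exists h => n v x; rewrite -tE -[LHS]/(kres h n (dt v x)) hE.
Qed.
Definition dtens_to_res (X : complex A) := projT1 (cid (dtens_to_res_ex X)).
Lemma dtens_to_resE (X : complex A) n (v : V) (x : X n) :
  dtens_to_res X n (dt v x) = dt (v : VH) (x : Res X n).
Proof. by move: (projT2 (cid (dtens_to_res_ex X))); apply. Qed.

Lemma dtens_to_of (X : complex A) : dtens_to_res X \oc dtens_of_res X = chid _.
Proof. by apply: dtens_eq => n v x; rewrite ocE (dtens_of_resE v x) dtens_to_resE. Qed.

Lemma res_dtens_eq (X : complex A) (Z : complex B) (s t : chmap (Res (dtens_cx V X)) Z) :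
  (forall n v (x : X n), s n (dt v x) = t n (dt v x)) -> s = t.
Proof.
move=> E; apply: chmap_ext => n; apply: dtens_add_eq => [u v|u v|v x]; rewrite ?E //.
  exact: (linearB (s n)).
exact: (linearB (t n)).
Qed.

Lemma dtens_of_res_nat (X Y : complex A) (g : chmap X Y) :
  dtens_of_res Y \oc dtens_ch VH (rest_ch f g) = rest_ch f (dtens_ch V g) \oc dtens_of_res X.
Proof.
apply: dtens_eq => n v x; rewrite !ocE dtens_chE (dtens_of_resE v x).
exact: etrans (dtens_of_resE _ _) (esym (dtens_chE g (v : V) (x : X n))).
Qed.

Lemma dtens_to_res_nat (X Y : complex A) (g : chmap X Y) :
  dtens_to_res Y \oc rest_ch f (dtens_ch V g) = dtens_ch VH (rest_ch f g) \oc dtens_to_res X.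
Proof.
apply: res_dtens_eq => n v x; rewrite !ocE (dtens_to_resE v x) dtens_chE.
exact: etrans (dtens_to_resE _ _) (esym (dtens_chE (rest_ch f g) (v : VH) (x : Res X n))).
Qed.

(** With its companion [dtens_of_ind], the reciprocity between [V (x) Ind X] and [Ind (V_H (x) X)].
    The composite in [dtens_of_to_ind] makes the former a retract of the latter, which is what
    transfers splittings. *)
Definition dtens_to_ind (X : complex B) : chmap (dtens_cx V (Ind X)) (Ind (dtens_cx VH X)) :=
  coind (dtens_ch VH (ind_pr X) \oc dtens_to_res (Ind X)).
Definition dtens_of_ind (X : complex B) : chmap (Ind (dtens_cx VH X)) (dtens_cx V (Ind X)) :=
  ind_ext (dtens_of_res (Ind X) \oc dtens_ch VH (ind_in X)).

Lemma dtens_of_indE (X : complex B) n a v (x : X n) :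
  dtens_of_ind X n (itens f a (dt (v : VH) x)) = a *: dt (v : V) (itens f 1 x).
Proof.
rewrite ind_extE; congr (_ *: _); rewrite ocE dtens_chE.
exact: (dtens_of_resE (X := Ind X) v (itens f 1 x)).
Qed.

Lemma dtens_of_to_ind (X : complex B) : dtens_of_ind X \oc dtens_to_ind X = chid _.
Proof.
apply: dtens_eq => n v u; rewrite ocE /dtens_to_ind coindE raddf_sum.
have dt0r : dt v (0 : Ind X n) = 0 by apply: (addrI (dt v 0)); rewrite -dtDr !addr0.
have dts (q : seq {set gT}) (P : pred {set gT}) (h : {set gT} -> Ind X n) :
    dt v (\sum_(D <- q | P D) h D) = \sum_(D <- q | P D) dt v (h D).
  by elim/big_rec2: _ => // D w1 w2 _ <-; rewrite dtDr.
have E : dt v u = \sum_(D in rcosets H [set: gT]) dt v (gelt (fingroup.repr D)^-1%g *: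
    (itens f 1 (ind_pr X n (gelt (fingroup.repr D) *: u : Ind X n)) : Ind X n)).
  by apply: etrans (dts _ _ _); congr (dt v _); exact: ind_dec.
apply: etrans _ (esym E); apply: eq_bigr => D _.
rewrite dt_gelt ocE (dtens_to_resE (X := Ind X)) dtens_chE itensZ mulr1.
by apply: etrans (dtens_of_indE _ _ _) _; rewrite dt_gelt geltK.
Qed.

Lemma dtens_to_ind_nat (X Y : complex B) (g : chmap X Y) :
  dtens_to_ind Y \oc dtens_ch V (ind_ch f g) = ind_ch f (dtens_ch VH g) \oc dtens_to_ind X.
Proof.
have pn (Z W : complex B) (h : chmap Z W) : ind_pr W \oc rest_ch f (ind_ch f h) = h \oc ind_pr Z.
  apply: chmap_ext => n; elim/tens_ind => [|u u' IHu IHu'|a x]; rewrite ?linear0 //.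
    by rewrite !linearD IHu IHu'.
  rewrite !ocE -[tens _ a x]/(itens f a x) -[rest_ch f _ n _]/(ind_ch f h n (itens f a x)).
  by rewrite ind_chE !ind_prE linearZ.
have L (Z : complex B) : ind_pr _ \oc rest_ch f (dtens_to_ind Z) =
    dtens_ch VH (ind_pr Z) \oc dtens_to_res (Ind Z) by exact: ind_pr_coind.
apply: ind_pr_uniq; rewrite !rest_chM [LHS]ocA L [RHS]ocA pn -[RHS]ocA L -[LHS]ocA.
rewrite dtens_to_res_nat !ocA; congr (_ \oc _).
have dM (X1 Y1 Z1 : complex B) (p : chmap Y1 Z1) (q : chmap X1 Y1) :
    dtens_ch VH p \oc dtens_ch VH q = dtens_ch VH (p \oc q).
  by apply: dtens_eq => n v x; rewrite ocE !dtens_chE.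
by rewrite !dM pn.
Qed.

Lemma dtens_of_ind_nat (X Y : complex B) (g : chmap X Y) :
  dtens_of_ind Y \oc ind_ch f (dtens_ch VH g) = dtens_ch V (ind_ch f g) \oc dtens_of_ind X.
Proof.
apply: ind_ext_eq => n u; rewrite !ocE ind_chE.
elim/dt_ind: u => [|u u' IHu IHu'|v x].
- have i0 (Z : complex B) : itens f 1 (0 : Z n) = 0 by exact: (linear0 (ind_in Z n)).
  by rewrite linear0 !i0 !linear0.
- have iD (Z : complex B) (x y : Z n) : itens f 1 (x + y) = itens f 1 x + itens f 1 y by exact: itensD.
  by rewrite (linearD (dtens_ch VH g n)) !iD !linearD IHu IHu'.
by rewrite dtens_chE !dtens_of_indE !scale1r dtens_chE ind_chE.
Qed.
End RestTensor.

Section SplitTransport.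
Variables (R S : pzRingType).

Lemma split_retract (X Y Z X' Y' Z' : complex R) (i : chmap X Y) (p : chmap Y Z)
    (i' : chmap X' Y') (p' : chmap Y' Z')
    (aX : chmap X X') (aY : chmap Y Y') (aZ : chmap Z Z')
    (bX : chmap X' X) (bY : chmap Y' Y) (bZ : chmap Z' Z) :
  bX \oc aX = chid X -> bY \oc aY = chid Y -> bZ \oc aZ = chid Z ->
  aY \oc i = i' \oc aX -> bY \oc i' = i \oc bX ->
  aZ \oc p = p' \oc aY -> bZ \oc p' = p \oc bY ->
  split_seq i' p' -> split_seq i p.
Proof.
move=> ba_X ba_Y ba_Z ai bi ap bp [r [s []]]; rewrite !cheqE chaddE => ri ps rs.
exists (bX \oc r \oc aY), (bY \oc s \oc aZ); rewrite !cheqE chaddE; split.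
- by rewrite -!ocA ai (ocA r) ri oc1l.
- by rewrite !ocA -bp -(ocA bZ) ps oc1r.
rewrite !ocA -bi -!(ocA _ aZ) ap !ocA -ocDl -!(ocA bY) -!ocDr.
by rewrite rs oc1r.
Qed.

Lemma term_split_retract (X Y Z X' Y' Z' : complex R) (i : chmap X Y) (p : chmap Y Z)
    (i' : chmap X' Y') (p' : chmap Y' Z')
    (aX : chmap X X') (aY : chmap Y Y') (aZ : chmap Z Z')
    (bX : chmap X' X) (bY : chmap Y' Y) (bZ : chmap Z' Z) :
  bX \oc aX = chid X -> bY \oc aY = chid Y -> bZ \oc aZ = chid Z ->
  aY \oc i = i' \oc aX -> bY \oc i' = i \oc bX ->
  aZ \oc p = p' \oc aY -> bZ \oc p' = p \oc bY ->
  term_split_seq i' p' -> term_split_seq i p.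
Proof.
move=> ba_X ba_Y ba_Z ai bi ap bp H n; have [r [s [ri ps rs]]] := H n.
have E (U W : complex R) (g h : chmap U W) : g = h -> forall x, g n x = h n x by move=> ->.
have aiE := E _ _ _ _ ai; have biE := E _ _ _ _ bi; have apE := E _ _ _ _ ap; have bpE := E _ _ _ _ bp.
have XE := E _ _ _ _ ba_X; have YE := E _ _ _ _ ba_Y; have ZE := E _ _ _ _ ba_Z.
exists (bX n \o r \o aY n), (bY n \o s \o aZ n); split=> /= [x|z|y].
- by rewrite -[aY n _]ocE aiE ocE ri -ocE XE.
- by rewrite -[p n _]ocE -bpE ocE ps -ocE ZE.
rewrite -[i n _]ocE -biE ocE -[aZ n _]ocE apE ocE -linearD rs -ocE.
by rewrite YE.
Qed.
End SplitTransport.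

Lemma ch_eqE (R : pzRingType) (X Y : complex R) (g h : chmap X Y) n x : g = h -> g n x = h n x.
Proof. by move->. Qed.

Section InductionExact.
Variables (k : comNzRingType) (gT : finGroupType) (H : {group gT}).
Local Notation A := (galg k gT).
Local Notation B := (galg k (subg_of H)).
Local Notation f := (@gincl k gT H).
Local Notation Ind := (ind_cx f).
Local Notation Res := (rest_cx f).

Lemma ind_in_nat (X Y : complex B) (g : chmap X Y) :
  rest_ch f (ind_ch f g) \oc ind_in X = ind_in Y \oc g.
Proof. by apply: chmap_ext => n x; rewrite !ocE; apply: ind_chE. Qed.

Lemma ind_pr_nat (X Y : complex B) (g : chmap X Y) :
  ind_pr Y \oc rest_ch f (ind_ch f g) = g \oc ind_pr X.
Proof.
apply: chmap_ext => n; elim/tens_ind => [|u v IHu IHv|a x]; rewrite ?linear0 ?linearD ?IHu ?IHv //.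
transitivity (gtrunc H a *: g n x).
  exact: etrans (congr1 (ind_pr Y n) (ind_chE f g a x)) (ind_prE a (g n x)).
by rewrite -linearZ; congr (g n _); symmetry; apply: ind_prE.
Qed.

(** Exactness is checked coset by coset: by [ind_dec] an element of an induced module is determined
    by, and can be assembled from, the values of [ind_pr] on its translates. *)
Lemma ind_exact (X Y Z : complex B) (i : chmap X Y) (p : chmap Y Z) :
  exact_seq i p -> exact_seq (ind_ch f i) (ind_ch f p).
Proof.
move=> E n; have [inj ker sur] := E n.
have prE (U W : complex B) (g : chmap U W) (u : Ind U n) :
  ind_pr W n (ind_ch f g n u : Ind W n) = g n (ind_pr U n u).
  transitivity ((ind_pr W \oc rest_ch f (ind_ch f g)) n u); first by [].
  by rewrite ind_pr_nat.
have z0 (U : complex B) (u : Ind U n) : (forall a : A, ind_pr U n (a *: u : Ind U n) = 0) -> u = 0.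
  move=> u0; rewrite [u]ind_dec big1 // => C _; rewrite u0.
  by rewrite (_ : itens f 1 0 = 0) ?scaler0 // -[LHS]/(ind_in U n 0) linear0.
have sc0 (U W : complex B) (g : chmap U W) (u : Ind U n) a :
    ind_ch f g n u = 0 -> g n (ind_pr U n (a *: u : Ind U n)) = 0.
  move=> u0; rewrite -prE linearZ u0 -[X in ind_pr W n X]/(a *: (0 : Ind W n)) scaler0.
  exact: linear0.
have i0 (u : Ind X n) : ind_ch f i n u = 0 -> u = 0.
  by move=> u0; apply: z0 => a; apply: inj; rewrite linear0; apply: sc0.
split=> [u v uv|u|u].
- by apply/eqP; rewrite -subr_eq0; apply/eqP/i0; rewrite linearB uv subrr.
- split=> [pu|[v <-]]; last by rewrite -ocE -ind_chM (exact_comp0 E) ind_ch0.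
  have ex C : exists x, i n x = ind_pr Y n (gelt (fingroup.repr C) *: u : Ind Y n).
    by apply/ker/sc0.
  pose s (C : {set gT}) := projT1 (cid (ex C)).
  have sE C : i n (s C) = _ := projT2 (cid (ex C)).
  exists (\sum_(C in rcosets H [set: gT]) gelt (fingroup.repr C)^-1%g *: (itens f 1 (s C) : Ind X n)).
  rewrite linear_sum [RHS]ind_dec; apply: eq_bigr => C _; rewrite linearZ; congr (_ *: _).
  by rewrite -sE; apply: ind_chE.
elim/tens_ind: u => [|u v [u' <-] [v' <-]|a z]; first by exists 0; rewrite linear0.
  by exists (u' + v'); rewrite linearD.
by have [y <-] := sur z; exists (itens f a y); apply: ind_chE.
Qed.

Lemma split_ind (X Y Z : complex B) (i : chmap X Y) (p : chmap Y Z) :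
  split_seq i p -> split_seq (ind_ch f i) (ind_ch f p).
Proof.
move=> [r [s []]]; rewrite !cheqE chaddE => ri ps rs.
by exists (ind_ch f r), (ind_ch f s); rewrite !cheqE chaddE -!ind_chM -ind_chD ri ps rs !ind_ch1.
Qed.

Lemma ind_map_comp (M N P : lmodType B) (g : {linear M -> N}) (h : {linear N -> P}) (u : ind f M) :
  ind_map f h (ind_map f g u) = ind_map f (h \o g) u.
Proof.
elim/tens_ind: u => [|u v IHu IHv|a x]; first by rewrite !raddf0.
  by rewrite [ind_map f g _]raddfD [LHS]raddfD [RHS]raddfD /= IHu IHv.
by rewrite [X in ind_map f h X]ind_map_tens ind_map_tens [RHS]ind_map_tens.
Qed.

Lemma ind_map_eq (M N : lmodType B) (g h : {linear M -> N}) : g =1 h -> ind_map f g =1 ind_map f h.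
Proof. by move/linear_ext ->. Qed.

Lemma ind_map_id (M : lmodType B) (u : ind f M) : ind_map f idfun u = u.
Proof.
elim/tens_ind: u => [|u v IHu IHv|a x]; first by rewrite raddf0.
  by rewrite raddfD /= IHu IHv.
exact: ind_map_tens.
Qed.

Lemma ind_map_add (M N : lmodType B) (g h : {linear M -> N}) (u : ind f M) :
  ind_map f (g \+ h) u = ind_map f g u + ind_map f h u.
Proof.
elim/tens_ind: u => [|u v IHu IHv|a x]; first by rewrite !raddf0 addr0.
  by rewrite [LHS]raddfD [ind_map f g _]raddfD [ind_map f h _]raddfD /= IHu IHv addrACA.
by rewrite !ind_map_tens; apply: itensD.
Qed.

Lemma term_split_ind (X Y Z : complex B) (i : chmap X Y) (p : chmap Y Z) :
  term_split_seq i p -> term_split_seq (ind_ch f i) (ind_ch f p).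
Proof.
move=> H0 n; have [r [s [ri ps rs]]] := H0 n.
exists (ind_map f r), (ind_map f s); split=> [x|z|y].
- apply: etrans (ind_map_comp _ _ _) _; apply: etrans (ind_map_id x); exact: ind_map_eq.
- apply: etrans (ind_map_comp _ _ _) _; apply: etrans (ind_map_id z); exact: ind_map_eq.
rewrite [X in X + _ = _]ind_map_comp [X in _ + X = _]ind_map_comp.
by rewrite -ind_map_add; apply: etrans (ind_map_id y); exact: ind_map_eq.
Qed.

Lemma split_rest (X Y Z : complex A) (i : chmap X Y) (p : chmap Y Z) :
  split_seq i p -> split_seq (rest_ch f i) (rest_ch f p).
Proof.
move=> [r [s []]]; rewrite !cheqE chaddE => ri ps rs.
by exists (rest_ch f r), (rest_ch f s); rewrite !cheqE chaddE -!rest_chM -rest_chD ri ps rs !rest_ch1.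
Qed.

Lemma term_split_rest (X Y Z : complex A) (i : chmap X Y) (p : chmap Y Z) :
  term_split_seq i p -> term_split_seq (rest_ch f i) (rest_ch f p).
Proof.
move=> H0 n; have [r [s [ri ps rs]]] := H0 n.
by exists (rest_map f r), (rest_map f s).
Qed.
End InductionExact.

(** * Transfer of split classes and stably zero maps between [G] and [H] *)

Section ClassTransfer.
Variables (k : idomainType) (F : fieldType) (r : {rmorphism k -> F}).
Hypothesis rP : forall x, (r x == 0) = (x \isn't a GRing.unit).
Variables (gT : finGroupType) (C : complex_cat k gT) (H : {group gT}).
Local Notation A := (galg k gT).
Local Notation B := (galg k (subg_of H)).
Local Notation CH := (sub_cat H C).
Local Notation f := (@gincl k gT H).
Local Notation Ind := (ind_cx f).
Local Notation Res := (rest_cx f).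

(** [V_H (x) Res E] is a retract of [Res (V (x) E)], so splittings of [V (x) E] restrict to it. *)
Lemma in_class_rest c (X Y Z : complex A) (i : chmap X Y) (p : chmap Y Z) :
  in_class C c i p -> in_class CH c (rest_ch f i) (rest_ch f p).
Proof.
have sp : split_seq (dtens_ch (cc_V C) i) (dtens_ch (cc_V C) p) ->
    split_seq (dtens_ch (cc_V CH) (rest_ch f i)) (dtens_ch (cc_V CH) (rest_ch f p)).
  move/(split_rest H); apply: split_retract; try exact: dtens_to_of;
  by [exact: dtens_of_res_nat | exact: dtens_to_res_nat].
have ts : term_split_seq (dtens_ch (cc_V C) i) (dtens_ch (cc_V C) p) ->
    term_split_seq (dtens_ch (cc_V CH) (rest_ch f i)) (dtens_ch (cc_V CH) (rest_ch f p)).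
  move/(term_split_rest H); apply: term_split_retract; try exact: dtens_to_of;
  by [exact: dtens_of_res_nat | exact: dtens_to_res_nat].
case: c => -[E]; (split; first exact: E); first exact: term_split_rest.
- exact: sp. - exact: ts.
by case: b => t s; split; [exact: term_split_rest | exact: sp].
Qed.

Lemma in_class_ind c (X Y Z : complex B) (i : chmap X Y) (p : chmap Y Z) :
  in_class CH c i p -> in_class C c (ind_ch f i) (ind_ch f p).
Proof.
have sp : split_seq (dtens_ch (cc_V CH) i) (dtens_ch (cc_V CH) p) ->
    split_seq (dtens_ch (cc_V C) (ind_ch f i)) (dtens_ch (cc_V C) (ind_ch f p)).
  move/split_ind; apply: split_retract; try exact: dtens_of_to_ind;
  by [exact: dtens_of_ind_nat | exact: dtens_to_ind_nat].
have ts : term_split_seq (dtens_ch (cc_V CH) i) (dtens_ch (cc_V CH) p) ->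
    term_split_seq (dtens_ch (cc_V C) (ind_ch f i)) (dtens_ch (cc_V C) (ind_ch f p)).
  move/term_split_ind; apply: term_split_retract; try exact: dtens_of_to_ind;
  by [exact: dtens_of_ind_nat | exact: dtens_to_ind_nat].
case: c => -[E]; (split; first exact: ind_exact); first exact: term_split_ind.
- exact: sp. - exact: ts.
by case: b => t s; split; [exact: term_split_ind | exact: sp].
Qed.

(** Restriction respects the class and is right adjoint to induction, so induction preserves
    projectivity for it. The next lemma uses the adjunction on the other side. *)
Lemma class_projective_ind c P : class_projective CH c P -> class_projective C c (Ind P).
Proof.
move=> /class_projectiveP[cP pP]; apply/class_projectiveP; split; first exact: in_cat_ind rP _ _ _ _ cP.
move=> X Y Z i p h cX cY cZ /in_class_rest ip.
have [g gE] := pP _ _ _ _ _ (rest_ch f h \oc ind_in P)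
  (in_cat_rest rP _ cX) (in_cat_rest rP _ cY) (in_cat_rest rP _ cZ) ip.
by exists (ind_ext g); apply: ind_ext_uniq; rewrite rest_chM -ocA ind_ext_in.
Qed.

Lemma class_projective_rest c P : class_projective C c P -> class_projective CH c (Res P).
Proof.
move=> /class_projectiveP[cP pP]; apply/class_projectiveP; split; first exact: (in_cat_rest rP H cP).
move=> X Y Z i p h cX cY cZ /in_class_ind ip.
have [g gE] := pP _ _ _ _ _ (coind h)
  (in_cat_ind rP cX) (in_cat_ind rP cY) (in_cat_ind rP cZ) ip.
exists (ind_pr Y \oc rest_ch f g).
by rewrite ocA -ind_pr_nat -ocA -rest_chM gE ind_pr_coind.
Qed.

Lemma cz_rest X Y (g : chmap X Y) : cz C g -> cz CH (rest_ch f g).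
Proof.
rewrite /cz /=; case: cc_htpy => [c|->] /=; last exact: chmap_ext.
move=> [P pP [u [v ->]]]; exists (Res P); first exact: class_projective_rest.
by exists (rest_ch f u), (rest_ch f v); rewrite rest_chM.
Qed.

Lemma cz_ind X Y (g : chmap X Y) : cz CH g -> cz C (ind_ch f g).
Proof.
rewrite /cz /=; case: cc_htpy => [c|->] /=; last exact: ind_ch0.
move=> [P pP [u [v ->]]]; exists (Ind P); first exact: class_projective_ind.
by exists (ind_ch f u), (ind_ch f v); rewrite ind_chM.
Qed.

Lemma gtrace_to_res (F1 : {set gT} -> Prop) F2 X Y (t : chmap (kx X) (kx Y)) (g : chmap (Res X) (Res Y)) :
  kres g = k_to_res H Y \oc t \oc k_of_res H X ->
  (forall S : {set gT}, S \subset H -> F1 S -> F2 (sgval @^-1: S)) ->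
  gtrace (@kconj k gT X Y) H F1 t -> ktrace F2 g.
Proof.
move=> gE FF tt; rewrite /ktrace gE.
have t2 := gtrace_subg (rs := fun h => kconj (sgval h)) (fun _ _ => erefl) FF tt.
apply: (gtrace_map (rm := fun h : subg_of H => @kconj k gT X Y (sgval h)) (phi := fun t => k_to_res H Y \oc t \oc k_of_res H X) _ _ t2).
- by move=> s s'; rewrite ocBr ocBl.
- by move=> h s _; rewrite kconj_to_res.
Qed.

Lemma ktrace_rest (F1 : {set gT} -> Prop) F2 X Y (g : chmap X Y) :
  (forall S : {set gT}, F1 S -> F2 (sgval @^-1: (S :&: H))) ->
  ktrace F1 g -> ktrace F2 (rest_ch f g).
Proof.
move=> FF tg.
apply: (gtrace_to_res (t := kres g) (F1 := fun S => F2 (sgval @^-1: S))) => //.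
  exact: chmap_ext.
exact: (gtrace_res (subsetT H) (fun S _ FS => FF S FS) tg).
Qed.

Lemma ktrace_kin F1 X Y (g : chmap X Y) : ktrace F1 g ->
  gtrace (@kconj k gT (Ind X) (Ind Y)) H (fun S => F1 (sgval @^-1: S)) (kin Y \oc kres g \oc kpr X).
Proof.
move=> tg.
have t1 : gtrace (fun h : subg_of H => @kconj k gT (Ind X) (Ind Y) (sgval h)) [set: subg_of H] F1
    (kin Y \oc kres g \oc kpr X).
  apply: (gtrace_map (phi := fun t => kin Y \oc t \oc kpr X) _ _ tg).
  - by move=> s t; rewrite ocBr ocBl.
  move=> h t _; rewrite /kin /kpr.
  have E s : k_of_res H (Ind Y) \oc kres (ind_in Y) \oc s \oc (kres (ind_pr X) \oc k_to_res H (Ind X)) =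
    k_of_res H (Ind Y) \oc (kres (ind_in Y) \oc s \oc kres (ind_pr X)) \oc k_to_res H (Ind X).
    by apply: chmap_ext.
  by rewrite !E -kconj_of_res !kconj_comp !kconj_kres.
exact: (gtrace_sgval (rho := @kconj k gT (Ind X) (Ind Y)) (fun _ _ => erefl) t1).
Qed.

Lemma ktrace_ind F1 (F2 : {set gT} -> Prop) X Y (g : chmap X Y) :
  (forall (S : {set gT}) x, S \subset H -> F1 (sgval @^-1: S) -> F2 (S :^ x)%g) ->
  ktrace F1 g -> ktrace F2 (ind_ch f g).
Proof.
move=> FF tg; rewrite /ktrace ind_ch_Tr.
apply: (gtrace_Tr (kconjP _ _) (subsetT H) _ (ktrace_kin tg)).
by move=> S x SH _; apply: FF.
Qed.

Lemma szero_rest (F1 : {set gT} -> Prop) F2 X Y (g : chmap X Y) :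
  (forall S : {set gT}, F1 S -> F2 (sgval @^-1: (S :&: H))) ->
  szero C F1 g -> szero CH F2 (rest_ch f g).
Proof.
move=> FF [t tt /cz_rest c]; exists (rest_ch f t); first exact: ktrace_rest tt.
by rewrite -rest_chB.
Qed.

Lemma szero_ind F1 (F2 : {set gT} -> Prop) X Y (g : chmap X Y) :
  (forall (S : {set gT}) x, S \subset H -> F1 (sgval @^-1: S) -> F2 (S :^ x)%g) ->
  szero CH F1 g -> szero C F2 (ind_ch f g).
Proof.
move=> FF [t tt /cz_ind c]; exists (ind_ch f t); first exact: ktrace_ind tt.
by rewrite -ind_chB.
Qed.
End ClassTransfer.

(** * Adjunctions between blocks *)

(* The model is X |-> eX, with inclusion ti and projection tp, for a central
   idempotent e. *)
Record truncation (R : pzRingType) := Truncation {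
  tO :> complex R -> complex R;
  ti : forall X, chmap (tO X) X;
  tp : forall X, chmap X (tO X);
  tpti : forall X, tp X \oc ti X = chid _;
  titp : forall X Y (g : chmap X Y), g \oc (ti X \oc tp X) = ti Y \oc tp Y \oc g }.

Section TruncatedMaps.
Variables (R : pzRingType) (t : truncation R).
Implicit Types X Y Z : complex R.

Definition tM X Y (g : chmap X Y) : chmap (t X) (t Y) := tp t Y \oc g \oc ti t X.

Lemma ti_nat X Y (g : chmap X Y) : ti t Y \oc tM g = g \oc ti t X.
Proof. by rewrite /tM !ocA -titp -!ocA tpti oc1r. Qed.

Lemma tp_nat X Y (g : chmap X Y) : tM g \oc tp t X = tp t Y \oc g.
Proof. by rewrite /tM -!ocA titp !ocA tpti oc1l. Qed.

Lemma tM1 X : tM (chid X) = chid _.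
Proof. by rewrite /tM oc1r tpti. Qed.

Lemma tMM X Y Z (g : chmap Y Z) (f : chmap X Y) : tM (g \oc f) = tM g \oc tM f.
Proof. by rewrite {2}/tM -[RHS]ocA ti_nat /tM !ocA. Qed.

Lemma tMB X Y (g f : chmap X Y) : tM (g - f) = tM g - tM f.
Proof. by rewrite /tM ocBr ocBl. Qed.

Lemma ti_mono X W (g h : chmap W (t X)) : ti t X \oc g = ti t X \oc h -> g = h.
Proof. by move=> /(congr1 (fun x => tp t X \oc x)); rewrite !ocA tpti !oc1l. Qed.
End TruncatedMaps.

Record adjunction (R S : pzRingType) := Adjunction {
  aF : complex S -> complex R;
  aFm : forall X Y, chmap X Y -> chmap (aF X) (aF Y);
  aG : complex R -> complex S;
  aGm : forall X Y, chmap X Y -> chmap (aG X) (aG Y);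
  aF1 : forall X, aFm (chid X) = chid _;
  aFM : forall X Y Z (g : chmap Y Z) (f : chmap X Y), aFm (g \oc f) = aFm g \oc aFm f;
  aFB : forall X Y (g f : chmap X Y), aFm (g - f) = aFm g - aFm f;
  aG1 : forall X, aGm (chid X) = chid _;
  aGM : forall X Y Z (g : chmap Y Z) (f : chmap X Y), aGm (g \oc f) = aGm g \oc aGm f;
  aGB : forall X Y (g f : chmap X Y), aGm (g - f) = aGm g - aGm f;
  au : forall X, chmap X (aG (aF X));
  ac : forall Y, chmap (aF (aG Y)) Y;
  au_nat : forall X Y (g : chmap X Y), au Y \oc g = aGm (aFm g) \oc au X;
  ac_nat : forall X Y (g : chmap X Y), g \oc ac X = ac Y \oc aFm (aGm g);
  ac_au : forall X, ac (aF X) \oc aFm (au X) = chid _;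
  au_ac : forall Y, aGm (ac Y) \oc au (aG Y) = chid _ }.

Section TruncatedAdjunction.
Variables (R S : pzRingType) (a : adjunction R S) (t : truncation R) (s : truncation S).

Definition gF X := t (aF a X).
Definition gFm X Y (g : chmap X Y) : chmap (gF X) (gF Y) := tM t (aFm a g).
Definition gG Y := s (aG a Y).
Definition gGm X Y (g : chmap X Y) : chmap (gG X) (gG Y) := tM s (aGm a g).

Definition gu X : chmap X (gG (gF X)) := tp s _ \oc aGm a (tp t (aF a X)) \oc au a X.
Definition gc Y : chmap (gF (gG Y)) Y := ac a Y \oc aFm a (ti s (aG a Y)) \oc ti t _.

Lemma gF1 X : gFm (chid X) = chid _. Proof. by rewrite /gFm aF1 tM1. Qed.
Lemma gFM X Y Z (g : chmap Y Z) (f : chmap X Y) : gFm (g \oc f) = gFm g \oc gFm f.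
Proof. by rewrite /gFm aFM tMM. Qed.
Lemma gFB X Y (g f : chmap X Y) : gFm (g - f) = gFm g - gFm f.
Proof. by rewrite /gFm aFB tMB. Qed.
Lemma gG1 X : gGm (chid X) = chid _. Proof. by rewrite /gGm aG1 tM1. Qed.
Lemma gGM X Y Z (g : chmap Y Z) (f : chmap X Y) : gGm (g \oc f) = gGm g \oc gGm f.
Proof. by rewrite /gGm aGM tMM. Qed.
Lemma gGB X Y (g f : chmap X Y) : gGm (g - f) = gGm g - gGm f.
Proof. by rewrite /gGm aGB tMB. Qed.

Lemma gu_nat X Y (g : chmap X Y) : gu Y \oc g = gGm (gFm g) \oc gu X.
Proof.
rewrite /gu /gGm /gFm -!ocA au_nat !ocA tp_nat; congr (_ \oc _).
by rewrite -!ocA -!aGM -tp_nat.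
Qed.

Lemma gc_nat X Y (g : chmap X Y) : g \oc gc X = gc Y \oc gFm (gGm g).
Proof.
by rewrite /gc /gFm -[RHS]ocA ti_nat !ocA ac_nat -!ocA; congr (_ \oc _); rewrite !ocA -!aFM ti_nat.
Qed.

Lemma titp_block (R' : pzRingType) (t' : truncation R') X : ti t' (t' X) \oc tp t' (t' X) = chid _.
Proof. by apply: (ti_mono (t := t')); rewrite titp oc1r -ocA tpti oc1r. Qed.

(** The equation [ti t Y \oc tp t Y = chid Y] says that [Y] lies in the block. On such objects the
    truncation can be moved across the counit, and the triangle identities below follow from those
    of [a]. *)
Lemma gc_tp Y : ti t Y \oc tp t Y = chid Y ->
  gc Y \oc tp t _ = ac a Y \oc aFm a (ti s (aG a Y)).
Proof. by move=> bY; rewrite /gc /gF /gG -!ocA titp ocA titp bY oc1l. Qed.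

Lemma ti_gu X : ti s X \oc tp s X = chid X ->
  ti s _ \oc gu X = aGm a (tp t (aF a X)) \oc au a X.
Proof. by move=> bX; rewrite /gu /gG /gF !ocA -titp -ocA -titp bX oc1r. Qed.

Lemma gu_gc Y : ti t Y \oc tp t Y = chid Y -> gGm (gc Y) \oc gu (gG Y) = chid _.
Proof.
move=> bY; apply: (ti_mono (t := s)); rewrite oc1r ocA ti_nat -ocA ti_gu; last exact: titp_block.
by rewrite ocA -aGM gc_tp // aGM -ocA -au_nat ocA au_ac oc1l.
Qed.

Lemma gc_gu X : ti s X \oc tp s X = chid X -> gc (gF X) \oc gFm (gu X) = chid _.
Proof.
move=> bX; suff E : gc (gF X) \oc gFm (gu X) \oc tp t _ = tp t (aF a X).
  by rewrite -[LHS]oc1r -(tpti t) ocA E.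
rewrite -ocA tp_nat ocA gc_tp; last exact: titp_block.
by rewrite -ocA -aFM ti_gu // aFM ocA -ac_nat -ocA ac_au oc1r.
Qed.
End TruncatedAdjunction.

Record ideal (R : pzRingType) := Ideal {
  iz :> forall X Y : complex R, chmap X Y -> Prop;
  iz0 : forall X Y, iz (0 : chmap X Y);
  izD : forall X Y (g h : chmap X Y), iz g -> iz h -> iz (g + h);
  izN : forall X Y (g : chmap X Y), iz g -> iz (- g);
  izl : forall X Y Z (g : chmap Y Z) (h : chmap X Y), iz h -> iz (g \oc h);
  izr : forall X Y Z (g : chmap Y Z) (h : chmap X Y), iz g -> iz (g \oc h) }.

Section IdealTheory.
Variables (R : pzRingType) (Z : ideal R).
Implicit Types X Y W : complex R.

Lemma iz_sub X Y (g h l : chmap X Y) : Z _ _ (g - h) -> Z _ _ (h - l) -> Z _ _ (g - l).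
Proof. by move=> z z'; rewrite -(subrK h g) -addrA; apply: izD. Qed.

Lemma iz_sym X Y (g h : chmap X Y) : Z _ _ (g - h) -> Z _ _ (h - g).
Proof. by move=> z; rewrite -opprB; apply: izN. Qed.

Lemma iz_refl X Y (g h : chmap X Y) : g = h -> Z _ _ (g - h).
Proof. by move->; rewrite subrr; apply: iz0. Qed.

Lemma iz_compl X Y W (g : chmap Y W) (h h' : chmap X Y) :
  Z _ _ (h - h') -> Z _ _ (g \oc h - g \oc h').
Proof. by move=> zh; rewrite -ocBr; apply: izl. Qed.

Lemma iz_compr X Y W (g g' : chmap Y W) (h : chmap X Y) :
  Z _ _ (g - g') -> Z _ _ (g \oc h - g' \oc h).
Proof. by move=> zh; rewrite -ocBl; apply: izr. Qed.

Definition ziso X Y (g : chmap X Y) : Prop :=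
  exists g' : chmap Y X, Z _ _ (g' \oc g - chid X) /\ Z _ _ (g \oc g' - chid Y).
End IdealTheory.

Section TruncatedEquivalence.
Variables (R S : pzRingType) (a : adjunction R S) (t : truncation R) (s : truncation S).
Variables (ZR : ideal R) (ZS : ideal S).
Hypothesis FZ : forall X Y (g : chmap X Y), ZS _ _ g -> ZR _ _ (gFm a t g).
Hypothesis GZ : forall X Y (g : chmap X Y), ZR _ _ g -> ZS _ _ (gGm a s g).
Hypothesis u_iso : forall X, ti s X \oc tp s X = chid X -> ziso ZS (gu a t s X).

(* On the image of gF the functor gG reflects ZR, since gF is left adjoint to gG. *)
Lemma gc_iso Y (w : chmap Y (gF a t (gG a s Y))) : ti t Y \oc tp t Y = chid Y ->
  ZR _ _ (gc a t s Y \oc w - chid Y) -> ziso ZR (gc a t s Y).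
Proof.
move=> bY cw; exists w; split=> //.
have bG := titp_block s (aG a Y).
have bF := titp_block t (aF a (gG a s Y)).
have [v [vu uv]] := u_iso bG.
have cu := gu_gc a s bY.
set c := gc a t s Y in cw *; set u := gu a t s _ in vu uv cu.
(* [gGm a s c] is a left inverse of the invertible [u], hence also a right inverse. *)
have Gc : ZS _ _ (u \oc gGm a s c - chid _).
  apply: (iz_sub (h := u \oc gGm a s c \oc (u \oc v))).
    by apply: iz_sym; rewrite -[X in _ - X]oc1r; apply: iz_compl.
  by rewrite -ocA (ocA (gGm a s c)) cu oc1l.
have Gw : ZS _ _ (gGm a s w - u).
  apply: (iz_sub (h := u \oc gGm a s c \oc gGm a s w)).
    by apply: iz_sym; rewrite -[X in _ - X]oc1l; apply: iz_compr.
  rewrite -ocA -gGM -[X in _ - X]oc1r; apply: iz_compl.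
  by rewrite -(gG1 a s) -gGB; apply: GZ.
have G0 : ZS _ _ (gGm a s (w \oc c - chid _)).
  rewrite gGB gGM gG1; apply: iz_sub Gc; exact: iz_compr.
set m := w \oc c - chid _ in G0 *.
(* [m] is recovered from its transpose, which is in [ZS] because [gGm a s m] is. *)
have -> : m = gc a t s _ \oc gFm a t (gGm a s m \oc gu a t s _).
  rewrite gFM ocA -gc_nat -ocA gc_gu ?oc1r //; exact: bG.
by apply/izl/FZ/izr.
Qed.
End TruncatedEquivalence.

Section Instances.
Variables (k : idomainType) (gT : finGroupType).

Definition block_trunc (e : galg k gT) (he : central_idempotent e) : truncation (galg k gT).
Proof.
refine (@Truncation _ (trunc_cx he) (trunc_in he) (trunc_pr he) (trunc_prin he) _).
by move=> X Y g; rewrite !trunc_inpr cact_nat.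
Defined.

Lemma block_truncP (e : galg k gT) (he : central_idempotent e) X : in_block e X ->
  ti (block_trunc he) X \oc tp (block_trunc he) X = chid X.
Proof. by move=> bX; rewrite [LHS]trunc_inpr cact_block. Qed.

Variable H : {group gT}.
Local Notation f := (@gincl k gT H).

Definition adj_ind : adjunction (galg k gT) (galg k (subg_of H)).
Proof.
refine (@Adjunction _ _ (ind_cx f) (@ind_ch _ _ f) (rest_cx f) (@rest_ch _ _ f) _ _ _ _ _ _
  (@ind_in k gT H) (fun Y => ind_ext (chid (rest_cx f Y))) _ _ _ _).
- exact: ind_ch1.
- exact: ind_chM.
- exact: ind_chB.
- exact: rest_ch1.
- exact: rest_chM.
- exact: rest_chB.
- by move=> X Y g; rewrite ind_in_nat.
- move=> X Y g; apply: ind_ext_uniq; rewrite !rest_chM -!ocA ind_in_nat ind_ext_in.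
  by rewrite ocA ind_ext_in oc1l oc1r.
- move=> X; apply: ind_ext_uniq; rewrite rest_chM -ocA ind_in_nat ocA ind_ext_in.
  by rewrite oc1l rest_ch1 oc1l.
- by move=> Y; rewrite ind_ext_in.
Defined.

Definition adj_coind : adjunction (galg k (subg_of H)) (galg k gT).
Proof.
refine (@Adjunction _ _ (rest_cx f) (@rest_ch _ _ f) (ind_cx f) (@ind_ch _ _ f) _ _ _ _ _ _
  (fun Y => coind (chid (rest_cx f Y))) (@ind_pr k gT H) _ _ _ _).
- exact: rest_ch1.
- exact: rest_chM.
- exact: rest_chB.
- exact: ind_ch1.
- exact: ind_chM.
- exact: ind_chB.
- move=> X Y g; apply: ind_pr_uniq; rewrite !rest_chM !ocA ind_pr_nat ind_pr_coind.
  by rewrite -ocA ind_pr_coind oc1l oc1r.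
- by move=> X Y g; rewrite ind_pr_nat.
- by move=> X; rewrite ind_pr_coind.
- move=> Y; apply: ind_pr_uniq; rewrite rest_chM ocA ind_pr_nat -ocA ind_pr_coind.
  by rewrite oc1r rest_ch1 oc1r.
Defined.
End Instances.

Section SzeroIdeal.
Variables (k : idomainType) (F : fieldType) (r : {rmorphism k -> F}).
Hypothesis rP : forall x, (r x == 0) = (x \isn't a GRing.unit).
Variables (gT : finGroupType) (C : complex_cat k gT).

Definition szero_ideal (Fam : {set gT} -> Prop) : ideal (galg k gT).
Proof.
refine (@Ideal _ (@szero k gT C Fam) _ _ _ _ _).
- exact: (szero0 rP).
- exact: (szeroD rP).
- exact: szeroN.
- exact: szero_compl.
- exact: szero_compr.
Defined.
End SzeroIdeal.

Lemma chZ (R : pzRingType) (X Y : complex R) (h : chmap X Y) n a (x : X n) :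
  h n (a *: x) = a *: h n x.
Proof. exact: linearZ. Qed.

Section UnitSections.
Variables (R S : pzRingType) (a : adjunction R S) (t : truncation R) (s : truncation S).
Variables (X : complex S) (j : chmap (aG a (aF a X)) X).

(** If [j] inverts the unit [au a X] up to maps that are to be ignored, this inverts the truncated
    unit. For induction [j] will be [ind_pr X]. *)
Definition gu_inv : chmap (gG a s (gF a t X)) X := j \oc aGm a (ti t (aF a X)) \oc ti s _.

Lemma gu_sect : gu_inv \oc gu a t s X =
  j \oc (aGm a (ti t (aF a X) \oc tp t (aF a X)) \oc (ti s _ \oc tp s _) \oc au a X).
Proof.
rewrite /gu_inv /gu aGM !ocA; congr (_ \oc _); rewrite -!ocA; congr (_ \oc _); congr (_ \oc _).
by rewrite [RHS]titp -!ocA.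
Qed.

Lemma gu_retr : chid _ - gu a t s X \oc gu_inv =
  tp s _ \oc aGm a (tp t (aF a X)) \oc (chid _ - au a X \oc j) \oc
  (aGm a (ti t (aF a X)) \oc ti s _).
Proof.
rewrite ocBr ocBl oc1r /gu /gu_inv !ocA; congr (_ - _).
by rewrite -(ocA (tp s _)) -aGM tpti aG1 oc1r tpti.
Qed.
End UnitSections.

Lemma gc_tp_comp (R S : pzRingType) (a : adjunction R S) (t : truncation R) (s : truncation S)
    (Y : complex R) (g : chmap Y (aF a (gG a s Y))) : ti t Y \oc tp t Y = chid Y ->
  gc a t s Y \oc (tp t _ \oc g) = ac a Y \oc (aFm a (ti s (aG a Y)) \oc g).
Proof. by move=> bY; rewrite !ocA; congr (_ \oc _); apply: gc_tp. Qed.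

(** * Unit and counit modulo relatively projective complexes *)

Section Green.
Variables (k : idomainType) (F : fieldType) (r : {rmorphism k -> F}) (p : nat).
Hypotheses (rP : forall x, (r x == 0) = (x \isn't a GRing.unit)) (pF : p \in [pchar F]).
Variables (gT : finGroupType) (C : complex_cat k gT).
Variables (Q : {group gT}) (e : galg k gT) (b : galg k (subg_of 'N(Q))).
Hypotheses (he : is_block e) (hQ : is_defect_group e Q) (hb : brauer_correspondent Q e b).
Local Notation H := 'N(Q)%G.
Local Notation bG := (gincl H b).
Local Notation CH := (sub_cat H C).
Local Notation f := (@gincl k gT H).
Local Notation Ind := (ind_cx f).
Local Notation Res := (rest_cx f).
Local Notation FX := (in_fam (famX Q)).
Local Notation FXH := (in_fam (fam_sub H (famX Q))).
Local Notation FYH := (in_fam (fam_sub H (famY Q))).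

Lemma ce : central_idempotent e. Proof. by case: he. Qed.
Lemma cb : central_idempotent b. Proof. by case: hb => -[]. Qed.

Local Notation tB := (block_trunc ce).
Local Notation tb := (block_trunc cb).
Local Notation aI := (adj_ind k H).

Lemma famX_in (S : {set gT}) s x : s \notin H -> (S :^ x \subset Q :&: Q :^ s)%g -> FX S.
Proof.
move=> ns Sx; exists (Q :&: Q :^ s)%G; last by exists x.
by apply/imsetP; exists s; rewrite // inE.
Qed.

Lemma famX_out (S : {set gT}) : FX S ->
  exists s x, s \notin H /\ (S :^ x \subset Q :&: Q :^ s)%g.
Proof. by move=> [_ /imsetP[s ns ->] [x Sx]]; exists s, x; rewrite inE in ns. Qed.

Lemma famXH_in (T : {set subg_of H}) s : s \notin H ->
  (forall t, t \in T -> sgval t \in (Q :&: Q :^ s)%g) -> FXH T.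
Proof.
move=> ns TQ; exists (sgval @*^-1 (Q :&: Q :^ s))%G.
  by apply/imsetP; exists (Q :&: Q :^ s)%G => //; apply/imsetP; exists s; rewrite // inE.
exists 1%g; rewrite conjsg1; apply/subsetP => t Tt.
by apply/morphpreP; split; [rewrite inE | apply: TQ].
Qed.

Lemma famYH_in (T : {set subg_of H}) s : s \notin H ->
  (forall t, t \in T -> sgval t \in (Q :^ s)%g) -> FYH T.
Proof.
move=> ns TQ; exists (sgval @*^-1 ('N(Q) :&: Q :^ s))%G.
  by apply/imsetP; exists ('N(Q) :&: Q :^ s)%G => //; apply/imsetP; exists s; rewrite // inE.
exists 1%g; rewrite conjsg1; apply/subsetP => t Tt.
by apply/morphpreP; split; [rewrite inE | rewrite inE TQ // andbT; apply: subgP].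
Qed.

Lemma conjH_notin s (x : subg_of H) : s \notin H -> (s * (sgval x)^-1)%g \notin H.
Proof. by move=> ns; rewrite groupMr // groupV; apply: subgP. Qed.

Lemma famXH_out (T : {set subg_of H}) : FXH T ->
  exists2 s, s \notin H & forall t, t \in T -> sgval t \in (Q :&: Q :^ s)%g.
Proof.
move=> [_ /imsetP[_ /imsetP[s ns ->] ->] [x Sx]]; rewrite inE in ns.
exists (s * (sgval x)^-1)%g => [|t Tt]; first exact: conjH_notin.
have : (t ^ x)%g \in (sgval @*^-1 (Q :&: Q :^ s))%g by apply: (subsetP Sx); rewrite memJ_conjg.
move/morphpreP=> [_ tx]; have {tx}/setIP[tQ tQs] : (sgval t ^ sgval x)%g \in (Q :&: Q :^ s)%g := tx.
apply/setIP; split.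
  by rewrite memJ_norm // in tQ; apply: subgP.
by rewrite conjsgM mem_conjgV.
Qed.

Lemma famYH_out (T : {set subg_of H}) : FYH T ->
  exists2 s, s \notin H & forall t, t \in T -> sgval t \in (Q :^ s)%g.
Proof.
move=> [_ /imsetP[_ /imsetP[s ns ->] ->] [x Sx]]; rewrite inE in ns.
exists (s * (sgval x)^-1)%g => [|t Tt]; first exact: conjH_notin.
have : (t ^ x)%g \in (sgval @*^-1 ('N(Q) :&: Q :^ s))%g by apply: (subsetP Sx); rewrite memJ_conjg.
move/morphpreP=> [_ tx]; have {tx}/setIP[_ tQs] : (sgval t ^ sgval x)%g \in ('N(Q) :&: Q :^ s)%g := tx.
by rewrite conjsgM mem_conjgV.
Qed.

(** If [S :^ x] lies in [Q :&: Q :^ s], then [S] lies in the conjugates of [Q] by [x^-1] and by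
    [s * x^-1], and one of these two elements is outside [H]. *)
Lemma szero_res X Y (g : chmap X Y) : szero C FX g -> szero CH FYH (rest_ch f g).
Proof.
apply: (szero_rest rP) => S /famX_out[s [x [ns Sx]]].
have [Hx|nx] := boolP (x \in H).
  apply: (@famYH_in _ (s * x^-1)%g) => [|t]; first by rewrite groupMr ?groupV.
  rewrite !inE => /andP[St _]; rewrite conjsgM mem_conjgV.
  by have := subsetP Sx (sgval t ^ x)%g; rewrite memJ_conjg !inE => /(_ St)/andP[].
apply: (@famYH_in _ x^-1%g) => [|t]; first by rewrite groupV.
rewrite !inE => /andP[St _]; rewrite mem_conjgV.
by have := subsetP Sx (sgval t ^ x)%g; rewrite memJ_conjg !inE => /(_ St)/andP[].
Qed.

Lemma szero_indX X Y (g : chmap X Y) : szero CH FXH g -> szero C FX (ind_ch f g).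
Proof.
apply: (szero_ind rP) => S x SH /famXH_out[s ns SQ].
apply: (@famX_in _ s x^-1%g) => //; rewrite -conjsgM mulgV conjsg1.
apply/subsetP => t St; have Ht := subsetP SH t St.
by have := SQ (subg H t); rewrite inE subgK //; apply.
Qed.

(** The identity of [W] is the action of [b], a trace from the conjugates of [Q] in [H], and [Q] is
    normal in [H]. *)
Lemma corr_chid (W : complex (galg k (subg_of H))) : in_block b W ->
  ktrace (fun T => forall t, t \in T -> sgval t \in Q) (chid W).
Proof.
move=> bW; rewrite /ktrace.
have -> : kres (chid W) = lact W b by apply: chmap_ext => n x; symmetry; apply: bW.
apply: gtrace_lact; case: hb => [_ [tb0 _] _].
apply: gtrace_fam (rel_trace_gtrace tb0) => S _ [x Sx] t St.
have : (t ^ x^-1)%g \in (sgval @*^-1 Q)%g by rewrite -mem_conjg; apply: (subsetP Sx).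
move/morphpreP=> [_ tx]; have : (sgval t ^ sgval (x^-1)%g)%g \in Q := tx.
by rewrite memJ_norm //; apply: subgP.
Qed.

(** Composing with the identity of [W] intersects stabilizers inside [H :&: Q :^ s] with [Q]. This
    is the passage from the family attached to restriction to the intersections [Q :&: Q :^ s]. *)
Lemma block_szero W W' (g : chmap W W') : in_block b W -> szero CH FYH g -> szero CH FXH g.
Proof.
move=> bW [g' tg zg]; exists g' => //; rewrite -[g']oc1r.
apply: (ktrace_mul _ tg (corr_chid bW)) => S S' /famYH_out[s ns SQ] S'Q.
by apply: (famXH_in ns) => t; rewrite !inE => /andP[/SQ-> /S'Q->].
Qed.

Definition szX := szero_ideal rP C FX.
Definition szXH := szero_ideal rP CH FXH.

Lemma gF_szero X Y (g : chmap X Y) : szXH _ _ g -> szX _ _ (gFm aI tB g).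
Proof. by move=> zg; apply: szero_compr; apply: szero_compl; apply: szero_indX. Qed.

Lemma gG_szero X Y (g : chmap X Y) : szX _ _ g -> szXH _ _ (gGm aI tb g).
Proof.
move=> zg; apply: block_szero; first exact: trunc_block.
by apply: szero_compr; apply: szero_compl; apply: szero_res.
Qed.

(** The composite is the truncation of [e * bG] to [kH] acting on [X]. Since [bG] acts there as the
    identity, the deviation is the truncation of [bG * (1 - e)], up to sign, and [corr_block_trace]
    applies. *)
Lemma gu_invl X : in_block b X ->
  szXH _ _ (gu_inv (a := aI) tB tb (ind_pr X) \oc gu aI tB tb X - chid X).
Proof.
move=> bX; rewrite gu_sect; apply: (szero_trace rP).
have key n (x : X n) : gtrunc H (e * (bG * 1)) *: x - x = - (gtrunc H (bG * (1 - e)) *: x).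
  have [_ ec] := ce; rewrite mulr1 mulrBr mulr1 -ec -opprB; congr (- _).
  have bx : gtrunc H bG *: x = x.
    by rewrite -[bG]mul1r gtrunc_mul gtrunc1 mul1r; apply: bX.
  rewrite -{1}bx -scalerBl; congr (_ *: _).
  by apply/ffunP => y; rewrite !ffunE.
have E : kres (ind_pr X \oc (rest_ch f (ti tB (Ind X) \oc tp tB (Ind X)) \oc
    (ti tb _ \oc tp tb _) \oc ind_in X) - chid X) = - lact X (gtrunc H (bG * (1 - e))).
  rewrite [ti tB _ \oc _]trunc_inpr [ti tb _ \oc _]trunc_inpr.
  apply: chmap_ext => n x; rewrite -[RHS]key -ind_prE [LHS]chBE; congr (_ - _); rewrite !ocE.
  congr (ind_pr X n _).
  apply: etrans (itensZ _ _ _); congr (e *: _).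
  by apply: etrans (itensZ _ _ _).
rewrite /ktrace [kres _]E; apply: (gtraceN (kconjP _ _)); apply: gtrace_lact.
have tc := corr_block_trace rP pF he hQ hb.
have {}tc := gtrace_subg (rs := fun h => gconj (sgval h)) (F' := FXH) (fun _ _ => erefl) _ tc.
apply: (gtrace_map (rm := fun h : subg_of H => @gconj k gT (sgval h)) (phi := gtrunc H) _ _ (tc _)).
- by move=> x y; apply/ffunP => z; rewrite !ffunE.
- by move=> h x _; apply: gtrunc_gconj.
move=> S SH [s ns SQ]; apply: (famXH_in ns) => t; rewrite inE => St.
exact: (subsetP SQ).
Qed.

(** [kin X \oc kpr X] is a trace from [Q] over [H], and its trace to [G] is the identity; by
    [gTr_rest] their difference is a trace from subgroups of the [Q :^ x] with [x] outside [H]. *)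
Lemma ind_compl_trace X : in_block b X ->
  ktrace FYH (chid (Res (Ind X)) - ind_in X \oc ind_pr X).
Proof.
move=> bX; have t0 := ktrace_kin (corr_chid bX).
apply: (gtrace_to_res (F1 := fun S => exists2 s, s \notin H & S \subset Q :^ s)%g) _ _
  (gTr_rest (kconjP _ _) (subsetT H) _ t0).
- rewrite [kres (chid _)](_ : _ = chid _); last exact: chmap_ext.
  by rewrite oc1r kpr_kin_Tr; apply: chmap_ext.
- move=> S SH [s ns SQ]; apply: (famYH_in ns) => t; rewrite inE => St.
  exact: (subsetP SQ).
move=> S x SH _ nx SQ; exists x => //; apply/subsetP => t /setIP[/imsetP[t' St' ->] _].
have Ht := subsetP SH t' St'.
by rewrite memJ_conjg; have := SQ (subg H t'); rewrite inE subgK //; apply.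
Qed.

Lemma gu_invr X : in_block b X ->
  szXH _ _ (gu aI tB tb X \oc gu_inv (a := aI) tB tb (ind_pr X) - chid _).
Proof.
move=> bX; rewrite -opprB; apply: izN; rewrite gu_retr.
apply: block_szero; first exact: trunc_block.
exact (szero_compr _ (szero_compl _ (szero_trace rP _ (ind_compl_trace bX)))).
Qed.

Lemma gu_iso X : ti tb X \oc tp tb X = chid X -> ziso szXH (gu aI tB tb X).
Proof.
move=> E; have bX : in_block b X.
  by move=> n x; rewrite -[RHS]/(chid X n x) -E [ti tb X \oc _]trunc_inpr.
by exists (gu_inv (a := aI) tB tb (ind_pr X)); split; [apply: gu_invl | apply: gu_invr].
Qed.

(* e = Tr_H^G c with c = Tr_Q^H a; the section of the counit is built from c. *)
Lemma gc_section Y : in_block e Y -> exists w : chmap Y (gF aI tB (gG aI tb Y)),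
  szX _ _ (gc aI tB tb Y \oc w - chid Y).
Proof.
move=> bY; case: hQ => /in_rel_traceE[a fa eE] _.
have QH : Q \subset H by apply: normG.
pose c := gTr gconj Q H a.
have tc : gtrace gconj H (fun S => S \subset Q) c.
  apply: (gtrace_Tr (gconjP _ _) QH (F := fun S => S \subset Q)); last exact: gfix_gtrace.
  by move=> S x _ Hx SQ; rewrite -(normP Hx) conjSg.
have fc := gtrace_fix (gconjP _ _) tc.
have eTr : e = gTr gconj H [set: gT] c by rewrite eE (gTr_trans (gconjP _ _) QH (subsetT H)).
have [cc ccE] : exists cc : chmap (Res Y) (Res Y), forall n (y : Y n), cc n y = c *: (y : Y n).
  have := @kfix_lift k _ (Res Y) (Res Y) (k_to_res H Y \oc lact Y c \oc k_of_res H Y).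
  case=> [h _|cc ccE]; last by by exists cc => n y; have := congr1 (fun h : chmap (kx (Res Y)) (kx (Res Y)) => h n y) ccE.
  by rewrite kconj_to_res kconj_lact fc //; apply: subgP.
pose g := coind (tp tb (Res Y) \oc cc).
have gE n (y : Y n) : ind_ext (chid (Res Y)) n (ind_ch f (ti tb (Res Y)) n (g n y)) =
    gTr gconj H [set: gT] (bG * c) *: y.
  rewrite -[LHS]ocE coindE; apply: etrans (linear_sum _ _ _ _) _.
  rewrite /gTr scaler_suml; apply: eq_bigr => D _.
  apply: etrans (chZ _ _ _) _; rewrite /gconj invgK -!scalerA; congr (_ *: _).
  apply: etrans (congr1 (ind_ext (chid (Res Y)) n) (ind_chE _ _ _ _)) _.
  apply: etrans (ind_extE _ _ _) _; rewrite scale1r.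
  apply: etrans (ch_eqE (n := n) _ (trunc_inpr cb (Res Y))) _.
  by rewrite cactE ccE.
exists (tp tB (aF aI (gG aI tb Y)) \oc g).
rewrite (gc_tp_comp (a := aI) (s := tb) g (block_truncP ce bY)).
apply: (szero_trace rP).
(* As [c] has trace [e] and [e] is a central idempotent, the deviation of [e * Tr (bG * c)] from [e]
   is itself a trace from [H]. *)
have TrE : gTr gconj H [set: gT] (e * (1 - bG) * c) = e - e * gTr gconj H [set: gT] (bG * c).
  have [ee ec] := ce.
  have E1 x : gTr gconj H [set: gT] (e * x) = e * gTr gconj H [set: gT] x.
    rewrite /gTr mulr_sumr; apply: eq_bigr => D _.
    by rewrite gconjM (central_gfix (K := [set: gT]%G) ec) ?inE.
  have E2 : gTr gconj H [set: gT] ((1 - bG) * c) = e - gTr gconj H [set: gT] (bG * c).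
    rewrite {1}eTr /gTr -sumrB; apply: eq_bigr => D _.
    by rewrite -(rhoB (gconjP _ _)) mulrBl mul1r.
  by rewrite -mulrA E1 E2 mulrBr ee.
rewrite /ktrace [kres _](_ : _ = - lact Y (gTr gconj H [set: gT] (e * (1 - bG) * c))).
  apply: (gtraceN (kconjP _ _)); apply: gtrace_lact.
  apply: (gtrace_Tr (gconjP _ _) (subsetT H) (F := fun S => exists2 s, s \notin H & S \subset Q :&: Q :^ s)%g).
    by move=> S x SH _ [s ns SQ]; apply: (@famX_in _ s x^-1%g); rewrite // -conjsgM mulgV conjsg1.
  (* The factor [e * (1 - bG)] brings stabilizers inside [Q :^ s], and [c] brings stabilizers inside
     [Q]. *)
  apply: gtrace_mul2 (block_corr_trace rP pF he hQ hb) tc => S S' [s ns SQ] S'Q.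
  exists s => //; apply/subsetP => t; rewrite !inE => /andP[/(subsetP SQ)-> /(subsetP S'Q)->].
  by [].
have key n (y : Y n) : gTr gconj H [set: gT] (bG * c) *: y - y =
    - ((e - e * gTr gconj H [set: gT] (bG * c)) *: y).
  by have [_ ec] := ce; rewrite -ec scalerBl opprB -scalerA bY.
by rewrite TrE; apply: chmap_ext => n y; rewrite -[RHS]key [LHS]chBE; congr (_ - _); apply: gE.
Qed.

(** On the summand [1 (x) X] the element [bG] acts as the identity, so [1 - e] acts on [Ind X] as
    the trace from [H] of [bG * (1 - e)] on that summand. Hence [Ind X] is stably its component in
    [B]. *)
Lemma ind_trunc_szero X : in_block b X ->
  szero C FX (ti tB (Ind X) \oc tp tB (Ind X) - chid _).
Proof.
move=> bX; apply: (szero_trace rP); rewrite [ti _ _ \oc _]trunc_inpr.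
pose K := @kconj k gT (Ind X) (Ind X).
pose t := lact (Ind X) (bG * (1 - e)) \oc (kin X \oc kpr X).
have tt : gtrace K H (fun S => exists2 s, s \notin H & S \subset Q :&: Q :^ s)%g t.
  have t0 := gtrace_lact (Ind X) (corr_block_trace rP pF he hQ hb).
  apply: (gtrace_map (phi := fun t => t \oc (kin X \oc kpr X)) _ _ t0) => [x y|g x Hg].
    by rewrite ocBl.
  by rewrite /K kconj_comp (kin_kpr_fix X Hg).
rewrite /ktrace [kres _](_ : _ = - gTr K H [set: gT] t).
  apply: (gtraceN (kconjP _ _)).
  apply: (gtrace_Tr (kconjP _ _) (subsetT H) _ tt) => S x SH _ [s ns SQ].
  by apply: (@famX_in _ s x^-1%g); rewrite // -conjsgM mulgV conjsg1.
have [_ ec] := ce.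
have E n (u : Ind X n) : gTr K H [set: gT] t n u = u - e *: u.
  have bz (x : X n) : bG *: (itens f 1 x : Ind X n) = itens f 1 x.
    by rewrite itensZ mulr1 -[bG]mul1r itens_bal bX.
  rewrite -[X in X - _]scale1r -scalerBl {2}[u]ind_dec scaler_sumr.
  apply: etrans (gTrE _ _ _) _; apply: eq_bigr => D _.
  transitivity (gelt (fingroup.repr D)^-1 *: ((bG * (1 - e)) *:
     (itens f 1 (ind_pr X n (gelt (fingroup.repr D) *: u : Ind X n)) : Ind X n))); first by [].
  have ec1 a : a * (1 - e) = (1 - e) * a by rewrite mulrBl mulrBr ec mul1r mulr1.
  by rewrite ec1 -scalerA bz !scalerA ec1.
apply: chmap_ext => n u; transitivity (- (u - e *: u : Ind X n)); first by rewrite opprB.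
by rewrite -E.
Qed.

(** Cutting [Res Y] with [bG] loses the action of [e * (1 - bG)], which by [block_corr_trace] is a
    trace from the groups [H :&: Q :^ s]. *)
Lemma res_trunc_szero Y : in_block e Y ->
  szero CH FYH (ti tb (Res Y) \oc tp tb (Res Y) - chid _).
Proof.
move=> bY; apply: (szero_trace rP); rewrite [ti _ _ \oc _]trunc_inpr.
have tt := gtraceN (kconjP Y Y) (gtrace_lact Y (block_corr_trace rP pF he hQ hb)).
apply: (gtrace_to_res (F1 := fun S => exists2 s, s \notin H & S \subset Q :^ s)%g) _ _ tt.
  have E n (y : Y n) : bG *: y - y = - ((e * (1 - bG)) *: y).
    by have [_ ec] := ce; rewrite -ec -scalerA bY scalerBl scale1r opprB.
  by apply: chmap_ext => n y; apply: E.
move=> S SH [s ns SQ]; apply: (famYH_in ns) => t; rewrite inE => St.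
exact: (subsetP SQ).
Qed.
End Green.

(** * Equivalences of stable categories *)

Definition sc_alg (T : stable_cat) := galg (sc_ring T) (sc_group T).
Definition stable_ideal (T : stable_cat) (Z : ideal (sc_alg T)) : Prop :=
  forall (X Y : T) (f g : chmap X Y), sc_eq f g <-> Z _ _ (f - g).

Section IsoTheory.
Variables (R : pzRingType) (Z : ideal R).
Implicit Types X Y W : complex R.

Lemma ziso1 X : ziso Z (chid X).
Proof. by exists (chid X); split; apply: iz_refl; rewrite oc1l. Qed.

Lemma ziso_comp X Y W (g : chmap Y W) (f : chmap X Y) : ziso Z g -> ziso Z f -> ziso Z (g \oc f).
Proof.
move=> [g' [g1 g2]] [f' [f1 f2]]; exists (f' \oc g'); split.
  apply: iz_sub f1; rewrite -ocA; apply: iz_compl; rewrite ocA -[X in _ - X]oc1l.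
  exact: iz_compr.
apply: iz_sub g2; rewrite -ocA; apply: iz_compl; rewrite ocA -[X in _ - X]oc1l.
exact: iz_compr.
Qed.

Lemma ziso_inv X Y (f : chmap X Y) (g : chmap Y X) :
  Z _ _ (g \oc f - chid X) -> Z _ _ (f \oc g - chid Y) -> ziso Z g.
Proof. by exists f. Qed.

Lemma iz_square_inv X Y X' Y' (f : chmap X Y) (f' : chmap X' Y')
    (al : chmap X X') (al' : chmap X' X) (be : chmap Y Y') (be' : chmap Y' Y) :
  Z _ _ (al \oc al' - chid _) -> Z _ _ (be' \oc be - chid _) ->
  Z _ _ (be \oc f - f' \oc al) -> Z _ _ (be' \oc f' - f \oc al').
Proof.
move=> a1 b1 sq; apply: (iz_sub (h := be' \oc f' \oc (al \oc al'))).
  by rewrite -[X in X - _]oc1r; apply: iz_compl; apply: iz_sym.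
apply: (iz_sub (h := be' \oc (be \oc f) \oc al')).
  rewrite ocA; apply: iz_compr; rewrite -ocA; apply: iz_compl; exact: iz_sym.
by rewrite ocA; apply: iz_compr; rewrite -[X in _ - X]oc1l; apply: iz_compr.
Qed.
End IsoTheory.

Section FormalFunctors.
Variables (T U : stable_cat) (ZT : ideal (sc_alg T)) (ZU : ideal (sc_alg U)).
Hypotheses (hT : stable_ideal ZT) (hU : stable_ideal ZU).

Lemma sc_isoP (X Y : T) (f : chmap X Y) : sc_iso f <-> ziso ZT f.
Proof.
by split=> -[g [g1 g2]]; exists g; split; first [exact/hT | exact/(hT (g \oc f))].
Qed.

Definition nat_iso (F F' : functor T U) (th : forall X : T, chmap (F X) (F' X)) : Prop :=
  (forall X, ziso ZU (th X)) /\
  forall (X Y : T) (f : chmap X Y), ZU _ _ (th Y \oc fmap F f - fmap F' f \oc th X).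

Lemma fmap_iz (F : functor T U) (X Y : T) (f g : chmap X Y) :
  ZT _ _ (f - g) -> ZU _ _ (fmap F f - fmap F g).
Proof. by move/hT/(fmap_eq F)/hU. Qed.

Lemma fmapM_iz (F : functor T U) (X Y Z : T) (g : chmap Y Z) (f : chmap X Y) :
  ZU _ _ (fmap F (g \oc f) - fmap F g \oc fmap F f).
Proof. exact/hU/fmap_comp. Qed.

Lemma fmap1_iz (F : functor T U) (X : T) : ZU _ _ (fmap F (chid X) - chid (F X)).
Proof. exact/hU/fmap_id. Qed.

Lemma fmap_iso (F : functor T U) (X Y : T) (f : chmap X Y) : ziso ZT f -> ziso ZU (fmap F f).
Proof.
move=> [g [g1 g2]]; exists (fmap F g); split.
  apply: iz_sub (fmap1_iz F X); apply: iz_sub (fmap_iz F g1); apply: iz_sym; exact: fmapM_iz.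
apply: iz_sub (fmap1_iz F Y); apply: iz_sub (fmap_iz F g2); apply: iz_sym; exact: fmapM_iz.
Qed.
End FormalFunctors.

Section Equivalences.
Variables (T U : stable_cat) (ZT : ideal (sc_alg T)) (ZU : ideal (sc_alg U)).
Hypotheses (hT : stable_ideal ZT) (hU : stable_ideal ZU).

Lemma equivalenceP (F : functor T U) : equivalence F <->
  exists (G : functor U T) (eta : forall X : T, chmap X (G (F X)))
    (eps : forall Y : U, chmap (F (G Y)) Y),
    [/\ forall X, ziso ZT (eta X),
        forall (X X' : T) (f : chmap X X'),
          ZT _ _ (eta X' \oc f - fmap G (fmap F f) \oc eta X),
        forall Y, ziso ZU (eps Y) &
        forall (Y Y' : U) (g : chmap Y Y'),
          ZU _ _ (eps Y' \oc fmap F (fmap G g) - g \oc eps Y)].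
Proof.
split=> -[G [eta [eps [e1 e2 e3 e4]]]]; exists G, eta, eps; split.
- by move=> X; apply/(sc_isoP hT).
- by move=> X X' f; apply/hT.
- by move=> Y; apply/(sc_isoP hU).
- by move=> Y Y' g; apply/hU.
- by move=> X; apply/(sc_isoP hT).
- by move=> X X' f; apply/hT/e2.
- by move=> Y; apply/(sc_isoP hU).
- by move=> Y Y' g; apply/hU/e4.
Qed.

Lemma equivalence_nat (F F' : functor T U) (th : forall X : T, chmap (F X) (F' X)) : nat_iso ZU th ->
  equivalence F -> equivalence F'.
Proof.
move=> [thI thN] /equivalenceP[G [eta [eps [e1 e2 e3 e4]]]]; apply/equivalenceP.
pose ti X := projT1 (cid (thI X)).
have ti1 X : ZU _ _ (ti X \oc th X - chid _) := (projT2 (cid (thI X))).1.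
have ti2 X : ZU _ _ (th X \oc ti X - chid _) := (projT2 (cid (thI X))).2.
exists G, (fun X => fmap G (th X) \oc eta X), (fun Y => eps Y \oc ti (G Y)); split=> [X|X X' f|Y|Y Y' g].
- by apply: ziso_comp => //; apply: fmap_iso hT _ _ _ _ _ => //; exact: hU.
- rewrite -ocA; apply: (iz_sub (h := fmap G (th X') \oc (fmap G (fmap F f) \oc eta X))).
    exact: iz_compl.
  rewrite !ocA; apply: iz_compr.
  apply: (iz_sub (h := fmap G (th X' \oc fmap F f))).
    by apply: iz_sym; apply: fmapM_iz hT _ _ _ _ _ _.
  apply: (iz_sub (h := fmap G (fmap F' f \oc th X))); last exact: fmapM_iz hT _ _ _ _ _ _.
  exact: (fmap_iz hU hT).
- by apply: ziso_comp => //; exact: ziso_inv (ti1 _) (ti2 _) .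
rewrite ocA; apply: (iz_sub (h := eps Y' \oc fmap F (fmap G g) \oc ti (G Y))); last exact: iz_compr.
rewrite -!ocA; apply: iz_compl.
by apply: iz_square_inv (thN _ _ (fmap G g)).
Qed.
End Equivalences.

Section EquivalenceSym.
Variables (T U : stable_cat) (ZT : ideal (sc_alg T)) (ZU : ideal (sc_alg U)).
Hypotheses (hT : stable_ideal ZT) (hU : stable_ideal ZU).
Variables (F : functor T U) (G : functor U T).
Variables (eta : forall X : T, chmap X (G (F X))) (eps : forall Y : U, chmap (F (G Y)) Y).
Hypotheses (etaI : forall X, ziso ZT (eta X))
  (etaN : forall (X X' : T) (f : chmap X X'), ZT _ _ (eta X' \oc f - fmap G (fmap F f) \oc eta X))
  (epsI : forall Y, ziso ZU (eps Y))
  (epsN : forall (Y Y' : U) (g : chmap Y Y'), ZU _ _ (eps Y' \oc fmap F (fmap G g) - g \oc eps Y)).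

Lemma equivalence_left : equivalence F.
Proof. by apply/(equivalenceP hT hU); exists G, eta, eps. Qed.

Lemma equivalence_right : equivalence G.
Proof.
apply/(equivalenceP hU hT).
pose eti X := projT1 (cid (etaI X)).
have eti1 X : ZT _ _ (eti X \oc eta X - chid _) := (projT2 (cid (etaI X))).1.
have eti2 X : ZT _ _ (eta X \oc eti X - chid _) := (projT2 (cid (etaI X))).2.
pose epi Y := projT1 (cid (epsI Y)).
have epi1 Y : ZU _ _ (epi Y \oc eps Y - chid _) := (projT2 (cid (epsI Y))).1.
have epi2 Y : ZU _ _ (eps Y \oc epi Y - chid _) := (projT2 (cid (epsI Y))).2.
exists F, epi, eti; split=> [Y|Y Y' g|X|X X' f].
- exact: ziso_inv (epi1 _) (epi2 _).
- by apply: iz_square_inv (epsN g).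
- exact: ziso_inv (eti1 _) (eti2 _).
by apply: iz_square_inv (etaN f).
Qed.
End EquivalenceSym.

(** * The functors between the stable categories of the two blocks *)

Section GreenFunctors.
Variables (k : idomainType) (F : fieldType) (r : {rmorphism k -> F}) (p : nat).
Hypotheses (rP : forall x, (r x == 0) = (x \isn't a GRing.unit)) (pF : p \in [pchar F]).
Variables (gT : finGroupType) (C : complex_cat k gT).
Variables (Q : {group gT}) (e : galg k gT) (b : galg k (subg_of 'N(Q))).
Hypotheses (he : is_block e) (hQ : is_defect_group e Q) (hb : brauer_correspondent Q e b).
Local Notation H := 'N(Q)%G.
Local Notation CH := (sub_cat H C).
Local Notation f := (@gincl k gT H).
Local Notation Ind := (ind_cx f).
Local Notation Res := (rest_cx f).
Local Notation FX := (in_fam (famX Q)).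
Local Notation FXH := (in_fam (fam_sub H (famX Q))).
Local Notation FYH := (in_fam (fam_sub H (famY Q))).
Local Notation ce := (ce he).
Local Notation cb := (cb hb).
Local Notation tB := (block_trunc ce).
Local Notation tb := (block_trunc cb).
Local Notation aI := (adj_ind k H).
Local Notation szX := (szX rP C Q).
Local Notation szXH := (szXH rP C Q).
Local Notation szYH := (szero_ideal rP CH FYH).
Local Notation CB := (stable_B C Q e).
Local Notation Cb := (stable_b C Q b).

Lemma bB (X : CB) : in_block e X. Proof. exact: bc_block. Qed.
Lemma bb (X : Cb) : in_block b X. Proof. exact: bc_block. Qed.
Arguments bB : clear implicits.
Arguments bb : clear implicits.

Lemma stable_ideal_B : @stable_ideal CB szX.
Proof. by move=> X Y g h; exact (@stable_eqP k F r rP gT C (famX Q) e ce X Y g h (bc_cat X) (bB X)). Qed.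

Lemma stable_ideal_b : @stable_ideal Cb szXH.
Proof. by move=> X Y g h; exact (@stable_eqP k F r rP _ CH (fam_sub H (famX Q)) b cb X Y g h (bc_cat X) (bb X)). Qed.

Lemma block1 (gT' : finGroupType) (X : complex (galg k gT')) : in_block 1 X.
Proof. by move=> n x; rewrite scale1r. Qed.

Arguments block1 : clear implicits.

Lemma stable_eq1P (gT' : finGroupType) (C' : complex_cat k gT') Fam (X Y : complex (galg k gT')) (g h : chmap X Y) :
  in_cat C' X -> (stable_eq C' Fam 1 g h <-> szero_ideal rP C' (in_fam Fam) X Y (g - h)).
Proof. by move=> cX; exact (@stable_eqP k F r rP gT' C' Fam 1 (central_idempotent1 k gT') X Y g h cX (block1 gT' X)). Qed.

Lemma stable_iso1P (gT' : finGroupType) (C' : complex_cat k gT') Fam (X Y : complex (galg k gT')) (g : chmap X Y) :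
  in_cat C' X -> in_cat C' Y ->
  (stable_iso C' Fam 1 g <-> ziso (szero_ideal rP C' (in_fam Fam)) g).
Proof. by move=> cX cY; exact (@stable_isoP k F r rP gT' C' Fam 1 (central_idempotent1 k gT') X Y g cX (block1 gT' X) cY (block1 gT' Y)). Qed.

Lemma I0_cat (X : Cb) : in_cat C (gF aI tB X).
Proof. exact: (trunc_cat rP ce (in_cat_ind rP (bc_cat X))). Qed.
Lemma R0_cat (Y : CB) : in_cat CH (gG aI tb Y).
Proof. exact: (trunc_cat rP cb (in_cat_rest rP H (bc_cat Y))). Qed.

Definition I0_ob (X : Cb) : CB :=
  @BlockComplex k gT C e (gF aI tB X) (I0_cat X) (@trunc_block k gT e ce (Ind X)).
Definition R0_ob (Y : CB) : Cb :=
  @BlockComplex k _ CH b (gG aI tb Y) (R0_cat Y) (@trunc_block k _ b cb (Res Y)).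

Definition I0_map (X Y : Cb) (g : chmap X Y) : chmap (I0_ob X) (I0_ob Y) := gFm aI tB g.
Definition R0_map (X Y : CB) (g : chmap X Y) : chmap (R0_ob X) (R0_ob Y) := gGm aI tb g.

Lemma I0_eq (X Y : Cb) (g h : chmap X Y) : sc_eq g h -> sc_eq (I0_map g) (I0_map h).
Proof.
move=> gh; apply: (stable_ideal_B (X := I0_ob X) (Y := I0_ob Y) _ _).2.
by rewrite [_ - _](esym (gFB aI tB g h)); apply: gF_szero; exact: ((stable_ideal_b g h).1 gh).
Qed.

Lemma I0_id (X : Cb) : sc_eq (I0_map (chid X)) (chid (I0_ob X)).
Proof. by apply/stable_ideal_B/iz_refl; exact (gF1 aI tB X). Qed.

Lemma I0_comp (X Y Z : Cb) (g : chmap Y Z) (h : chmap X Y) :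
  sc_eq (I0_map (g \oc h)) (I0_map g \oc I0_map h).
Proof. by apply/stable_ideal_B/iz_refl; exact (gFM aI tB g h). Qed.

Lemma R0_eq (X Y : CB) (g h : chmap X Y) : sc_eq g h -> sc_eq (R0_map g) (R0_map h).
Proof.
move=> gh; apply: (stable_ideal_b (X := R0_ob X) (Y := R0_ob Y) _ _).2.
by rewrite [_ - _](esym (gGB aI tb g h)); apply: gG_szero; exact: ((stable_ideal_B g h).1 gh).
Qed.

Lemma R0_id (X : CB) : sc_eq (R0_map (chid X)) (chid (R0_ob X)).
Proof. by apply/stable_ideal_b/iz_refl; exact (gG1 aI tb X). Qed.

Lemma R0_comp (X Y Z : CB) (g : chmap Y Z) (h : chmap X Y) :
  sc_eq (R0_map (g \oc h)) (R0_map g \oc R0_map h).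
Proof. by apply/stable_ideal_b/iz_refl; exact (gGM aI tb g h). Qed.

Definition I0 : functor Cb CB := Functor I0_eq I0_id I0_comp.
Definition R0 : functor CB Cb := Functor R0_eq R0_id R0_comp.

Definition etaG (X : Cb) : chmap X (R0 (I0 X)) := gu aI tB tb X.
Definition epsG (Y : CB) : chmap (I0 (R0 Y)) Y := gc aI tB tb Y.

Lemma etaG_iso X : ziso szXH (etaG X).
Proof. exact (gu_iso rP pF C he hQ (block_truncP cb (bb X))). Qed.

Lemma epsG_iso Y : ziso szX (epsG Y).
Proof.
have [w wE] := gc_section rP pF C he hQ hb (bB Y).
exact (gc_iso (@gF_szero _ _ _ rP _ C _ _ he) (@gG_szero _ _ _ rP _ C _ _ _ hb) (@gu_iso _ _ _ _ rP pF _ C _ _ _ he hQ hb)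
  (block_truncP ce (bB Y)) wE).
Qed.

Lemma I0_equivalence : equivalence I0.
Proof.
apply: (equivalence_left stable_ideal_b stable_ideal_B etaG_iso _ epsG_iso).
  by move=> X X' g; apply: iz_refl; exact (gu_nat aI tB tb g).
by move=> Y Y' g; apply: iz_refl; exact (esym (gc_nat aI tB tb g)).
Qed.

Lemma R0_equivalence : equivalence R0.
Proof.
apply: (equivalence_right stable_ideal_b stable_ideal_B etaG_iso _ epsG_iso).
  by move=> X X' g; apply: iz_refl; exact (gu_nat aI tB tb g).
by move=> Y Y' g; apply: iz_refl; exact (esym (gc_nat aI tB tb g)).
Qed.

Lemma I0_induced : induced_by_ind I0.
Proof.
exists (fun X : Cb => tp tB (Ind X)); split=> [X|X Y g].
  apply/stable_iso1P; [exact: in_cat_ind (bc_cat X) | exact: bc_cat (I0 X) |].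
  exists (ti tB (Ind X)); split; last by apply: iz_refl; exact (tpti tB (Ind X)).
  exact: (ind_trunc_szero rP pF C he hQ hb (bb X)).
apply/stable_eq1P; first exact: in_cat_ind (bc_cat X).
apply: iz_refl; exact (esym (tp_nat tB (ind_ch f g))).
Qed.

Lemma R0_induced : induced_by_res R0.
Proof.
exists (fun Y : CB => tp tb (Res Y)); split=> [X|X Y g].
  apply/stable_iso1P; [exact: in_cat_rest (bc_cat X) | exact: bc_cat (R0 X) |].
  exists (ti tb (Res X)); split; last by apply: iz_refl; exact (tpti tb (Res X)).
  exact: (res_trunc_szero rP pF C he hQ hb (bB X)).
apply/stable_eq1P; first exact: in_cat_rest (bc_cat X).
apply: iz_refl; exact (esym (tp_nat tb (rest_ch f g))).
Qed.

(** Since [Ind X] is stably isomorphic to its component in [B], every functor induced by induction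
    is naturally isomorphic to the explicit [I0], and statements about [I0] transfer to it. *)
Lemma induced_by_indP (I : functor Cb CB) : induced_by_ind I ->
  exists th : forall X : Cb, chmap (I0 X) (I X), @nat_iso Cb CB szX I0 I th.
Proof.
move=> [eta [etaI etaN]]; exists (fun X => eta X \oc ti tB (Ind X)); split=> [X|X Y g].
  have cI : in_cat C (Ind X) := in_cat_ind rP (bc_cat X).
  apply: ziso_comp.
    exact/(stable_iso1P _ _ cI (bc_cat (I X)))/etaI.
  exists (tp tB (Ind X)); split; first by apply: iz_refl; exact (tpti tB (Ind X)).
  exact: (ind_trunc_szero rP pF C he hQ hb (bb X)).
have cI : in_cat C (Ind X) := in_cat_ind rP (bc_cat X).
have z : szX _ _ _ := (stable_eq1P _ _ _ cI).1 (etaN X Y g).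
rewrite -ocA [ti tB _ \oc _](ti_nat tB (ind_ch f g)) !ocA.
exact: iz_compr.
Qed.

(** The isomorphisms supplied hold modulo the family attached to restriction; between objects of [b]
    they are improved by [block_szero]. *)
Lemma induced_by_resP (R : functor CB Cb) : induced_by_res R ->
  exists th : forall Y : CB, chmap (R0 Y) (R Y), @nat_iso CB Cb szXH R0 R th.
Proof.
move=> [eta [etaI etaN]]; exists (fun X => eta X \oc ti tb (Res X)).
have cR (Y : CB) : in_cat CH (Res Y) := in_cat_rest rP H (bc_cat Y).
split=> [X|X Y g].
  have [h [h1 h2]] : ziso szYH (eta X \oc ti tb (Res X)).
    apply: ziso_comp.
      exact/(stable_iso1P _ _ (cR X) (bc_cat (R X)))/etaI.
    exists (tp tb (Res X)); split; first by apply: iz_refl; exact (tpti tb (Res X)).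
    exact: (res_trunc_szero rP pF C he hQ hb (bB X)).
  exists h; split; first exact (block_szero hb (bb (R0 X)) h1).
  exact (block_szero hb (bb (R X)) h2).
apply: (block_szero hb (bb (R0 X))).
have z : szYH _ _ _ := (stable_eq1P _ _ _ (cR X)).1 (etaN X Y g).
rewrite -ocA [ti tb _ \oc _](ti_nat tb (rest_ch f g)) !ocA.
exact: (iz_compr (Z := szYH)).
Qed.

Lemma ind_equivalence (I : functor Cb CB) : induced_by_ind I -> equivalence I.
Proof.
move=> /induced_by_indP[th thP].
exact (equivalence_nat stable_ideal_b stable_ideal_B thP I0_equivalence).
Qed.

Lemma res_equivalence (R : functor CB Cb) : induced_by_res R -> equivalence R.
Proof.
move=> /induced_by_resP[th thP].
exact (equivalence_nat stable_ideal_B stable_ideal_b thP R0_equivalence).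
Qed.
End GreenFunctors.

(** * Tensor products with k-free modules *)

Section KLinear.
Variables (k : comNzRingType) (gT : finGroupType).
Local Notation A := (galg k gT).

Definition klin (V : lmodType A) (phi : V -> k) : Prop :=
  (forall u v, phi (u + v) = phi u + phi v) /\ (forall c v, phi ((c%:A : A) *: v) = c * phi v).

Record kbasis (V : lmodType A) (I : finType) := KBasis {
  kbv : I -> V;
  kbd : I -> V -> k;
  kbdL : forall i, klin (kbd i);
  kb_sum : forall v, v = \sum_i ((kbd i v)%:A : A) *: kbv i;
  kb_dual : forall i j, kbd i (kbv j) = (i == j)%:R }.

Lemma fin_free_kbasis (V : lmodType A) : fin_free V -> exists n, inhabited (kbasis V 'I_n).
Proof.
move=> [n [b bP]].
pose c v := projT1 (cid (bP v)).
have cP v : v = \sum_i ((c v i)%:A : A) *: b i := (projT2 (cid (bP v))).1.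
have cU v (d : {ffun 'I_n -> k}) : v = \sum_i ((d i)%:A : A) *: b i -> c v = d.
  exact: (projT2 (cid (bP v))).2.
exists n; split; refine (@KBasis V _ b (fun i v => c v i) _ cP _) => [i|i j].
  split=> [u v|a v].
    rewrite (cU (u + v) [ffun j => c u j + c v j]) ?ffunE // [in LHS](cP u) [in LHS](cP v) -big_split.
    by apply: eq_bigr => j _; rewrite ffunE !scalerDl.
  rewrite (cU _ [ffun j => a * c v j]) ?ffunE // {1}(cP v) scaler_sumr.
  by apply: eq_bigr => j _; rewrite ffunE scalerA -scalerAl mul1r scalerA.
rewrite (cU (b j) [ffun l => (l == j)%:R]) ?ffunE // (bigD1 j) //= ffunE eqxx !scale1r big1 ?addr0 //.
by move=> l /negPf nl; rewrite ffunE nl !scale0r.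
Qed.

Section Maps.
Variable V : lmodType A.
Implicit Types (X Y : complex A).
Local Notation T := (dtens_cx V).

Program Definition dw X (v : V) : chmap (kx X) (kx (T X)) :=
  @mk_chmap _ (kx X) (kx (T X)) (fun n (x : X n) => dt v x) _ _.
Next Obligation.
by move=> c x y; rewrite dtDr; congr (_ + _); rewrite [RHS]dt_alg; symmetry; apply: dtZ.
Qed.
Next Obligation. by symmetry; apply: dtens_map_dt. Qed.

Lemma db_ex X (phi : V -> k) (hp : klin phi) : exists t : chmap (kx (T X)) (kx X),
  forall n v (x : X n), t n (dt v x) = ((phi v)%:A : A) *: x.
Proof.
case: hp => pD pZ; apply: dtens_k_ex => [n u v x|n v x y|n c v x|n c v x|n v x].
- by rewrite pD !scalerDl.
- by rewrite [LHS]scalerDr.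
- by rewrite pZ -[RHS]/((c%:A : A) *: (((phi v)%:A : A) *: x)) [RHS]scalerA -scalerAl mul1r scalerA.
- by rewrite [LHS]algC.
- by rewrite [RHS]linearZ.
Qed.

Definition db X phi (hp : klin phi) := projT1 (cid (db_ex X hp)).
Lemma dbE X phi (hp : klin phi) n v (x : X n) : db X hp n (dt v x) = ((phi v)%:A : A) *: x.
Proof. exact: (projT2 (cid (db_ex X hp))). Qed.

Lemma kdt_eq X (W : complex k) (s t : chmap (kx (T X)) W) :
  (forall n v (x : X n), s n (dt v x) = t n (dt v x)) -> s = t.
Proof.
move=> E; apply: chmap_ext => n; apply: dtens_add_eq => [u v|u v|v x]; last exact: E.
  exact: (linearB (s n)).
exact: (linearB (t n)).
Qed.

Lemma dwD X u v : dw X (u + v) = dw X u + dw X v.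
Proof. by apply: chmap_ext => n x; apply: dtDl. Qed.

Lemma dw_sum X I (s : seq I) (u : I -> V) : dw X (\sum_(i <- s) u i) = \sum_(i <- s) dw X (u i).
Proof.
elim/big_rec2: _ => [|i x y _ <-]; last exact: dwD.
by apply: chmap_ext => n x; apply: dt0l.
Qed.

Lemma dwZ X (c : k) v : dw X ((c%:A : A) *: v) = dw X v \oc lact X c%:A.
Proof. by apply: chmap_ext => n x; apply: dtZ. Qed.

Lemma kconj_dw X g v : kconj g (dw X v) = dw X (gelt g *: v).
Proof.
by apply: chmap_ext => n x; rewrite kconjE [LHS]dt_gelt geltKV.
Qed.

Lemma kconj_db X g phi psi (hp : klin phi) (hs : klin psi) :
  (forall v, psi (gelt g *: v) = phi v) -> kconj g (db X hp) = db X hs.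
Proof.
move=> E; apply: kdt_eq => n v x; rewrite kconjE [X in db _ _ _ X]dt_gelt !dbE.
by rewrite -[in RHS](geltKV g v) E algC geltKV.
Qed.

Lemma db_dw X phi (hp : klin phi) v : db X hp \oc dw X v = lact X (phi v)%:A.
Proof. by apply: chmap_ext => n x; rewrite ocE dbE. Qed.

Lemma dw_nat X Y (f : chmap X Y) v : kres (dtens_ch V f) \oc dw X v = dw Y v \oc kres f.
Proof. by apply: chmap_ext => n x; apply: dtens_chE. Qed.

Lemma db_nat X Y (f : chmap X Y) phi (hp : klin phi) :
  db Y hp \oc kres (dtens_ch V f) = kres f \oc db X hp.
Proof.
apply: kdt_eq => n v x; rewrite !ocE dbE.
apply: etrans (congr1 (db Y hp n) (dtens_chE _ _ _)) _; rewrite dbE.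
by rewrite -[RHS]/(f n (_ *: x)) linearZ.
Qed.

Lemma lact_central X Y (t : chmap (kx X) (kx Y)) (c : k) : t \oc lact X c%:A = lact Y c%:A \oc t.
Proof. by apply: chmap_ext => n x; apply: kchZ. Qed.

Lemma lactC1 X : lact X (1%:A) = chid (kx X).
Proof. by apply: chmap_ext => n x; rewrite /= !scale1r. Qed.
Lemma lactC0 X : lact X ((0 : k)%:A) = 0.
Proof. by apply: chmap_ext => n x; rewrite /= !scale0r. Qed.

Variables (I : finType) (B : kbasis V I).
(** With [bd], the inclusions and projections that make [V (x) X], as a complex of [k]-modules, a
    direct sum of copies of [X] indexed by the basis. *)
Definition bw X (i : I) := dw X (kbv B i).
Definition bd X (i : I) := db X (kbdL B i).

Lemma bw_bd X : \sum_i bw X i \oc bd X i = chid _.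
Proof.
apply: kdt_eq => n v x; rewrite ch_sumE {2}[v](kb_sum B) dt_suml; apply: eq_bigr => i _.
by rewrite ocE /bd dbE -[LHS]/(dt _ _) dtZ.
Qed.

Lemma bd_bw X i j : bd X i \oc bw X j = if i == j then chid _ else 0.
Proof.
rewrite /bd /bw db_dw kb_dual; case: eqP => _; [exact: lactC1 | exact: lactC0].
Qed.

Lemma bw_nat X Y (f : chmap X Y) i : kres (dtens_ch V f) \oc bw X i = bw Y i \oc kres f.
Proof. exact: dw_nat. Qed.
Lemma bd_nat X Y (f : chmap X Y) i : bd Y i \oc kres (dtens_ch V f) = kres f \oc bd X i.
Proof. exact: db_nat. Qed.

Lemma kbasis_exact X Y Z (i : chmap X Y) (p : chmap Y Z) :
  exact_seq i p -> exact_seq (dtens_ch V i) (dtens_ch V p).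
Proof.
move=> E n; have [inj ker sur] := E n.
have dec (W : complex A) (u : T W n) : u = \sum_j dt (kbv B j) (bd W j n u : W n).
  by rewrite {1}(_ : u = (chid (kx (T W))) n u) // -bw_bd ch_sumE.
have bdE (U W : complex A) (f : chmap U W) j (u : T U n) : bd W j n (dtens_ch V f n u) = f n (bd U j n u).
  transitivity ((bd W j \oc kres (dtens_ch V f)) n u); first by [].
  by rewrite bd_nat.
have i0 (u : T X n) : dtens_ch V i n u = 0 -> u = 0.
  move=> u0; rewrite [u]dec big1 // => j _.
  suff -> : bd X j n u = 0 :> X n by apply: (addrI (dt (kbv B j) (0 : X n))); rewrite -dtDr !addr0.
  by apply: inj; rewrite -bdE u0 !linear0.
split=> [u v uv|u|u].
- by apply/eqP; rewrite -subr_eq0; apply/eqP/i0; rewrite linearB uv subrr.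
- split=> [pu|[v <-]].
    have ex j : exists x, i n x = bd Y j n u.
      by apply/ker; rewrite -bdE pu linear0.
    pose s j := projT1 (cid (ex j)).
    have sE j : i n (s j) = _ := projT2 (cid (ex j)).
    exists (\sum_j dt (kbv B j) (s j)); rewrite linear_sum [RHS]dec; apply: eq_bigr => j _.
    by rewrite dtens_chE sE.
  have -> : dtens_ch V p n (dtens_ch V i n v) = dtens_ch V (p \oc i) n v.
    move: v; apply: dtens_add_eq => [u' v'|u' v'|v x]; rewrite ?linearB //.
    by rewrite !dtens_chE.
  rewrite (exact_comp0 E) [v]dec linear_sum big1 // => j _; rewrite dtens_chE ch0E.
  by apply: (addrI (dt (kbv B j) (0 : Z n))); rewrite -dtDr !addr0.
have ex j : exists y, p n y = bd Z j n u by apply: sur.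
pose s j := projT1 (cid (ex j)).
have sE j : p n (s j) = _ := projT2 (cid (ex j)).
exists (\sum_j dt (kbv B j) (s j)); rewrite linear_sum [RHS]dec; apply: eq_bigr => j _.
by rewrite dtens_chE sE.
Qed.
End Maps.
End KLinear.

(** * Dual modules and the adjunctions between tensor functors *)

Section DualPair.
Variables (k : comNzRingType) (gT : finGroupType).
Local Notation A := (galg k gT).
Implicit Types (X Y Z : complex A).

Lemma dtens_ch1 (V : lmodType A) X : dtens_ch V (chid X) = chid _.
Proof. by apply: dtens_eq => n v x; apply: dtens_chE. Qed.

Lemma dtens_chM (V : lmodType A) X Y Z (g : chmap Y Z) (f : chmap X Y) :
  dtens_ch V (g \oc f) = dtens_ch V g \oc dtens_ch V f.
Proof. by apply: dtens_eq => n v x; rewrite ocE !dtens_chE. Qed.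

Lemma dtens_chB (V : lmodType A) X Y (g f : chmap X Y) :
  dtens_ch V (g - f) = dtens_ch V g - dtens_ch V f.
Proof.
apply: dtens_eq => n v x; rewrite chBE !dtens_chE chBE.
apply: (addIr (dt v (f n x))); rewrite subrK -dtDr subrK.
by [].
Qed.

Lemma kres_inj X Y : injective (@kres k gT X Y).
Proof. exact: rest_ch_inj. Qed.

Lemma kresM X Y Z (g : chmap Y Z) (f : chmap X Y) : kres (g \oc f) = kres g \oc kres f.
Proof. exact: chmap_ext. Qed.

Lemma kres1 X : kres (chid X) = chid (kx X).
Proof. exact: chmap_ext. Qed.

Lemma kdt_eq2 (V W : lmodType A) X (Z : complex k) (s t : chmap (kx (dtens_cx V (dtens_cx W X))) Z) :
  (forall n v w (x : X n), s n (dt v (dt w x)) = t n (dt v (dt w x))) -> s = t.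
Proof.
move=> E; apply: kdt_eq => n v u.
transitivity ((s \oc dw _ v) n u); first by [].
transitivity ((t \oc dw _ v) n u); last by [].
by apply: ch_eqE; apply: kdt_eq => m w x; apply: E.
Qed.

Variables (V W : lmodType A) (I : finType) (BV : kbasis V I) (BW : kbasis W I).

(** The bilinear form on [W] and [V] for which the two bases are dual is invariant under the
    group. *)
Definition dual_pair : Prop := forall g v w,
  \sum_i kbd BW i (gelt g *: w) * kbd BV i (gelt g *: v) = \sum_i kbd BW i w * kbd BV i v.
Hypothesis dp : dual_pair.

Lemma kbd_act g i j : kbd BW j (gelt g *: kbv BW i) = kbd BV i (gelt g^-1%g *: kbv BV j).
Proof.
have E1 w : \sum_l kbd BW l w * kbd BV l (kbv BV j) = kbd BW j w.
  rewrite (bigD1 j) //= kb_dual eqxx mulr1 big1 ?addr0 // => l /negPf nl.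
  by rewrite kb_dual nl mulr0.
have E2 v : \sum_l kbd BW l (kbv BW i) * kbd BV l v = kbd BV i v.
  rewrite (bigD1 i) //= kb_dual eqxx mul1r big1 ?addr0 // => l /negPf nl.
  by rewrite kb_dual nl mul0r.
by rewrite -E1 -{1}(geltKV g (kbv BV j)) dp E2.
Qed.

Lemma dw_dec X (w : W) : dw X w = \sum_j bw BW X j \oc lact X (kbd BW j w)%:A.
Proof.
rewrite {1}(kb_sum BW w) dw_sum; apply: eq_bigr => j _; exact: dwZ.
Qed.

(** The canonical element, the sum of the [w_i (x) v_i], is invariant by [kbd_act]; it gives the
    unit of [adj_dual]. *)
Lemma coev_ex X : exists f : chmap X (dtens_cx W (dtens_cx V X)),
  kres f = \sum_i bw BW _ i \oc bw BV X i.
Proof.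
apply: kfix_lift => g _; rewrite (rho_sum (kconjP _ _)).
transitivity (\sum_i \sum_j bw BW _ j \oc
    dw X (((kbd BV i (gelt g^-1%g *: kbv BV j))%:A : A) *: (gelt g *: kbv BV i))).
  apply: eq_bigr => i _; rewrite kconj_comp !kconj_dw (dw_dec _ (gelt g *: kbv BW i)) oc_suml.
  by apply: eq_bigr => j _; rewrite -ocA dwZ lact_central kbd_act.
rewrite exchange_big; apply: eq_bigr => j _ /=; rewrite -oc_sumr -dw_sum; congr (_ \oc dw X _).
rewrite -[RHS](geltKV g) [in RHS](kb_sum BV (gelt g^-1%g *: _)) scaler_sumr.
by apply: eq_bigr => i _; rewrite algC.
Qed.

Definition coev X := projT1 (cid (coev_ex X)).
Lemma coevE X : kres (coev X) = \sum_i bw BW _ i \oc bw BV X i.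
Proof. exact: (projT2 (cid (coev_ex X))). Qed.

Lemma ev_ex X : exists f : chmap (dtens_cx V (dtens_cx W X)) X,
  kres f = \sum_i bd BW X i \oc bd BV _ i.
Proof.
apply: kfix_lift => g _.
have E n v w (x : X n) : (\sum_i bd BW X i \oc bd BV _ i) n (dt v (dt w x)) =
    ((\sum_i kbd BW i w * kbd BV i v)%:A : A) *: x.
  rewrite ch_sumE scaler_suml scaler_suml; apply: eq_bigr => i _.
  transitivity (bd BW X i n (((kbd BV i v)%:A : A) *: (dt w x : dtens_cx W X n))).
    by rewrite ocE; congr (bd BW X i n _); apply: dbE.
  transitivity (((kbd BV i v)%:A : A) *: (bd BW X i n (dt w x) : X n)); first exact: kchZ.
  by rewrite /bd dbE scalerA mulrC -scalerAl mul1r scalerA.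
apply: kdt_eq2 => n v w x; rewrite kconjE.
have -> : gelt g^-1%g *: (dt v (dt w x) : dtens_cx V (dtens_cx W X) n) =
    dt (gelt g^-1%g *: v) (dt (gelt g^-1%g *: w) (gelt g^-1%g *: x)).
  by rewrite dt_gelt; congr (dt _ _); apply: dt_gelt.
by rewrite !E dp algC geltKV.
Qed.

Definition ev X := projT1 (cid (ev_ex X)).
Lemma evE X : kres (ev X) = \sum_i bd BW X i \oc bd BV _ i.
Proof. exact: (projT2 (cid (ev_ex X))). Qed.

Definition adj_dual : adjunction A A.
Proof.
refine (@Adjunction _ _ (dtens_cx V) (@dtens_ch _ _ V) (dtens_cx W) (@dtens_ch _ _ W) _ _ _ _ _ _
  coev ev _ _ _ _).
- exact: dtens_ch1.
- exact: dtens_chM.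
- exact: dtens_chB.
- exact: dtens_ch1.
- exact: dtens_chM.
- exact: dtens_chB.
- move=> X Y g; apply: kres_inj; rewrite !kresM !coevE oc_suml oc_sumr.
  by apply: eq_bigr => i _; rewrite ocA bw_nat -!ocA bw_nat.
- move=> X Y g; apply: kres_inj; rewrite !kresM !evE oc_suml oc_sumr.
  by apply: eq_bigr => i _; rewrite ocA -bd_nat -!ocA bd_nat.
- move=> X; apply: kres_inj; rewrite kresM kres1 evE oc_suml -(bw_bd BV).
  apply: eq_bigr => i _; rewrite -ocA bd_nat coevE ocA oc_sumr (bigD1 i) //= ocA bd_bw eqxx oc1l.
  by rewrite big1 ?addr0 // => j /negPf nj; rewrite ocA bd_bw eq_sym nj oc0l.
move=> Y; apply: kres_inj; rewrite kresM kres1 coevE oc_sumr -(bw_bd BW).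
apply: eq_bigr => i _; rewrite ocA bw_nat evE -ocA oc_suml (bigD1 i) //= -ocA bd_bw eqxx oc1r.
by rewrite big1 ?addr0 // => j /negPf nj; rewrite -ocA bd_bw nj oc0r.
Defined.
End DualPair.

Section DualModule.
Variables (k : comNzRingType) (gT : finGroupType).
Local Notation A := (galg k gT).

Definition antip (a : A) : A := [ffun x => a x^-1%g].
Lemma antipM a b : antip (a * b) = antip b * antip a.
Proof.
apply/ffunP => x; rewrite ffunE !galgME (reindex_inj (mulgI x^-1%g)) /=; apply: eq_bigr => y _.
by rewrite !ffunE mulrC !invMg !invgK mulgK.
Qed.
Lemma antipD a b : antip (a + b) = antip a + antip b.
Proof. by apply/ffunP => x; rewrite !ffunE. Qed.
Lemma antip_gelt g : antip (gelt g) = gelt g^-1%g.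
Proof. by apply/ffunP => x; rewrite !ffunE (can2_eq invgK invgK). Qed.
Lemma antipZ c a : antip (c *: a) = c *: antip a.
Proof. by apply/ffunP => x; rewrite ffunE galgZE [RHS]galgZE ffunE. Qed.
Lemma antip1 : antip 1 = 1.
Proof. by rewrite -gelt1 antip_gelt invg1. Qed.

Section Dual.
Variables (V : lmodType A) (I : finType) (B : kbasis V I).

(** The argument is a phantom: it keeps the basis with the type, since the action on coordinate
    vectors is defined from it and the antipode. *)
Definition kdual_of (D : kbasis V I) : Type := {ffun I -> k}.
Local Notation kdual := (kdual_of B).
HB.instance Definition _ := GRing.Zmodule.on kdual.

Definition pair (phi : kdual) (v : V) : k := \sum_i phi i * kbd B i v.

Lemma pairD phi u v : pair phi (u + v) = pair phi u + pair phi v.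
Proof. by rewrite -big_split; apply: eq_bigr => i _; rewrite (kbdL B i).1 mulrDr. Qed.
Lemma pairZ phi c v : pair phi ((c%:A : A) *: v) = c * pair phi v.
Proof. by rewrite mulr_sumr; apply: eq_bigr => i _; rewrite (kbdL B i).2 mulrCA. Qed.
Lemma pairDl phi psi v : pair (phi + psi) v = pair phi v + pair psi v.
Proof. by rewrite -big_split; apply: eq_bigr => i _; rewrite ffunE mulrDl. Qed.
Lemma pair_b phi j : pair phi (kbv B j) = phi j.
Proof.
rewrite /pair (bigD1 j) //= kb_dual eqxx mulr1 big1 ?addr0 // => i /negPf ni.
by rewrite kb_dual ni mulr0.
Qed.

Definition kd_scale (a : A) (phi : kdual) : kdual := [ffun j => pair phi (antip a *: kbv B j)].

Lemma pair_scale a phi v : pair (kd_scale a phi) v = pair phi (antip a *: v).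
Proof.
rewrite {2}(kb_sum B v) scaler_sumr.
transitivity (\sum_i pair phi (antip a *: (((kbd B i v)%:A : A) *: kbv B i))); last first.
  elim/big_rec2: _ => [|i u w _ ->]; last by rewrite pairD.
  by apply: (addrI (pair phi 0)); rewrite -pairD !addr0.
by apply: eq_bigr => i _; rewrite ffunE algC pairZ mulrC.
Qed.

Lemma kd_scaleA a b phi : kd_scale a (kd_scale b phi) = kd_scale (a * b) phi.
Proof. by apply/ffunP => j; rewrite !ffunE pair_scale scalerA antipM. Qed.
Lemma kd_scale1 : left_id 1 kd_scale.
Proof. by move=> phi; apply/ffunP => j; rewrite ffunE antip1 scale1r pair_b. Qed.
Lemma kd_scaleDr : right_distributive kd_scale +%R.
Proof. by move=> a phi psi; apply/ffunP => j; rewrite !ffunE pairDl. Qed.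
Lemma kd_scaleDl phi : {morph kd_scale^~ phi : a b / a + b}.
Proof. by move=> a b; apply/ffunP => j; rewrite !ffunE antipD scalerDl pairD. Qed.

HB.instance Definition _ := GRing.Zmodule_isLmodule.Build A kdual
  kd_scaleA kd_scale1 kd_scaleDr kd_scaleDl.

Lemma kd_algE c (phi : kdual) i : ((c%:A : A) *: phi) i = c * phi i.
Proof. by rewrite ffunE antipZ antip1 pairZ pair_b. Qed.

Definition dual_basis : kbasis kdual I.
Proof.
refine (@KBasis k gT kdual I (fun i => [ffun j => (j == i)%:R] : kdual) (fun i phi => phi i) _ _ _).
- by move=> i; split=> [u v|c v]; [rewrite ffunE | exact: kd_algE].
- move=> phi; apply/ffunP => j; rewrite sum_ffunE (bigD1 j) //= kd_algE ffunE eqxx mulr1.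
  by rewrite big1 ?addr0 // => i /negPf ni; rewrite kd_algE ffunE eq_sym ni mulr0.
by move=> i j; rewrite ffunE.
Defined.

Lemma dual_basis_pair : dual_pair B dual_basis.
Proof.
move=> g v w; transitivity (pair (kd_scale (gelt g) w) (gelt g *: v)); first by [].
by rewrite pair_scale antip_gelt geltK.
Qed.

(** [V] is also dual to its dual; so tensoring with the dual is both left and right adjoint to
    tensoring with [V]. *)
Lemma dual_basis_pair_sym : dual_pair dual_basis B.
Proof.
move=> g w v; have := dual_basis_pair g v w.
move=> E; transitivity (\sum_i kbd dual_basis i (gelt g *: w) * kbd B i (gelt g *: v)).
  by apply: eq_bigr => i _; apply: mulrC.
by rewrite E; apply: eq_bigr => i _; apply: mulrC.
Qed.
End Dual.
End DualModule.

(** * Permutation modules and sequences split by them *)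

Section PermutationBasis.
Variables (k : comNzRingType) (gT : finGroupType).
Local Notation A := (galg k gT).

(** The upper bound on stabilizers makes the identity of [V (x) X] a trace. The lower bound gives
    for each [P] a basis vector fixed by [P], hence a [P]-equivariant projection of [V (x) X] to
    [X]. *)
Definition perm_basis (L : {group gT} -> Prop) (M : lmodType A) : Prop :=
  exists (I : finType) (B : kbasis M I) (act : gT -> I -> I),
    [/\ gaction [set: gT] act, forall g i, gelt g *: kbv B i = kbv B (act g i),
        forall i, exists2 P, L P & exists x, (stab [set: gT] act i :^ x \subset P)%g &
        forall P, L P -> exists i, (P : {set gT}) \subset stab [set: gT] act i].

Lemma perm_basis_nil (L : {group gT} -> Prop) : (forall P, ~ L P) -> perm_basis L 'rV[A]_0.
Proof.
move=> nL; exists void.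
have B : kbasis 'rV[A]_0 void.
  refine (@KBasis k gT _ void (of_void _) (of_void _) _ _ _); try by case.
  by move=> v; rewrite thinmx0 [RHS]thinmx0.
exists B, (fun _ w => w); split; [by split | by move=> g [] | by case | by move=> P /nL].
Qed.

Lemma perm_basis_pair (L L1 L2 : {group gT} -> Prop) (M1 M2 : lmodType A) :
  (forall P, L P <-> L1 P \/ L2 P) ->
  perm_basis L1 M1 -> perm_basis L2 M2 -> perm_basis L (M1 * M2)%type.
Proof.
move=> LE [I1 [B1 [a1 [A1 e1 s1 f1]]]] [I2 [B2 [a2 [A2 e2 s2 f2]]]].
pose b (i : I1 + I2) : M1 * M2 := match i with inl i => (kbv B1 i, 0) | inr i => (0, kbv B2 i) end.
pose d (i : I1 + I2) (v : M1 * M2) : k := match i with inl i => kbd B1 i v.1 | inr i => kbd B2 i v.2 end.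
have d0 (M : lmodType A) (I : finType) (B : kbasis M I) i : kbd B i 0 = 0.
  by apply: (addrI (kbd B i 0)); rewrite -(kbdL B i).1 !addr0.
have bL i : klin (d i).
  by case: i => i; split=> [u v|c v]; first [exact: (kbdL _ i).1 | exact: (kbdL _ i).2].
have bS v : v = \sum_i ((d i v)%:A : A) *: b i.
  have E1 : (\sum_i ((kbd B1 i v.1)%:A : A) *: ((kbv B1 i, 0) : M1 * M2)) = (v.1, 0).
    rewrite {2}(kb_sum B1 v.1); elim/big_rec2: _ => [|i x y _ ->] //.
    by apply: injective_projections; rewrite /= ?scaler0 ?addr0.
  have E2 : (\sum_i ((kbd B2 i v.2)%:A : A) *: ((0, kbv B2 i) : M1 * M2)) = (0, v.2).
    rewrite {2}(kb_sum B2 v.2); elim/big_rec2: _ => [|i x y _ ->] //.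
    by apply: injective_projections; rewrite /= ?scaler0 ?addr0.
  transitivity ((v.1, 0) + (0, v.2) : M1 * M2); last by rewrite -E1 -E2 big_sumType.
  by apply: injective_projections; rewrite /= ?addr0 ?add0r.
have bD i j : d i (b j) = (i == j)%:R.
  by case: i => i; case: j => j /=; rewrite ?kb_dual ?d0.
pose act g (i : I1 + I2) : I1 + I2 := match i with inl i => inl (a1 g i) | inr i => inr (a2 g i) end.
have st1 i : stab [set: gT] act (inl i) = stab [set: gT] a1 i by apply/setP => g; rewrite !inE.
have st2 i : stab [set: gT] act (inr i) = stab [set: gT] a2 i by apply/setP => g; rewrite !inE.
exists (I1 + I2)%type, (KBasis bL bS bD), act; split.
- case: A1 => A11 A1M; case: A2 => A21 A2M; split=> [[i|i]|g h [i|i] Gg Gh] /=.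
  + by rewrite A11. + by rewrite A21. + by rewrite A1M. + by rewrite A2M.
- by move=> g [i|i] /=; apply: injective_projections; rewrite /= ?e1 ?e2 ?scaler0.
- case=> i; rewrite ?st1 ?st2.
    by have [P LP x] := s1 i; exists P => //; apply/LE; left.
  by have [P LP x] := s2 i; exists P => //; apply/LE; right.
move=> P /LE[/f1|/f2] [i Pi]; first by exists (inl i); rewrite st1.
by exists (inr i); rewrite st2.
Qed.

Section InducedTrivial.
Variable P : {group gT}.
Local Notation B := (galg k (subg_of P)).
Local Notation N := (rest gaug k^o : lmodType B).
Local Notation f := (@gincl k gT P).

(** The trivial module sits in every degree with zero differential, so that the results on induced
    complexes can be read in degree [0]. *)
Definition const_cx : complex B := @Complex B (fun=> N) (fun=> \0) (fun _ _ => erefl).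
Local Notation IX := (ind_cx f const_cx 0).
Local Notation one := ((1 : k) : const_cx 0).

Lemma trivZ (a : B) (c : k) : a *: (c : const_cx 0) = gaug a * c.
Proof. by []. Qed.

Lemma gaug_gelt (h : subg_of P) : gaug (gelt h : B) = 1.
Proof.
rewrite /gaug (bigD1 h) //= ffunE eqxx big1 ?addr0 // => x /negPf nx.
by rewrite ffunE nx.
Qed.

Lemma gaug_alg (c : k) : gaug (c%:A : B) = c.
Proof.
rewrite /gaug (eq_bigr (fun x => c * (1 : B) x)) => [|x _]; last exact: galgZE.
by rewrite -mulr_sumr -[\sum_i _]/(gaug (1 : B)) rmorph1 mulr1.
Qed.

Definition Itr := {C : {set gT} | C \in rcosets P [set: gT]}.
Definition trb (C : Itr) : ind f N := gelt (fingroup.repr (val C))^-1%g *: (itens f 1 one : IX).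
Definition trd (C : Itr) (u : ind f N) : k := ind_pr const_cx 0 (gelt (fingroup.repr (val C)) *: u : IX).

Lemma itens_one (a : B) : f a *: (itens f 1 one : IX) = itens f 1 (gaug a : const_cx 0).
Proof.
apply: etrans (itensZ _ _ _) _; rewrite mulr1 -{1}[f a]mul1r.
by apply: etrans (itens_bal _ _ _) _; rewrite trivZ mulr1.
Qed.

Lemma gelt_itens g : gelt g *: (itens f 1 one : IX) = itens f (gelt g) one.
Proof. by apply: etrans (itensZ _ _ _) _; rewrite mulr1. Qed.

Lemma trd_lin C : klin (trd C).
Proof.
split=> [u v|c v]; rewrite /trd; first by rewrite scalerDr linearD.
rewrite algC -(gincl_alg P c).
transitivity ((c%:A : B) *: ind_pr const_cx 0 (gelt (fingroup.repr (val C)) *: v : IX)).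
  exact: (chZ (ind_pr const_cx) (c%:A : B)).
by rewrite trivZ gaug_alg.
Qed.

Lemma trb_scale (c : k) C : (c%:A : A) *: trb C =
  gelt (fingroup.repr (val C))^-1%g *: (itens f 1 (c : const_cx 0) : IX).
Proof.
by rewrite /trb -algC -(gincl_alg P c) [f _ *: _]itens_one gaug_alg.
Qed.

Lemma trb_sum u : u = \sum_C ((trd C u)%:A : A) *: trb C.
Proof.
rewrite {1}[u](@ind_dec k gT P const_cx 0 u) big_sub; apply: eq_bigr => C _.
by rewrite trb_scale.
Qed.

Lemma trd_trb C D : trd C (trb D) = (C == D)%:R.
Proof.
rewrite /trd /trb scalerA -geltM [gelt _ *: _]gelt_itens.
pose z : const_cx 0 := one; rewrite -/z.
apply: (etrans (y := gtrunc P (gelt (fingroup.repr (val C) * (fingroup.repr (val D))^-1)%g) *: z)).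
  exact: (@ind_prE k gT P const_cx 0 _ z).
rewrite gtrunc_gelt -(inj_eq val_inj).
have rK (E : Itr) : val E = (P :* fingroup.repr (val E))%g.
  by case/rcosetsP: (valP E) => x _ ->; rewrite rcoset_repr.
have -> : (val C == val D) = (fingroup.repr (val C) * (fingroup.repr (val D))^-1 \in P)%g.
  rewrite {1}(rK C) {1}(rK D) eq_sym; apply/eqP/idP => [E|m].
    by rewrite -mem_rcoset E rcoset_refl.
  by apply/esym/rcoset_eqP; rewrite mem_rcoset.
case: ifP => _; first by rewrite trivZ gaug_gelt mulr1.
by rewrite scale0r.
Qed.

Definition tr_basis : kbasis (ind f N) Itr := KBasis trd_lin trb_sum trd_trb.

Lemma rc_act g (C : Itr) : (val C :* g^-1)%g \in rcosets P [set: gT].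
Proof. by case/rcosetsP: (valP C) => x _ ->; rewrite -rcosetM; apply/rcosetsP; exists (x * g^-1)%g; rewrite ?inE. Qed.
Definition tr_act g (C : Itr) : Itr :=
  exist (fun D : {set gT} => D \in rcosets P [set: gT]) _ (rc_act g C).

Lemma trb_act g C : gelt g *: trb C = trb (tr_act g C).
Proof.
rewrite /trb scalerA -geltM /=; case/rcosetsP: (valP C) => x _ ->; rewrite -rcosetM.
have [u Pu ->] := rcosetP (mem_repr_rcoset P x).
have [v Pv ->] := rcosetP (mem_repr_rcoset P (x * g^-1)).
have H w z : w \in P -> gelt (w * z)^-1%g *: (itens f 1 one : IX) = gelt z^-1%g *: (itens f 1 one : IX).
  move=> Pw; rewrite invMg geltM -scalerA; congr (_ *: _).
  have -> : gelt w^-1%g = f (gelt (subg P w^-1)) :> A by rewrite gincl_gelt subgK ?groupV.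
  by rewrite [f _ *: _]itens_one gaug_gelt.
rewrite geltM -scalerA (H u) // (H v) // scalerA -geltM.
by congr (gelt _ *: _); rewrite invMg invgK.
Qed.

Lemma perm_basis_ind : perm_basis (fun P' => P' = P) (ind f N).
Proof.
exists Itr, tr_basis, tr_act; split.
- split=> [C|g h C _ _]; apply: val_inj => /=; first by rewrite invg1 rcoset1.
  by rewrite invMg rcosetM.
- exact: trb_act.
- move=> C; exists P => //; case/rcosetsP: (valP C) => x _ CE; exists x^-1%g.
  apply/subsetP => g; rewrite mem_conjgV inE => /andP[_ /eqP/(congr1 val)/= E].
  rewrite CE -rcosetM in E.
  have : (x * (g ^ x)^-1)%g \in (P :* x)%g by rewrite -E rcoset_refl.
  by rewrite mem_rcoset conjgE !invMg invgK !mulgA mulgV mul1g mulgK groupV.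
move=> P' ->; have Pr : (P : {set gT}) \in rcosets P [set: gT].
  by apply/rcosetsP; exists 1%g; rewrite ?rcoset1 ?inE.
exists (exist (fun D : {set gT} => D \in rcosets P [set: gT]) _ Pr : Itr); apply/subsetP => g Pg; rewrite !inE -(inj_eq val_inj) /=.
by rewrite rcoset_id ?groupV.
Qed.
End InducedTrivial.

Lemma perm_module_basis (Fam : {set {group gT}}) : perm_basis (fun P => P \in Fam) (perm_module k Fam).
Proof.
rewrite /perm_module.
have -> : (fun P : {group gT} => (P \in Fam : Prop)) = (fun P => P \in enum Fam) by apply: funext => P; rewrite mem_enum.
elim: (enum Fam) => [|P s IHs] /=; first by apply: perm_basis_nil.
apply: perm_basis_pair (perm_basis_ind P) IHs => P'.
by rewrite inE; split=> [/orP[/eqP|]|[->|->]]; rewrite ?eqxx ?orbT; auto.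
Qed.
End PermutationBasis.

Section PermutationTensor.
Variables (k : idomainType) (gT : finGroupType) (Fam : {set {group gT}}).
Local Notation A := (galg k gT).
Variables (V : lmodType A) (I : finType) (B : kbasis V I) (act : gT -> I -> I).
Hypotheses (actA : gaction [set: gT] act) (actE : forall g i, gelt g *: kbv B i = kbv B (act g i)).
Hypotheses (actS : forall i, exists2 P, P \in Fam & exists x, (stab [set: gT] act i :^ x \subset P)%g)
  (actP : forall P : {group gT}, P \in Fam -> exists i, (P : {set gT}) \subset stab [set: gT] act i).
Local Notation T := (dtens_cx V).
Implicit Types (X Y W : complex A).

Let actI g : injective (act g).
Proof. by apply: (gaction_inj actA); rewrite inE. Qed.

Lemma bw_act X g i : kconj g (bw B X i) = bw B X (act g i).
Proof. by rewrite /bw kconj_dw actE. Qed.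

Lemma bd_act X g i : kconj g (bd B X i) = bd B X (act g i).
Proof.
apply: kconj_db => v; have [dD dZ] := kbdL B (act g i).
have d0 : kbd B (act g i) 0 = 0 by apply: (addrI (kbd B (act g i) 0)); rewrite -dD !addr0.
rewrite {1}(kb_sum B v) scaler_sumr.
transitivity (\sum_j kbd B (act g i) (gelt g *: (((kbd B j v)%:A : A) *: kbv B j))).
  by elim/big_rec2: _ => [|j u w _ <-]; rewrite ?d0 ?dD.
rewrite (bigD1 i) //= big1 ?addr0 => [|j /negPf ni].
  by rewrite algC dZ actE kb_dual eqxx mulr1.
by rewrite algC dZ actE kb_dual (inj_eq (@actI g)) eq_sym ni mulr0.
Qed.

Lemma tens_trace X : ktrace (in_fam Fam) (chid (T X)).
Proof.
exists I, act, (fun i => bw B X i \oc bd B X i); split=> //.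
- by move=> g i _; rewrite kconj_comp bw_act bd_act.
- by move=> i _; apply: actS.
- by rewrite bw_bd kres1.
Qed.

Let sum_act (Z W : complex A) (t : I -> chmap (kx Z) (kx W)) :
  (forall g i, kconj g (t i) = t (act g i)) -> exists h : chmap Z W, kres h = \sum_i t i.
Proof.
move=> tE; apply: kfix_lift => g _; rewrite (rho_sum (kconjP _ _)).
rewrite [RHS](reindex_inj (@actI g)) /=; apply: eq_bigr => i _; exact: tE.
Qed.

(** [eta] sends [x] to the sum of the [b_i (x) x]. For the product on [V] with the basis as
    orthogonal idempotents, the retraction [m] is multiplication. A member of [Fam] ensures that a
    basis vector exists, and its coordinate is a left inverse of [eta]. *)
Lemma tens_hull X : exists (eta : chmap X (T X)),
  (exists m, m \oc dtens_ch V eta = chid _) /\ ((exists P, P \in Fam) -> forall n, injective (eta n)).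
Proof.
have [eta etaE] := sum_act (t := bw B X) (bw_act X).
exists eta; split.
  have [|m mE] := sum_act (t := fun i => bw B X i \oc bd B X i \oc bd B (T X) i).
    by move=> g i; rewrite !kconj_comp bw_act !bd_act.
  exists m; apply: kres_inj; rewrite kresM kres1 mE oc_suml -(bw_bd B); apply: eq_bigr => i _.
  rewrite -ocA bd_nat etaE ocA -(ocA (bw B X i)) oc_sumr (bigD1 i) //= bd_bw eqxx big1 ?addr0 ?oc1r //.
  by move=> j /negPf nj; rewrite bd_bw eq_sym nj.
move=> [P /actP[i _]] n x y xy.
suff E : bd B X i \oc kres eta = chid _.
  by rewrite -[x]/((chid (kx X)) n x) -[y]/((chid (kx X)) n y) -E !ocE; congr (bd B X i n _).
rewrite etaE oc_sumr (bigD1 i) //= bd_bw eqxx big1 ?addr0 //.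
by move=> j /negPf nj; rewrite bd_bw eq_sym nj.
Qed.

(** Dually, [q] adds the coordinates, and the section is the comultiplication sending [b_i] to
    [b_i (x) b_i]. *)
Lemma tens_cover X : exists (q : chmap (T X) X),
  (exists s, dtens_ch V q \oc s = chid _) /\ ((exists P, P \in Fam) -> forall n x, exists u, q n u = x).
Proof.
have [q qE] := sum_act (t := bd B X) (bd_act X).
have qb i : kres q \oc bw B X i = chid _.
  rewrite qE oc_suml (bigD1 i) //= bd_bw eqxx big1 ?addr0 //.
  by move=> j /negPf nj; rewrite bd_bw nj.
exists q; split.
  have [|s sE] := sum_act (t := fun i => bw B (T X) i \oc (bw B X i \oc bd B X i)).
    by move=> g i; rewrite !kconj_comp !bw_act bd_act.
  exists s; apply: kres_inj; rewrite kresM kres1 sE oc_sumr -(bw_bd B); apply: eq_bigr => i _.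
  by rewrite ocA bw_nat -ocA (ocA (kres q)) qb oc1l.
move=> [P /actP[i _]] n x; exists (bw B X i n x).
transitivity ((kres q \oc bw B X i) n x); first by [].
by rewrite qb.
Qed.

(** A basis vector fixed by [P] cuts from the splitting of [V (x) i] a [k]-linear splitting of [i]
    fixed by [P]: the sequence splits over each member of [Fam]. *)
Lemma tens_split_fix X Y (i : chmap X Y) (rho : chmap (T Y) (T X)) (P : {group gT}) :
  rho \oc dtens_ch V i = chid _ -> P \in Fam ->
  exists2 t : chmap (kx Y) (kx X), gfix (@kconj k gT Y X) P t & t \oc kres i = chid _.
Proof.
move=> ri /actP[j Pj]; exists (bd B X j \oc kres rho \oc bw B Y j) => [g Pg|].
  have /eqP E : act g j == j by have := subsetP Pj g Pg; rewrite !inE.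
  by rewrite !kconj_comp kconj_kres bw_act bd_act E.
by rewrite -ocA -bw_nat -!ocA (ocA (kres rho)) -kresM ri kres1 oc1l bd_bw eqxx.
Qed.

Lemma gTr_comp X Y W (P : {group gT}) (t : chmap (kx Y) (kx W)) (i : chmap X Y) :
  gTr (@kconj k gT Y W) P [set: gT] t \oc kres i = gTr (@kconj k gT X W) P [set: gT] (t \oc kres i).
Proof.
by rewrite oc_suml; apply: eq_bigr => D _; rewrite kconj_comp kconj_kres.
Qed.

(** Write [g] as a sum of traces of the [t P], and compose each [t P] with a [P]-fixed splitting of
    [i] before taking the trace. *)
Lemma trace_extends X Y W (i : chmap X Y) (rho : chmap (T Y) (T X)) (g : chmap X W) :
  rho \oc dtens_ch V i = chid _ -> ktrace (in_fam Fam) g -> exists h : chmap Y W, h \oc i = g.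
Proof.
move=> ri /(gtrace_canon (kconjP _ _))[t [ft gE]].
have ex (P : {group gT}) : exists u : chmap (kx Y) (kx X), P \in Fam ->
    gfix (@kconj k gT Y X) P u /\ u \oc kres i = chid _.
  have [PF|] := boolP (P \in Fam); last by exists 0.
  by have [u fu ui] := tens_split_fix ri PF; exists u.
pose u P := projT1 (cid (ex P)); have uP P : P \in Fam -> _ := projT2 (cid (ex P)).
have [h hE] : exists h : chmap Y W, kres h =
    \sum_(P in Fam) gTr (@kconj k gT Y W) P [set: gT] (t P \oc u P).
  apply: kfix_lift => x Gx; rewrite (rho_sum (kconjP _ _)); apply: eq_bigr => P PF.
  apply: (gTr_fix _ Gx) => y Py; have [fu _] := uP P PF.
  by rewrite kconj_comp fu // (ft P).
exists h; apply: kres_inj; rewrite kresM hE gE oc_suml; apply: eq_bigr => P PF.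
by have [_ ui] := uP P PF; rewrite gTr_comp -ocA ui oc1r.
Qed.
End PermutationTensor.

(** * The Frobenius structure *)

Section Contractible.
Variables (k : idomainType) (gT : finGroupType).
Local Notation A := (galg k gT).
Implicit Types (X Y Z : complex A) (M : int -> lmodType A).

Definition tmono X Y (i : chmap X Y) : Prop :=
  forall n, exists r : {linear Y n -> X n}, forall x, r (i n x) = x.
Definition tepi Y Z (p : chmap Y Z) : Prop :=
  forall n, exists s : {linear Z n -> Y n}, forall z, p n (s z) = z.

Section Cone.
Variable M : int -> lmodType A.

(** The contractible complex on the family [M]. A map into it amounts to arbitrary maps to the
    [M n], a map out of it to arbitrary maps from the [M (n + 1)]; so it is both injective and
    projective for term split sequences. *)
Program Definition cone : complex A :=
  @mk_complex A (fun n => (M n * M (n + 1))%type : lmodType A) (fun n u => (u.2, 0)) _ _.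
Next Obligation. by move=> a u v; apply: injective_projections; rewrite /= ?scaler0 ?addr0. Qed.

Lemma cone_into X (al : forall n, {linear X n -> M n}) :
  exists h : chmap X cone, forall n x, h n x = (al n x, al (n + 1) (cd X n x)).
Proof.
pose h n (x : X n) : cone n := (al n x, al (n + 1) (cd X n x)).
have hl n : linear (h n).
  by move=> a x y; apply: injective_projections; rewrite /= !linearP.
have hd n x : h (n + 1) (cd X n x) = cd cone n (h n x).
  by rewrite /h cdd linear0.
by exists (mk_chmap hl hd).
Qed.

Lemma cone_into_eq X (h h' : chmap X cone) : (forall n x, (h n x).1 = (h' n x).1) -> h = h'.
Proof.
move=> E; apply: chmap_ext => n x; apply: injective_projections; first exact: E.
have := E (n + 1) (cd X n x); rewrite !chd; exact.
Qed.

Lemma cone_inj X Y (i : chmap X Y) (h : chmap X cone) : tmono i -> exists g : chmap Y cone, g \oc i = h.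
Proof.
move=> ti; pose r n := projT1 (cid (ti n)); have rE n x : r n (i n x) = x := projT2 (cid (ti n)) x.
have al_ex n : exists a : {linear X n -> M n}, forall x, a x = (h n x).1.
  by apply: mk_linear => c x y; rewrite linearP.
pose al n := projT1 (cid (al_ex n)); have alE n x : al n x = (h n x).1 := projT2 (cid (al_ex n)) x.
have [g gE] := cone_into (fun n => al n \o r n : {linear Y n -> M n}).
exists g; apply: cone_into_eq => n x; rewrite ocE gE /= rE; exact: alE.
Qed.

(** Every degree is a successor, but only up to the equation [n - 1 + 1 = n]. The family is
    transported along it, and uniqueness of equality proofs on integers removes the transport. *)
Lemma succ_family (U : int -> lmodType A) (phi : forall n, {linear M (n + 1) -> U (n + 1)}) :
  exists al : forall n, {linear M n -> U n}, forall n x, al (n + 1) x = phi n x.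
Proof.
pose al n : {linear M n -> U n} :=
  eq_rect (n - 1 + 1) (fun m => {linear M m -> U m}) (phi (n - 1)) n (subrK 1 n).
exists al => n x; rewrite /al.
suff H m (e : m + 1 = n + 1) : eq_rect (m + 1) (fun m => {linear M m -> U m}) (phi m) (n + 1) e = phi n.
  by rewrite H.
have mn : m = n by apply: (addIr 1).
by move: e; rewrite mn => e; rewrite (eq_irrelevance e erefl).
Qed.

Lemma cone_from Z (ga : forall n, {linear M (n + 1) -> Z n}) :
  exists h : chmap cone Z, forall n b, h n (0, b) = ga n b.
Proof.
have [al alE] := succ_family (fun n => cd Z n \o ga n : {linear M (n + 1) -> Z (n + 1)}).
pose h n (u : cone n) : Z n := al n u.1 + ga n u.2.
have hl n : linear (h n).
  by move=> a x y; rewrite /h /= !linearP scalerDr addrACA.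
have hd n u : h (n + 1) (cd cone n u) = cd Z n (h n u).
  rewrite /h /= linear0 addr0 linearD alE /=.
  suff -> : cd Z n (al n u.1) = 0 by rewrite add0r.
  move: (u.1); rewrite -[n](subrK 1) => a; rewrite alE /=; exact: cdd.
by exists (mk_chmap hl hd) => n b; rewrite /= /h linear0 add0r.
Qed.

Lemma cone_from_eq Z (h h' : chmap cone Z) : (forall n b, h n (0, b) = h' n (0, b)) -> h = h'.
Proof.
move=> E; apply: chmap_ext => n [a b].
have -> : ((a, b) : cone n) = (a, 0) + (0, b) by apply: injective_projections; rewrite /= ?addr0 ?add0r.
rewrite !linearD E; congr (_ + _).
move: a {b}; rewrite -[n](subrK 1) => a.
have -> : ((a, 0) : cone (n - 1 + 1)) = cd cone (n - 1) (0, a) by [].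
by rewrite !chd E.
Qed.

Lemma cone_proj Y Z (p : chmap Y Z) (h : chmap cone Z) : tepi p -> exists g : chmap cone Y, p \oc g = h.
Proof.
move=> tp; pose s n := projT1 (cid (tp n)); have sE n x : p n (s n x) = x := projT2 (cid (tp n)) x.
have ga_ex n : exists a : {linear M (n + 1) -> Y n}, forall b, a b = s n (h n (0, b)).
  apply: mk_linear => c x y; rewrite -linearP -linearP; congr (s n (h n _)).
  by apply: injective_projections; rewrite /= ?scaler0 ?addr0.
pose ga n := projT1 (cid (ga_ex n)); have gaE n b : ga n b = s n (h n (0, b)) := projT2 (cid (ga_ex n)) b.
have [g gE] := cone_from ga.
exists g; apply: cone_from_eq => n b; rewrite ocE gE gaE; exact: sE.
Qed.
End Cone.

Lemma cone_hull X : exists i : chmap X (cone X), tmono i.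
Proof.
have [i iE] := @cone_into X X (fun n => idfun).
exists i => n.
have [r rE] : exists r : {linear cone X n -> X n}, forall u, r u = u.1.
  by apply: mk_linear => a u v.
by exists r => x; rewrite rE iE.
Qed.

Definition shifted X (n : int) : lmodType A := X (n - 1).

Lemma cone_cover X : exists q : chmap (cone (shifted X)) X, tepi q.
Proof.
pose to n : {linear X n -> shifted X (n + 1)} :=
  eq_rect n (fun m => {linear X n -> X m}) idfun _ (esym (addrK 1 n)).
pose fr n : {linear shifted X (n + 1) -> X n} :=
  eq_rect n (fun m => {linear X m -> X n}) idfun _ (esym (addrK 1 n)).
have toK n x : fr n (to n x) = x.
  by rewrite /fr /to /shifted; move: (n + 1 - 1) (esym _) => m e; destruct e.
have [q qE] := cone_from fr.
exists q => n.
have [s sE] : exists s : {linear X n -> cone (shifted X) n}, forall x, s x = (0, to n x).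
  apply: mk_linear => a x y; apply: injective_projections; rewrite /= ?scaler0 ?addr0 //.
  by rewrite linearP.
by exists s => x; rewrite sE qE toK.
Qed.
End Contractible.

Section AdjunctionExtension.
Variables (R S : pzRingType) (a : adjunction R S).

Lemma adj_extend X Y W (i : chmap X Y) (h : chmap X (aG a W)) :
  (exists g', g' \oc aFm a i = ac a W \oc aFm a h) -> exists g, g \oc i = h.
Proof.
move=> [g' gE]; exists (aGm a g' \oc au a Y).
by rewrite -ocA au_nat ocA -aGM gE aGM -ocA -au_nat ocA au_ac oc1l.
Qed.

Lemma adj_lift Y Z W (p : chmap Y Z) (h : chmap (aF a W) Z) :
  (exists g', aGm a p \oc g' = aGm a h \oc au a W) -> exists g, p \oc g = h.
Proof.
move=> [g' gE]; exists (ac a Y \oc aFm a g').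
by rewrite ocA ac_nat -ocA -aFM gE aFM ocA -ac_nat -ocA ac_au oc1r.
Qed.
End AdjunctionExtension.

Section TermSplitting.
Variables (R : pzRingType).
Implicit Types X Y Z : complex R.

Lemma term_split_of_mono X Y Z (i : chmap X Y) (p : chmap Y Z) : exact_seq i p ->
  (forall n, exists r : {linear Y n -> X n}, forall x, r (i n x) = x) -> term_split_seq i p.
Proof.
move=> E H n; have [r rE] := H n; have [inj ker sur] := E n.
pose y z := projT1 (cid (sur z)); have yE z : p n (y z) = z := projT2 (cid (sur z)).
have pi x : p n (i n x) = 0 by apply/ker; exists x.
have kE u v : p n u = p n v -> u - i n (r u) = v - i n (r v).
  move=> uv; have /ker[x xE] : p n (u - v) = 0 by rewrite linearB uv subrr.
  have -> : r u = x + r v by rewrite -(subrK v u) -xE linearD rE.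
  have -> : i n (x + r v) = i n x + i n (r v) by exact: linearD.
  by rewrite xE opprD opprB [u + _]addrA [u + _]addrC subrK.
have [s sE] : exists s : {linear Z n -> Y n}, forall z, s z = y z - i n (r (y z)).
  apply: mk_linear => c u v.
  rewrite -(kE (c *: y u + y v)); last by rewrite linearP !yE.
  have -> : i n (r (c *: y u + y v)) = c *: i n (r (y u)) + i n (r (y v)) by rewrite !linearP.
  by rewrite scalerBr opprD addrACA.
exists r, s; split=> // [z|u]; first by rewrite sE linearB yE pi subr0.
by rewrite sE (kE (y (p n u)) u) ?yE // addrC subrK.
Qed.

Lemma term_split_of_epi X Y Z (i : chmap X Y) (p : chmap Y Z) : exact_seq i p ->
  (forall n, exists s : {linear Z n -> Y n}, forall z, p n (s z) = z) -> term_split_seq i p.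
Proof.
move=> E H; apply: term_split_of_mono => // n; have [s sE] := H n; have [inj ker sur] := E n.
have ex y : exists x, i n x = y - s (p n y) by apply/ker; rewrite linearB sE subrr.
pose r y := projT1 (cid (ex y)); have rE y : i n (r y) = _ := projT2 (cid (ex y)).
have [r' r'E] : exists r' : {linear Y n -> X n}, forall y, r' y = r y.
  apply: mk_linear => c u v; apply: inj; rewrite linearP !rE.
  have -> : s (p n (c *: u + v)) = c *: s (p n u) + s (p n v) by rewrite !linearP.
  by rewrite scalerBr opprD addrACA.
exists r' => x; apply: inj; rewrite r'E rE.
have -> : p n (i n x) = 0 by apply/ker; exists x.
by rewrite linear0 subr0.
Qed.
End TermSplitting.

(** * Hulls and covers for the split classes *)

Section SplitClasses.
Variables (k : idomainType) (F : fieldType) (r : {rmorphism k -> F}).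
Hypothesis rP : forall x, (r x == 0) = (x \isn't a GRing.unit).
Variables (gT : finGroupType) (C : complex_cat k gT).
Variables (I : finType) (B : kbasis (cc_V C) I).
Local Notation A := (galg k gT).
Local Notation V := (cc_V C).
Local Notation T := (dtens_ch V).
Local Notation TO := (dtens_cx V).
Implicit Types (X Y Z W : complex A) (c : split_class).
Local Notation aD := (adj_dual (@dual_basis_pair k gT V I B)).
Local Notation aE := (adj_dual (@dual_basis_pair_sym k gT V I B)).

(** A splitting of an exact sequence is determined by either end. Described by one map, the classes
    become stable under cancellation of a factor. *)
Definition c_mono c X Y (i : chmap X Y) : Prop :=
  match c with
  | TermSplit => tmono i
  | VSplit => exists q, q \oc T i = chid _
  | VTermSplit => tmono (T i)
  | TermVSplit => tmono i /\ exists q, q \oc T i = chid _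
  end.

Definition c_epi c Y Z (p : chmap Y Z) : Prop :=
  match c with
  | TermSplit => tepi p
  | VSplit => exists s, T p \oc s = chid _
  | VTermSplit => tepi (T p)
  | TermVSplit => tepi p /\ exists s, T p \oc s = chid _
  end.

Lemma in_class_c_mono c X Y Z (i : chmap X Y) (p : chmap Y Z) : exact_seq i p ->
  (in_class C c i p <-> c_mono c i).
Proof.
move=> E; have VE := kbasis_exact B E; rewrite /in_class /c_mono.
have ts X' Y' Z' (i' : chmap X' Y') (p' : chmap Y' Z') : exact_seq i' p' -> term_split_seq i' p' <-> tmono i'.
  move=> E'; split=> [H n|]; last exact: term_split_of_mono.
  by have [q [s [qE _ _]]] := H n; exists q.
have sp : split_seq (T i) (T p) <-> exists q, q \oc T i = chid _.
  split=> [[q [s [/chmap_ext qE _ _]]]|[q qE]]; first by exists q.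
  exact: split_of_retraction VE qE.
by case: c; rewrite ?ts //; intuition.
Qed.

Lemma in_class_c_epi c X Y Z (i : chmap X Y) (p : chmap Y Z) : exact_seq i p ->
  (in_class C c i p <-> c_epi c p).
Proof.
move=> E; have VE := kbasis_exact B E; rewrite /in_class /c_epi.
have ts X' Y' Z' (i' : chmap X' Y') (p' : chmap Y' Z') : exact_seq i' p' -> term_split_seq i' p' <-> tepi p'.
  move=> E'; split=> [H n|]; last exact: term_split_of_epi.
  by have [q [s [_ sE _]]] := H n; exists s.
have sp : split_seq (T i) (T p) <-> exists s, T p \oc s = chid _.
  split=> [[q [s [_ /chmap_ext sE _]]]|[s sE]]; first by exists s.
  exact: split_of_section VE sE.
by case: c; rewrite ?ts //; intuition.
Qed.

Lemma tmono_cancel X Y Z (i : chmap X Y) (q : chmap Y Z) : tmono (q \oc i) -> tmono i.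
Proof. by move=> H n; have [s sE] := H n; exists (s \o q n) => x; apply: sE. Qed.

Lemma tepi_cancel X Y Z (i : chmap X Y) (q : chmap Y Z) : tepi (q \oc i) -> tepi q.
Proof. by move=> H n; have [s sE] := H n; exists (i n \o s) => x; apply: sE. Qed.

Lemma c_mono_cancel c X Y Z (i : chmap X Y) (q : chmap Y Z) : c_mono c (q \oc i) -> c_mono c i.
Proof.
have sp : (exists s, s \oc T (q \oc i) = chid _) -> exists s, s \oc T i = chid _.
  by move=> [s]; rewrite dtens_chM ocA => sE; exists (s \oc T q).
case: c => //=; first exact: tmono_cancel.
  by rewrite dtens_chM; apply: tmono_cancel.
by move=> [H1 H2]; split; [apply: tmono_cancel H1 | apply: sp].
Qed.

Lemma c_epi_cancel c X Y Z (i : chmap X Y) (q : chmap Y Z) : c_epi c (q \oc i) -> c_epi c q.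
Proof.
have sp : (exists s, T (q \oc i) \oc s = chid _) -> exists s, T q \oc s = chid _.
  by move=> [s]; rewrite dtens_chM -ocA => sE; exists (T i \oc s).
case: c => //=; first exact: tepi_cancel.
  by rewrite dtens_chM; apply: tepi_cancel.
by move=> [H1 H2]; split; [apply: tepi_cancel H1 | apply: sp].
Qed.

Definition c_inj c K := forall X Y (i : chmap X Y) (h : chmap X K), c_mono c i -> exists g, g \oc i = h.
Definition c_proj c K := forall Y Z (p : chmap Y Z) (h : chmap K Z), c_epi c p -> exists g, p \oc g = h.

Lemma c_proj_class c K : in_cat C K -> c_proj c K -> class_projective C c K.
Proof.
move=> cK pK; apply/class_projectiveP; split=> // X Y Z i p h _ _ _ ip.
by apply: pK; apply/(in_class_c_epi c (proj1 ip)).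
Qed.

Lemma dtens_cat (U : lmodType A) (J : finType) (D : kbasis U J) X : in_cat C X -> in_cat C (dtens_cx U X).
Proof.
move=> cX; apply: (in_cat_kjoint rP (C' := C) (X := fun _ : J => X) (phi := fun j => bd D X j)) => // n u u0.
have -> : u = (chid (kx (dtens_cx U X))) n u by [].
by rewrite -(bw_bd D) ch_sumE big1 // => j _; rewrite ocE u0 linear0.
Qed.

Lemma cone_cat (M : int -> lmodType A) : ccat C (fun n => rest (in_alg A) (M n)) -> in_cat C (cone M).
Proof.
move=> cM; apply/(in_catE rP).
have f1 n : exists f : {linear kx (cone M) n -> rest (in_alg A) (M n)}, forall u : cone M n, f u = u.1.
  by apply: mk_linear => a u v.
have f2 n : exists f : {linear kx (cone M) n -> rest (in_alg A) (M (n + 1))}, forall u : cone M n, f u = u.2.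
  by apply: mk_linear => a u v.
pose E (b : bool) n : lmodType k := if b then (rest (in_alg A) (M n) : lmodType k) else rest (in_alg A) (M (n + 1)).
pose phi b n : {linear kx (cone M) n -> E b n} :=
  match b with true => projT1 (cid (f1 n)) | false => projT1 (cid (f2 n)) end.
apply: (gcat_joint (phi := phi)) => [[]|n u u0] //.
  exact: gcat_shift 1 cM.
apply: injective_projections.
  by have := u0 true; rewrite /phi (projT2 (cid (f1 n))).
by have := u0 false; rewrite /phi (projT2 (cid (f2 n))).
Qed.

Lemma cone_self_cat X : in_cat C X -> in_cat C (cone X).
Proof. by move=> /(in_catE rP) cX; apply: cone_cat. Qed.

Lemma cone_shifted_cat X : in_cat C X -> in_cat C (cone (shifted X)).
Proof. by move=> /(in_catE rP) cX; apply: cone_cat; apply: gcat_shift (-1) cX. Qed.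

(** Transposing along the adjunction of [V (x) -] with its dual moves the extension problem to
    [V (x) i], which has a retraction. *)
Lemma T_inj_split W : c_inj VSplit (dtens_cx (kdual_of B) W).
Proof.
move=> X Y i h [q qE]; refine (@adj_extend A A aD X Y W i h _).
pose E := ev (@dual_basis_pair k gT V I B) W \oc T h.
by exists (E \oc q); transitivity (E \oc (q \oc T i)); [rewrite ocA | rewrite qE oc1r].
Qed.

Lemma T_proj_split W : c_proj VSplit (dtens_cx (kdual_of B) W).
Proof.
move=> Y Z p h [s sE]; refine (@adj_lift A A aE Y Z W p h _).
pose E := T h \oc coev (@dual_basis_pair_sym k gT V I B) W.
by exists (s \oc E); transitivity (T p \oc s \oc E); [rewrite ocA | rewrite sE oc1l].
Qed.

Lemma T_cone_inj M : c_inj VTermSplit (dtens_cx (kdual_of B) (cone M)).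
Proof.
move=> X Y i h ti; refine (@adj_extend A A aD X Y (cone M) i h _).
exact: cone_inj ti.
Qed.

Lemma T_cone_proj M : c_proj VTermSplit (dtens_cx (kdual_of B) (cone M)).
Proof.
move=> Y Z p h tp; refine (@adj_lift A A aE Y Z (cone M) p h _).
exact: cone_proj tp.
Qed.

Lemma c_inj_biprod K L : c_inj TermSplit K -> c_inj VSplit L -> c_inj TermVSplit (biprod K L).
Proof.
move=> iK iL X Y i h [ti si].
have [g1 g1E] := iK X Y i (bp1 K L \oc h) ti; have [g2 g2E] := iL X Y i (bp2 K L \oc h) si.
exists (bi1 K L \oc g1 + bi2 K L \oc g2).
by rewrite ocDl -!ocA g1E g2E !ocA -ocDl biprod1 oc1l.
Qed.

Lemma c_proj_biprod K L : c_proj TermSplit K -> c_proj VSplit L -> c_proj TermVSplit (biprod K L).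
Proof.
move=> iK iL Y Z p h [ti si].
have [g1 g1E] := iK Y Z p (h \oc bi1 K L) ti; have [g2 g2E] := iL Y Z p (h \oc bi2 K L) si.
exists (g1 \oc bp1 K L + g2 \oc bp2 K L).
by rewrite ocDr !ocA g1E g2E -!ocA -ocDr biprod1 oc1r.
Qed.

(** For [VSplit] the hull is the unit from [X] to the dual of [V] tensored with [V (x) X]: a
    triangle identity splits it after tensoring with [V]. Term splitting is obtained from
    contractible complexes, and the mixed class from a sum. These objects are projective, yet serve
    as hulls; [class_cover] is dual. *)
Lemma class_hull c X : in_cat C X ->
  exists K (i : chmap X K), [/\ in_cat C K, c_proj c K & c_mono c i].
Proof.
move=> cX; have [i1 i1E] := cone_hull X.
have cT W : in_cat C W -> in_cat C (dtens_cx (kdual_of B) W) by apply: dtens_cat (dual_basis B) _.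
have cV W : in_cat C W -> in_cat C (TO W) by apply: dtens_cat B _.
have P1 : c_proj TermSplit (cone X) by move=> Y Z p h; apply: cone_proj.
have s2 : ac aD (TO X) \oc T (au aD X) = chid _ by exact: (ac_au aD X).
case: c.
- by exists (cone X), i1; split=> //; exact: cone_self_cat.
- exists (dtens_cx (kdual_of B) (TO X)), (au aD X); split; [by apply/cT/cV | exact: T_proj_split |].
  by exists (ac aD (TO X)).
- have [j jE] := cone_hull (TO X).
  exists (dtens_cx (kdual_of B) (cone (TO X))), (aGm aD j \oc au aD X); split.
  + by apply/cT/cone_self_cat/cV.
  + exact: T_cone_proj.
  apply: (tmono_cancel (q := ac aD (cone (TO X)))); rewrite dtens_chM ocA.
  have -> : ac aD (cone (TO X)) \oc T (aGm aD j) = j \oc ac aD (TO X) by exact: (esym (ac_nat aD j)).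
  by rewrite -ocA s2 oc1r.
exists (biprod (cone X) (dtens_cx (kdual_of B) (TO X))), (bi1 _ _ \oc i1 + bi2 _ _ \oc au aD X); split.
- by apply: (in_cat_biprod rP); [exact: cone_self_cat | apply/cT/cV].
- by apply: c_proj_biprod => //; exact: T_proj_split.
split.
  apply: (tmono_cancel (q := bp1 _ _)); rewrite ocDr !ocA bp11 bp12 oc1l oc0l addr0; exact: i1E.
exists (ac aD (TO X) \oc T (bp2 _ _)).
by rewrite -ocA -dtens_chM ocDr !ocA bp21 bp22 oc1l oc0l add0r.
Qed.

Lemma class_cover c X : in_cat C X ->
  exists K (q : chmap K X), [/\ in_cat C K, c_inj c K & c_epi c q].
Proof.
move=> cX; have [q1 q1E] := cone_cover X.
have cT W : in_cat C W -> in_cat C (dtens_cx (kdual_of B) W) by apply: dtens_cat (dual_basis B) _.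
have cV W : in_cat C W -> in_cat C (TO W) by apply: dtens_cat B _.
have P1 : c_inj TermSplit (cone (shifted X)) by move=> Y Z p h; apply: cone_inj.
have s2 : T (ac aE X) \oc au aE (TO X) = chid _ by exact: (au_ac aE X).
case: c.
- by exists (cone (shifted X)), q1; split=> //; exact: cone_shifted_cat.
- exists (dtens_cx (kdual_of B) (TO X)), (ac aE X); split; [by apply/cT/cV | exact: T_inj_split |].
  by exists (au aE (TO X)).
- have [j jE] := cone_cover (TO X).
  exists (dtens_cx (kdual_of B) (cone (shifted (TO X)))), (ac aE X \oc aFm aE j); split.
  + by apply/cT/cone_shifted_cat/cV.
  + exact: T_cone_inj.
  apply: (tepi_cancel (i := au aE (cone (shifted (TO X))))); rewrite dtens_chM -ocA.
  have -> : T (aFm aE j) \oc au aE (cone (shifted (TO X))) = au aE (TO X) \oc j by exact: (esym (au_nat aE j)).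
  by rewrite ocA s2 oc1l.
exists (biprod (cone (shifted X)) (dtens_cx (kdual_of B) (TO X))), (q1 \oc bp1 _ _ + ac aE X \oc bp2 _ _); split.
- by apply: (in_cat_biprod rP); [exact: cone_shifted_cat | apply/cT/cV].
- by apply: c_inj_biprod => //; exact: T_inj_split.
split.
  apply: (tepi_cancel (i := bi1 _ _)); rewrite ocDl -!ocA bp11 bp21 oc1r oc0r addr0; exact: q1E.
exists (T (bi2 _ _) \oc au aE (TO X)).
by rewrite ocA -dtens_chM ocDl -!ocA bp12 bp22 oc1r oc0r add0r.
Qed.
End SplitClasses.

(** * The exact structure [S] and stably zero maps *)

Section Frobenius.
Variables (k : idomainType) (F : fieldType) (r : {rmorphism k -> F}).
Hypothesis rP : forall x, (r x == 0) = (x \isn't a GRing.unit).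
Variables (gT : finGroupType) (C : complex_cat k gT) (Fam : {set {group gT}}).
Hypotheses (hV : fin_free (cc_V C)) (nd : S_nondegenerate C Fam).
Variable e : galg k gT.
Hypothesis he : central_idempotent e.
Local Notation A := (galg k gT).
Local Notation VF := (perm_module k Fam).
Local Notation T := (dtens_ch VF).
Local Notation TO := (dtens_cx VF).
Local Notation sz := (szero C (in_fam Fam)).
Implicit Types (X Y Z W : complex A) (c : split_class).

Definition S_mono X Y (i : chmap X Y) : Prop :=
  (exists rho, rho \oc T i = chid _) /\ (if cc_htpy C is Some c then c_mono C c i else True).

Lemma S_mono_cancel X Y Z (i : chmap X Y) (q : chmap Y Z) : S_mono (q \oc i) -> S_mono i.
Proof.
move=> [[rho rE] cm]; split; first by exists (rho \oc T q); rewrite -ocA -dtens_chM.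
by move: cm; case: cc_htpy => // c; apply: c_mono_cancel.
Qed.

Lemma VF_exact X Y Z (i : chmap X Y) (p : chmap Y Z) : exact_seq i p -> exact_seq (T i) (T p).
Proof. by have [I [B _]] := perm_module_basis k Fam; move=> E; exact: (kbasis_exact B E). Qed.

Lemma in_S_mono (X Y Z : StableCat C Fam e) (i : chmap X Y) (p : chmap Y Z) :
  in_S i p <-> exact_seq i p /\ S_mono i.
Proof.
have [n [B]] := fin_free_kbasis hV.
split=> [[E [rho [s [/chmap_ext rE _ _]]] cl]|[E [[rho rE] cm]]].
  split=> //; split; first by exists rho.
  by move: cl => /=; case: cc_htpy => // c /(in_class_c_mono B c E).
split=> //; first exact: split_of_retraction (VF_exact E) rE.
by move: cm => /=; case: cc_htpy => // c /(in_class_c_mono B c E).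
Qed.

(** For empty [Fam] the module [VF] is zero, and being split after tensoring with it says nothing;
    injectivity then comes from the class, by [S_nondegenerate]. *)
Lemma nd_mono c X Y (i : chmap X Y) : cc_htpy C = Some c -> Fam = finset.set0 ->
  c_mono C c i -> forall n, injective (i n).
Proof.
move=> hc F0; have [N [B]] := fin_free_kbasis hV.
have tm X' Y' (i' : chmap X' Y') : tmono i' -> forall n, injective (i' n).
  by move=> H n; have [q qE] := H n; apply: can_inj qE.
have Vm : (exists v : cc_V C, v != 0) -> (forall n, injective (dtens_ch (cc_V C) i n)) -> forall n, injective (i n).
  move=> [v v0] inj n x y xy.
  have [j _] : exists j : 'I_N, True.
    case: N B => [|N] B; last by exists ord0.
    by case/eqP: v0; rewrite (kb_sum B v) big_ord0.
  have E : dt (kbv B j) x = dt (kbv B j) y by apply: inj; rewrite !dtens_chE xy.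
  have K (z : X n) : bd B X j n (dt (kbv B j) z) = z.
    transitivity ((bd B X j \oc bw B X j) n z); [by [] | by rewrite bd_bw eqxx].
  by rewrite -[x]K -[y]K E.
have nd' : match c return Prop with VSplit | VTermSplit => exists v : cc_V C, v != 0 | _ => True end.
  by case: nd => [|]; rewrite ?F0 ?eqxx // hc; case: (c).
case: c {hc} nd' => nd' /= H.
- exact: tm.
- case: H => q qE; apply: Vm => // n; apply: (can_inj (g := q n)) => u.
  transitivity ((q \oc dtens_ch (cc_V C) i) n u); [by [] | by rewrite qE].
- by apply: Vm => //; apply: tm H.
by apply: tm (proj1 H).
Qed.

Lemma nd_epi c X Y (p : chmap X Y) : cc_htpy C = Some c -> Fam = finset.set0 ->
  c_epi C c p -> forall n y, exists x, p n x = y.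
Proof.
move=> hc F0; have [N [B]] := fin_free_kbasis hV.
have tm X' Y' (p' : chmap X' Y') : tepi p' -> forall n y, exists x, p' n x = y.
  by move=> H n y; have [q qE] := H n; exists (q y).
have Vm : (exists v : cc_V C, v != 0) -> (forall n u, exists w, dtens_ch (cc_V C) p n w = u) ->
    forall n y, exists x, p n x = y.
  move=> [v v0] sur n y.
  have [j _] : exists j : 'I_N, True.
    case: N B => [|N] B; last by exists ord0.
    by case/eqP: v0; rewrite (kb_sum B v) big_ord0.
  have [w wE] := sur n (dt (kbv B j) y); exists (bd B X j n w).
  transitivity ((kres p \oc bd B X j) n w); first by [].
  rewrite -bd_nat ocE [X in bd B Y j n X]wE.
  transitivity ((bd B Y j \oc bw B Y j) n y); [by [] | by rewrite bd_bw eqxx].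
have nd' : match c return Prop with VSplit | VTermSplit => exists v : cc_V C, v != 0 | _ => True end.
  by case: nd => [|]; rewrite ?F0 ?eqxx // hc; case: (c).
case: c {hc} nd' => nd' /= H.
- exact: tm.
- case: H => q qE; apply: Vm => // n u; exists (q n u).
  transitivity ((dtens_ch (cc_V C) p \oc q) n u); [by [] | by rewrite qE].
- by apply: Vm => //; apply: tm H.
by apply: tm (proj1 H).
Qed.

(** In a homotopy category [J] is [VF (x) X] plus a class hull of [X]. The identity of the first
    summand is a trace and the second is projective for the class, so [1_J] is stably zero; the two
    components provide the two splitting conditions. *)
Lemma S_hull0 X : in_cat C X -> exists J (i : chmap X J),
  [/\ in_cat C J, sz (chid J), S_mono i & forall n, injective (i n)].
Proof.
move=> cX; have [I [B [act [actA actE actS actP]]]] := perm_module_basis k Fam.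
have [eta [[m mE] etaI]] := tens_hull actA actE actP X.
have zT : sz (chid (TO X)) by apply: (szero_trace rP); apply: tens_trace actA actE actS X.
have cT : in_cat C (TO X) := dtens_cat rP B cX.
have Fne : Fam != finset.set0 -> exists P, P \in Fam by move/set0Pn.
case hc : (cc_htpy C) => [c|]; last first.
  exists (TO X), eta; split=> //; first by split; [exists m | rewrite hc].
  by apply/etaI/Fne; case: nd => //; rewrite hc.
have [N [D]] := fin_free_kbasis hV.
have [K [i [cK pK mi]]] := class_hull rP D c cX.
exists (biprod (TO X) K), (bi1 _ _ \oc eta + bi2 _ _ \oc i).
have p1 : bp1 _ _ \oc (bi1 (TO X) K \oc eta + bi2 _ _ \oc i) = eta.
  by rewrite ocDr !ocA bp11 bp12 oc1l oc0l addr0.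
have p2 : bp2 _ _ \oc (bi1 (TO X) K \oc eta + bi2 _ _ \oc i) = i.
  by rewrite ocDr !ocA bp21 bp22 oc1l oc0l add0r.
split.
- exact: in_cat_biprod.
- rewrite -biprod1; apply: (szeroD rP).
    by rewrite -[bi1 _ _]oc1r; apply/szero_compr/szero_compl.
  apply: szero_cz; rewrite /cz hc; exists K; first exact: (c_proj_class D cK pK).
  by exists (bp2 _ _), (bi2 _ _).
- split; first by exists (m \oc T (bp1 _ _)); rewrite -ocA -dtens_chM p1.
  by rewrite hc; apply: (c_mono_cancel (q := bp2 _ _)); rewrite p2.
move=> n x y xy; have [F0|/Fne/etaI inj] := eqVneq Fam finset.set0.
  by apply: (nd_mono hc F0 mi); rewrite -p2 !ocE xy.
by apply: (inj n); rewrite -p1 !ocE xy.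
Qed.

Lemma S_hull X : in_cat C X -> in_block e X -> exists J (i : chmap X J),
  [/\ in_cat C J, in_block e J, sz (chid J), S_mono i & forall n, injective (i n)].
Proof.
move=> cX bX; have [J [i [cJ zJ mi inj]]] := S_hull0 cX.
have E : trunc_in he J \oc (trunc_pr he J \oc i) = i.
  by rewrite ocA trunc_inpr -cact_nat cact_block // oc1r.
exists (trunc_cx he J), (trunc_pr he J \oc i); split.
- exact: trunc_cat.
- exact: trunc_block.
- rewrite -(trunc_prin he) -[trunc_pr he J]oc1r.
  by apply: szero_compr; apply: szero_compl.
- by apply: (S_mono_cancel (q := trunc_in he J)); rewrite E.
by move=> n x y xy; apply: (inj n); rewrite -E !ocE [X in trunc_in he J n X]xy.
Qed.

(** The trace part extends by [trace_extends]. For the rest it suffices to extend a map to a class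
    projective [P]. Such a [P] is a retract of [VF (x) P] plus a class injective complex, and on the
    first summand the identity is a trace. *)
Lemma S_mono_extends X Y W (i : chmap X Y) (g : chmap X W) : S_mono i -> sz g ->
  exists h : chmap Y W, h \oc i = g.
Proof.
move=> [[rho rE] cm] [g' tg zg].
have [I [B [act [actA actE actS actP]]]] := perm_module_basis k Fam.
have ext W' (g0 : chmap X W') : ktrace (in_fam Fam) g0 -> exists h, h \oc i = g0.
  by move=> tg0; exact: (trace_extends actA actE actP rE tg0).
suff [h2 h2E] : exists h, h \oc i = g - g'.
  by have [h1 h1E] := ext W g' tg; exists (h1 + h2); rewrite ocDl h1E h2E addrC subrK.
move: zg; rewrite /cz; case hc: (cc_htpy C) => [c|]; last by move->; exists 0; rewrite oc0l.
rewrite hc in cm; move=> [P pP [u [v ->]]].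
suff [h hE] : exists h, h \oc i = u by exists (v \oc h); rewrite -ocA hE.
have [N [D]] := fin_free_kbasis hV; have cP : in_cat C P := proj1 pP.
have [q1 [[s sE] qS]] := tens_cover actA actE actP P.
have [K [q2 [cK iK eq2]]] := class_cover rP D c cP.
(* The second component puts the kernel sequence of [q] in the class; surjectivity comes from [q1]
   when [Fam] is nonempty and from [q2] otherwise. *)
pose q := q1 \oc bp1 (TO P) K + q2 \oc bp2 _ _.
have qi1 : q \oc bi1 _ _ = q1 by rewrite /q ocDl -!ocA bp11 bp21 oc1r oc0r addr0.
have qi2 : q \oc bi2 _ _ = q2 by rewrite /q ocDl -!ocA bp12 bp22 oc1r oc0r add0r.
have qsur n y : exists x, q n x = y.
  have [F0|/set0Pn Fne] := eqVneq Fam finset.set0.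
    by have [x <-] := @nd_epi c K P q2 hc F0 eq2 n y; exists (bi2 _ _ n x); rewrite -qi2.
  by have [x <-] := qS Fne n y; exists (bi1 _ _ n x); rewrite -qi1.
have [L [j jE]] := ker_exact qsur.
have cB : in_cat C (biprod (TO P) K) by apply: (in_cat_biprod rP) => //; exact: (dtens_cat rP B cP).
have cL : in_cat C L := in_cat_exact1 rP jE cB.
have icl : in_class C c j q.
  by apply/(in_class_c_epi D c jE); apply: (c_epi_cancel (i := bi2 _ _)); rewrite qi2.
have [w wE] := (proj2 ((class_projectiveP C c P).1 pP)) _ _ _ _ _ (chid P) cL cB cP icl.
have [h1 h1E] : exists h, h \oc i = bp1 _ _ \oc w \oc u.
  apply: ext; rewrite -[_ \oc w]oc1l -[_ \oc (_ \oc w) \oc u]ocA.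
  by apply: ktrace_compr; apply: tens_trace actA actE actS P.
have [h2 h2E] := iK _ _ i (bp2 _ _ \oc w \oc u) cm.
exists (q1 \oc h1 + q2 \oc h2).
by rewrite ocDl -!ocA h1E h2E !ocA -!ocDl -/q wE oc1l.
Qed.

(** The test map is a hull [j] of [X]: it extends along [i], and being [S_mono] passes from the
    composite [j] to its first factor [i]. *)
Lemma S_mono_of_extends X Y (i : chmap X Y) : in_cat C X -> in_block e X ->
  (forall W (g : chmap X W), in_cat C W -> in_block e W -> sz g -> exists h : chmap Y W, h \oc i = g) ->
  S_mono i.
Proof.
move=> cX bX H; have [J [j [cJ bJ zJ mj _]]] := S_hull cX bX.
have [|h hE] := H J j cJ bJ; first by rewrite -[j]oc1l; apply: szero_compr.
by apply: (S_mono_cancel (q := h)); rewrite hE.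
Qed.

(** The hull of an injective [J] splits, so [1_J] factors through an object with stably zero
    identity. *)
Lemma S_injectiveP (J : StableCat C Fam e) : S_injective J <-> sz (chid J).
Proof.
split=> [iJ|zJ X Y Z i p /in_S_mono[E mi]]; last first.
  apply/(hom_to_exactP _ E) => h; apply: S_mono_extends => //.
  by rewrite -[h]oc1l; apply: szero_compr.
have cJ : in_cat C J := bc_cat J.
have bJ : in_block e J by exact: bc_block.
have [K [i [cK bK zK mi inj]]] := S_hull cJ bJ.
have [L [p E]] := coker_exact inj.
have cL : in_cat C L := in_cat_exact3 rP E cK.
have bL : in_block e L.
  move=> n z; have [_ _ sur] := E n; have [y <-] := sur z.
  by rewrite -linearZ bK.
have Ei : @in_S (StableCat C Fam e) J (BlockComplex cK bK) (BlockComplex cL bL) i p.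
  exact/in_S_mono.
have [h hE] := (hom_to_exactP J E).1 (iJ _ _ _ _ _ Ei) (chid J).
by rewrite -hE -[h]oc1r; apply/szero_compr/szero_compl.
Qed.
End Frobenius.

(** * Triangulations *)

(** Gathers what the triangulation argument uses of complexes and blocks, so that one proof serves
    for [B] and [b] and for both functors. *)
Record frobenius (T : stable_cat) (Z : ideal (sc_alg T)) : Prop := Frobenius {
  frS : forall (X Y L : T) (i : chmap X Y) (p : chmap Y L), in_S i p <->
    exact_seq i p /\ forall (W : T) (g : chmap X W), Z _ _ g -> exists h : chmap Y W, h \oc i = g;
  frJ : forall J : T, S_injective J <-> Z _ _ (chid J);
  frH : forall X : T, exists (J L : T) (i : chmap X J) (p : chmap J L), in_S i p /\ S_injective J;
  frD : forall X Y : T, exists (D : T) (i1 : chmap X D) (i2 : chmap Y D) (p1 : chmap D X) (p2 : chmap D Y),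
    [/\ p1 \oc i1 = chid _, p2 \oc i2 = chid _, p1 \oc i2 = 0, p2 \oc i1 = 0 &
        i1 \oc p1 + i2 \oc p2 = chid _] }.

Lemma is_pushoutP (T : stable_cat) (X Y I E : T) (i : chmap X I) (s : chmap X Y) (a : chmap I E) (b : chmap Y E) :
  is_pushout i s a b <-> a \oc i = b \oc s /\
  forall W (a' : chmap I W) (b' : chmap Y W), a' \oc i = b' \oc s ->
    exists h : chmap E W, [/\ h \oc a = a', h \oc b = b' &
      forall h' : chmap E W, h' \oc a = a' -> h' \oc b = b' -> h' = h].
Proof.
split=> [[/chmap_ext E1 H]|[E1 H]]; split; rewrite ?cheqE // => W a' b'.
  move=> E2; have [|h [/chmap_ext h1 /chmap_ext h2 h3]] := H W a' b'; first by rewrite cheqE.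
  by exists h; split=> // h' e1 e2; apply/chmap_ext/h3; rewrite cheqE.
move=> /chmap_ext E2; have [h [h1 h2 h3]] := H W a' b' E2.
exists h; rewrite !cheqE; split=> // h' /chmap_ext e1 /chmap_ext e2.
by rewrite cheqE; apply: h3.
Qed.

Section Cosyzygies.
Variables (T : stable_cat) (Z : ideal (sc_alg T)).
Hypotheses (hT : stable_ideal Z) (fr : frobenius Z).

Definition hull (X J L : T) (i : chmap X J) (p : chmap J L) : Prop := in_S i p /\ S_injective J.

(** [f'] is a value at [f] of the cosyzygy functor, for arbitrary hulls of source and target and not
    just those chosen by a shift. *)
Definition lifted (X J L X' J' L' : T) (i : chmap X J) (p : chmap J L)
    (i' : chmap X' J') (p' : chmap J' L') (f : chmap X X') (f' : chmap L L') : Prop :=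
  exists g : chmap J J', g \oc i = i' \oc f /\ f' \oc p = p' \oc g.

Lemma hull_exact (X J L : T) (i : chmap X J) (p : chmap J L) : hull i p -> exact_seq i p.
Proof. by case=> /(frS fr)[]. Qed.

Lemma inj_extends (X J L K : T) (i : chmap X J) (p : chmap J L) (f : chmap X K) :
  in_S i p -> Z _ _ (chid K) -> exists g : chmap J K, g \oc i = f.
Proof. by move=> /(frS fr)[_ H] zK; apply: H; rewrite -[f]oc1l; apply: izr. Qed.

Section Pair.
Variables (X J L X' J' L' : T) (i : chmap X J) (p : chmap J L) (i' : chmap X' J') (p' : chmap J' L').
Hypotheses (h : hull i p) (h' : hull i' p').

Lemma lift_factor (f : chmap X X') (g : chmap J J') : g \oc i = i' \oc f ->
  exists f' : chmap L L', f' \oc p = p' \oc g.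
Proof.
move=> gi; apply: (exact_factor (hull_exact h)).
by rewrite -ocA gi ocA (exact_comp0 (hull_exact h')) oc0l.
Qed.

Lemma lift_exists (f : chmap X X') : exists f', lifted i p i' p' f f'.
Proof.
have [g gi] := inj_extends (i' \oc f) h.1 ((frJ fr J').1 h'.2).
by have [f' f'p] := lift_factor gi; exists f', g.
Qed.

(** A stably zero [f] extends to [l] on [J]. Then [g - i' \oc l] vanishes on [X] and factors as
    [m \oc p], so [f' = p' \oc m] passes through the injective [J']. *)
Lemma lifted_iz f f' : lifted i p i' p' f f' -> Z _ _ f -> Z _ _ f'.
Proof.
move=> [g [gi f'p]] zf; have [l li] := ((frS fr i p).1 h.1).2 _ f zf.
have [m mp] : exists m : chmap L J', m \oc p = g - i' \oc l.
  by apply: (exact_factor (hull_exact h)); rewrite ocBl -ocA li gi subrr.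
have -> : f' = p' \oc m.
  apply: (exact_epi (hull_exact h)); rewrite f'p -ocA mp ocBr ocA.
  by rewrite (exact_comp0 (hull_exact h')) oc0l subr0.
by apply: izl; rewrite -[m]oc1l; apply: izr; exact: ((frJ fr J').1 h'.2).
Qed.

Lemma lifted_sub f f' g g' : lifted i p i' p' f f' -> lifted i p i' p' g g' ->
  lifted i p i' p' (f - g) (f' - g').
Proof.
move=> [l [li lp]] [m [mi mp]]; exists (l - m).
by rewrite !ocBl !ocBr li mi lp mp.
Qed.

Lemma lifted_uniq f f' g g' : lifted i p i' p' f f' -> lifted i p i' p' g g' ->
  Z _ _ (f - g) -> Z _ _ (f' - g').
Proof. by move=> l m; apply: lifted_iz; apply: lifted_sub. Qed.
End Pair.

Lemma lifted1 (X J L : T) (i : chmap X J) (p : chmap J L) : lifted i p i p (chid _) (chid _).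
Proof. by exists (chid _); rewrite !oc1l !oc1r. Qed.

Lemma lifted_comp (X J L X' J' L' X2 J2 L2 : T) (i : chmap X J) (p : chmap J L)
    (i' : chmap X' J') (p' : chmap J' L') (i2 : chmap X2 J2) (p2 : chmap J2 L2) f f' g g' :
  lifted i p i' p' f f' -> lifted i' p' i2 p2 g g' -> lifted i p i2 p2 (g \oc f) (g' \oc f').
Proof.
move=> [l [li lp]] [m [mi mp]]; exists (m \oc l); split; first by rewrite -ocA li !ocA mi.
by rewrite -ocA lp !ocA mp.
Qed.

Lemma lifted_ziso (X J L X' J' L' : T) (i : chmap X J) (p : chmap J L)
    (i' : chmap X' J') (p' : chmap J' L') f f' :
  hull i p -> hull i' p' -> lifted i p i' p' f f' -> ziso Z f -> ziso Z f'.
Proof.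
move=> h h' l [g [gf fg]]; have [g' l'] := lift_exists h' h g.
exists g'; split.
  exact: (lifted_uniq h h (lifted_comp l l') (lifted1 i p)).
exact: (lifted_uniq h' h' (lifted_comp l' l) (lifted1 i' p')).
Qed.

Lemma shift_hull (W : shift T) X : hull (sh_i W X) (sh_p W X).
Proof. by split; [apply: sh_S | apply: sh_injP]. Qed.

Lemma shift_lifted (W : shift T) (X Y : T) (f : chmap X Y) f' :
  lifted (sh_i W X) (sh_p W X) (sh_i W Y) (sh_p W Y) f f' -> Z _ _ (fmap W f - f').
Proof. by move=> [g [gi gp]]; apply/hT; apply: (sh_map (g := g)); rewrite cheqE. Qed.

Lemma shift_exists : inhabited (shift T).
Proof.
pose Jx X := projT1 (cid (frH fr X)); pose J2 X := projT2 (cid (frH fr X)).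
pose Lx X := projT1 (cid (J2 X)); pose L2 X := projT2 (cid (J2 X)).
pose ix X := projT1 (cid (L2 X)); pose i2 X := projT2 (cid (L2 X)).
pose px X := projT1 (cid (i2 X)).
have hx X : hull (ix X) (px X) := projT2 (cid (i2 X)).
pose fm (X Y : T) (f : chmap X Y) := projT1 (cid (lift_exists (hx X) (hx Y) f)).
have fl (X Y : T) (f : chmap X Y) : lifted (ix X) (px X) (ix Y) (px Y) f (fm X Y f).
  exact: projT2 (cid (lift_exists (hx X) (hx Y) f)).
have fme (X Y : T) (f g : chmap X Y) : sc_eq f g -> sc_eq (fm X Y f) (fm X Y g).
  by move/hT => z; apply/hT; exact: (lifted_uniq (hx X) (hx Y) (fl _ _ f) (fl _ _ g) z).
have fm1 (X : T) : sc_eq (fm X X (chid X)) (chid (Lx X)).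
  apply/hT; apply: (lifted_uniq (hx X) (hx X) (fl _ _ _) (lifted1 _ _)).
  exact: iz_refl.
have fmM (X Y W : T) (g : chmap Y W) (f : chmap X Y) : sc_eq (fm X W (g \oc f)) (fm Y W g \oc fm X Y f).
  apply/hT; apply: (lifted_uniq (hx X) (hx W) (fl _ _ _) (lifted_comp (fl _ _ _) (fl _ _ _))).
  exact: iz_refl.
constructor; apply: (@Shift T (Functor fme fm1 fmM) Jx ix px).
- by move=> X; apply: (hx X).1.
- by move=> X; apply: (hx X).2.
move=> X Y f g f'; rewrite !cheqE => gi gp; apply/hT.
have lg : lifted (ix X) (px X) (ix Y) (px Y) f f' by exists g.
apply: (lifted_uniq (hx X) (hx Y) (fl _ _ f) lg); exact: iz_refl.
Qed.

Lemma distinguished_iso (W : shift T) (X Y E X' Y' E' : T)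
    (u : chmap X Y) (v : chmap Y E) (w : chmap E (W X))
    (u' : chmap X' Y') (v' : chmap Y' E') (w' : chmap E' (W X'))
    (al : chmap X' X) (be : chmap Y' Y) (ga : chmap E' E) :
  distinguished u v w -> ziso Z al -> ziso Z be -> ziso Z ga ->
  Z _ _ (be \oc u' - u \oc al) -> Z _ _ (ga \oc v' - v \oc be) ->
  Z _ _ (fmap W al \oc w' - w \oc ga) -> distinguished u' v' w'.
Proof.
move=> [X0 [Y0 [E0 [s [b [q [al0 [be0 [ga0 [st [i1 i2 i3] s1 s2 s3]]]]]]]]]] j1 j2 j3 t1 t2 t3.
have {}i1 := (sc_isoP hT al0).1 i1; have {}i2 := (sc_isoP hT be0).1 i2.
have {}i3 := (sc_isoP hT ga0).1 i3.
have {}s1 := (hT (be0 \oc u) (s \oc al0)).1 s1.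
have {}s2 := (hT (ga0 \oc v) (b \oc be0)).1 s2.
have {}s3 := (hT (fmap W al0 \oc w) (q \oc ga0)).1 s3.
exists X0, Y0, E0, s, b, q, (al0 \oc al), (be0 \oc be), (ga0 \oc ga); split=> //.
- by split; apply/(sc_isoP hT); apply: ziso_comp.
- apply/hT; rewrite -ocA; apply: (iz_sub (iz_compl _ t1)); rewrite !ocA; exact: iz_compr.
- apply/hT; rewrite -ocA; apply: (iz_sub (iz_compl _ t2)); rewrite !ocA; exact: iz_compr.
apply/hT; apply: (iz_sub (iz_compr _ (fmapM_iz hT W al0 al))).
rewrite -ocA; apply: (iz_sub (iz_compl _ t3)); rewrite !ocA; exact: iz_compr.
Qed.
End Cosyzygies.

(* The last field holds if F is left adjoint to a functor preserving the ideals: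
   take for g' and c the transpose of g and the counit. *)
Record frobenius_functor (T U : stable_cat) (ZT : ideal (sc_alg T)) (ZU : ideal (sc_alg U))
    (F : functor T U) : Prop := FrobeniusFunctor {
  ffF1 : forall X : T, fmap F (chid X) = chid _;
  ffFM : forall (X Y W : T) (g : chmap Y W) (f : chmap X Y), fmap F (g \oc f) = fmap F g \oc fmap F f;
  ffFB : forall (X Y : T) (g f : chmap X Y), fmap F (g - f) = fmap F g - fmap F f;
  ffE : forall (X Y W : T) (i : chmap X Y) (p : chmap Y W), exact_seq i p -> exact_seq (fmap F i) (fmap F p);
  ffP : forall (X Y I E : T) (i : chmap X I) (s : chmap X Y) (a : chmap I E) (b : chmap Y E),
    is_pushout i s a b -> is_pushout (fmap F i) (fmap F s) (fmap F a) (fmap F b);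
  ffH : forall (X : T) (W : U) (g : chmap (F X) W), ZU _ _ g ->
    exists (W' : T) (g' : chmap X W') (c : chmap (F W') W), ZT _ _ g' /\ c \oc fmap F g' = g }.

Section FrobeniusFunctor.
Variables (T U : stable_cat) (ZT : ideal (sc_alg T)) (ZU : ideal (sc_alg U)).
Hypotheses (hT : stable_ideal ZT) (hU : stable_ideal ZU) (frT : frobenius ZT) (frU : frobenius ZU).
Variable F : functor T U.
Hypothesis sa : frobenius_functor ZT ZU F.

Lemma frobeniusF0 (X Y : T) : fmap F (0 : chmap X Y) = 0.
Proof. by rewrite -[0 in LHS](subrr 0) (ffFB sa) subrr. Qed.

Lemma frobeniusFD (X Y : T) (g f : chmap X Y) : fmap F (g + f) = fmap F g + fmap F f.
Proof. by apply: (addIr (- fmap F f)); rewrite -(ffFB sa) !addrK. Qed.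

Lemma frobenius_szero (X Y : T) (f : chmap X Y) : ZT _ _ f -> ZU _ _ (fmap F f).
Proof.
by move=> zf; rewrite -[fmap F f]subr0 -(frobeniusF0 X Y); apply: (fmap_iz hT hU); rewrite subr0.
Qed.

(** A stably zero map out of [F X] comes by [ffH] from one out of [X]; that one extends to [J], and
    [F] carries the extension over. *)
Lemma frobenius_hull (X J L : T) (i : chmap X J) (p : chmap J L) :
  hull i p -> hull (fmap F i) (fmap F p).
Proof.
move=> [/(frS frT)[E H] /(frJ frT)zJ]; split; last first.
  by apply/(frJ frU); rewrite -(ffF1 sa); apply: frobenius_szero.
apply/(frS frU); split=> [|W g zg]; first exact: (ffE sa).
have [W' [g' [c [zg' cg']]]] := ffH sa zg; have [h hi] := H _ g' zg'.
by exists (c \oc fmap F h); rewrite -ocA -(ffFM sa) hi.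
Qed.

Variables (WT : shift T) (WU : shift U).
Local Notation hF X := (frobenius_hull (shift_hull WT X)).
Local Notation hW X := (shift_hull WU (F X)).

Lemma frobenius_shift : exists phi : forall X : T, chmap (F (WT X)) (WU (F X)),
  forall X, lifted (fmap F (sh_i WT X)) (fmap F (sh_p WT X)) (sh_i WU (F X)) (sh_p WU (F X)) (chid _) (phi X).
Proof.
exists (fun X => projT1 (cid (lift_exists frU (hF X) (hW X) (chid _)))) => X.
exact: projT2 (cid (lift_exists frU (hF X) (hW X) (chid _))).
Qed.

Section Comparison.
Variable phi : forall X : T, chmap (F (WT X)) (WU (F X)).
Hypothesis phiP : forall X,
  lifted (fmap F (sh_i WT X)) (fmap F (sh_p WT X)) (sh_i WU (F X)) (sh_p WU (F X)) (chid _) (phi X).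

Lemma phi_iso X : ziso ZU (phi X).
Proof. exact (lifted_ziso frU (hF X) (hW X) (phiP X) (ziso1 ZU (F X))). Qed.

Lemma phi_nat (X Y : T) (f : chmap X Y) :
  ZU _ _ (phi Y \oc fmap F (fmap WT f) - fmap WU (fmap F f) \oc phi X).
Proof.
have [f' lf] := lift_exists frT (shift_hull WT X) (shift_hull WT Y) f.
have [f2 lf2] := lift_exists frU (hW X) (hW Y) (fmap F f).
have lF : lifted (fmap F (sh_i WT X)) (fmap F (sh_p WT X)) (fmap F (sh_i WT Y)) (fmap F (sh_p WT Y))
    (fmap F f) (fmap F f').
  by have [g [gi gp]] := lf; exists (fmap F g); rewrite -!(ffFM sa) gi gp.
apply: (iz_sub (h := phi Y \oc fmap F f')).
  by apply: iz_compl; apply: (fmap_iz hT hU); apply: shift_lifted.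
apply: (iz_sub (h := f2 \oc phi X)); last first.
  by apply: iz_compr; apply: iz_sym; apply: shift_lifted.
apply: (lifted_uniq frU (hF X) (hW Y) (lifted_comp lF (phiP Y)) (lifted_comp (phiP X) lf2)).
by apply: iz_refl; rewrite oc1l oc1r.
Qed.

(* With J the S-injective hull of F X0 chosen by WU, and I that of X0 chosen by
   WT, the pushout of F X0 -> J along (s, i) : F X0 -> F Y0 (+) F I is
   J (+) F E, since F X0 -> J extends to F I. *)
Lemma frobenius_standard (X0 Y0 E0 : T) (s : chmap X0 Y0) (b : chmap Y0 E0) (q : chmap E0 (WT X0)) :
  standard_triangle s b q ->
  distinguished (fmap F s) (fmap F b) (phi X0 \oc fmap F q).
Proof.
move=> [a [/(ffP sa)/is_pushoutP[ab H] /chmap_ext qa]]; rewrite cheqE ch00 => qb.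
have [g [gi gp]] := phiP X0; rewrite oc1r in gi.
have zI : ZU _ _ (chid (F (sh_inj WT X0))) := (frJ frU _).1 (hF X0).2.
have zJ : ZU _ _ (chid (sh_inj WU (F X0))) := (frJ frU _).1 (hW X0).2.
have [Y1 [j1 [j2 [q1 [q2 [q1j1 q2j2 q1j2 q2j1 jq]]]]]] := frD frU (F Y0) (F (sh_inj WT X0)).
have [E1 [k1 [k2 [r1 [r2 [r1k1 r2k2 r1k2 r2k1 kr]]]]]] := frD frU (sh_inj WU (F X0)) (F E0).
pose s1 := j1 \oc fmap F s + j2 \oc fmap F (sh_i WT X0).
pose b1 := k2 \oc fmap F b \oc q1 + (k1 \oc g - k2 \oc fmap F a) \oc q2.
pose w1 := sh_p WU (F X0) \oc r1 + phi X0 \oc fmap F q \oc r2.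
have b1j1 : b1 \oc j1 = k2 \oc fmap F b.
  by rewrite /b1 ocDl -!ocA q1j1 q2j1 !oc0r addr0 oc1r.
have b1j2 : b1 \oc j2 = k1 \oc g - k2 \oc fmap F a.
  by rewrite /b1 ocDl -!ocA q1j2 q2j2 !oc0r add0r oc1r.
have w1k1 : w1 \oc k1 = sh_p WU (F X0).
  by rewrite /w1 ocDl -!ocA r1k1 r2k1 !oc0r addr0 oc1r.
have w1k2 : w1 \oc k2 = phi X0 \oc fmap F q.
  by rewrite /w1 ocDl -!ocA r1k2 r2k2 !oc0r add0r oc1r.
(* Adding a summand whose identity is stably zero is a stable isomorphism; this discards the
   injective summands of [Y1] and [E1]. *)
have inj_iso (A B D : U) (d1 : chmap A D) (d2 : chmap B D) (e1 : chmap D A) (e2 : chmap D B) :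
    e1 \oc d1 = chid _ -> d1 \oc e1 + d2 \oc e2 = chid _ -> ZU _ _ (chid B) -> ziso ZU d1.
  move=> ed de zB; exists e1; split; first exact: iz_refl.
  rewrite -de opprD addrA subrr add0r; apply: izN.
  by apply: izl; rewrite -[e2]oc1l; apply: izr.
exists (F X0), Y1, E1, s1, b1, w1, (chid _), j1, k2; split.
- exists k1; split.
  + apply/is_pushoutP; split=> [|W a' b' E'].
      rewrite /s1 ocDr !ocA b1j1 b1j2 ocBl -!ocA ab gi addrC subrK //.
    (* The test map on the injective summand of [E1] is [a']. On [F E0] it is glued from [b' \oc j1]
       and the correction [a' \oc g - b' \oc j2], which are compatible because [g] restricts to the
       chosen hull of [F X0]. *)
    have [|h [ha hb hu]] := H W (a' \oc g - b' \oc j2) (b' \oc j1).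
      rewrite ocBl -ocA gi E' /s1 ocDr !ocA addrK //.
    have [m [m1 m2]] : exists m : chmap E1 W, m \oc k1 = a' /\ m \oc k2 = h.
      exists (a' \oc r1 + h \oc r2); rewrite !ocDl -!ocA r1k1 r2k1 r1k2 r2k2.
      by rewrite !oc0r !oc1r addr0 add0r.
    exists m; split=> // [|m' m'1 m'2].
      rewrite -[RHS]oc1r -jq [RHS]ocDr [LHS]ocDr !ocA ocBr !ocA m1 m2 hb ha.
      by congr (_ + _); congr (_ \oc _); rewrite opprB addrC subrK.
    have m'k2 : m' \oc k2 = h.
      apply: hu; last by rewrite -m'2 -!ocA b1j1.
      by rewrite -m'2 -m'1 -!ocA b1j2 ocBr opprB addrC subrK.
    by rewrite -[m']oc1r -[m]oc1r -kr !ocDr !ocA m'1 m'k2 m1 m2.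
  + by rewrite cheqE.
  have wb : phi X0 \oc fmap F q \oc fmap F b = 0 by rewrite -ocA -(ffFM sa) qb frobeniusF0 oc0r.
  have wa : phi X0 \oc fmap F q \oc fmap F a = sh_p WU (F X0) \oc g by rewrite -ocA -(ffFM sa) qa gp.
  by rewrite cheqE ch00 /b1 ocDr !ocA ocBr !ocA w1k1 w1k2 wb wa subrr !oc0l addr0.
- split; apply/(sc_isoP hU); first exact: ziso1.
    exact: inj_iso q1j1 jq zI.
  have kr' : k2 \oc r2 + k1 \oc r1 = chid _ by rewrite addrC.
  exact: inj_iso r2k2 kr' zJ.
- apply/hU; rewrite oc1r /s1 opprD addrA subrr add0r; apply: izN.
  by apply: izl; rewrite -[fmap F _]oc1l; apply: izr.
- by apply/hU; apply: iz_refl; rewrite b1j1.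
apply/hU; rewrite w1k2; apply: (iz_sub (h := chid _ \oc (phi X0 \oc fmap F q))).
  by apply: iz_compr; apply: fmap1_iz.
by apply: iz_refl; rewrite oc1l.
Qed.

Lemma frobenius_distinguished (X Y E : T) (f : chmap X Y) (v : chmap Y E) (w : chmap E (WT X)) :
  distinguished f v w -> distinguished (fmap F f) (fmap F v) (phi X \oc fmap F w).
Proof.
move=> [X0 [Y0 [E0 [s [b [q [al [be [ga [st [i1 i2 i3] s1 s2 s3]]]]]]]]]].
apply: (distinguished_iso hU (al := fmap F al) (be := fmap F be) (ga := fmap F ga) (frobenius_standard st)).
- exact/(fmap_iso hT hU)/(sc_isoP hT).
- exact/(fmap_iso hT hU)/(sc_isoP hT).
- exact/(fmap_iso hT hU)/(sc_isoP hT).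
- by rewrite -!(ffFM sa); apply: (fmap_iz hT hU); exact/hT.
- by rewrite -!(ffFM sa); apply: (fmap_iz hT hU); exact/hT.
rewrite ocA; apply: (iz_sub (h := phi X0 \oc fmap F (fmap WT al) \oc fmap F w)).
  by apply: iz_compr; apply: iz_sym; apply: phi_nat.
rewrite -!ocA -!(ffFM sa); apply: iz_compl; apply: (fmap_iz hT hU); exact/hT.
Qed.
End Comparison.

Lemma frobenius_triangulated : triangulated WT WU F.
Proof.
split=> [X Y f g|]; first by apply/hU/iz_refl; rewrite !chaddE frobeniusFD.
have [phi phiP] := frobenius_shift; exists phi; split=> [X|X Y f|X Y E f v w d].
- exact/(sc_isoP hU)/phi_iso.
- exact/hU/phi_nat.
exact: frobenius_distinguished.
Qed.
End FrobeniusFunctor.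

Section TriangulatedNat.
Variables (T U : stable_cat) (ZT : ideal (sc_alg T)) (ZU : ideal (sc_alg U)).
Hypotheses (hT : stable_ideal ZT) (hU : stable_ideal ZU).
Variables (WT : shift T) (WU : shift U).

(** The comparison for [F'] is [phi] conjugated by the natural isomorphism [th], and triangles are
    carried over along the inverse of [th]. *)
Lemma triangulated_nat (F F' : functor T U) (th : forall X : T, chmap (F X) (F' X)) : nat_iso ZU th ->
  triangulated WT WU F -> triangulated WT WU F'.
Proof.
move=> [thI thN] [Fadd [phi [phiI phiN phiD]]].
pose ti X := projT1 (cid (thI X)).
have ti1 X : ZU _ _ (ti X \oc th X - chid _) := (projT2 (cid (thI X))).1.
have ti2 X : ZU _ _ (th X \oc ti X - chid _) := (projT2 (cid (thI X))).2.
have tiN (X Y : T) (f : chmap X Y) : ZU _ _ (ti Y \oc fmap F' f - fmap F f \oc ti X).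
  exact: iz_square_inv (thN _ _ f).
have F'E (X Y : T) (f : chmap X Y) : ZU _ _ (fmap F' f - th Y \oc fmap F f \oc ti X).
  apply: (iz_sub (h := fmap F' f \oc th X \oc ti X)); last by apply: iz_compr; apply: iz_sym.
  by rewrite -ocA -[X in X - _]oc1r; apply: iz_compl; apply: iz_sym.
split=> [X Y f g|].
  apply/hU; rewrite chaddE; apply: (iz_sub (F'E _ _ _)).
  apply: (iz_sub (h := th Y \oc (fmap F f + fmap F g) \oc ti X)).
    by apply: iz_compr; apply: iz_compl; have /hU := Fadd X Y f g; rewrite !chaddE.
  by rewrite ocDr ocDl chaddE opprD addrACA; apply: izD; apply: iz_sym.
exists (fun X => fmap WU (th X) \oc phi X \oc ti (WT X)); split=> [X|X Y f|X Y E f v w d].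
- apply/(sc_isoP hU); apply: ziso_comp; last exact: ziso_inv (ti1 _) (ti2 _).
  by apply: ziso_comp; [apply: (fmap_iso hU hU) | apply/(sc_isoP hU)].
- apply/hU; rewrite -!ocA; apply: (iz_sub (iz_compl _ (iz_compl _ (tiN _ _ _)))).
  rewrite !ocA; apply: iz_compr; rewrite -ocA.
  apply: (iz_sub (iz_compl _ ((hU _ _).1 (phiN X Y f)))); rewrite !ocA; apply: iz_compr.
  apply: (iz_sub (iz_sym (fmapM_iz hU WU _ _))); apply: (iz_sub _ (fmapM_iz hU WU _ _)).
  by apply: (fmap_iz hU hU).
apply: (distinguished_iso hU (al := ti X) (be := ti Y) (ga := ti E) (phiD _ _ _ _ _ _ d)).
- exact: ziso_inv (ti1 _) (ti2 _).
- exact: ziso_inv (ti1 _) (ti2 _).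
- exact: ziso_inv (ti1 _) (ti2 _).
- exact: tiN.
- exact: tiN.
apply: (iz_sub (h := phi X \oc (ti (WT X) \oc fmap F' w))); last first.
  by rewrite -ocA; apply: iz_compl.
rewrite -!ocA [X in X - _]ocA -[X in _ - X]oc1l; apply: iz_compr.
apply: (iz_sub (iz_sym (fmapM_iz hU WU _ _))).
by apply: (iz_sub (fmap_iz hU hU WU (ti1 X))); apply: fmap1_iz.
Qed.
End TriangulatedNat.

(** * Exactness and pushouts under truncated adjoints *)

Section TruncatedExactness.
Variables (R : pzRingType) (t : truncation R).

(** By naturality of [ti] and [tp] the truncated sequence is a retract of the given one. *)
Lemma tM_exact (X Y Z : complex R) (i : chmap X Y) (p : chmap Y Z) :
  exact_seq i p -> exact_seq (tM t i) (tM t p).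
Proof.
move=> E n; have [inj im sur] := E n.
have K W (w : t W n) : tp t W n (ti t W n w) = w by rewrite -ocE tpti.
have iN x : ti t Y n (tM t i n x) = i n (ti t X n x) by rewrite -!ocE ti_nat.
have pN y : ti t Z n (tM t p n y) = p n (ti t Y n y) by rewrite -!ocE ti_nat.
have iT x : tM t i n (tp t X n x) = tp t Y n (i n x) by rewrite -!ocE tp_nat.
have pT y : tM t p n (tp t Y n y) = tp t Z n (p n y) by rewrite -!ocE tp_nat.
split=> [x y xy|y|z].
- by rewrite -[x]K -[y]K; congr (tp t X n _); apply: inj; rewrite -!iN xy.
- split=> [y0|[x <-]].
    have /im[x xE] : p n (ti t Y n y) = 0 by rewrite -pN y0 linear0.
    by exists (tp t X n x); rewrite iT xE K.
  have p0 : p n (i n (ti t X n x)) = 0 by apply/im; exists (ti t X n x).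
  by rewrite -[LHS]K pN iN p0 linear0.
have [y yE] := sur (ti t Z n z); exists (tp t Y n y).
by rewrite pT yE K.
Qed.
End TruncatedExactness.

Section TruncatedLeftAdjoint.
Variables (R S : pzRingType) (a : adjunction R S) (t : truncation R) (s : truncation S).

(** A map out of [gF a t K] is recovered from its transpose. The block condition is put on [K]
    alone, because pushouts are tested against arbitrary complexes [W]. *)
Lemma gc_gFm (K : complex S) (W : complex R) (g : chmap (gF a t K) W) :
  ti s K \oc tp s K = chid K -> gc a t s W \oc gFm a t (gGm a s g \oc gu a t s K) = g.
Proof. by move=> bK; rewrite gFM ocA -gc_nat -ocA gc_gu // oc1r. Qed.

Lemma gF_pushout (X Y I E : complex S) (i : chmap X I) (f : chmap X Y) (h : chmap I E) (b : chmap Y E) :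
  ti s Y \oc tp s Y = chid Y -> ti s I \oc tp s I = chid I -> ti s E \oc tp s E = chid E ->
  (forall W (a' : chmap I W) (b' : chmap Y W), a' \oc i = b' \oc f ->
    exists l : chmap E W, [/\ l \oc h = a', l \oc b = b' &
      forall l' : chmap E W, l' \oc h = a' -> l' \oc b = b' -> l' = l]) ->
  forall W (a' : chmap (gF a t I) W) (b' : chmap (gF a t Y) W), a' \oc gFm a t i = b' \oc gFm a t f ->
    exists l : chmap (gF a t E) W, [/\ l \oc gFm a t h = a', l \oc gFm a t b = b' &
      forall l' : chmap (gF a t E) W, l' \oc gFm a t h = a' -> l' \oc gFm a t b = b' -> l' = l].
Proof.
move=> bY bI bE H W a' b' ab.
have [|l [lh lb lu]] := H (gG a s W) (gGm a s a' \oc gu a t s I) (gGm a s b' \oc gu a t s Y).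
  by rewrite -[LHS]ocA -[RHS]ocA (gu_nat a t s i) (gu_nat a t s f) [LHS]ocA [RHS]ocA -(gGM a s) -(gGM a s) ab.
exists (gc a t s W \oc gFm a t l); split.
- by rewrite -ocA -gFM lh gc_gFm.
- by rewrite -ocA -gFM lb gc_gFm.
move=> l' l'h l'b; rewrite -[LHS](gc_gFm l' bE); congr (_ \oc gFm a t _).
apply: lu.
  by rewrite -[LHS]ocA (gu_nat a t s h) [LHS]ocA -(gGM a s) l'h.
by rewrite -[LHS]ocA (gu_nat a t s b) [LHS]ocA -(gGM a s) l'b.
Qed.

Lemma left_adjoint_factor (ZS : ideal S) (K : complex S) (W : complex R) (g : chmap (gF a t K) W) :
  ti s K \oc tp s K = chid K -> ZS _ _ (gGm a s g) ->
  exists (g' : chmap K (gG a s W)) (c : chmap (gF a t (gG a s W)) W), ZS _ _ g' /\ c \oc gFm a t g' = g.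
Proof.
by move=> bK zg; exists (gGm a s g \oc gu a t s K), (gc a t s W); split; [apply: izr | exact: gc_gFm].
Qed.
End TruncatedLeftAdjoint.

Section StableFrobenius.
Variables (k : idomainType) (F : fieldType) (r : {rmorphism k -> F}).
Hypothesis rP : forall x, (r x == 0) = (x \isn't a GRing.unit).
Variables (gT : finGroupType) (C : complex_cat k gT) (Fam : {set {group gT}}).
Hypotheses (hV : fin_free (cc_V C)) (nd : S_nondegenerate C Fam).
Variable e : galg k gT.
Hypothesis he : central_idempotent e.

Lemma stable_frobenius : @frobenius (StableCat C Fam e) (szero_ideal rP C (in_fam Fam)).
Proof.
split=> [X Y L i p|J|X|X Y].
- split=> [/(in_S_mono hV)[E mi]|[E H]].
    by split=> // W g zg; exact (S_mono_extends rP hV nd mi zg).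
  apply/(in_S_mono hV); split=> //.
  apply: (S_mono_of_extends rP hV nd he (bc_cat X) (@bc_block _ _ _ _ X)) => W g cW bW zg.
  exact: (H (BlockComplex cW bW) g zg).
- exact (S_injectiveP rP hV nd he J).
- have [J [i [cJ bJ zJ mi inj]]] := S_hull rP hV nd he (bc_cat X) (@bc_block _ _ _ _ X).
  have [L [p E]] := coker_exact inj.
  have cL : in_cat C L := in_cat_exact3 rP E cJ.
  have bL : in_block e L.
    move=> n z; have [_ _ sur] := E n; have [y <-] := sur z.
    by rewrite -linearZ bJ.
  exists (BlockComplex cJ bJ), (BlockComplex cL bL), i, p; split.
    exact/(in_S_mono hV).
  exact/(S_injectiveP rP hV nd he).
have cD : in_cat C (biprod X Y) := in_cat_biprod rP (bc_cat X) (bc_cat Y).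
have bD : in_block e (biprod X Y).
  have bX : in_block e X := @bc_block _ _ _ _ X.
  have bY : in_block e Y := @bc_block _ _ _ _ Y.
  by move=> n [x y]; transitivity (e *: x, e *: y); [by [] | rewrite bX bY].
exists (BlockComplex cD bD), (bi1 X Y), (bi2 X Y), (bp1 X Y), (bp2 X Y); split.
- exact: bp11.
- exact: bp22.
- exact: bp12.
- exact: bp21.
exact: biprod1.
Qed.
End StableFrobenius.

(** * The Green functors are triangulated *)

Section GreenTriangulated.
Variables (k : idomainType) (F : fieldType) (r : {rmorphism k -> F}) (p : nat).
Hypotheses (rP : forall x, (r x == 0) = (x \isn't a GRing.unit)) (pF : p \in [pchar F]).
Variables (gT : finGroupType) (C : complex_cat k gT).
Variables (Q : {group gT}) (e : galg k gT) (b : galg k (subg_of 'N(Q))).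
Hypotheses (he : is_block e) (hQ : is_defect_group e Q) (hb : brauer_correspondent Q e b).
Local Notation H := 'N(Q)%G.
Local Notation ce := (ce he).
Local Notation cb := (cb hb).
Local Notation tB := (block_trunc ce).
Local Notation tb := (block_trunc cb).
Local Notation szX := (szX rP C Q).
Local Notation szXH := (szXH rP C Q).
Local Notation CB := (stable_B C Q e).
Local Notation Cb := (stable_b C Q b).
Local Notation I0 := (I0 rP C he hb).
Local Notation R0 := (R0 rP C he hb).

Lemma I0_frobenius : @frobenius_functor Cb CB szXH szX I0.
Proof.
split.
- by move=> X; exact (gF1 (adj_ind k H) tB X).
- by move=> X Y W g f; exact (gFM (adj_ind k H) tB g f).
- by move=> X Y g f; exact (gFB (adj_ind k H) tB g f).
- by move=> X Y W i q E; exact (tM_exact tB (ind_exact E)).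
- move=> X Y I E i s a b0 /is_pushoutP[ab Hu]; apply/is_pushoutP; split.
    by rewrite [LHS](esym (gFM (adj_ind k H) tB a i)) ab; exact (gFM (adj_ind k H) tB b0 s).
  exact (@gF_pushout _ _ (adj_ind k H) tB tb X Y I E i s a b0 (block_truncP cb (@bb k gT C Q b Y))
    (block_truncP cb (@bb k gT C Q b I)) (block_truncP cb (@bb k gT C Q b E)) Hu).
move=> X W g zg.
exists (R0 W); exact (@left_adjoint_factor _ _ (adj_ind k H) tB tb szXH X W g
  (block_truncP cb (@bb k gT C Q b X)) (@gG_szero _ _ _ rP _ C _ _ _ hb _ _ g zg)).
Qed.

(** An instance of [left_adjoint_factor] for [adj_coind], where restriction is the left adjoint; the
    functors are unfolded so that it matches [R0], which is defined through [adj_ind]. *)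
Lemma coind_factor (X : complex (galg k gT)) W (g : chmap (tb (rest_cx (gincl H) X)) W) :
  in_block e X -> szX _ _ (tM tB (ind_ch (gincl H) g)) ->
  exists (g' : chmap X (tB (ind_cx (gincl H) W))) (c : chmap (tb (rest_cx (gincl H) (tB (ind_cx (gincl H) W)))) W),
    szX _ _ g' /\ c \oc tM tb (rest_ch (gincl H) g') = g.
Proof.
move=> /(block_truncP ce) bX.
have := @left_adjoint_factor _ _ (adj_coind k H) tb tB szX X W.
rewrite /gF /gG /gFm /gGm /adj_coind; cbn [aF aG aFm aGm] => L; exact (L g bX).
Qed.

Lemma rest_exact (X Y Z : complex (galg k gT)) (i : chmap X Y) (q : chmap Y Z) :
  exact_seq i q -> exact_seq (rest_ch (gincl H) i) (rest_ch (gincl H) q).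
Proof. by []. Qed.

(** The truncated restriction is a right adjoint in [adj_ind] but a left adjoint in [adj_coind]; the
    latter gives the preservation of pushouts and the last field. *)
Lemma R0_frobenius : @frobenius_functor CB Cb szX szXH R0.
Proof.
split.
- by move=> X; exact (gG1 (adj_ind k H) tb X).
- by move=> X Y W g f; exact (gGM (adj_ind k H) tb g f).
- by move=> X Y g f; exact (gGB (adj_ind k H) tb g f).
- by move=> X Y W i q E; exact (tM_exact tb (rest_exact E)).
- move=> X Y I E i s a b0 /is_pushoutP[ab Hu]; apply/is_pushoutP; split.
    by rewrite [LHS](esym (gGM (adj_ind k H) tb a i)) ab; exact (gGM (adj_ind k H) tb b0 s).
  exact (@gF_pushout _ _ (adj_coind k H) tb tB X Y I E i s a b0 (block_truncP ce (@bB k gT C Q e Y))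
    (block_truncP ce (@bB k gT C Q e I)) (block_truncP ce (@bB k gT C Q e E)) Hu).
move=> X W g zg.
have zg' : szX _ _ (tM tB (ind_ch (gincl H) g)) by exact (@gF_szero _ _ _ rP _ C _ _ he _ _ g zg).
have [g' [c L]] := @coind_factor X W g (@bB k gT C Q e X) zg'.
exists (I0 W); exists (g' : chmap X (I0 W)); exists (c : chmap (R0 (I0 W)) W); exact L.
Qed.

Hypotheses (hV : fin_free (cc_V C)) (nd : S_nondegenerate C (famX Q)).

Lemma fin_free_rest : fin_free (cc_V (sub_cat H C)).
Proof.
have [n [B BP]] := hV; exists n, B => v; have [c [cE cU]] := BP v.
have K (x : k) (w : cc_V C) : (x%:A : galg k (subg_of H)) *: (w : rest (gincl H) (cc_V C)) = (x%:A : galg k gT) *: w.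
  by transitivity (gincl H x%:A *: w); [by [] | rewrite gincl_alg].
exists c; split.
  by rewrite [LHS]cE; apply: eq_bigr => i _; rewrite [RHS]K.
by move=> c' c'E; apply: cU; rewrite [LHS]c'E; apply: eq_bigr => i _; rewrite [LHS]K.
Qed.

Lemma nondegenerate_sub : S_nondegenerate (sub_cat H C) (fam_sub H (famX Q)).
Proof.
case: nd => [/set0Pn[P PX]|]; last by right.
by left; apply/set0Pn; exists (sgval @*^-1 P)%G; apply: imset_f.
Qed.

Lemma frobenius_B : @frobenius CB szX.
Proof. exact (stable_frobenius rP hV nd ce). Qed.

Lemma frobenius_b : @frobenius Cb szXH.
Proof. exact (stable_frobenius rP fin_free_rest nondegenerate_sub cb). Qed.

Lemma ind_triangulated (Wb : shift Cb) (WB : shift CB) (I : functor Cb CB) :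
  induced_by_ind I -> triangulated Wb WB I.
Proof.
move=> /(induced_by_indP rP pF he hQ hb)[th thP].
refine (@triangulated_nat Cb CB szX (@stable_ideal_B k F r rP gT C Q e he) Wb WB I0 I th thP _).
exact (frobenius_triangulated (@stable_ideal_b k F r rP gT C Q e b hb) (@stable_ideal_B k F r rP gT C Q e he) frobenius_b frobenius_B I0_frobenius Wb WB).
Qed.

Lemma res_triangulated (Wb : shift Cb) (WB : shift CB) (R : functor CB Cb) :
  induced_by_res R -> triangulated WB Wb R.
Proof.
move=> /(induced_by_resP rP pF he hQ hb)[th thP].
refine (@triangulated_nat CB Cb szXH (@stable_ideal_b k F r rP gT C Q e b hb) WB Wb R0 R th thP _).
exact (frobenius_triangulated (@stable_ideal_B k F r rP gT C Q e he) (@stable_ideal_b k F r rP gT C Q e b hb) frobenius_B frobenius_b R0_frobenius WB Wb).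
Qed.

Lemma shifts_exist : inhabited (shift Cb) /\ inhabited (shift CB).
Proof.
split; first exact (shift_exists (@stable_ideal_b k F r rP gT C Q e b hb) frobenius_b).
exact (shift_exists (@stable_ideal_B k F r rP gT C Q e he) frobenius_B).
Qed.
End GreenTriangulated.

Theorem theorem9p4 (k : idomainType) (p : nat)
    (hk : closed_field_pchar p k \/ complete_dvr p k)
    (gT : finGroupType) (Q : {group gT})
    (e : galg k gT) (he : is_block e) (hQ : is_defect_group e Q)
    (b : galg k (subg_of 'N(Q))) (hb : brauer_correspondent Q e b)
    (C : complex_cat k gT) (hV : fin_free (cc_V C)) :
  let CB := stable_B C Q e in
  let Cb := stable_b C Q b in
  [/\ exists I : functor Cb CB, induced_by_ind I,
      forall I : functor Cb CB, induced_by_ind I -> equivalence I,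
      exists R : functor CB Cb, induced_by_res R,
      forall R : functor CB Cb, induced_by_res R -> equivalence R &
      S_nondegenerate C (famX Q) ->
      [/\ inhabited (shift Cb), inhabited (shift CB) &
        forall (Wb : shift Cb) (WB : shift CB),
          (forall I : functor Cb CB, induced_by_ind I -> triangulated Wb WB I) /\
          (forall R : functor CB Cb, induced_by_res R -> triangulated WB Wb R)]].
Proof.
have [F [r [rP pF]]] := residue_ring hk.
split.
- by exists (I0 rP C he hb); exact (I0_induced rP pF C he hQ hb).
- by move=> I; exact (@ind_equivalence k F r p rP pF gT C Q e b he hQ hb I).
- by exists (R0 rP C he hb); exact (R0_induced rP pF C he hQ hb).
- by move=> R; exact (@res_equivalence k F r p rP pF gT C Q e b he hQ hb R).
move=> nd; have [sb sB] := shifts_exist rP he hb hV nd.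
split=> // Wb WB; split=> [I hI|R hR].
  exact (ind_triangulated rP pF he hQ hb hV nd Wb WB hI).
exact (res_triangulated rP pF he hQ hb hV nd Wb WB hR).
Qed.
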